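(* Let $E$ be a self-adjoint operator whose spectrum $\sigma(E)$ is uncountable, and let $\boldsymbol d$ be a bounded sequence of real numbers. Then the algorithm for determining diagonals of self-adjoint operators with $\ge5$-point essential spectrum (the pruning algorithm described in the context) is conclusive for the pair $(E,\boldsymbol d)$. That is, after a countable (possibly transfinite) number of steps the algorithm stops with one of the answers ''$\boldsymbol d$ is a diagonal of $E$'' or ''$\boldsymbol d$ is not a diagonal of $E$'' (it never passes to the case of $4$-point essential spectrum), and this answer is correct.
   Context: Hilbert spaces are separable, operators are bounded. $\boldsymbol d=(d_i)$ is a diagonal of a self-adjoint $E$ if $d_i=\langle Ee_i,e_i\rangle$ for some orthonormal basis $(e_i)$. $\#|X|$ is the cardinality of $X$ (possibly $\infty$). Majorization function: for a countable real sequence $\boldsymbol d=(d_i)$ let $C_{\boldsymbol d}(\alpha)=\sum_{0\le d_i<\alpha}d_i$, $D_{\boldsymbol d}(\alpha)=\sum_{\alpha\le d_i\le1}(1-d_i)$, and $f_{\boldsymbol d}(\alpha)=\sum_{d_i\le\alpha}(\alpha-d_i)$ for $\alpha\le0$; $f_{\boldsymbol d}(\alpha)=(1-\alpha)C_{\boldsymbol d}(\alpha)+\alpha D_{\boldsymbol d}(\alpha)$ for $\alpha\in(0,1)$; $f_{\boldsymbol d}(\alpha)=\sum_{d_i\ge\alpha}(d_i-\alpha)$ for $\alpha\ge1$. Let $\pi$ be the spectral measure of $E$. The right essential spectrum is $\sigma^+_{ess}(E)=\{\lambda\in\mathbb R:\operatorname{rank}\pi([\lambda,\lambda+\varepsilon])=\infty\text{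 for all }\varepsilon>0\}$, and the left essential spectrum is $\sigma^-_{ess}(E)=\{\lambda:-\lambda\in\sigma^+_{ess}(-E)\}$. Normalization: if $a=\min\sigma_{ess}(E)<b=\max\sigma_{ess}(E)$, replace $E$ by $(E-a\mathbf I)/(b-a)$ and each $d_i$ by $(d_i-a)/(b-a)$, so that $\{0,1\}\subset\sigma_{ess}(E)\subset[0,1]$. For a normalized pair let $\boldsymbol\lambda=(\lambda_j)$ be the list of all eigenvalues of $E$ with multiplicity (possibly empty), $\delta^L=\liminf_{\beta\nearrow0}(f_{\boldsymbol\lambda}(\beta)-f_{\boldsymbol d}(\beta))$ and $\delta^U=\liminf_{\beta\searrow1}(f_{\boldsymbol\lambda}(\beta)-f_{\boldsymbol d}(\beta))$. Necessity test for a normalized pair $(E,\boldsymbol d)$, $\boldsymbol d$ an infinite sequence: it is passed if (1) $f_{\boldsymbol d}(\alpha)\le f_{\boldsymbol\lambda}(\alpha)$ for all $\alpha\in\mathbb R\setminus[0,1]$; (2) if $\delta^L=0$ then $\#|\{i:d_i=0\}|\le\#|\{j:\lambda_j=0\}|$ and $\#|\{i:d_i\le0\}|\le\#|\{j:\lambda_j\le0\}|$; (3) if $\delta^U=0$ then $\#|\{i:d_i=1\}|\le\#|\{j:\lambda_j=1\}|$ and $\#|\{i:d_i\ge1\}|\le\#|\{j:\lambda_j\ge1\}|$; and (4) one of the following holds: (i) $\delta^L=\delta^U=\infty$; (ii) $\delta^L<\infty$, $\delta^U=\infty$, $\sum_{d_i>0}d_i=\infty$; (iii) $\delta^U<\infty$,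 $\delta^L=\infty$, $\sum_{d_i<1}(1-d_i)=\infty$; (iv) $\delta^L+\delta^U<\infty$ and $f_{\boldsymbol d}(1/2)=\infty$. Pruning: for a normalized pair with $\delta^L=0$ and $0\notin\sigma^+_{ess}(E)$, the pruning at $0$ is $(E',\boldsymbol d')$, where $E'$ is the restriction of $E$ to the range of $\pi([0,\infty))$ and $\boldsymbol d'=(d_i)_{d_i\ge0}$. With $\boldsymbol\lambda'=(\lambda'_j)$ the eigenvalue list of $E'$ and $\alpha_0=\min\sigma_{ess}(E')$, put $\delta'^L=\liminf_{\alpha\nearrow\alpha_0}\big(\sum_{\lambda'_j\le\alpha}(\alpha-\lambda'_j)-\sum_{d'_i\le\alpha}(\alpha-d'_i)\big)$. Symmetrically, for $\delta^U=0$ and $1\notin\sigma^-_{ess}(E)$, the pruning at $1$ is the restriction of $E$ to the range of $\pi((-\infty,1])$ together with $(d_i)_{d_i\le1}$, and with $\alpha_1=\max\sigma_{ess}(E')$, $\delta'^U=\liminf_{\alpha\searrow\alpha_1}\big(\sum_{\lambda'_j\ge\alpha}(\lambda'_j-\alpha)-\sum_{d'_i\ge\alpha}(d'_i-\alpha)\big)$. The algorithm, with input $(E,\boldsymbol d)$, $\#|\sigma_{ess}(E)|\ge5$: Step A. Normalize the pair. If $\#|\sigma_{ess}(E)|<5$, stop and pass to the algorithm for $4$-point essential spectrum. Step B. Apply the necessity test. If it fails, stop with the answer ''not a diagonal''. Step C. If $\delta^L=0$, $0\notin\sigma^+_{ess}(E)$ and $\delta'^L\le0$, prune at $0$ and return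 to Step A. Otherwise, if $\delta^U=0$, $1\notin\sigma^-_{ess}(E)$ and $\delta'^U\le0$, prune at $1$ and return to Step A. Step D. If neither pruning in Step C applies: if $\delta^L=0$ and $0\notin\sigma^+_{ess}(E)$, prune at $0$ and normalize; then, if $\delta^U=0$ and $1\notin\sigma^-_{ess}(E)$, prune at $1$ and normalize. Apply the necessity test to the resulting pair: the answer is ''diagonal'' if it passes and ''not a diagonal'' if it fails. The loop A–C is run by (countable) transfinite recursion: after infinitely many prunings, i.e. at a limit stage, one continues at Step A with the restriction of the (un-normalized) operator to the intersection of all the spectral subspaces retained so far and with the subsequence of terms retained at all earlier stages. *)

(* Defs.v *)
From HB Require Import structures.
From mathcomp Require Export all_boot all_order all_algebra.
From mathcomp Require Export complex.
From mathcomp Require Export all_classical all_reals all_analysis.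

Set Implicit Arguments.
Unset Strict Implicit.
Unset Printing Implicit Defensive.

Export Order.TTheory GRing.Theory Num.Theory Num.Def.
Export numFieldNormedType.Exports.

Local Open Scope classical_set_scope.
Local Open Scope card_scope.
Local Open Scope complex_scope.
Local Open Scope ring_scope.

Section Majorization.
Context {R : realType} {I : choiceType}.

(* A countable real family is given by an index set J and values x. *)
Implicit Types (J : set I) (x : I -> R) (a : R).

Definition lower_excess J x a : \bar R :=
  \esum_(i in [set i | J i /\ x i <= a]) (a - x i)%:E.

Definition upper_excess J x a : \bar R :=
  \esum_(i in [set i | J i /\ a <= x i]) (x i - a)%:E.

Definition lower_sum J x a : \bar R :=
  \esum_(i in [set i | J i /\ 0 <= x i < a]) (x i)%:E.

Definition upper_sum J x a : \bar R :=
  \esum_(i in [set i | J i /\ a <= x i <= 1]) (1 - x i)%:E.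

Definition majorization J x a : \bar R :=
  if a <= 0 then lower_excess J x a
  else if a < 1 then
    ((1 - a)%:E * lower_sum J x a + a%:E * upper_sum J x a)%E
  else upper_excess J x a.

End Majorization.

Section Operators.
Context {R : realType} {H : completeNormedModType R[i]}.

Definition separable : Prop := exists D : set H, countable D /\ dense D.

(* The norm of H is the one induced by the inner product ip, which is linear
   in its first argument and conjugate-linear in the second. *)
Definition inner_product_norm (ip : {dot H for Num.conj}) : Prop :=
  forall x, ip x x = `|x| ^+ 2.

Variable ip : {dot H for Num.conj}.

Definition self_adjoint (E : H -> H) : Prop :=
  forall x y, ip (E x) y = ip x (E y).

(* z belongs to the spectrum iff E - z has no bounded two-sided inverse. *)
Definition spectrum (E : H -> H) : set R[i] :=
  [set z | ~ exists G : {linear H -> H}, [/\ continuous G,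
     (forall x, G (E x - z *: x) = x) & (forall x, E (G x) - z *: G x = x)]].

Definition orthonormal_basis (e : nat -> H) : Prop :=
  (forall i j, ip (e i) (e j) = (i == j)%:R) /\
  (forall x, series (fun i => ip x (e i) *: e i) @ \oo --> x).

Definition is_diagonal (E : H -> H) (d : nat -> R) : Prop :=
  exists e, orthonormal_basis e /\ forall i, ip (E (e i)) (e i) = (d i)%:C.

(* [dim_ge V n]: the linear subspace V has dimension at least n. *)
Definition dim_ge (V : set H) (n : nat) : Prop :=
  exists v : 'I_n -> H, (forall k, V (v k)) /\
    forall c : 'I_n -> R[i], \sum_k c k *: v k = 0 -> forall k, c k = 0.

Definition dim_infinite (V : set H) : Prop := forall n, dim_ge V n.

(* An operator together with a sequence. The operator is the restriction of
   [op] to the closed reducing subspace [space]; the sequence is the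
   subsequence (term i) with i ranging over [idx]. *)
Record pair := Pair {
  op : H -> H; space : set H; term : nat -> R; idx : set nat }.

Implicit Types p : pair.

(* The spectral measure of op|space; its projections are extended by 0 to the
   orthogonal complement of space, so pi setT is the projection onto space. *)
Definition is_spectral_measure p (pi : set R -> H -> H) : Prop :=
  [/\ (forall B, measurable B ->
         [/\ linear (pi B), self_adjoint (pi B) &
             forall x, pi B (pi B x) = pi B x]),
      (forall B C, measurable B -> measurable C ->
         forall x, pi (B `&` C) x = pi B (pi C x)),
      range (pi setT) = space p &
      forall x, exists mu : {measure set (measurableTypeR R) -> \bar R},
        (forall B, measurable B -> (ip (pi B x) x) = (fine (mu B))%:C) /\
        (mu setT < +oo)%E /\
        (space p x -> mu.-integrable setT (fun t : R => t%:E) /\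
          ip (op p x) x = (Rintegral mu setT (fun t : R => t))%:C)].

Definition spectral_measure p : set R -> H -> H :=
  xget (fun _ _ => 0) [set pi | is_spectral_measure p pi].

Definition spectral_range p (B : set R) : set H := range (spectral_measure p B).

Definition ess p : set R :=
  [set l | forall e, 0 < e -> dim_infinite (spectral_range p `]l - e, l + e[)].

Definition right_ess p : set R :=
  [set l | forall e, 0 < e -> dim_infinite (spectral_range p `[l, l + e])].

Definition left_ess p : set R :=
  [set l | right_ess (Pair (fun x => - op p x) (space p) (term p) (idx p))
             (- l)].

(* ess p is compact, so for nonempty ess p these are its min and max. *)
Definition ess_min p : R := inf (ess p).
Definition ess_max p : R := sup (ess p).

Definition normalize p : pair :=
  let a := ess_min p in let b := ess_max p in
  Pair (fun x => ((b - a)^-1)%:C *: (op p x - a%:C *: x)) (space p)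
       (fun i => (term p i - a) / (b - a)) (idx p).

Definition eigenspace p (t : R) : set H :=
  [set x | space p x /\ op p x = t%:C *: x].

(* The list of eigenvalues with multiplicity: an eigenvalue t is listed once
   for each index (t, k) with k < dim (eigenspace p t), with value t. *)
Definition eig_index p : set (R * nat) :=
  [set tk | dim_ge (eigenspace p tk.1) tk.2.+1].

Definition f_d p : R -> \bar R := majorization (idx p) (term p).
Definition f_lambda p : R -> \bar R := majorization (eig_index p) fst.

Definition deltaL p : \bar R :=
  limf_einf (fun b => f_lambda p b - f_d p b)%E (at_left (0 : R)).

Definition deltaU p : \bar R :=
  limf_einf (fun b => f_lambda p b - f_d p b)%E (at_right (1 : R)).

Definition d_in p (P : R -> Prop) : set nat :=
  [set i | idx p i /\ P (term p i)].

Definition lambda_in p (P : R -> Prop) : set (R * nat) :=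
  [set j | eig_index p j /\ P j.1].

(* All families here are countable, so [#<=] compares their numbers of terms
   in {0, 1, ..., oo}. The test is meant for infinite sequences; a finite one
   (which may remain after a limit stage) fails it. *)
Definition necessity_test p : Prop :=
  [/\ infinite_set (idx p),
      (forall a : R, ~~ (0 <= a <= 1) -> (f_d p a <= f_lambda p a)%E),
      (deltaL p = 0%E ->
         (d_in p (fun t => t = 0) #<= lambda_in p (fun t => t = 0)) /\
         (d_in p (fun t => t <= 0) #<= lambda_in p (fun t => t <= 0))),
      (deltaU p = 0%E ->
         (d_in p (fun t => t = 1) #<= lambda_in p (fun t => t = 1)) /\
         (d_in p (fun t => 1 <= t) #<= lambda_in p (fun t => 1 <= t))) &
      [\/ deltaL p = +oo%E /\ deltaU p = +oo%E,
          [/\ (deltaL p < +oo)%E, deltaU p = +oo%E &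
              \esum_(i in d_in p (fun t => 0 < t)) (term p i)%:E = +oo%E],
          [/\ (deltaU p < +oo)%E, deltaL p = +oo%E &
              \esum_(i in d_in p (fun t => t < 1)) (1 - term p i)%:E = +oo%E] |
          (deltaL p + deltaU p < +oo)%E /\ f_d p (2^-1) = +oo%E]].

Definition prunable0 p : Prop := deltaL p = 0%E /\ ~ right_ess p 0.

Definition prune0 p : pair :=
  Pair (op p) (spectral_range p `[0, +oo[) (term p) (d_in p (fun t => 0 <= t)).

Definition prunable1 p : Prop := deltaU p = 0%E /\ ~ left_ess p 1.

Definition prune1 p : pair :=
  Pair (op p) (spectral_range p `]-oo, 1]) (term p) (d_in p (fun t => t <= 1)).

Definition deltaL' p : \bar R :=
  let p' := prune0 p in
  limf_einf (fun a => lower_excess (eig_index p') fst a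
                      - lower_excess (idx p') (term p') a)%E
            (at_left (ess_min p')).

Definition deltaU' p : \bar R :=
  let p' := prune1 p in
  limf_einf (fun a => upper_excess (eig_index p') fst a
                      - upper_excess (idx p') (term p') a)%E
            (at_right (ess_max p')).

Inductive answer := Diagonal | NotDiagonal | FourPoint.

Inductive result := Stop of answer | Continue of pair.

Definition final_pruning p : pair :=
  let p0 := if `[< prunable0 p >] then normalize (prune0 p) else p in
  if `[< prunable1 p0 >] then normalize (prune1 p0) else p0.

(* One pass through the loop. The number of points of the essential spectrum
   is unaffected by normalization; it is checked on p itself since
   normalization needs ess_min p < ess_max p. *)
Definition one_pass p : result :=
  let q := normalize p in
  if ~~ (`I_5 #<= ess p) then Stop FourPoint
  else if ~~ `[< necessity_test q >] then Stop NotDiagonal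
  else if `[< prunable0 q /\ (deltaL' q <= 0)%E >] then Continue (prune0 q)
  else if `[< prunable1 q /\ (deltaU' q <= 0)%E >] then Continue (prune1 q)
  else if `[< necessity_test (final_pruning q) >] then Stop Diagonal
  else Stop NotDiagonal.

(* Notations for the countable ordinals; OSup o is the supremum of the o n.
   Every countable ordinal has such a notation. *)
Inductive countable_ordinal :=
  | OZero
  | OSucc of countable_ordinal
  | OSup of (nat -> countable_ordinal).

(* The pair before pass number o; once the algorithm has stopped the pair no
   longer changes. At a limit the original operator is restricted to the
   intersection of the retained subspaces; these decrease with o, so it is
   enough to intersect along the sequence defining the limit. If the supremum
   is attained, OSup yields the pair of the attained stage, up to an affine
   change which normalization absorbs. *)
Fixpoint stage (E : H -> H) (d : nat -> R) (o : countable_ordinal) : pair :=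
  match o with
  | OZero => Pair E setT d setT
  | OSucc o' =>
      match one_pass (stage E d o') with
      | Continue p => p
      | Stop _ => stage E d o'
      end
  | OSup s =>
      Pair E (\bigcap_n space (stage E d (s n)))
           d (\bigcap_n idx (stage E d (s n)))
  end.

Definition stops_with (E : H -> H) (d : nat -> R) (w : answer) : Prop :=
  exists o : countable_ordinal, one_pass (stage E d o) = Stop w.

Definition correct (E : H -> H) (d : nat -> R) (w : answer) : Prop :=
  match w with
  | Diagonal => is_diagonal E d
  | NotDiagonal => ~ is_diagonal E d
  | FourPoint => False
  end.

Definition conclusive (E : H -> H) (d : nat -> R) : Prop :=
  (exists w, stops_with E d w) /\ (forall w, stops_with E d w -> correct E d w).

End Operators.

Arguments separable {R} H.

(* Main.v *)
(* The test is necessary and, at ends that are not prunable, sufficient: a basis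
   realizing [d] compresses [E] below the essential spectrum, which gives the
   excess inequalities by a trace argument, and when the low excess gap tends
   to 0 the trace inequality is sharp, so the basis splits along the spectral
   subspaces.  Conversely one prepares an orthonormal family with values below
   [d_i] for the small [d_i] and above for the large ones, leaving two
   infinite-dimensional spectral subspaces free, and rotates the family towards
   vectors absorbing a dense sequence; the divergence condition in the test
   makes the absorbed part exhaust the space.  At a prunable end the eigenvalues
   and entries beyond the end realize each other exactly.  In a pruning step of
   the loop every realizing basis is adapted to the pruned space: a component of
   some [e_i] in the kernel would be an extra vector in the pruned space, whose
   contribution keeps the pruned gap positive.

   The stages are, up to affine changes, restrictions of [E] to spectral
   subspaces; a pruning never cuts between two condensation points of the
   spectrum, so the essential spectrum stays infinite.  Every pruning drops an
   entry of [d], and the stage at the supremum of the stages dropping the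
   entries that are ever dropped cannot be pruned. *)

From HB Require Import structures.
Require Import Defs.
From mathcomp Require Import ring lra measurable_realfun.

Set Implicit Arguments.
Unset Strict Implicit.
Unset Printing Implicit Defensive.

Local Open Scope classical_set_scope.
Local Open Scope card_scope.
Local Open Scope complex_scope.
Local Open Scope ring_scope.

(** * Hilbert spaces *)

(** The algorithm speaks of a spectral measure picked by choice, so nothing about a stage can be
    computed before existence and uniqueness are known. The spectral theorem is therefore built up
    from square roots, half-line projections and the Stieltjes measures of single vectors;
    uniqueness then yields the measure of a restriction or of an affine image. Only lower ends are
    analysed: [reflect], which is t -> 1 - t on operator and entries, carries the results to upper
    ends. Normalization at each pass blocks a direct comparison of stages, so the notions of the
    loop are recast in forms that commute with increasing affine maps, and the recursion is rerun
    without normalization. In the last step a realizing basis need not split along the cut; what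
    survives is an orthonormal family with finite-dimensional complement in the cut space, and
    necessity is proved for such families. Ordinal notations at a limit are not increasing, so the
    stages have to be shown comparable before their realizations can be glued. *)

Section ComplexParts.
Context {R : realType}.
Implicit Types z w : R[i].

Lemma ReD z w : complex.Re (z + w) = complex.Re z + complex.Re w.
Proof. by case: z => ? ?; case: w. Qed.
Lemma ImD z w : complex.Im (z + w) = complex.Im z + complex.Im w.
Proof. by case: z => ? ?; case: w. Qed.
Lemma ReN z : complex.Re (- z) = - complex.Re z.
Proof. by case: z. Qed.
Lemma ImN z : complex.Im (- z) = - complex.Im z.
Proof. by case: z. Qed.
Lemma ReM z w : complex.Re (z * w) =
  complex.Re z * complex.Re w - complex.Im z * complex.Im w.
Proof. by case: z => ? ?; case: w. Qed.
Lemma ImM z w : complex.Im (z * w) =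
  complex.Re z * complex.Im w + complex.Im z * complex.Re w.
Proof. by case: z => ? ?; case: w. Qed.
Lemma ReJ z : complex.Re z^*%C = complex.Re z.
Proof. by case: z. Qed.
Lemma ImJ z : complex.Im z^*%C = - complex.Im z.
Proof. by case: z. Qed.
Lemma ReR (r : R) : complex.Re r%:C = r. Proof. by []. Qed.
Lemma ImR (r : R) : complex.Im r%:C = 0. Proof. by []. Qed.
Lemma Re0 : complex.Re (0 : R[i]) = 0. Proof. by []. Qed.
Lemma Im0 : complex.Im (0 : R[i]) = 0. Proof. by []. Qed.
Lemma Re1 : complex.Re (1 : R[i]) = 1. Proof. by []. Qed.
Lemma Im1 : complex.Im (1 : R[i]) = 0. Proof. by []. Qed.
Lemma complexP z w :
  complex.Re z = complex.Re w -> complex.Im z = complex.Im w -> z = w.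
Proof. by case: z => ? ?; case: w => ? ? /= -> ->. Qed.
Lemma Re_sum I (r : seq I) (F : I -> R[i]) :
  complex.Re (\sum_(i <- r) F i) = \sum_(i <- r) complex.Re (F i).
Proof. by elim: r => [|a r IH]; rewrite ?big_nil // !big_cons ReD IH. Qed.

(** Squared modulus with values in the real field. Together with [sqn] and [rip] it keeps all
    estimates in an ordered field and mostly avoids square roots. *)
Definition ab2 z : R := complex.Re z ^+ 2 + complex.Im z ^+ 2.

Lemma ab2_ge0 z : 0 <= ab2 z.
Proof. by rewrite addr_ge0 ?sqr_ge0. Qed.
Lemma ab20 : ab2 0 = 0. Proof. by rewrite /ab2 Re0 Im0 expr0n addr0. Qed.
Lemma ab2_eq0 z : ab2 z = 0 -> z = 0.
Proof.
move/eqP; rewrite paddr_eq0 ?sqr_ge0 // !sqrf_eq0 => /andP[/eqP a /eqP b].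
exact: complexP.
Qed.
Lemma ab2M z w : ab2 (z * w) = ab2 z * ab2 w.
Proof. rewrite /ab2 ReM ImM; ring. Qed.
Lemma ab2J z : ab2 z^*%C = ab2 z.
Proof. by rewrite /ab2 ReJ ImJ sqrrN. Qed.
Lemma ab2N z : ab2 (- z) = ab2 z.
Proof. by rewrite /ab2 ReN ImN !sqrrN. Qed.
Lemma ab2R (r : R) : ab2 r%:C = r ^+ 2.
Proof. by rewrite /ab2 ReR ImR expr0n addr0. Qed.
Lemma ab21 : ab2 1 = 1. Proof. by rewrite /ab2 Re1 Im1 expr0n addr0 expr1n. Qed.
Lemma mulJ_ab2 z : z * z^*%C = (ab2 z)%:C.
Proof.
by apply: complexP; rewrite /ab2 ?ReM ?ImM ?ReJ ?ImJ ?ReR ?ImR; ring.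
Qed.
Lemma sqr_Re_le z : complex.Re z ^+ 2 <= ab2 z.
Proof. by rewrite lerDl sqr_ge0. Qed.
Lemma ab2D_le z w : ab2 (z + w) <= 2 * ab2 z + 2 * ab2 w.
Proof.
rewrite /ab2 ReD ImD -subr_ge0.
have := sqr_ge0 (complex.Re z - complex.Re w).
have := sqr_ge0 (complex.Im z - complex.Im w).
nra.
Qed.
End ComplexParts.

Lemma subrBB (V : zmodType) (x a b : V) : (x - a) - (x - b) = b - a.
Proof. by rewrite opprB addrC subrKA. Qed.

Section RealFacts.
Context {R : realType}.

Lemma discriminant_le (a b c : R) : 0 <= a -> 0 <= c ->
  (forall t : R, 0 <= a * t ^+ 2 + 2 * b * t + c) -> b ^+ 2 <= a * c.
Proof.
move=> a0 c0 h; case: (eqVneq a 0) => [a_0|an0].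
  rewrite a_0 mul0r; case: (eqVneq b 0) => [->|bn0]; first by rewrite expr0n.
  (* With vanishing leading coefficient the expression is affine in t, and for b <> 0 it takes the
     value -1 at this point. *)
  have := h (- (c + 1) / (2 * b)); rewrite a_0.
  have -> : 0 * (- (c + 1) / (2 * b)) ^+ 2 + 2 * b * (- (c + 1) / (2 * b)) + c = -1.
    by field.
  by rewrite oppr_ge0 ler10.
have {}a0 : 0 < a by rewrite lt_def an0.
have := h (- b / a).
have -> : a * (- b / a) ^+ 2 + 2 * b * (- b / a) + c = (a * c - b ^+ 2) / a.
  by field.
by rewrite pmulr_lge0 ?invr_gt0 // subr_ge0.
Qed.
End RealFacts.

Section Hilbert.
Context {R : realType} {H : completeNormedModType R[i]}.
Variable ip : {dot H for Num.conj}.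
Hypothesis Hip : inner_product_norm ip.
Implicit Types (x y z : H) (c : R[i]).

Lemma ipC x y : ip y x = (ip x y)^*%C.
Proof. by rewrite hermC expr0 mul1r. Qed.
Lemma ipDl x y z : ip (x + y) z = ip x z + ip y z.
Proof. exact: linearDl. Qed.
Lemma ipDr x y z : ip z (x + y) = ip z x + ip z y.
Proof. exact: linearDr. Qed.
Lemma ipBl x y z : ip (x - y) z = ip x z - ip y z.
Proof. exact: linearBl. Qed.
Lemma ipBr x y z : ip z (x - y) = ip z x - ip z y.
Proof. exact: linearBr. Qed.
Lemma ipNl x z : ip (- x) z = - ip x z.
Proof. exact: linearNl. Qed.
Lemma ipNr x z : ip z (- x) = - ip z x.
Proof. exact: linearNr. Qed.
Lemma ip0l z : ip 0 z = 0.
Proof. exact: linear0l. Qed.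
Lemma ip0r z : ip z 0 = 0.
Proof. exact: linear0r. Qed.
Lemma ipZl c x z : ip (c *: x) z = c * ip x z.
Proof. exact: linearZl_LR. Qed.
Lemma ipZr c x z : ip z (c *: x) = c^*%C * ip z x.
Proof. by rewrite ipC ipZl rmorphM /= -ipC. Qed.
Lemma ip_suml I (r : seq I) (F : I -> H) z :
  ip (\sum_(i <- r) F i) z = \sum_(i <- r) ip (F i) z.
Proof. by elim: r => [|a r IH]; rewrite ?big_nil ?ip0l // !big_cons ipDl IH. Qed.
Lemma ip_sumr I (r : seq I) (F : I -> H) z :
  ip z (\sum_(i <- r) F i) = \sum_(i <- r) ip z (F i).
Proof. by elim: r => [|a r IH]; rewrite ?big_nil ?ip0r // !big_cons ipDr IH. Qed.

Definition sqn x : R := complex.Re (ip x x).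
Definition rip x y : R := complex.Re (ip x y).
Local Notation nn := sqn.
Local Notation rp := rip.

Lemma ipnn x : ip x x = (nn x)%:C.
Proof.
apply: complexP => //; rewrite ImR.
have /(congr1 (@complex.Im R)) := ipC x x; rewrite ImJ => h; lra.
Qed.
Lemma norm_nn x : `|x| ^+ 2 = (nn x)%:C.
Proof. by rewrite -Hip ipnn. Qed.
Lemma nn_ge0 x : 0 <= nn x.
Proof. by rewrite -lecR -norm_nn exprn_ge0. Qed.
Lemma nn0 : nn 0 = 0. Proof. by rewrite /sqn ip0l. Qed.
Lemma nn_eq0 x : nn x = 0 -> x = 0.
Proof.
move=> h; apply/eqP; rewrite -normr_eq0 -sqrf_eq0 norm_nn h.
by apply/eqP.
Qed.
Lemma nn_gt0 x : x <> 0 -> 0 < nn x.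
Proof.
by move=> h; rewrite lt_def nn_ge0 andbT; apply/eqP => /nn_eq0.
Qed.
Lemma rpC x y : rp x y = rp y x.
Proof. by rewrite /rip ipC ReJ. Qed.
Lemma rpDl x y z : rp (x + y) z = rp x z + rp y z.
Proof. by rewrite /rip ipDl ReD. Qed.
Lemma rpDr x y z : rp z (x + y) = rp z x + rp z y.
Proof. by rewrite /rip ipDr ReD. Qed.
Lemma rpNl x z : rp (- x) z = - rp x z.
Proof. by rewrite /rip ipNl ReN. Qed.
Lemma rpNr x z : rp z (- x) = - rp z x.
Proof. by rewrite /rip ipNr ReN. Qed.
Lemma rpZl (r : R) x z : rp (r%:C *: x) z = r * rp x z.
Proof. by rewrite /rip ipZl ReM ReR ImR mul0r subr0. Qed.
Lemma rpZr (r : R) x z : rp z (r%:C *: x) = r * rp z x.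
Proof. by rewrite rpC rpZl rpC. Qed.
Lemma nnE x : nn x = rp x x. Proof. by []. Qed.
Lemma nnD x y : nn (x + y) = nn x + nn y + 2 * rp x y.
Proof. rewrite !nnE rpDl !rpDr (rpC y x); ring. Qed.
Lemma nnN x : nn (- x) = nn x.
Proof. by rewrite /sqn ipNl ipNr opprK. Qed.
Lemma nnB x y : nn (x - y) = nn x + nn y - 2 * rp x y.
Proof. rewrite nnD nnN rpNr; ring. Qed.
Lemma nnBC x y : nn (x - y) = nn (y - x).
Proof. by rewrite -nnN opprB. Qed.
Lemma nnZ c x : nn (c *: x) = ab2 c * nn x.
Proof.
by rewrite /sqn ipZl ipZr mulrA mulJ_ab2 ReM ReR ImR mul0r subr0.
Qed.
Lemma nnZr (r : R) x : nn (r%:C *: x) = r ^+ 2 * nn x.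
Proof. by rewrite nnZ ab2R. Qed.
Lemma nnD_orth x y : ip x y = 0 -> nn (x + y) = nn x + nn y.
Proof. by move=> h; rewrite nnD /rip h Re0 mulr0 addr0. Qed.
Lemma nnD_le x y : nn (x + y) <= 2 * nn x + 2 * nn y.
Proof. have := nn_ge0 (x - y); rewrite nnB nnD; lra. Qed.
Lemma nnB_le x y : nn (x - y) <= 2 * nn x + 2 * nn y.
Proof. by have := nnD_le x (- y); rewrite nnN. Qed.
Lemma parallelogram x y : nn (x + y) + nn (x - y) = 2 * nn x + 2 * nn y.
Proof. rewrite nnB nnD; ring. Qed.

Lemma ip_eq0C x y : ip x y = 0 -> ip y x = 0.
Proof. by move=> h; rewrite ipC h conjc0. Qed.

(** A unimodular factor rotating z onto the nonnegative real axis: the device that turns estimates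
    of real parts into estimates of moduli. *)
Lemma phase_exists (z : R[i]) : exists w : R[i], ab2 w = 1 /\
  complex.Im (w * z) = 0 /\ 0 <= complex.Re (w * z) /\
  complex.Re (w * z) ^+ 2 = ab2 z.
Proof.
case: (eqVneq (ab2 z) 0) => [/ab2_eq0 -> | h].
  exists 1; rewrite mul1r ab21 ab20 Re0 Im0; split => //; split => //.
  by split => //; rewrite expr0n.
have h0 : 0 < ab2 z by rewrite lt_def h ab2_ge0.
set s := Num.sqrt (ab2 z).
have s2 : s ^+ 2 = ab2 z by rewrite sqr_sqrtr ?ab2_ge0.
have s0 : 0 < s by rewrite sqrtr_gt0.
exists ((s^-1)%:C * z^*%C).
have e : (s^-1)%:C * z^*%C * z = s%:C.
  rewrite -mulrA (mulrC z^*%C) mulJ_ab2 -s2 -rmorphM /=.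
  by congr (_ %:C); field; rewrite gt_eqF.
rewrite e ReR ImR s2; split; last by rewrite ltW.
by rewrite ab2M ab2J ab2R -s2; field; rewrite gt_eqF.
Qed.

(** For w a phase of [ip (T x) y], positivity of the form at w x + t y for all real t is a quadratic
    inequality whose discriminant gives the bound. Applied with y := T x, it turns vanishing of the
    form at x into T x = 0. *)
Lemma psd_CS (T : H -> H) : linear T -> self_adjoint ip T ->
  (forall x, 0 <= rp (T x) x) ->
  forall x y, ab2 (ip (T x) y) <= rp (T x) x * rp (T y) y.
Proof.
move=> lT sT pT x y.
have [w [w1 [wI [w0 wR]]]] := phase_exists (ip (T x) y).
have TD u v : T (u + v) = T u + T v by have := lT 1 u v; rewrite !scale1r.
have TZ c u : T (c *: u) = c *: T u.
  have T0 : T 0 = 0 by have := lT (-1) 0 0; rewrite !scaleN1r oppr0 addr0 addNr.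
  by have := lT c u 0; rewrite !addr0 T0 addr0.
rewrite -wR (mulrC (rp _ _)); apply: discriminant_le => // t.
have := pT (w *: x + t%:C *: y).
have e1 : rp (T (w *: x)) (w *: x) = rp (T x) x.
  by rewrite TZ /rip ipZl ipZr mulrA mulJ_ab2 w1 mul1r.
have e2 : rp (T (w *: x)) y = complex.Re (w * ip (T x) y).
  by rewrite TZ /rip ipZl.
have e3 : rp (T y) (w *: x) = complex.Re (w * ip (T x) y).
  by rewrite /rip sT -[complex.Re (ip y _)]ReJ -ipC TZ ipZl.
rewrite !TD !rpDl !rpDr [T (t%:C *: y)]TZ !rpZl !rpZr e1 e2 e3.
by congr (0 <= _); ring.
Qed.

Lemma CS x y : ab2 (ip x y) <= nn x * nn y.
Proof.
have := @psd_CS id _ _ _ x y; apply => //; exact: nn_ge0.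
Qed.
Lemma CSr x y : rp x y ^+ 2 <= nn x * nn y.
Proof. exact: le_trans (sqr_Re_le _) (CS x y). Qed.

Definition hn x : R := Num.sqrt (nn x).
Lemma hn_ge0 x : 0 <= hn x. Proof. exact: sqrtr_ge0. Qed.
Lemma hn2 x : hn x ^+ 2 = nn x. Proof. by rewrite sqr_sqrtr ?nn_ge0. Qed.
Lemma norm_hn x : `|x| = (hn x)%:C.
Proof.
apply/eqP; rewrite -(eqrXn2 (n := 2)) ?ler0c ?hn_ge0 //.
by rewrite norm_nn -rmorphXn /= hn2.
Qed.
Lemma rp_le x y : rp x y <= hn x * hn y.
Proof.
rewrite -sqrtrM ?nn_ge0 //; apply: le_trans (ler_norm _) _.
by rewrite -sqrtr_sqr ler_wsqrtr // CSr.
Qed.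
Lemma hnD x y : hn (x + y) <= hn x + hn y.
Proof.
rewrite -(@ler_pXn2r _ 2) ?nnegrE ?addr_ge0 ?hn_ge0 // sqrrD !hn2 nnD.
by have := rp_le x y; lra.
Qed.
Lemma hnB_tri x y z : hn (x - z) <= hn (x - y) + hn (y - z).
Proof. by rewrite -[x - z](subrKA y) hnD. Qed.

(** Convergence through the real squared norm; [cvgHP] identifies it with convergence in the normed
    module, where the radii are positive elements of R[i]. *)
Definition cvgn (u : nat -> H) l :=
  forall e : R, 0 < e -> exists N, forall n, (N <= n)%N -> nn (u n - l) < e.
Local Notation cvgH := cvgn.
Definition cauchyn (u : nat -> H) :=
  forall e : R, 0 < e -> exists N, forall m n, (N <= m)%N -> (N <= n)%N ->
    nn (u m - u n) < e.

Lemma nn_lt_norm x (e : R) : 0 < e -> (`|x| < e%:C) = (nn x < e ^+ 2).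
Proof.
move=> e0; rewrite norm_hn ltcR -hn2 ltr_pXn2r ?nnegrE ?hn_ge0 //.
exact: ltW.
Qed.

Lemma cvgHP (u : nat -> H) l : cvgH u l <-> u @ \oo --> l.
Proof.
split=> [h|/cvgrPdist_lt h].
  apply/cvgrPdist_lt => e e0.
  have eR : e = (complex.Re e)%:C.
    by apply: complexP => //; rewrite ImR; apply: ger0_Im; apply: ltW.
  have e'0 : 0 < complex.Re e by move: e0; rewrite eR ltcR.
  have [N hN] := h (complex.Re e ^+ 2) (exprn_gt0 _ e'0).
  near=> n; rewrite eR nn_lt_norm // nnBC; apply: hN.
  by near: n; exact: nbhs_infty_ge.
move=> e e0.
have s0 : 0 < Num.sqrt e by rewrite sqrtr_gt0.
have /= := h (Num.sqrt e)%:C; rewrite ltcR => /(_ s0) [N _ hN].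
exists N => n Nn; have := hN n Nn.
by rewrite /= nn_lt_norm // sqr_sqrtr ?ltW // nnBC.
Unshelve. all: by end_near. Qed.

Lemma cauchyH_cvg (u : nat -> H) : cauchyn u -> exists l, cvgH u l.
Proof.
move=> h.
have : cauchy (u @ \oo).
  apply/cauchy_ballP => e e0.
  have eR : e = (complex.Re e)%:C.
    by apply: complexP => //; rewrite ImR; apply: ger0_Im; apply: ltW.
  have e'0 : 0 < complex.Re e by move: e0; rewrite eR ltcR.
  have [N hN] := h (complex.Re e ^+ 2) (exprn_gt0 _ e'0).
  rewrite near_map2; near=> m n.
  rewrite -ball_normE /ball_ /= eR nn_lt_norm //; apply: hN.
  - by near: m; exact: nbhs_infty_ge.
  - by near: n; exact: nbhs_infty_ge.
move/cauchy_cvg => /cvg_ex[l hl]; exists l; exact/cvgHP.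
Unshelve. all: by end_near. Qed.

Lemma separable_seq : separable H ->
  exists y : nat -> H, forall x (e : R), 0 < e -> exists n, nn (x - y n) < e.
Proof.
case=> D [cD dD].
have [y hy] : exists y : nat -> H, D `<=` range y.
  case/countable_injP: cD => f finj.
  exists (fun n => xget 0 [set x | D x /\ f x = n]) => x Dx; exists (f x) => //.
  case: xgetP => [z -> [Dz fz]|/(_ x)]; last by case.
  by apply: finj => //; rewrite inE.
exists y => x e e0.
have s0 : 0 < Num.sqrt e by rewrite sqrtr_gt0.
have b0 : ball x (Num.sqrt e)%:C !=set0.
  by exists x; apply: ballxx; rewrite ltcR.
have bo : open (ball x (Num.sqrt e)%:C) by apply: ball_open; rewrite ltcR.
have [z [/= bz Dz]] := dD _ b0 bo.
have [n _ en] := hy z Dz; exists n; rewrite en.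
by move: bz; rewrite -ball_normE /ball_ /= nn_lt_norm // sqr_sqrtr // ltW.
Qed.

Lemma continuous_bounded (E : {linear H -> H}) : continuous E ->
  exists M : R, 0 <= M /\ forall x, nn (E x) <= M * nn x.
Proof.
move=> cE.
have /cvgrPdist_lt /(_ 1 ltr01) := cE 0; rewrite (linear0 E).
move=> /nbhs_ballP[e /= e0 he].
have eR : e = (complex.Re e)%:C.
  by apply: complexP => //; rewrite ImR; apply: ger0_Im; apply: ltW.
have e'0 : 0 < complex.Re e by move: e0; rewrite eR ltcR.
set r := complex.Re e in eR e'0.
exists (4 / r ^+ 2); split; first by rewrite divr_ge0 // sqr_ge0.
move=> x; case: (pselect (x = 0)) => [->|xn0].
  by rewrite linear0 nn0 mulr0.
have x0 := nn_gt0 xn0.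
have h0 : 0 < hn x by rewrite sqrtr_gt0.
(* Scales x to norm r / 2, inside the ball on which E has norm below 1; this is the source of the
   constant 4 / r^2. *)
set t := r / (2 * hn x).
have t0 : 0 < t by rewrite divr_gt0 // mulr_gt0.
have := he (t%:C *: x); rewrite -ball_normE /ball_ /= sub0r normrN eR.
rewrite nn_lt_norm // nnZr -hn2 -exprMn.
have -> : t * hn x = r / 2 by rewrite /t; field; rewrite gt_eqF.
have lt2 : (r / 2) ^+ 2 < r ^+ 2 by rewrite ltr_pXn2r ?nnegrE //; lra.
move=> /(_ lt2).
have -> : (1 : R[i]) = 1%:C by [].
rewrite sub0r normrN nn_lt_norm // linearZ nnZr expr1n => h.
have -> : 4 / r ^+ 2 * hn x ^+ 2 = 1 / t ^+ 2.
  by rewrite /t; field; rewrite !gt_eqF.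
by rewrite ler_pdivlMr ?exprn_gt0 // mulrC ltW.
Qed.

Lemma bounded_continuous (G : {linear H -> H}) (M : R) : 0 <= M ->
  (forall x, nn (G x) <= M * nn x) -> continuous G.
Proof.
move=> M0 hM x; apply/cvgrPdist_lt => e e0.
have eR : e = (complex.Re e)%:C.
  by apply: complexP => //; rewrite ImR; apply: ger0_Im; apply: ltW.
have e'0 : 0 < complex.Re e by move: e0; rewrite eR ltcR.
set r := complex.Re e in eR e'0.
(* The summand 1 keeps the denominator positive when M = 0. *)
set t := r / (Num.sqrt M + 1).
have s0 : 0 < Num.sqrt M + 1 by rewrite ltr_wpDl ?sqrtr_ge0.
have t0 : 0 < t by rewrite divr_gt0.
apply/nbhs_ballP; exists t%:C; first by rewrite /= ltcR.
move=> y /=; rewrite -ball_normE /ball_ /= nn_lt_norm // => hy.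
rewrite eR nn_lt_norm // -linearB.
apply: le_lt_trans (hM _) _; apply: le_lt_trans (_ : _ <= (Num.sqrt M) ^+ 2 * t ^+ 2) _.
  by rewrite sqr_sqrtr // ler_wpM2l // ltW.
rewrite -exprMn ltr_pXn2r ?nnegrE ?mulr_ge0 ?sqrtr_ge0 // ?ltW //.
by rewrite /t mulrA ltr_pdivrMr // mulrC ltr_pM2l // ltrDl.
Qed.

End Hilbert.

Section RealSequences.
Context {R : realType}.

Lemma bounded_nondecreasing_cauchy (a : nat -> R) (M : R) :
  (forall n, a n <= a n.+1) -> (forall n, a n <= M) ->
  forall e : R, 0 < e -> exists N, forall m n,
    (N <= m)%N -> (m <= n)%N -> a n - a m < e.
Proof.
move=> inc bd e e0.
have hs : has_sup (range a).
  by split; [exists (a 0%N), 0%N|exists M => _ [n _ <-]].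
have [_ [N _ <-] hN] := sup_adherent e0 hs.
have mono m n : (m <= n)%N -> a m <= a n.
  by move/subnK <-; elim: (n - m)%N => // k IH; rewrite addSn (le_trans IH).
exists N => m n Nm mn.
have := ub_le_sup hs.2 (imageT a n); have := mono _ _ Nm; lra.
Qed.

Lemma ge0_eps_le0 (a c : R) : 0 <= c -> (forall e, 0 < e -> a <= c * e) -> a <= 0.
Proof.
move=> c0 h; rewrite leNgt; apply/negP => a0.
have c1 : 0 < c + 1 by lra.
have := h (a / (2 * (c + 1))); rewrite divr_gt0 ?mulr_gt0 // => /(_ isT).
rewrite mulrA ler_pdivlMr ?mulr_gt0 //; nra.
Qed.

End RealSequences.

(** * Closed subspaces, orthogonal projections and orthonormal sequences *)

Section Subspaces.
Context {R : realType} {H : completeNormedModType R[i]}.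
Variable ip : {dot H for Num.conj}.
Hypothesis Hip : inner_product_norm ip.
Implicit Types (x y z : H) (c : R[i]) (V W : set H).

Local Notation nn := (sqn ip).
Local Notation rp := (rip ip).
Local Notation cvgH := (cvgn ip).
Local Notation nn_ge0 := (nn_ge0 Hip).

Section LinearMaps.
Variable T : H -> H.
Hypothesis lT : linear T.

Lemma linD x y : T (x + y) = T x + T y.
Proof. by have := lT 1 x y; rewrite !scale1r. Qed.
Lemma lin0 : T 0 = 0.
Proof. by have := lT (-1) 0 0; rewrite !scaleN1r oppr0 addr0 addNr. Qed.
Lemma linZ c x : T (c *: x) = c *: T x.
Proof. by have := lT c x 0; rewrite !addr0 lin0 addr0. Qed.
Lemma linN x : T (- x) = - T x.
Proof. by rewrite -scaleN1r linZ scaleN1r. Qed.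
Lemma linB x y : T (x - y) = T x - T y.
Proof. by rewrite linD linN. Qed.
Lemma lin_sum I (r : seq I) (P : pred I) (F : I -> H) :
  T (\sum_(i <- r | P i) F i) = \sum_(i <- r | P i) T (F i).
Proof.
elim: r => [|a r IH]; first by rewrite !big_nil lin0.
by rewrite !big_cons; case: ifP => // _; rewrite linD IH.
Qed.
End LinearMaps.

Lemma cvgH_unique (u : nat -> H) l l' : cvgH u l -> cvgH u l' -> l = l'.
Proof.
move=> h h'; apply/eqP; rewrite -subr_eq0; apply/eqP; apply: (nn_eq0 Hip).
apply/eqP; rewrite eq_le nn_ge0 andbT.
apply: (@ge0_eps_le0 _ _ 4) => // e e0.
have [N hN] := h e e0; have [N' hN'] := h' e e0.
have := hN (maxn N N') (leq_maxl _ _); have := hN' (maxn N N') (leq_maxr _ _).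
set w := u _ => a b.
have -> : l - l' = (w - l') - (w - l) by rewrite subrBB.
by have := nnB_le Hip (w - l') (w - l); lra.
Qed.

Lemma cvgH_cst l : cvgH (fun=> l) l.
Proof. by move=> e e0; exists 0%N => n _; rewrite subrr nn0. Qed.

Lemma cvgH_eventually (u v : nat -> H) l N :
  (forall n, (N <= n)%N -> u n = v n) -> cvgH u l -> cvgH v l.
Proof.
move=> uv h e e0; have [N' hN'] := h e e0; exists (maxn N N') => n.
by rewrite geq_max => /andP[a b]; rewrite -uv // hN'.
Qed.

Lemma cvgH_comb c (u v : nat -> H) l m : cvgH u l -> cvgH v m ->
  cvgH (fun n => c *: u n + v n) (c *: l + m).
Proof.
move=> hu hv e e0.
have c0 : 0 < 2 * ab2 c + 2 by have := ab2_ge0 c; lra.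
have e1 : 0 < e / (2 * ab2 c + 2) by rewrite divr_gt0.
have [N hN] := hu _ e1; have [N' hN'] := hv _ e1.
exists (maxn N N') => n; rewrite geq_max => /andP[/hN a /hN' b].
rewrite opprD addrACA -scalerBr.
apply: le_lt_trans (nnD_le Hip _ _) _; rewrite nnZ //.
move: a b; rewrite !ltr_pdivlMr // => a b.
have := nn_ge0 (u n - l); have := nn_ge0 (v n - m); have := ab2_ge0 c.
nra.
Qed.

Lemma cvgH_ip0 (u : nat -> H) l z :
  cvgH u l -> (forall n, ip (u n) z = 0) -> ip l z = 0.
Proof.
move=> h h0; apply: ab2_eq0; apply/eqP; rewrite eq_le ab2_ge0 andbT.
apply: (@ge0_eps_le0 _ _ (nn z)) => [|e e0]; first exact: nn_ge0.
have [N hN] := h e e0.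
have := CS Hip (u N - l) z; rewrite ipBl h0 sub0r ab2N => k.
apply: le_trans k _; rewrite mulrC ler_wpM2l ?nn_ge0 //.
by rewrite ltW // hN.
Qed.

Lemma cvgH_bounded (T : H -> H) (M : R) : linear T -> 0 <= M ->
  (forall x, nn (T x) <= M * nn x) ->
  forall u l, cvgH u l -> cvgH (fun n => T (u n)) (T l).
Proof.
move=> lT M0 hM u l h e e0.
have M1 : 0 < M + 1 by lra.
have [N hN] := h (e / (M + 1)) (divr_gt0 e0 M1).
exists N => n /hN; rewrite ltr_pdivlMr // -linB // => a.
by have := hM (u n - l); have := nn_ge0 (u n - l); nra.
Qed.

Lemma cvgH_nn_le (u : nat -> H) l (c : R) :
  cvgH u l -> (forall n, nn (u n) <= c) -> nn l <= c.
Proof.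
move=> h hc.
have c0 : 0 <= c by exact: le_trans (nn_ge0 _) (hc 0%N).
have hl : hn ip l <= Num.sqrt c.
  apply/ler_addgt0Pr => e e0; have [N hN] := h _ (exprn_gt0 2 e0).
  have := hnB_tri Hip l (u N) 0; rewrite !subr0 => k.
  apply: le_trans k _; rewrite addrC; apply: lerD.
    by rewrite ler_wsqrtr // hc.
  rewrite -(@ler_pXn2r _ 2) ?nnegrE ?hn_ge0 ?ltW // hn2 // nnBC //.
  by rewrite hN.
by rewrite -hn2 // -(sqr_sqrtr c0) ler_pXn2r ?nnegrE ?hn_ge0 ?sqrtr_ge0.
Qed.

Definition subsp V := V 0 /\ forall c x y, V x -> V y -> V (c *: x + y).
Definition closedH V := forall u l, (forall n, V (u n)) -> cvgH u l -> V l.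
Definition csub V := subsp V /\ closedH V.

Lemma subspD V x y : subsp V -> V x -> V y -> V (x + y).
Proof. by move=> [_ h] Vx Vy; have := h 1 x y Vx Vy; rewrite scale1r. Qed.
Lemma subspZ V c x : subsp V -> V x -> V (c *: x).
Proof. by move=> [h0 h] Vx; have := h c x 0 Vx h0; rewrite addr0. Qed.
Lemma subspN V x : subsp V -> V x -> V (- x).
Proof. by move=> h Vx; rewrite -scaleN1r; exact: subspZ. Qed.
Lemma subspB V x y : subsp V -> V x -> V y -> V (x - y).
Proof. by move=> h Vx Vy; apply: subspD => //; exact: subspN. Qed.
Lemma subsp_sum V I (r : seq I) (P : pred I) (F : I -> H) : subsp V ->
  (forall i, P i -> V (F i)) -> V (\sum_(i <- r | P i) F i).
Proof.
move=> h hF; elim: r => [|a r IH]; first by rewrite big_nil; case: h.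
by rewrite big_cons; case: ifP => // Pa; apply: subspD => //; exact: hF.
Qed.

Lemma csub_perp (D : set H) : csub [set x | forall y, D y -> ip x y = 0].
Proof.
split; first split.
- by move=> y _; rewrite ip0l.
- by move=> c x y hx hy z Dz; rewrite ipDl ipZl hx // hy // mulr0 addr0.
- by move=> u l hu cu z Dz; apply: (cvgH_ip0 cu) => n; exact: hu.
Qed.

Lemma csubI V W : csub V -> csub W -> csub (V `&` W).
Proof.
move=> [[v0 vl] vc] [[w0 wl] wc]; split; first split.
- by split.
- by move=> c x y [? ?] [? ?]; split; [exact: vl|exact: wl].
- move=> u l h cu; split; [apply: (vc u)|apply: (wc u)] => // n.
    exact: (h n).1. exact: (h n).2.
Qed.

Lemma csub_ker (T : H -> H) (M : R) : linear T -> 0 <= M ->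
  (forall x, nn (T x) <= M * nn x) -> csub [set x | T x = 0].
Proof.
move=> lT M0 hM; split; first split; rewrite /=.
- exact: lin0.
- by move=> c x y hx hy; rewrite lT hx hy scaler0 addr0.
- move=> u l hu cu.
  apply: (cvgH_unique (cvgH_bounded lT M0 hM cu)).
  by apply: (cvgH_eventually (N := 0) _ (@cvgH_cst 0)) => n _; rewrite hu.
Qed.

Section Projection.
Variable V : set H.
Hypothesis cV : csub V.

Lemma proj_exists x : exists p, V p /\ forall v, V v -> ip (x - p) v = 0.
Proof.
have sV := cV.1.
pose D := [set nn (x - v) | v in V].
have hD : has_inf D.
  by split; [exists (nn (x - 0)), 0 => //; exact: sV.1|
             exists 0 => _ [v _ <-]; exact: nn_ge0].
set d := inf D.
have dle v : V v -> d <= nn (x - v) by move=> Vv; apply: (ge_inf hD.2); exists v.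
have hu n : exists v, V v /\ nn (x - v) < d + n.+1%:R^-1.
  have n0 : 0 < n.+1%:R^-1 :> R by rewrite invr_gt0.
  by have [_ [v Vv <-] hv] := inf_adherent n0 hD; exists v.
have [u hu'] := choice hu.
(* The midpoint of u m and u n lies in V, hence at squared distance at least d from x; the
   parallelogram law then makes the minimizing sequence Cauchy. *)
have key m n : nn (u m - u n) <= 2 * m.+1%:R^-1 + 2 * n.+1%:R^-1.
  have := parallelogram ip (x - u m) (x - u n).
  have -> : x - u m + (x - u n) = 2%:C *: (x - (2^-1)%:C *: (u m + u n)).
    rewrite scalerBr scalerA -rmorphM /= mulfV ?pnatr_eq0 // scale1r.
    by rewrite -[2]/(1 + 1) rmorphD /= scalerDl !scale1r opprD addrACA.
  have -> : x - u m - (x - u n) = - (u m - u n).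
    by rewrite subrBB opprB.
  rewrite nnZr // nnN //.
  have Vm : V ((2^-1)%:C *: (u m + u n)).
    by apply: subspZ => //; apply: subspD => //; case: (hu' m); case: (hu' n).
  have := dle _ Vm; have := (hu' m).2; have := (hu' n).2.
  move: (m.+1%:R^-1) (n.+1%:R^-1) => a b; lra.
have cu : cauchyn ip u.
  move=> e e0.
  have e4 : 0 < e / 4 by lra.
  have [N hN] : exists N, forall n, (N <= n)%N -> n.+1%:R^-1 < e / 4.
    have [N _ hN] := near_infty_natSinv_lt (PosNum e4).
    by exists N => n; exact: hN.
  exists N => m n /hN + /hN; have := key m n.
  move: (m.+1%:R^-1) (n.+1%:R^-1) => a b; lra.
have [p hp] := cauchyH_cvg Hip cu.
have Vp : V p by apply: (cV.2 u) => // n; case: (hu' n).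
exists p; split => // v Vv.
have dp : nn (x - p) <= d.
  apply/ler_addgt0Pr => e e0.
  have [N _ hN] := near_infty_natSinv_lt (PosNum e0).
  apply: (@cvgH_nn_le (fun n => x - u (n + N)%N)) => [e1 e10|n].
    have [N1 hN1] := hp e1 e10; exists N1 => n Nn.
    rewrite opprB addrC addrA subrK nnBC // hN1 //.
    exact: leq_trans Nn (leq_addr _ _).
  apply: le_trans (ltW (hu' _).2) _; rewrite lerD2l ltW //.
  by apply: hN => /=; rewrite leq_addl.
(* Moving p along w v, with w the phase making the pairing with x - p real, gives a quadratic
   polynomial in t with zero constant term that is never negative; its linear coefficient must
   vanish. *)
have [w [w1 [wI [w0 wR]]]] := phase_exists (ip v (x - p)).
apply: ip_eq0C; apply: ab2_eq0; rewrite -wR.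
suff: complex.Re (w * ip v (x - p)) ^+ 2 <= 0 by
  move=> h; apply/eqP; rewrite eq_le h sqr_ge0.
rewrite -[leRHS](mulr0 (nn v)); apply: discriminant_le; rewrite ?nn_ge0 // => t.
rewrite addr0.
have Vt : V (p - t%:C *: (w *: v)).
  by apply: subspB => //; apply: subspZ => //; exact: subspZ.
have := dle _ Vt; rewrite opprB addrA addrAC addrC nnD // nnZr // nnZ // w1.
rewrite rpZl // /rip ipZl; move: dp; nra.
Qed.

Definition proj : H -> H := fun x => sval (cid (proj_exists x)).

Lemma proj_in x : V (proj x).
Proof. by rewrite /proj; case: cid => p []. Qed.
Lemma proj_perp x v : V v -> ip (x - proj x) v = 0.
Proof. by rewrite /proj; case: cid => p [? h] /h. Qed.
Lemma proj_uniq x p : V p -> (forall v, V v -> ip (x - p) v = 0) -> p = proj x.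
Proof.
move=> Vp h; apply/eqP; rewrite -subr_eq0; apply/eqP; apply: (nn_eq0 Hip).
have Vd : V (p - proj x) by apply: subspB cV.1 Vp (proj_in x).
rewrite /sqn {1}(_ : p - proj x = (x - proj x) - (x - p)); last first.
  by rewrite subrBB.
by rewrite ipBl proj_perp // h // subrr Re0.
Qed.
Lemma proj_id x : V x -> proj x = x.
Proof. by move=> Vx; rewrite -(@proj_uniq x x) // => v _; rewrite subrr ip0l. Qed.
Lemma proj_ip x v : V v -> ip (proj x) v = ip x v.
Proof. by move=> /(proj_perp x); rewrite ipBl => /eqP; rewrite subr_eq0 => /eqP. Qed.
Lemma proj_idem x : proj (proj x) = proj x.
Proof. by rewrite proj_id //; exact: proj_in. Qed.
Lemma proj_linear : linear proj.
Proof.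
move=> c x y; apply/esym; apply: proj_uniq.
  by apply: cV.1.2; exact: proj_in.
move=> v Vv; rewrite opprD addrACA -scalerBr ipDl ipZl !proj_perp //.
by rewrite mulr0 addr0.
Qed.
Lemma proj_sa : self_adjoint ip proj.
Proof.
move=> x y; rewrite -[in RHS]proj_ip; last exact: proj_in.
rewrite [LHS]ipC [ip y (proj x)](esym (proj_ip y (proj_in x))) -ipC.
by rewrite [in RHS]ipC -ipC.
Qed.
End Projection.

Definition orthn (J : set nat) (u : nat -> H) :=
  forall i j, J i -> J j -> ip (u i) (u j) = (i == j)%:R.

Section Orthonormal.
Variables (J : set nat) (u : nat -> H).
Hypothesis oJ : orthn J u.

Definition psum x N := \sum_(i < N | `[< J i >]) ip x (u i) *: u i.

Lemma psumS x N : psum x N.+1 =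
  psum x N + (if `[< J N >] then ip x (u N) *: u N else 0).
Proof.
by rewrite /psum big_mkcond big_ord_recr /= -big_mkcond.
Qed.

Lemma psum_ip x N k : J k -> ip (psum x N) (u k) = (k < N)%N%:R * ip x (u k).
Proof.
move=> Jk; elim: N => [|N IH].
  by rewrite /psum big_ord0 ip0l ltn0 mul0r.
rewrite psumS ipDl IH; case: asboolP => JN.
  rewrite ipZl oJ // [(k < N.+1)%N]ltnS (leq_eqVlt k) eq_sym.
  case: (eqVneq k N) => [<-|_] /=; first by rewrite ltnn mul0r add0r mulr1 mul1r.
  by rewrite mulr0 addr0.
rewrite ip0l addr0 [(k < N.+1)%N]ltnS (leq_eqVlt k).
case: (eqVneq k N) => [e|//].
by rewrite e in Jk.
Qed.

Definition psq x N : R := \sum_(i < N | `[< J i >]) ab2 (ip x (u i)).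

Lemma psqS x N : psq x N.+1 =
  psq x N + (if `[< J N >] then ab2 (ip x (u N)) else 0).
Proof. by rewrite /psq big_mkcond big_ord_recr /= -big_mkcond. Qed.

Lemma nn_psum x N : nn (x - psum x N) = nn x - psq x N.
Proof.
elim: N => [|N IH]; first by rewrite /psum /psq !big_ord0 !subr0.
rewrite psumS psqS; case: asboolP => JN; last by rewrite !addr0.
rewrite opprD addrA nnB // IH nnZ // [nn (u N)]/sqn oJ // eqxx Re1.
have -> : rp (x - psum x N) (ip x (u N) *: u N) = ab2 (ip x (u N)).
  by rewrite /rip ipZr ipBl psum_ip // ltnn mul0r subr0 mulrC mulJ_ab2 ReR.
ring.
Qed.

Lemma psq_le x N : psq x N <= nn x.
Proof. by have := nn_ge0 (x - psum x N); rewrite nn_psum subr_ge0. Qed.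

Lemma psq_mono x N : psq x N <= psq x N.+1.
Proof. by rewrite psqS lerDl; case: ifP => // _; exact: ab2_ge0. Qed.

(** Both partial sums of x are partial sums of the single vector [psum x N], so Pythagoras for that
    vector suffices. *)
Lemma psum_diff x M N : (M <= N)%N ->
  nn (psum x N - psum x M) = psq x N - psq x M.
Proof.
move=> MN.
have -> : psum x N - psum x M = psum (psum x N) N - psum (psum x N) M.
  rewrite /psum; congr (_ - _); apply: eq_bigr => i /asboolP Ji.
    by rewrite psum_ip // ltn_ord mul1r.
  by rewrite psum_ip // (leq_trans (ltn_ord i)) // mul1r.
have e : psum (psum x N) N = psum x N.
  rewrite {1 3}/psum; apply: eq_bigr => i /asboolP Ji.
  by rewrite psum_ip // ltn_ord mul1r.
rewrite e nn_psum.
have h K : (K <= N)%N -> psq (psum x N) K = psq x K.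
  move=> KN; apply: eq_bigr => i /asboolP Ji.
  by rewrite psum_ip // (leq_trans (ltn_ord i)) // mul1r.
rewrite h //; congr (_ - _).
have := nn_psum (psum x N) N; rewrite e subrr nn0 h // => /eqP.
by rewrite eq_sym subr_eq0 => /eqP.
Qed.

(* [x] lies in the closed span of the family, expressed as a double orthogonal. *)
Definition in_cspan x :=
  forall z, (forall i, J i -> ip z (u i) = 0) -> ip x z = 0.

Lemma psum_cvg x : in_cspan x -> cvgH (psum x) x.
Proof.
move=> hx.
have cS : cauchyn ip (psum x).
  move=> e e0.
  have [N hN] := bounded_nondecreasing_cauchy (psq_mono x) (psq_le x) e0.
  exists N => m n Nm Nn; case/orP: (leq_total m n) => mn.
    by rewrite nnBC // psum_diff // hN.
  by rewrite psum_diff // hN.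
have [s hs] := cauchyH_cvg Hip cS.
suff e : x - s = 0 by rewrite -{2}(subrK s x) e add0r.
(* The residual x - s is orthogonal to the family, hence to x, which lies in the closed span, and to
   s, which is a limit of partial sums. *)
have perp i : J i -> ip (x - s) (u i) = 0.
  move=> Ji; apply: (@cvgH_ip0 (fun n => x - psum x (n + i.+1)%N)).
    move=> e e0; have [N hN] := hs e e0; exists N => n Nn.
    rewrite opprB addrC addrA subrK nnBC // hN //.
    exact: leq_trans Nn (leq_addr _ _).
  by move=> n; rewrite ipBl psum_ip // ltn_addl // mul1r subrr.
apply: (nn_eq0 Hip); rewrite /sqn ipBl hx // sub0r ReN.
rewrite (cvgH_ip0 hs) ?Re0 ?oppr0 // => n.
rewrite /psum -(big_filter _ (fun i : 'I_n => `[< J i >])) ip_suml big_seq big1 // => i.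
rewrite mem_filter => /andP[/asboolP Ji _].
by rewrite ipZl (ip_eq0C (perp i Ji)) mulr0.
Qed.

Lemma psum_tail x n (c : R) : in_cspan x ->
  (forall N, (n <= N)%N -> psq x N - psq x n <= c) -> nn (x - psum x n) <= c.
Proof.
move=> hx hc.
apply: (@cvgH_nn_le (fun N => psum x (N + n)%N - psum x n)).
  move=> e e0; have [N hN] := psum_cvg hx e0; exists N => m Nm.
  rewrite opprB addrA subrK hN //; exact: leq_trans Nm (leq_addr _ _).
by move=> N; rewrite psum_diff ?leq_addl // hc // leq_addl.
Qed.

End Orthonormal.

Lemma complete_basis (e : nat -> H) : orthn setT e ->
  (forall x, (forall i, ip x (e i) = 0) -> x = 0) -> orthonormal_basis ip e.
Proof.
move=> oe ce; split => [i j|x]; first exact: oe.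
have := @psum_cvg setT e oe x; rewrite /in_cspan => h.
have {}h : cvgH (psum setT e x) x.
  by apply: h => z hz; rewrite (ce z) ?ip0r // => i; exact: hz.
apply/(cvgHP Hip); apply: (cvgH_eventually (N := 0) _ h) => n _.
rewrite /psum /series /= big_mkord; apply: eq_bigl => i.
by apply/asboolP.
Qed.

Lemma basis_complete (e : nat -> H) x : orthonormal_basis ip e ->
  (forall i, ip x (e i) = 0) -> x = 0.
Proof.
move=> [_ /(_ x) h] h0; apply: (cvgH_unique _ (@cvgH_cst 0)).
apply: (cvgH_eventually (N := 0) _ ((cvgHP Hip _ _).2 h)) => n _.
by rewrite /series /= big1 // => i _; rewrite h0 scale0r.
Qed.

End Subspaces.

(** * Positive operators and square roots *)

Section Positive.
Context {R : realType} {H : completeNormedModType R[i]}.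
Variable ip : {dot H for Num.conj}.
Hypothesis Hip : inner_product_norm ip.
Implicit Types (x y z : H) (c : R[i]) (T S C : H -> H).

Local Notation nn := (sqn ip).
Local Notation rp := (rip ip).
Local Notation cvgH := (cvgn ip).
Local Notation nn_ge0 := (nn_ge0 Hip).
Local Notation sa := (self_adjoint ip).

Definition bounded_by (M : R) T := 0 <= M /\ forall x, nn (T x) <= M * nn x.
Definition commutes T S := forall x, T (S x) = S (T x).
Definition projection T := [/\ linear T, sa T & forall x, T (T x) = T x].

Lemma rp_sa T x y : sa T -> rp (T x) y = rp x (T y).
Proof. by move=> h; rewrite /rip h. Qed.

Lemma projection_rp T x : projection T -> rp (T x) x = nn (T x).
Proof. by move=> [_ s i]; rewrite -i rp_sa // i. Qed.

Lemma proj_projection V (cV : csub ip V) : projection (proj Hip cV).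
Proof. by split; [exact: proj_linear|exact: proj_sa|exact: proj_idem]. Qed.

Lemma projection_nn T x : projection T -> nn x = nn (T x) + nn (x - T x).
Proof.
move=> [l s i]; rewrite -{1}(subrK (T x) x) addrC (nnD_orth (x := T x)) //.
by rewrite ipBr s s i -s subrr.
Qed.

Lemma projection_le T x : projection T -> nn (T x) <= nn x.
Proof. by move=> /(projection_nn x) ->; rewrite lerDl nn_ge0. Qed.

Lemma projection_bounded T : projection T -> bounded_by 1 T.
Proof. by move=> pT; split=> // x; rewrite mul1r projection_le. Qed.

(** Cauchy-Schwarz for the form of T at x and T x gives |T x|^4 <= <T x, x> <T (T x), T x>, and the
    last factor is at most |T x|^2. *)
Lemma psd_contraction T : linear T -> sa T ->
  (forall x, 0 <= rp (T x) x <= nn x) -> forall x, nn (T x) <= rp (T x) x.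
Proof.
move=> lT sT bT x.
have pT y : 0 <= rp (T y) y by case/andP: (bT y).
have := psd_CS lT sT pT x (T x).
rewrite /ab2 -/(sqn ip (T x)).
have -> : complex.Im (ip (T x) (T x)) = 0 by rewrite ipnn ImR.
rewrite expr0n addr0 => h.
have /andP[_ b] := bT (T x).
have := nn_ge0 (T x); rewrite le_eqVlt => /orP[/eqP <-|n0]; first exact: pT.
rewrite -(ler_pM2r n0); apply: le_trans (_ : _ <= rp (T x) x * rp (T (T x)) (T x)) _.
  by rewrite -expr2.
by rewrite ler_wpM2l.
Qed.

Lemma psd_contraction_bounded T : linear T -> sa T ->
  (forall x, 0 <= rp (T x) x <= nn x) -> bounded_by 1 T.
Proof.
move=> lT sT bT; split=> // x; rewrite mul1r.
by apply: le_trans (psd_contraction lT sT bT x) _; case/andP: (bT x).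
Qed.

Lemma ip_lim2 (a b : nat -> H) l m x y : cvgH a l -> cvgH b m ->
  (forall n, ip (a n) y = ip x (b n)) -> ip l y = ip x m.
Proof.
move=> ha hb h; apply/eqP; rewrite -subr_eq0; apply/eqP; apply: ab2_eq0.
apply/eqP; rewrite eq_le ab2_ge0 andbT.
apply: (@ge0_eps_le0 _ _ (2 * nn x + 2 * nn y)) => [|e e0].
  by have := nn_ge0 x; have := nn_ge0 y; lra.
have [N hN] := ha e e0; have [N' hN'] := hb e e0.
have := hN (maxn N N') (leq_maxl _ _); have := hN' (maxn N N') (leq_maxr _ _).
set n := maxn _ _ => k k'.
have -> : ip l y - ip x m = - ip (a n - l) y + ip x (b n - m).
  by rewrite ipBl ipBr h opprB addrA subrK.
apply: le_trans (ab2D_le _ _) _; rewrite ab2N.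
have := CS Hip (a n - l) y; have := CS Hip x (b n - m).
by have := nn_ge0 x; have := nn_ge0 y; nra.
Qed.

Lemma rp_lim_le (a : nat -> H) l x (c : R) : cvgH a l ->
  (forall n, rp (a n) x <= c) -> rp l x <= c.
Proof.
move=> ha h; rewrite leNgt; apply/negP => lc.
suff : (rp l x - c) ^+ 2 <= 0.
  by rewrite leNgt exprn_gt0 // subr_gt0.
apply: (@ge0_eps_le0 _ _ (nn x)) => [|e e0]; first exact: nn_ge0.
have [N hN] := ha e e0; have k := hN N (leqnn _).
have e1 : rp l x = rp (a N) x - rp (a N - l) x by rewrite rpDl rpNl; ring.
apply: le_trans (_ : _ <= rp (a N - l) x ^+ 2) _.
  by have := h N; rewrite e1 in lc *; nra.
by have := CSr Hip (a N - l) x; have := nn_ge0 x; nra.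
Qed.

Lemma rp_lim_ge (a : nat -> H) l x (c : R) : cvgH a l ->
  (forall n, c <= rp (a n) x) -> c <= rp l x.
Proof.
move=> ha h; rewrite -lerN2 -rpNr; apply: (rp_lim_le ha) => n.
by rewrite rpNr lerN2.
Qed.

(** The differences T n - T m with m <= n lie between 0 and 1, so [psd_contraction] bounds |(T n - T
    m) x|^2 by the increment of the bounded monotone sequence <T n x, x>. *)
Lemma monotone_limit (T : nat -> H -> H) :
  (forall n, linear (T n)) -> (forall n, sa (T n)) ->
  (forall n x, 0 <= rp (T n x) x <= nn x) ->
  (forall n x, rp (T n x) x <= rp (T n.+1 x) x) ->
  exists L, [/\ linear L, sa L, forall x, 0 <= rp (L x) x <= nn x &
    forall x, cvgH (fun n => T n x) (L x)].
Proof.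
move=> lT sT bT mT.
have mono m n x : (m <= n)%N -> rp (T m x) x <= rp (T n x) x.
  by move/subnK <-; elim: (n - m)%N => // k IH; rewrite addSn (le_trans IH).
have cT x : exists l, cvgH (fun n => T n x) l.
  apply: (cauchyH_cvg Hip) => e e0.
  have [||N hN] := @bounded_nondecreasing_cauchy _ (fun n => rp (T n x) x) (nn x) _ _ e e0.
  - by move=> n; exact: mT.
  - by move=> n; case/andP: (bT n x).
  have key m n : (N <= m)%N -> (m <= n)%N -> nn (T n x - T m x) < e.
    move=> Nm mn; apply: le_lt_trans (hN m n Nm mn).
    rewrite -rpNl -rpDl.
    apply: (@psd_contraction (fun y => T n y - T m y)) => [c u v|u v|y].
    - by rewrite lT lT scalerBr opprD addrACA.
    - by rewrite ipBl ipBr sT sT.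
    - rewrite rpDl rpNl subr_ge0 mono //=.
      by have /andP[_] := bT n y; have /andP[] := bT m y; lra.
  exists N => m n Nm Nn; case/orP: (leq_total m n) => mn; last exact: key.
  by rewrite nnBC key.
have [L hL] := choice cT.
exists L; split => // [c u v|u v|x].
- apply: (cvgH_unique Hip (hL _)).
  apply: (cvgH_eventually (N := 0) _ (cvgH_comb Hip c (hL u) (hL v))) => n _.
  by rewrite lT.
- by apply: (ip_lim2 (hL u) (hL v)) => n; rewrite sT.
- apply/andP; split.
  + by apply: (rp_lim_ge (hL x)) => n; case/andP: (bT n x).
  + by apply: (rp_lim_le (hL x)) => n; case/andP: (bT n x).
Qed.

(* The operators obtained from the powers of X by nonnegative combinations;
   the cone is stable under composition. *)
Inductive cone (X : H -> H) : (H -> H) -> Prop :=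
| cone_pow k : cone X (fun x => iter k X x)
| cone_add S T : cone X S -> cone X T -> cone X (fun x => S x + T x)
| cone_scale r S : 0 <= r -> cone X S -> cone X (fun x => r%:C *: S x).

Lemma linear_iter X k : linear X -> linear (fun x => iter k X x).
Proof. by move=> l; elim: k => //= k IH c x y; rewrite IH l. Qed.

Lemma cone_linear X S : linear X -> cone X S -> linear S.
Proof.
move=> lX; elim=> [k|S1 T1 _ l1 _ l2 c x y|r S1 _ _ l1 c x y].
- exact: linear_iter.
- by rewrite l1 l2 scalerDr addrACA.
- by rewrite l1 scalerDr !scalerA mulrC.
Qed.

Lemma commutes_iter X C k : commutes C X -> commutes C (fun x => iter k X x).
Proof. by move=> h x; elim: k => //= k IH; rewrite h IH. Qed.

Lemma cone_commutes X S C : linear C -> commutes C X -> cone X S -> commutes C S.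
Proof.
move=> lC h; elim=> [k|S1 T1 _ l1 _ l2 x|r S1 _ _ l1 x].
- exact: commutes_iter.
- by rewrite linD // l1 l2.
- by rewrite linZ // l1.
Qed.

Lemma cone_comm X S T : linear X -> cone X S -> cone X T -> commutes S T.
Proof.
move=> lX cS cT; apply: cone_commutes (cone_linear lX cS) _ cT => x.
by rewrite (cone_commutes lX _ cS).
Qed.

Lemma cone_comp X S T : linear X -> cone X S -> cone X T -> cone X (S \o T).
Proof.
move=> lX; elim=> [k|S1 T1 _ l1 _ l2 cT|r S1 r0 _ l1 cT].
- elim=> [l|S1 T1 _ l1 _ l2|r S1 r0 _ l1].
  + have -> : (fun x => iter k X x) \o (fun x => iter l X x) = fun x => iter (k + l) X x.
      by apply/funext => x; rewrite /= iterD.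
    exact: cone_pow.
  + have -> : (fun x => iter k X x) \o (fun x => S1 x + T1 x) =
        fun x => ((fun x => iter k X x) \o S1) x + ((fun x => iter k X x) \o T1) x.
      by apply/funext => x /=; rewrite (linD (linear_iter k lX)).
    exact: cone_add.
  + have -> : (fun x => iter k X x) \o (fun x => r%:C *: S1 x) =
        fun x => r%:C *: ((fun x => iter k X x) \o S1) x.
      by apply/funext => x /=; rewrite (linZ (linear_iter k lX)).
    exact: cone_scale.
- exact: cone_add (l1 cT) (l2 cT).
- exact: cone_scale r0 (l1 cT).
Qed.

Lemma cone_sa X S : sa X -> cone X S -> sa S.
Proof.
move=> sX; elim=> [k|S1 T1 _ l1 _ l2 x y|r S1 _ _ l1 x y].
- by elim: k => [|k IH] x y //=; rewrite sX IH -iterSr.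
- by rewrite ipDl ipDr l1 l2.
- by rewrite ipZl ipZr l1 conjc_real.
Qed.

Lemma cone_psd X S : sa X -> (forall x, 0 <= rp (X x) x) -> cone X S ->
  forall x, 0 <= rp (S x) x.
Proof.
move=> sX pX; elim=> [k x|S1 T1 _ l1 _ l2 x|r S1 r0 _ l1 x]; last 2 first.
- by rewrite rpDl addr_ge0.
- by rewrite rpZl mulr_ge0.
have sit j : sa (fun x => iter j X x) by apply: cone_sa sX (cone_pow _ _).
(* Writing the exponent as b + 2 j reduces the form of a power of X at x to that of X^b, with b at
   most 1, at X^j x. *)
have [j [b ->]] : exists j, exists b : bool, k = (b + (j + j))%N.
  by exists k./2, (odd k); rewrite addnn odd_double_half.
rewrite addnCA iterD.
have -> := rp_sa (iter (b + j) X x) x (sit j).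
by case: b => /=; [exact: pX|exact: nn_ge0].
Qed.

Section SquareRoot.
Variable X : H -> H.
Hypotheses (lX : linear X) (sX : sa X).
Hypothesis bX : forall x, 0 <= rp (X x) x <= nn x.

Let W := fix W n : H -> H := if n is k.+1 then
  fun x => (2^-1)%:C *: (X x + W k (W k x)) else fun x => 0%:C *: x.

Let half_ge0 : 0 <= 2^-1 :> R.
Proof. by rewrite invr_ge0. Qed.

Let cone_W n : cone X (W n).
Proof.
elim: n => [|n IH] /=; first exact: (cone_scale (lexx _) (cone_pow X 0)).
apply: (cone_scale half_ge0 (S := fun x => X x + W n (W n x))).
apply: (cone_add (cone_pow X 1)); exact: cone_comp.
Qed.

(** The recursion gives W_{n+2} - W_{n+1} = (W_{n+1} + W_n) (W_{n+1} - W_n) / 2 because the factors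
    commute, so the increments stay in the cone; this is why the sequence increases. *)
Let cone_D n : cone X (fun x => W n.+1 x - W n x).
Proof.
elim: n => [|n IH].
  have -> : (fun x => W 1 x - W 0 x) = (fun x => (2^-1)%:C *: X x).
    by apply/funext => x /=; rewrite !scale0r subr0 addr0.
  exact: (cone_scale half_ge0 (cone_pow X 1)).
have -> : (fun x => W n.+2 x - W n.+1 x) =
  fun x => (2^-1)%:C *: ((fun x => W n.+1 x + W n x) \o
                         (fun x => W n.+1 x - W n x)) x.
  apply/funext => x; rewrite [in LHS](_ : W n.+2 x =
    (2^-1)%:C *: (X x + W n.+1 (W n.+1 x))) //.
  rewrite [X in _ - X](_ : W n.+1 x = (2^-1)%:C *: (X x + W n (W n x))) //.
  rewrite -scalerBr; congr (_ *: _).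
  have lW k : linear (W k) by exact: cone_linear (cone_W k).
  rewrite /comp -/(W n.+1) !(linB (lW _)) (cone_comm lX (cone_W n) (cone_W n.+1)).
  by rewrite opprD addrACA subrr add0r subrKA.
exact: (cone_scale half_ge0 (cone_comp lX (cone_add (cone_W _) (cone_W _)) IH)).
Qed.

Let W_le n x : 0 <= rp (W n x) x <= nn x.
Proof.
have pX y : 0 <= rp (X y) y by case/andP: (bX y).
elim: n x => [|n IH] x; first by rewrite /= scale0r /rip ip0l lexx nn_ge0.
rewrite (cone_psd sX pX (cone_W n.+1)) /= rpZl rpDl.
rewrite (rp_sa _ _ (cone_sa sX (cone_W n))) -nnE.
have lW := cone_linear lX (cone_W n).
have := psd_contraction lW (cone_sa sX (cone_W n)) IH x.
by have /andP[] := IH x; have /andP[] := bX x; lra.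
Qed.

(* W is the increasing limit of polynomials in X; it solves 2W = X + W^2, so
   that (1 - W)^2 = 1 - X. *)
Lemma sqrt_exists : exists W, [/\ linear W, sa W,
  forall x, 0 <= rp (W x) x <= nn x,
  forall x, 2%:C *: W x = X x + W (W x) &
  forall C, linear C -> (exists M, bounded_by M C) -> commutes C X -> commutes C W].
Proof.
have lW n := cone_linear lX (cone_W n).
have sW n := cone_sa sX (cone_W n).
have pX y : 0 <= rp (X y) y by case/andP: (bX y).
have [|L [lL sL bL cL]] := monotone_limit lW sW W_le.
  move=> n x; rewrite -subr_ge0 -rpNl -rpDl.
  exact: (cone_psd sX pX (cone_D n)).
exists L; split => // [x|C lC [M [M0 hM]] cC x].
  have h1 : cvgH (fun n => 2%:C *: W n.+1 x + 0) (2%:C *: L x + 0).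
    apply: cvgH_comb (cvgH_cst _ _) => // e e0.
    have [N hN] := cL x e e0; exists N => n Nn; apply: hN.
    exact: leq_trans Nn (leqnSn _).
  rewrite addr0 in h1; apply: (cvgH_unique Hip h1).
  have h2 : cvgH (fun n => W n (W n x)) (L (L x)).
    move=> e e0.
    have e4 : 0 < e / 4 by lra.
    have [N hN] := cL x _ e4; have [N' hN'] := cL (L x) _ e4.
    exists (maxn N N') => n; rewrite geq_max => /andP[/hN a /hN' b].
    have -> : W n (W n x) - L (L x) = W n (W n x - L x) + (W n (L x) - L (L x)).
      by rewrite (linB (lW n)) subrKA.
    apply: le_lt_trans (nnD_le Hip _ _) _.
    have := (psd_contraction_bounded (lW n) (sW n) (W_le n)).2 (W n x - L x).
    by rewrite mul1r; lra.
  have h3 := cvgH_comb Hip 1 (cvgH_cst ip (X x)) h2.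
  rewrite scale1r in h3; apply: (cvgH_eventually (N := 0) _ h3) => n _.
  by rewrite addr0 /= scalerA -rmorphM /= mulfV ?pnatr_eq0 // scale1r.
have h1 := cvgH_bounded Hip lC M0 hM (cL x).
apply: (cvgH_unique Hip h1); apply: (cvgH_eventually (N := 0) _ (cL (C x))) => n _.
by rewrite (cone_commutes lC cC (cone_W n)).
Qed.

End SquareRoot.

(** The square root of B^2. As [bounded_by] bounds squared norms, X = 1 - B^2 / m with m = M + 1
    lies between 0 and 1; the solution W for X satisfies (1 - W)^2 = B^2 / m, and sqrt m (1 - W) is
    the root. *)
Lemma abs_exists (B : H -> H) (M : R) : linear B -> sa B -> bounded_by M B ->
  exists S, [/\ linear S, sa S, exists M', bounded_by M' S,
  forall x, 0 <= rp (S x) x & (forall x, S (S x) = B (B x)) /\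
  forall C, linear C -> (exists M, bounded_by M C) -> commutes C B -> commutes C S].
Proof.
move=> lB sB [M0 hM].
pose m := M + 1; have m0 : 0 < m by rewrite /m; lra.
pose X x := x - (m^-1)%:C *: B (B x).
have lX : linear X.
  move=> c x y; rewrite /X !lB scalerDr scalerBr opprD addrACA.
  by congr (_ - _ + _); rewrite !scalerA mulrC.
have sX : sa X.
  by move=> x y; rewrite /X ipBl ipBr ipZl ipZr conjc_real !sB.
have rX x : rp (X x) x = nn x - m^-1 * nn (B x).
  by rewrite /X rpDl rpNl rpZl (rp_sa _ _ sB).
have bX x : 0 <= rp (X x) x <= nn x.
  have a : 0 <= m^-1 * nn (B x) by rewrite mulr_ge0 ?nn_ge0 // invr_ge0 ltW.
  have b : m^-1 * nn (B x) <= nn x.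
    rewrite mulrC ler_pdivrMr //; have := hM x; have := nn_ge0 x.
    by rewrite /m; nra.
  rewrite rX; lra.
have [W [lW sW bW eW cW]] := sqrt_exists lX sX bX.
pose s : R := Num.sqrt m.
have s0 : 0 <= s by exact: sqrtr_ge0.
have lS : linear (fun x => s%:C *: (x - W x)).
  move=> c x y; rewrite lW opprD addrACA -scalerBr scalerDr !scalerA.
  by rewrite mulrC.
exists (fun x => s%:C *: (x - W x)); split => //.
- by move=> x y; rewrite ipZl ipZr conjc_real ipBl ipBr sW.
- exists (s ^+ 2 * 4); split=> [|x]; first by rewrite mulr_ge0 ?sqr_ge0.
  rewrite nnZr -mulrA; apply: ler_wpM2l; first exact: sqr_ge0.
  have := nnB_le Hip x (W x).
  by have := (psd_contraction_bounded lW sW bW).2 x; lra.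
- move=> x; rewrite rpZl rpDl rpNl mulr_ge0 //.
  by have /andP[] := bW x; rewrite -nnE; lra.
split => [x|C lC bC cC x].
- rewrite (linZ lW) -scalerBr scalerA -rmorphM /= -expr2 sqr_sqrtr ?(ltW m0) //.
  have -> : x - W x - W (x - W x) = (m^-1)%:C *: B (B x).
    rewrite (linB lW) opprB addrA [_ + W (W x)]addrC !addrA.
    apply/eqP; rewrite subr_eq subr_eq; apply/eqP.
    have := eW x; rewrite -[2]/(1 + 1) rmorphD /= scalerDl !scale1r => e.
    by rewrite -addrA e /X addrA [_ + (x - _)]addrC subrK addrC.
  by rewrite scalerA -rmorphM /= mulfV ?gt_eqF // scale1r.
- rewrite (linZ lC) (linB lC) cW // => y.
  by rewrite /X (linB lC) (linZ lC) !cC.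
Qed.

(** P projects onto the kernel of |B| + B, where B = -|B|. Since (|B| - B) (|B| + B) = 0, the
    orthogonal complement lies in the kernel of |B| - B, where B = |B|. Kernel vectors of B are
    counted on the nonpositive side. *)
Lemma posneg_split (B : H -> H) (M : R) : linear B -> sa B -> bounded_by M B ->
  exists P, [/\ projection P,
  forall x, P x = x -> rp (B x) x <= 0,
  forall x, P x = 0 -> 0 <= rp (B x) x,
  forall x, B x = 0 -> P x = x &
  forall C, linear C -> sa C -> (exists M, bounded_by M C) ->
    commutes C B -> commutes C P].
Proof.
move=> lB sB bB.
have [S [lS sS [MS bS] pS [S2 cS]]] := abs_exists lB sB bB.
have cBS : commutes B S by apply: cS => //; exists M.
pose N x := S x + B x.
have lN : linear N by move=> c x y; rewrite /N lS lB scalerDr addrACA.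
have sN : sa N by move=> x y; rewrite /N ipDl ipDr sS sB.
pose D x := S x - B x.
have lD : linear D by move=> c x y; rewrite /D lS lB scalerBr opprD addrACA.
have bd2 (T : H -> H) : (forall x, nn (T x) <= 2 * nn (S x) + 2 * nn (B x)) ->
    bounded_by (2 * MS + 2 * M) T.
  have [MS0 hS] := bS; have [M0 hB] := bB.
  move=> hT; split=> [|x]; first lra.
  by have := hT x; have := hS x; have := hB x; lra.
have bN := bd2 N (fun x => nnD_le Hip _ _).
have bD := bd2 D (fun x => nnB_le Hip _ _).
have cN : csub ip [set x | N x = 0] by exact: (csub_ker Hip lN bN.1 bN.2).
have cD : csub ip [set x | D x = 0] by exact: (csub_ker Hip lD bD.1 bD.2).
have DN x : D (N x) = 0.
  by rewrite /D /N (linD lS) (linD lB) S2 cBS [S (B x) + _]addrC subrr.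
exists (proj Hip cN); split.
- exact: proj_projection.
- move=> x Px; have : N x = 0 by rewrite -Px; exact: (proj_in Hip cN).
  rewrite /N addrC => /eqP; rewrite addr_eq0 => /eqP ->.
  by rewrite rpNl oppr_le0 pS.
- move=> x Px.
  have xN v : N v = 0 -> ip x v = 0.
    by move=> Nv; have := proj_perp Hip cN x Nv; rewrite Px subr0.
  pose z := x - proj Hip cD x.
  have Nz : N z = 0.
    apply: (nn_eq0 Hip); rewrite /sqn sN.
    by rewrite (proj_perp Hip cD x (v := N (N z))) ?Re0 //; exact: DN.
  have z0 : z = 0.
    apply: (nn_eq0 Hip); rewrite /sqn {1}/z ipBl xN // sub0r.
    by rewrite (ip_eq0C (proj_perp Hip cD x (proj_in Hip cD x))) oppr0 Re0.
  have : D x = 0.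
    have -> : x = proj Hip cD x by apply/eqP; rewrite -subr_eq0 -/z z0.
    exact: (proj_in Hip cD).
  by move/eqP; rewrite subr_eq0 => /eqP <-.
- move=> x Bx; apply: proj_id => /=.
  have Sx : S x = 0.
    by apply: (nn_eq0 Hip); rewrite /sqn sS S2 Bx (lin0 lB) ip0r Re0.
  by rewrite /N Sx Bx addr0.
- move=> C lC sC bC cC x.
  have cCN y : C (N y) = N (C y) by rewrite /N (linD lC) cC (cS C).
  apply/esym/eqP; rewrite eq_sym; apply/eqP; apply: proj_uniq => /=.
    by rewrite -cCN (_ : N _ = 0) ?(lin0 lC) //; exact: (proj_in Hip cN).
  move=> v Nv; rewrite -(linB lC) sC; apply: (proj_perp Hip cN) => /=.
  by rewrite -cCN Nv (lin0 lC).
Qed.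

(** The properties wanted of the spectral projections of the closed half-lines ending at t.
    Eigenvectors for t itself lie in the range of [P t], and this clause is what yields right
    continuity. *)
Definition halfline_projection (A : H -> H) (P : R -> H -> H) :=
  [/\ forall t, projection (P t),
   forall t x, P t x = x -> rp (A x) x <= t * nn x,
   forall t x, P t x = 0 -> t * nn x <= rp (A x) x,
   forall t x, A x = t%:C *: x -> P t x = x &
   forall t C, linear C -> sa C -> (exists M, bounded_by M C) ->
     commutes C A -> commutes C (P t)].

Lemma halfline_projection_exists (A : H -> H) (M : R) :
  linear A -> sa A -> bounded_by M A -> exists P, halfline_projection A P.
Proof.
move=> lA sA [M0 hM].
have hP t := @posneg_split (fun x => A x - t%:C *: x) (2 * M + 2 * t ^+ 2).
have {}hP : forall t, exists P, [/\ projection P,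
  forall x, P x = x -> rp (A x - t%:C *: x) x <= 0,
  forall x, P x = 0 -> 0 <= rp (A x - t%:C *: x) x,
  forall x, A x - t%:C *: x = 0 -> P x = x &
  forall C, linear C -> sa C -> (exists M, bounded_by M C) ->
    commutes C (fun x => A x - t%:C *: x) -> commutes C P].
  move=> t; apply: hP => [c x y|x y|].
  - rewrite lA scalerDr scalerBr opprD addrACA; congr (_ - _ + _).
    by rewrite !scalerA mulrC.
  - by rewrite ipBl ipBr ipZl ipZr conjc_real sA.
  - split=> [|x]; first by have := sqr_ge0 t; lra.
    apply: le_trans (nnB_le Hip _ _) _; rewrite nnZr.
    by have := hM x; lra.
have [P hP'] := choice hP.
exists P; split => [t|t x Px|t x Px|t x Ax|t C lC sC bC cC].
- by case: (hP' t).
- have [_ h _ _ _] := hP' t.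
  by have := h x Px; rewrite rpDl rpNl rpZl subr_le0 -nnE.
- have [_ _ h _ _] := hP' t.
  by have := h x Px; rewrite rpDl rpNl rpZl subr_ge0 -nnE.
- by have [_ _ _ h _] := hP' t; apply: h; rewrite Ax subrr.
- have [_ _ _ _ h] := hP' t; apply: h => // x.
  by rewrite (linB lC) (linZ lC) cC.
Qed.

Section HalfLines.
Variables (A : H -> H) (M : R) (P : R -> H -> H).
Hypotheses (lA : linear A) (sA : sa A) (bA : bounded_by M A).
Hypothesis hP : halfline_projection A P.

Let pP t : projection (P t). Proof. by case: hP. Qed.
Let lP t : linear (P t). Proof. by case: (pP t). Qed.
Let sP t : sa (P t). Proof. by case: (pP t). Qed.
Let iP t x : P t (P t x) = P t x. Proof. by case: (pP t). Qed.

Lemma halfline_commA t : commutes A (P t).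
Proof. by have [_ _ _ _ h] := hP; apply: h => //; exists M. Qed.

Lemma halfline_comm s t : commutes (P s) (P t).
Proof.
have [_ _ _ _ h] := hP; apply: h; rewrite ?/P //.
- by exists 1; exact: projection_bounded.
- by move=> x; rewrite halfline_commA.
Qed.

(** The defect y of the inclusion lies in the range of P s and in the kernel of P t, so t |y|^2 <=
    <A y, y> <= s |y|^2 with s < t. *)
Lemma halfline_mono s t x : s <= t -> P t (P s x) = P s x.
Proof.
rewrite le_eqVlt => /orP[/eqP <-|st]; first exact: iP.
apply/eqP; rewrite eq_sym -subr_eq0; set y := _ - _; apply/eqP.
have [_ h1 h2 _ _] := hP.
have y1 : P s y = y by rewrite /y (linB (lP s)) iP halfline_comm iP.
have y2 : P t y = 0 by rewrite /y (linB (lP t)) iP subrr.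
apply: (nn_eq0 Hip); have := h1 s y y1; have := h2 t y y2; have := nn_ge0 y; nra.
Qed.

Lemma halfline_mono' s t x : s <= t -> P s (P t x) = P s x.
Proof. by move=> st; rewrite halfline_comm halfline_mono. Qed.

Let rA_le x : `|rp (A x) x| <= Num.sqrt M * nn x.
Proof.
have [M0 hM] := bA.
rewrite -(@ler_pXn2r _ 2) ?nnegrE ?mulr_ge0 ?sqrtr_ge0 ?nn_ge0 //.
rewrite real_normK ?num_real // exprMn sqr_sqrtr //.
apply: le_trans (CSr Hip _ _) _; rewrite expr2 mulrA ler_wpM2r ?nn_ge0 //.
Qed.

Lemma halfline_low t x : t < - Num.sqrt M -> P t x = 0.
Proof.
move=> tM; apply: (nn_eq0 Hip); have [_ h1 _ _ _] := hP.
have := h1 t (P t x) (iP t x); have := rA_le (P t x); rewrite ler_norml.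
by have := nn_ge0 (P t x); move=> ? /andP[? ?] ?; nra.
Qed.

Lemma halfline_high t x : Num.sqrt M < t -> P t x = x.
Proof.
move=> tM; apply/eqP; rewrite eq_sym -subr_eq0; apply/eqP.
apply: (nn_eq0 Hip); have [_ _ h1 _ _] := hP.
have e : P t (x - P t x) = 0 by rewrite (linB (lP t)) iP subrr.
have := h1 t _ e; have := rA_le (x - P t x); rewrite ler_norml.
by have := nn_ge0 (x - P t x); move=> ? /andP[? ?] ?; nra.
Qed.

(** The limit K of P (t n) x, for t n decreasing to s, differs from P s x by a vector y killed by P
    s with form value s |y|^2. The form of A - s is nonnegative on the kernel of P s, so
    Cauchy-Schwarz makes y an eigenvector for s, which P s fixes; hence y = 0. *)
Lemma halfline_right_continuous s x (e : R) : 0 < e ->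
  exists t, s < t /\ nn (P t x) < nn (P s x) + e.
Proof.
move=> e0; pose t n := s + n.+1%:R^-1.
have st n : s < t n by rewrite ltrDl invr_gt0.
have tt n : t n.+1 <= t n.
  by rewrite lerD2l lef_pV2 ?posrE // ler_nat.
pose T n y := y - P (t n) y.
have pT n : projection (T n).
  split=> [c y z|y z|y]; rewrite /T.
  - by rewrite lP scalerBr opprD addrACA.
  - by rewrite ipBl ipBr sP.
  - by rewrite (linB (lP _)) iP subrr subr0.
have [||||L [lL sL bL cL]] := @monotone_limit T.
- by move=> n; case: (pT n).
- by move=> n; case: (pT n).
- by move=> n y; rewrite projection_rp // nn_ge0 projection_le.
- move=> n y; rewrite !projection_rp //.
  rewrite -(lerD2l (nn (P (t n) y))) -projection_nn // (projection_nn y (pP (t n.+1))).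
  rewrite lerD2r -{1}(halfline_mono' _ (tt n)).
  exact: projection_le.
pose K := x - L x.
have cK : cvgH (fun n => P (t n) x) K.
  move=> e1 e10; have [N hN] := cL x e1 e10; exists N => n /hN.
  rewrite /T /K -nnN opprB; congr (sqn ip _ < _).
  by rewrite !opprB addrCA.
have PK m : P (t m) K = K.
  have b := (projection_bounded (pP (t m))).
  have c1 := cvgH_bounded Hip (lP (t m)) b.1 b.2 cK.
  apply: (cvgH_unique Hip c1); apply: (cvgH_eventually (N := m) _ cK) => n mn.
  rewrite halfline_mono //.
  by move/subnK: mn => <-; elim: (n - m)%N => // k IH; rewrite addSn (le_trans (tt _)).
pose y := K - P s x.
have Psy : P s y = 0.
  have b := (projection_bounded (pP s)).
  have c1 := cvgH_bounded Hip (lP s) b.1 b.2 cK.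
  have c2 : cvgH (fun n => P s (P (t n) x)) (P s x).
    apply: (cvgH_eventually (N := 0) _ (cvgH_cst ip _)) => n _.
    by rewrite halfline_mono' // ltW.
  by rewrite /y (linB (lP s)) iP (cvgH_unique Hip c1 c2) subrr.
have Pty m : P (t m) y = y.
  by rewrite /y (linB (lP _)) PK halfline_mono // ltW.
have [_ h1 h2 h3 _] := hP.
have ry : rp (A y) y - s * nn y = 0.
  apply/eqP; rewrite eq_le subr_ge0 h2 // andbT.
  apply: (@ge0_eps_le0 _ _ (nn y)) => [|e1 e10]; first exact: nn_ge0.
  have [N _ hN] := near_infty_natSinv_lt (PosNum e10).
  have := h1 _ _ (Pty N); have := hN N (leqnn _); rewrite /t /=.
  by move: (N.+1%:R^-1) => r; have := nn_ge0 y; nra.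
have y0 : y = 0.
  rewrite -Psy; apply/esym; apply: h3; apply/eqP; rewrite -subr_eq0; apply/eqP.
  (* The compression of A - s to the kernel of P s, written on the whole space so that [psd_CS]
     applies. *)
  pose B z := A (z - P s z) - s%:C *: (z - P s z).
  have -> : A y - s%:C *: y = B y by rewrite /B Psy subr0.
  have lB : linear B.
    move=> c u v; rewrite /B lP opprD addrACA -scalerBr lA.
    move: (u - P s u) (v - P s v) => {}u {}v.
    rewrite scalerDr scalerBr opprD addrACA; congr (_ - _ + _).
    by rewrite !scalerA mulrC.
  have PB z : P s (B z) = 0.
    rewrite /B (linB (lP s)) -halfline_commA (linZ (lP s)) (linB (lP s)) iP.
    by rewrite subrr (lin0 lA) scaler0 subrr.
  have e1 z w : ip (B z) w = ip (B z) (w - P s w).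
    by rewrite ipBr -sP PB ip0l subr0.
  have sB : sa B.
    move=> z w; rewrite (e1 z w) [RHS]ipC (e1 w z) -ipC /B.
    move: (z - P s z) (w - P s w) => {}z {}w.
    by rewrite ipBl ipBr ipZl ipZr conjc_real sA.
  apply: (nn_eq0 Hip).
  have pB z : 0 <= rp (B z) z.
    rewrite /rip e1 -/(rp (B z) (z - P s z)) /B rpDl rpNl rpZl subr_ge0 -nnE.
    by apply: h2; rewrite (linB (lP s)) iP subrr.
  have := psd_CS lB sB pB y (B y).
  have -> : rp (B y) y = 0.
    by rewrite /B Psy subr0 rpDl rpNl rpZl -nnE.
  rewrite mul0r => h; have /ab2_eq0 : ab2 (ip (B y) (B y)) = 0.
    by apply/eqP; rewrite eq_le h ab2_ge0.
  by rewrite /sqn => ->.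
have [N hN] := cK e e0.
exists (t N); split => //.
rewrite (projection_nn (P (t N) x) (pP s)) halfline_mono' ?(ltW (st _)) //.
by rewrite ltrD2l; move/eqP: y0; rewrite subr_eq0 => /eqP <-; rewrite hN.
Qed.

End HalfLines.

End Positive.

(** * Spectral measures *)

Section FiniteMeasuresOnTheLine.
Context {R : realType}.
Implicit Types (mu nu : {measure set (measurableTypeR R) -> \bar R}) (D : set R).

Lemma in_widened_interval (m k t : R) : 0 < m -> `|t| < k ->
  - (m + k) < t <= m + k.
Proof. by move=> m0; rewrite ltr_norml => /andP[? ?]; lra. Qed.

Lemma widened_interval_mono (m k l t : R) : k <= l ->
  - (m + k) < t <= m + k -> - (m + l) < t <= m + l.
Proof. lra. Qed.

Lemma measurable_id_EFin D :
  measurable_fun (D : set (measurableTypeR R)) (@EFin R).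
Proof. by apply/measurable_EFinP; exact: measurable_id. Qed.

Lemma integrable_id_supported mu (D : set R) (m : R) :
  measurable D -> (mu setT < +oo)%E -> mu (~` D) = 0%E ->
  (forall t, D t -> `|t| <= m) -> mu.-integrable setT (fun t : R => t%:E).
Proof.
move=> mD fmu D0 Dm.
apply/(negligible_integrable _ measurableT (measurable_id_EFin (D := setT)) D0).
  exact: measurableC.
rewrite setTD setCK.
apply: (@measurable_bounded_integrable _ (measurableTypeR R) R mu
  (fun t : R => t) D) => //.
- by apply: le_lt_trans fmu; apply: le_measure; rewrite ?inE.
- exists m; split; first exact: num_real.
  by move=> x mx t Dt; apply: le_trans (Dm t Dt) (ltW mx).
Qed.

Lemma Rintegral_id_split mu (D : set R) : measurable D ->
  mu.-integrable setT (fun t : R => t%:E) ->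
  Rintegral mu setT (fun t : R => t) =
  Rintegral mu D (fun t : R => t) + Rintegral mu (~` D) (fun t : R => t).
Proof.
move=> mD imu; rewrite -[in LHS](setUv D).
rewrite (@Rintegral_setU _ (measurableTypeR R) R mu D (~` D)) ?setUv //.
  exact: measurableC.
by apply/disj_set2P; rewrite setICr.
Qed.

Lemma Rintegral_id_null mu (D : set R) : measurable D -> mu D = 0%E ->
  Rintegral mu D (fun t : R => t) = 0.
Proof.
by move=> mD D0; rewrite /Rintegral null_set_integral.
Qed.

Lemma Rintegral_id_eq mu nu (D : set R) :
  (forall B, measurable B -> B `<=` D -> mu B = nu B) ->
  Rintegral mu D (fun t : R => t) = Rintegral nu D (fun t : R => t).
Proof.
by move=> h; rewrite /Rintegral; congr fine; exact: eq_measure_integral.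
Qed.

Lemma Rintegral_id_le mu (D : set R) (c : R) : measurable D ->
  (mu setT < +oo)%E -> mu.-integrable setT (fun t : R => t%:E) ->
  (forall t, D t -> t <= c) ->
  Rintegral mu D (fun t : R => t) <= c * fine (mu D).
Proof.
move=> mD fmu imu Dc; rewrite -(@Rintegral_cst _ (measurableTypeR R)) //.
apply: le_Rintegral => //.
- apply: (@integrableS _ (measurableTypeR R) R mu setT D) => //.
- apply: (measurable_bounded_integrable (f := fun=> c)) => //.
    by apply: le_lt_trans fmu; apply: le_measure; rewrite ?inE.
  by exists `|c|; split; [exact: num_real|move=> x cx t _; exact: ltW].
Qed.

Lemma Rintegral_id_ge mu (D : set R) (c : R) : measurable D ->
  (mu setT < +oo)%E -> mu.-integrable setT (fun t : R => t%:E) ->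
  (forall t, D t -> c <= t) ->
  c * fine (mu D) <= Rintegral mu D (fun t : R => t).
Proof.
move=> mD fmu imu Dc; rewrite -(@Rintegral_cst _ (measurableTypeR R)) //.
apply: le_Rintegral => //.
- apply: (measurable_bounded_integrable (f := fun=> c)) => //.
    by apply: le_lt_trans fmu; apply: le_measure; rewrite ?inE.
  by exists `|c|; split; [exact: num_real|move=> x cx t _; exact: ltW].
- apply: (@integrableS _ (measurableTypeR R) R mu setT D) => //.
Qed.

Lemma lebesgue_stieltjes_oc (f : cumulative R R) (a b : R) : a <= b ->
  lebesgue_stieltjes_measure f (`]a, b]%classic) = (f b - f a)%:E.
Proof.
move=> ab; rewrite /lebesgue_stieltjes_measure /measure_extension /=.
by rewrite measurable_mu_extE; [exact: wlength_itv_bnd|exact: is_ocitv].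
Qed.

End FiniteMeasuresOnTheLine.

(** * Existence of the projection-valued measure *)

Section Resolution.
Context {R : realType} {H : completeNormedModType R[i]}.
Variable ip : {dot H for Num.conj}.
Hypothesis Hip : inner_product_norm ip.
Implicit Types (x y z : H) (c : R[i]) (T S C : H -> H) (B : set R).

Local Notation nn := (sqn ip).
Local Notation rp := (rip ip).
Local Notation cvgH := (cvgn ip).
Local Notation nn_ge0 := (nn_ge0 Hip).
Local Notation sa := (self_adjoint ip).
Local Notation projection := (projection ip).

Lemma sa_zero T : linear T -> sa T -> (forall x, rp (T x) x = 0) ->
  forall x, T x = 0.
Proof.
move=> lT sT h x; apply: (nn_eq0 Hip).
have pT y : 0 <= rp (T y) y by rewrite h.
have := psd_CS lT sT pT x (T x); rewrite h mul0r => h0.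
have /ab2_eq0 : ab2 (ip (T x) (T x)) = 0.
  by apply/eqP; rewrite eq_le h0 ab2_ge0.
by rewrite /sqn => ->.
Qed.

Lemma rp_cvg (u : nat -> H) l x : cvgH u l ->
  (fun n => rp (u n) x) @ \oo --> rp l x.
Proof.
move=> h; apply/cvgrPdist_lt => e e0.
have n1 : 0 < nn x + 1 by have := nn_ge0 x; lra.
have [N hN] := h (e ^+ 2 / (nn x + 1)) (divr_gt0 (exprn_gt0 2 e0) n1).
exists N => // n /= /hN; rewrite ltr_pdivlMr // => k.
rewrite -rpNl -rpDl -(@ltr_pXn2r _ 2) ?nnegrE ?(ltW e0) //.
rewrite real_normK ?num_real //; apply: le_lt_trans (CSr Hip _ _) _.
by rewrite nnBC; have := nn_ge0 (u n - l); nra.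
Qed.

Lemma projection_eq S T : projection S -> projection T ->
  (forall x, nn (S x) = nn (T x)) -> forall x, S x = T x.
Proof.
move=> pS pT h x; apply/eqP; rewrite -subr_eq0; apply/eqP.
have [lS sS _] := pS; have [lT sT _] := pT.
apply: (sa_zero (T := fun x => S x - T x)) => [c u v|u v|u].
- by rewrite lS lT scalerBr opprD addrACA.
- by rewrite ipBl ipBr sS sT.
- by rewrite rpDl rpNl !projection_rp // h subrr.
Qed.

(* A family of finite measures mu x, quadratic in x, with total mass |x|^2,
   whose values on an intersection-stable generating class of sets come from
   projections. *)
Section Dynkin.
Variable mu : H -> {measure set (measurableTypeR R) -> \bar R}.
Variable G : set (set R).
Hypothesis GE : @measurable _ (measurableTypeR R) = <<s G >>.
Hypothesis GI : setI_closed G.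
Hypothesis muT : forall x, mu x setT = (nn x)%:E.
Let rep B T := projection T /\ forall x, mu x B = (nn (T x))%:E.
Hypothesis repG : forall B, G B -> exists T, rep B T.

Let mu_le x B : measurable B -> (mu x B <= (nn x)%:E)%E.
Proof. by move=> mB; rewrite -muT; apply: le_measure; rewrite ?inE. Qed.

(** At the vector T' x the set B' already carries the total mass |T' x|^2, so B has mass zero
    there. *)
Lemma rep_disjoint B B' T T' : measurable B -> measurable B' ->
  B `&` B' = set0 -> rep B T -> rep B' T' -> forall x, T (T' x) = 0.
Proof.
move=> mB mB' dB [pT hT] [pT' hT'] x; apply: (nn_eq0 Hip).
have := mu_le (T' x) (measurableU _ _ mB mB').
have -> : mu (T' x) (B `|` B') = (mu (T' x) B + mu (T' x) B')%E.
  exact: (measureU (mu (T' x)) mB mB' dB).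
rewrite hT hT' -EFinD lee_fin.
have [_ _ i] := pT'; rewrite i => h.
by apply/eqP; rewrite eq_le nn_ge0 andbT; lra.
Qed.

(** Dynkin induction: a complement is represented by 1 - T, a disjoint union by the strong limit of
    the finite sums, which are projections because the summands annihilate each other. *)
Lemma rep_all B : measurable B -> exists T, rep B T.
Proof.
move=> mB; have : <<s G >> B by rewrite -GE.
apply: (@dynkin_induction _ (measurableTypeR R) G (fun B => exists T, rep B T)) => //.
- by exists id; split => // x; exact: muT.
- move=> S mS [T [pT hT]]; have [l s i] := pT.
  exists (fun x => x - T x); split.
    split=> [c x y|x y|x].
    + by rewrite l opprD addrACA -scalerBr.
    + by rewrite ipBl ipBr s.
    + by rewrite (linB l) i subrr subr0.
  move=> x; have fT : (mu x setT < +oo)%E by rewrite muT ltry.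
  have := measureD measurableT mS fT; rewrite setTD setTI => ->.
  have -> : (mu x setT - mu x S = (nn x)%:E - (nn (T x))%:E)%E by rewrite -hT -muT.
  rewrite -EFinB; congr _%:E.
  by rewrite (projection_nn x pT); ring.
- move=> F mF tF /choice[Q hQ].
  have dQ i j x : i != j -> Q i (Q j x) = 0.
    move=> ij; apply: (rep_disjoint (mF i) (mF j) _ (hQ i) (hQ j)).
    apply/eqP; apply: contraNT ij => /set0P[t [Fi Fj]].
    by apply/eqP; apply: tF => //; exists t.
  have pQ i : projection (Q i) by case: (hQ i).
  have lQ i : linear (Q i) by case: (pQ i).
  have sQ i : sa (Q i) by case: (pQ i).
  have iQ i x : Q i (Q i x) = Q i x by case: (pQ i).
  pose T n x := \sum_(i < n) Q i x.
  have lT n : linear (T n).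
    move=> c x y; rewrite /T scaler_sumr -big_split /=.
    by apply: eq_bigr => i _; rewrite lQ.
  have sT n : sa (T n).
    move=> x y; rewrite /T ip_suml ip_sumr; apply: eq_bigr => i _; exact: sQ.
  have pT n : projection (T n).
    split=> // x; rewrite {2}/T (lin_sum (lT n)); apply: eq_bigr => i _.
    rewrite /T (bigD1 i) //= iQ big1 ?addr0 // => j ji.
    by rewrite dQ // (inj_eq val_inj).
  have nT n x : nn (T n x) = \sum_(i < n) nn (Q i x).
    rewrite -projection_rp // /rip ip_suml Re_sum.
    by apply: eq_bigr => i _; exact: projection_rp.
  have [||||L [lL sL bL cL]] := @monotone_limit _ _ ip Hip T => //.
  + by move=> n x; rewrite projection_rp // nn_ge0 (projection_le Hip).
  + move=> n x; rewrite !projection_rp // !nT big_ord_recr /= lerDl.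
    exact: nn_ge0.
  have LL x : L (L x) = L x.
    apply: (cvgH_unique Hip _ (cL x)).
    have bd n y : nn (T n y) <= 1 * nn y by rewrite mul1r projection_le.
    move=> e e0; have e4 : 0 < e / 4 by lra.
    have [N hN] := cL x _ e4; have [N' hN'] := cL (L x) _ e4.
    exists (maxn N N') => n; rewrite geq_max => /andP[/hN a /hN' b].
    have -> : T n x - L (L x) = T n (T n x - L x) + (T n (L x) - L (L x)).
      by rewrite (linB (lT n)) subrKA; case: (pT n) => _ _ ->.
    apply: le_lt_trans (nnD_le Hip _ _) _.
    by have := bd n (T n x - L x); lra.
  have pL : projection L by [].
  exists L; split => // x.
  have h := @measure_semi_sigma_additive _ _ _ (mu x) F mF tF
    (bigcup_measurable (fun k _ => mF k)).
  rewrite (_ : (fun n => _) = (fun n => (nn (T n x))%:E)) in h; last first.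
    apply/funext => n; rewrite nT big_mkord -sumEFin; apply: eq_bigr => i _.
    by case: (hQ i) => _ ->.
  apply: (cvg_unique _ h) => //.
  apply: cvg_EFin; first by apply: nearW.
  rewrite -projection_rp // (_ : _ \o _ = fun n => rp (T n x) x); last first.
    by apply/funext => n /=; rewrite -projection_rp.
  exact: rp_cvg.
Qed.
End Dynkin.

(** The spectral theorem in weak form: only the diagonal values <A x, x> are expressed as integrals.
    Off-diagonal information has to be recovered by polarization. *)
Definition pvm A (pi : set R -> H -> H) :=
  [/\ forall B, measurable B -> projection (pi B),
     forall B (C : set R), measurable B -> measurable C ->
       forall x, pi (B `&` C) x = pi B (pi C x),
     forall x, pi setT x = x &
     forall x, exists mu : {measure set (measurableTypeR R) -> \bar R},
       [/\ forall B, measurable B -> mu B = (nn (pi B x))%:E,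
          mu.-integrable setT (fun t : R => t%:E) &
          rp (A x) x = Rintegral mu setT (fun t : R => t)]].

Section Existence.
Variables (A : H -> H) (M : R) (P : R -> H -> H).
Hypotheses (lA : linear A) (sA : sa A) (bA : bounded_by ip M A).
Hypothesis hP : halfline_projection ip A P.

Let pP t : projection (P t). Proof. by case: hP. Qed.
Let lP t : linear (P t). Proof. by case: (pP t). Qed.
Let sP t : sa (P t). Proof. by case: (pP t). Qed.
Let iP t x : P t (P t x) = P t x. Proof. by case: (pP t). Qed.
Let mono := halfline_mono Hip lA sA bA hP.
Let mono' := halfline_mono' Hip lA sA bA hP.
Let PcommA := halfline_commA lA sA bA hP.

(** The distribution function at x of the measure to be built; being monotone and right continuous,
    it generates a Stieltjes measure. *)
Let F x t : R := nn (P t x).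

Let F_le x s t : s <= t -> F x s <= F x t.
Proof. by move=> st; rewrite /F -{1}(mono' _ st) (projection_le Hip). Qed.

Let F_rc x : right_continuous (F x : R -> R).
Proof.
move=> s; apply/cvgrPdist_lt => e e0.
have [t [st ht]] := halfline_right_continuous Hip lA sA bA hP s x e0.
near=> u.
have su : s < u by near: u; exact: nbhs_right_gt.
have ut : u < t by near: u; exact: nbhs_right_lt.
have := F_le x (ltW su); have := F_le x (ltW ut); rewrite /F => h1 h2.
by rewrite ltr_norml; lra.
Unshelve. all: by end_near. Qed.

Let cum x : cumulative R R :=
  HB.pack (F x : R -> R) (isCumulative.Build R _ R (F x) (@F_le x) (@F_rc x)).

Let mu x : {measure set (measurableTypeR R) -> \bar R} :=
  lebesgue_stieltjes_measure (cum x).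

Let mu_oc x (a b : R) : a <= b -> mu x (`]a, b]%classic) = (F x b - F x a)%:E.
Proof. exact: (lebesgue_stieltjes_oc (cum x)). Qed.

Let m := Num.sqrt M + 1.
Let m_gt0 : 0 < m. Proof. by rewrite /m ltr_wpDl ?sqrtr_ge0. Qed.

Let Plow t x : t <= - m -> P t x = 0.
Proof.
by move=> h; apply: (halfline_low Hip bA hP); rewrite /m in h; lra.
Qed.
Let Phigh t x : m <= t -> P t x = x.
Proof.
by move=> h; apply: (halfline_high Hip bA hP); rewrite /m in h; lra.
Qed.

Let mu_T x : mu x setT = (nn x)%:E.
Proof.
pose D n : set (measurableTypeR R) := `](- (m + n%:R)), (m + n%:R)]%classic.
have ncov : \bigcup_n D n = setT.
  rewrite -subTset => t _; exists (Num.bound `|t : R|) => //.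
  rewrite /D /= in_itv /=.
  exact: in_widened_interval m_gt0 (archi_boundP (normr_ge0 _)).
have mD n : measurable (D n) by exact: measurable_itv.
have nD : nondecreasing_seq D.
  move=> i j ij; apply/subsetPset => t; rewrite /D /= !in_itv /=.
  by apply: widened_interval_mono; rewrite ler_nat.
have h := nondecreasing_cvg_mu (mu := mu x) mD (bigcup_measurable (fun k _ => mD k)) nD.
rewrite ncov in h; apply: (cvg_unique _ h) => //.
rewrite (_ : _ \o _ = cst (nn x)%:E); first exact: cvg_cst.
apply/funext => n; have n0 : (0 : R) <= n%:R by [].
have := m_gt0 => m0.
by rewrite /= mu_oc; [rewrite /F Phigh ?Plow ?nn0 ?subr0 //|]; lra.
Qed.

Let oc_projection a b : a <= b -> projection (fun x => P b x - P a x).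
Proof.
move=> ab; split=> [c x y|x y|x].
- by rewrite !lP scalerBr opprD addrACA.
- by rewrite ipBl ipBr !sP.
- by rewrite !(linB (lP _)) !iP (mono _ ab) (mono' _ ab) subrr subr0.
Qed.

Let nn_oc a b x : a <= b -> nn (P b x - P a x) = nn (P b x) - nn (P a x).
Proof.
by move=> ab; rewrite (projection_nn (P b x) (pP a)) (mono' _ ab); ring.
Qed.

Let rep B T := projection T /\ forall x, mu x B = (nn (T x))%:E.

Let rep_exists B : measurable B -> exists T, rep B T.
Proof.
apply: (@rep_all mu (@ocitv R)) => //.
- exact: ocitvI.
- move=> X /ocitvP[->|[[a b] /= ab ->]].
    exists (fun=> 0); split; first split.
    + by move=> c x y; rewrite scaler0 addr0.
    + by move=> x y; rewrite ip0l ip0r.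
    + by [].
    + by move=> x; rewrite measure0 nn0.
  exists (fun x => P b x - P a x); split; first exact/oc_projection/ltW.
  by move=> x; rewrite mu_oc ?ltW // nn_oc // ltW.
Qed.

Let pi B : H -> H := if pselect (measurable B) is left mB
  then sval (cid (rep_exists mB)) else fun=> 0.

Let piP B : measurable B -> rep B (pi B).
Proof. by rewrite /pi; case: pselect => // mB _; case: cid. Qed.

Let pi_p B : measurable B -> projection (pi B).
Proof. by move=> /piP[]. Qed.

Let pi_mu B x : measurable B -> mu x B = (nn (pi B x))%:E.
Proof. by move=> /piP[]. Qed.

Let pi_disj B (C : set R) x : measurable B -> measurable C -> B `&` C = set0 ->
  pi B (pi C x) = 0.
Proof.
by move=> mB mC d; apply: (rep_disjoint mu_T mB mC d (piP mB) (piP mC)).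
Qed.

Let pi_add B (C : set R) x : measurable B -> measurable C -> B `&` C = set0 ->
  pi (B `|` C) x = pi B x + pi C x.
Proof.
move=> mB mC d.
have [lB sB iB] := pi_p mB; have [lC sC iC] := pi_p mC.
have d' : C `&` B = set0 by rewrite setIC.
have pS : projection (fun x => pi B x + pi C x).
  split=> [c u v|u v|u].
  - by rewrite lB lC scalerDr addrACA.
  - by rewrite ipDl ipDr sB sC.
  - by rewrite (linD lB) (linD lC) iB iC !pi_disj // addr0 add0r.
apply: (projection_eq (pi_p (measurableU _ _ mB mC)) pS) => u.
have [] := piP (measurableU _ _ mB mC) => _ /(_ u).
have -> : mu u (B `|` C) = (mu u B + mu u C)%E by exact: (measureU (mu u) mB mC d).
rewrite !pi_mu // -EFinD => -[<-]; rewrite nnD_orth //.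
by rewrite sB pi_disj // ip0r.
Qed.

Let pi_setI B (C : set R) x : measurable B -> measurable C ->
  pi (B `&` C) x = pi B (pi C x).
Proof.
move=> mB mC.
have mBC := measurableI _ _ mB mC.
have mBD : measurable (B `\` C) by exact: measurableD.
have mCD : measurable (C `\` B) by exact: measurableD.
have [lB _ iB] := pi_p mBC; have [lD _ _] := pi_p mBD.
have eB y : pi B y = pi (B `&` C) y + pi (B `\` C) y.
  rewrite -pi_add ?setUIDK // -subset0 => t [[_ Ct] [_ nCt]]; exact: nCt.
have eC : pi C x = pi (B `&` C) x + pi (C `\` B) x.
  rewrite setIC -pi_add ?setUIDK //; first exact: measurableI.
  by rewrite -subset0 => t [[_ Ct] [_ nCt]]; exact: nCt.
rewrite eB eC !(linD lB) !(linD lD) iB !pi_disj ?addr0 //.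
- by rewrite -subset0 => t [[_ nt] [t' _]]; exact: nt.
- by rewrite -subset0 => t [[_ nt] [_ t']]; exact: nt.
- by rewrite -subset0 => t [[tB _] [_ t']]; exact: t'.
Qed.

Let pi_oc a b x : a <= b -> pi `]a, b] x = P b x - P a x.
Proof.
move=> ab; have mab : measurable (`]a, b] : set R) by exact: measurable_itv.
apply: (projection_eq (pi_p mab) (oc_projection ab)) => u.
by have := pi_mu u mab; rewrite mu_oc // => -[<-]; rewrite nn_oc.
Qed.

Let mu_fin x : (mu x setT < +oo)%E.
Proof. by rewrite mu_T ltry. Qed.

Let piT x : pi `](- m), m] x = x.
Proof.
have m0 := m_gt0.
have mm : - m <= m by lra.
by rewrite (pi_oc x mm) Phigh // Plow // subr0.
Qed.

Let int_id x : (mu x).-integrable setT (fun t : R => t%:E).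
Proof.
have mD : measurable (`](- m), m] : set R) by exact: measurable_itv.
apply: (@integrable_id_supported _ (mu x) `](- m), m] m) => //.
  rewrite pi_mu; last exact: measurableC.
  rewrite -(piT x) pi_disj ?nn0 //; first exact: measurableC.
  by rewrite setICl.
move=> t /=; rewrite in_itv /= ler_norml => /andP[a b]; lra.
Qed.

Let G x : R := Rintegral (mu x) setT (fun t : R => t).

Let G_on D x : measurable D -> pi D x = x ->
  G x = Rintegral (mu x) D (fun t : R => t).
Proof.
move=> mD Dx; have mC : measurable (~` D) by exact: measurableC.
rewrite /G (Rintegral_id_split mD (int_id x)) (Rintegral_id_null mC) ?addr0 //.
by rewrite pi_mu // -Dx pi_disj ?nn0 // setICl.
Qed.

Let G_add D x y : measurable D -> pi D x = x -> pi D y = 0 ->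
  G (x + y) = G x + G y.
Proof.
move=> mD Dx Dy; have mC : measurable (~` D) by exact: measurableC.
have [lC _ _] := pi_p mC; have [lD _ _] := pi_p mD.
have Cy : pi (~` D) y = y.
  have := pi_add y mD mC (setICr D); rewrite setUv Dy add0r => <-.
  by have := pi_setI y measurableT (measurable_itv `](- m), m]); rewrite setTI piT.
have Cx : pi (~` D) x = 0 by rewrite -Dx pi_disj // setICl.
rewrite (G_on mD Dx) (G_on mC Cy) /G (Rintegral_id_split mD (int_id _)).
have -> : Rintegral (mu (x + y)) D (fun t : R => t) = Rintegral (mu x) D (fun t : R => t).
  apply: (@Rintegral_id_eq _ (mu (x + y)) (mu x) D) => B mB BD; rewrite !pi_mu //.
  have [lB _ _] := pi_p mB.
  by rewrite (linD lB) -Cy pi_disj ?addr0 // -subset0 => t [/BD Dt]; exact.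
have -> // : Rintegral (mu (x + y)) (~` D) (fun t : R => t) = Rintegral (mu y) (~` D) (fun t : R => t).
apply: (@Rintegral_id_eq _ (mu (x + y)) (mu y) (~` D)) => B mB BD; rewrite !pi_mu //.
have [lB _ _] := pi_p mB.
rewrite (linD lB) -Dx pi_disj ?add0r // -subset0 => t [/BD Dt]; exact: Dt.
Qed.

(** Both <A x, x> and the integral G x lie between a |x|^2 and b |x|^2, which is the case n = 0.
    Both are additive over the two orthogonal pieces of x that belong to the halves of the interval,
    so each bisection halves the error. *)
Let bisect n : forall a b x, a <= b -> pi `]a, b] x = x ->
  `|rp (A x) x - G x| <= (b - a) / 2 ^+ n * nn x.
Proof.
elim: n => [|n IH] a b x ab abx.
  have mab : measurable (`]a, b] : set R) by exact: measurable_itv.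
  have Pb : P b x = x by rewrite -{1}abx pi_oc // (linB (lP b)) iP mono // -pi_oc.
  have Pa : P a x = 0.
    by rewrite -{1}abx pi_oc // (linB (lP a)) iP mono' // subrr.
  have [_ h1 h2 _ _] := hP.
  have := h1 b x Pb; have := h2 a x Pa.
  have : G x <= b * nn x.
    rewrite (G_on mab abx); apply: le_trans (Rintegral_id_le (c := b) mab (mu_fin x) (int_id x) _) _.
      by move=> t /=; rewrite in_itv /= => /andP[].
    by rewrite pi_mu // abx.
  have : a * nn x <= G x.
    rewrite (G_on mab abx); apply: le_trans (Rintegral_id_ge (c := a) mab (mu_fin x) (int_id x) _).
      by rewrite pi_mu // abx.
    by move=> t /=; rewrite in_itv /= => /andP[/ltW].
  by rewrite expr0 divr1 mulrBl ler_norml; lra.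
pose c := (a + b) / 2.
have ac : a <= c by rewrite /c; lra.
have cb : c <= b by rewrite /c; lra.
have mac : measurable (`]a, c] : set R) by exact: measurable_itv.
pose x1 := P c x - P a x; pose x2 := P b x - P c x.
have ex : x = x1 + x2.
  by rewrite -{1}abx pi_oc // /x1 /x2 [RHS]addrC subrKA.
have p1 : pi `]a, c] x1 = x1.
  by rewrite pi_oc // /x1 !(linB (lP _)) !iP mono // mono' // subrr subr0.
have p2 : pi `]c, b] x2 = x2.
  by rewrite pi_oc // /x2 !(linB (lP _)) !iP mono // mono' // subrr subr0.
have p12 : pi `]a, c] x2 = 0.
  rewrite pi_oc // /x2 !(linB (lP _)) iP (mono' _ cb) (mono' _ ab) (mono' _ ac).
  by rewrite !subrr.
have orth : ip x1 x2 = 0.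
  rewrite -{1}p1; have [_ s _] := pi_p mac; by rewrite s p12 ip0r.
have orthA : ip (A x1) x2 = 0.
  rewrite -{1}p1 pi_oc // (linB lA) !PcommA -pi_oc //.
  by have [_ s _] := pi_p mac; rewrite s p12 ip0r.
clearbody x1 x2.
have -> : rp (A x) x = rp (A x1) x1 + rp (A x2) x2.
  have e1 : rp (A x1) x2 = 0 by rewrite /rip orthA.
  have e2 : rp (A x2) x1 = 0 by rewrite /rip sA (ip_eq0C orthA).
  by rewrite ex (linD lA) rpDl !rpDr e1 e2 addr0 add0r.
have -> : G x = G x1 + G x2 by rewrite {1}ex (G_add mac p1 p12).
have -> : nn x = nn x1 + nn x2 by rewrite {1}ex nnD_orth.
have h1 := IH a c x1 ac p1; have h2 := IH c b x2 cb p2.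
have e : (b - a) / 2 ^+ n.+1 = (c - a) / 2 ^+ n.
  by rewrite /c exprS; field; rewrite expf_neq0.
have e' : (b - a) / 2 ^+ n.+1 = (b - c) / 2 ^+ n.
  by rewrite /c exprS; field; rewrite expf_neq0.
rewrite mulrDr {1}e e' opprD addrACA.
by apply: le_trans (ler_normD _ _) _; exact: lerD.
Qed.

Lemma pvm_of_halflines : exists pi, pvm A pi.
Proof.
exists pi; split => [B mB|B C mB mC x|x|x].
- exact: pi_p.
- exact: pi_setI.
- by have := pi_setI x measurableT (measurable_itv `](- m), m]); rewrite setTI piT.
exists (mu x); split => [B mB||]; [exact: pi_mu|exact: int_id|].
apply/eqP; rewrite -subr_eq0 -normr_le0.
have m0 := m_gt0.
have c0 : 0 <= 2 * m * nn x by rewrite mulr_ge0 ?nn_ge0 //; lra.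
apply: (ge0_eps_le0 c0) => e e0.
have [n hn] : exists n : nat, (2 ^+ n)^-1 < e.
  have [N _ hN] := near_infty_natSinv_expn_lt (PosNum e0).
  by exists N; have := hN N (leqnn _); rewrite div1r.
have mm : - m <= m by lra.
apply: le_trans (bisect n mm (piT x)) _.
rewrite opprK -[m + m]mulr2n -[m *+ 2]mulr_natl mulrAC.
by apply: ler_wpM2l => //; exact: ltW.
Qed.

End Existence.

Lemma pvm_exists A (M : R) : linear A -> sa A -> bounded_by ip M A ->
  exists pi, pvm A pi.
Proof.
move=> lA sA bA; have [P hP] := halfline_projection_exists Hip lA sA bA.
exact: (pvm_of_halflines lA sA bA hP).
Qed.

End Resolution.

Lemma ray_bigcup {R : realType} (t : R) :
  `]t, +oo[%classic = \bigcup_n `[t + n.+1%:R^-1, +oo[%classic :> set R.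
Proof.
apply/seteqP; split=> s /=; rewrite ?in_itv /= ?andbT.
  move=> ts; have st : 0 < s - t by rewrite subr_gt0.
  have [N _ hN] := near_infty_natSinv_lt (PosNum st).
  exists N => //=; rewrite in_itv /= andbT.
  by have := hN N (leqnn _) => /= /ltW; rewrite lerBrDl.
case=> n _ /=; rewrite in_itv /= andbT => h; apply: lt_le_trans h.
by rewrite ltrDl invr_gt0.
Qed.

(** * Uniqueness of the spectral measure; restrictions and affine images *)

Section SpectralMeasures.
Context {R : realType} {H : completeNormedModType R[i]}.
Variable ip : {dot H for Num.conj}.
Hypothesis Hip : inner_product_norm ip.
Implicit Types (x y z : H) (c : R[i]) (T : H -> H) (B C D : set R).

Local Notation nn := (sqn ip).
Local Notation rp := (rip ip).
Local Notation cvgH := (cvgn ip).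
Local Notation nn_ge0 := (nn_ge0 Hip).
Local Notation sa := (self_adjoint ip).
Local Notation projection := (projection ip).

Definition bsa (A : H -> H) :=
  [/\ linear A, sa A & exists M, bounded_by ip M A].

(** [is_spectral_measure] in terms of the real quantities [sqn] and [rip]; [smeasP] gives the
    equivalence for self-adjoint operators. *)
Definition smeas (A : H -> H) (S : set H) (pi : set R -> H -> H) :=
  [/\ forall B, measurable B -> projection (pi B),
     forall B C, measurable B -> measurable C ->
       forall x, pi (B `&` C) x = pi B (pi C x),
     range (pi setT) = S &
     forall x, exists mu : {measure set (measurableTypeR R) -> \bar R},
       (forall B, measurable B -> mu B = (nn (pi B x))%:E) /\
       (S x -> mu.-integrable setT (fun t : R => t%:E) /\
          rp (A x) x = Rintegral mu setT (fun t : R => t))].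

Lemma sa_ip_rp A x : sa A -> ip (A x) x = (rp (A x) x)%:C.
Proof.
move=> sA; apply: complexP => //; rewrite ImR.
by have /(congr1 (@complex.Im R)) := ipC ip (A x) x; rewrite sA ImJ => h; lra.
Qed.

Lemma smeasP A S t J pi : sa A ->
  is_spectral_measure ip (Pair A S t J) pi <-> smeas A S pi.
Proof.
move=> sA; split=> -[h1 h2 h3 h4]; split => //.
- move=> x; have [mu [m1 [m2 m3]]] := h4 x; exists mu; split => [B mB|Sx].
    have [_ _ i] := h1 B mB.
    have fB : (mu B < +oo)%E by apply: le_lt_trans m2; apply: le_measure; rewrite ?inE.
    have := m1 B mB => /(congr1 (@complex.Re R)); rewrite ReR => e.
    rewrite -(@projection_rp _ _ ip (pi B)); last exact: h1.
    by rewrite /rip e fineK // ge0_fin_numE.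
  have [i e] := m3 Sx; split => //.
  by move/(congr1 (@complex.Re R)): e.
move=> x; have [mu [m1 m3]] := h4 x; exists mu; split => [B mB|].
    rewrite m1 //=; have [_ s i] := h1 B mB.
    by rewrite -{1}i s ipnn.
  split; first by rewrite m1 // ltry.
  move=> Sx; have [i e] := m3 Sx; split => //.
  by rewrite /= sa_ip_rp // e.
Qed.

Section Properties.
Variables (A : H -> H) (S : set H) (pi : set R -> H -> H).
Hypotheses (hA : bsa A) (hpi : smeas A S pi).
Hypothesis AS : forall x, S x -> S (A x).

Let lA : linear A. Proof. by case: hA. Qed.
Let sA : sa A. Proof. by case: hA. Qed.

Lemma sm_proj B : measurable B -> projection (pi B).
Proof. by case: hpi => h _ _ _; exact: h. Qed.
Lemma sm_lin B : measurable B -> linear (pi B).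
Proof. by move=> /sm_proj[]. Qed.
Lemma sm_sa B : measurable B -> sa (pi B).
Proof. by move=> /sm_proj[]. Qed.
Lemma sm_idem B x : measurable B -> pi B (pi B x) = pi B x.
Proof. by move=> /sm_proj[_ _ ->]. Qed.
Lemma sm_I B C x : measurable B -> measurable C ->
  pi (B `&` C) x = pi B (pi C x).
Proof. by case: hpi => _ h _ _ mB mC; exact: h. Qed.
Lemma sm_comm B C x : measurable B -> measurable C ->
  pi B (pi C x) = pi C (pi B x).
Proof. by move=> mB mC; rewrite -!sm_I // setIC. Qed.

Lemma sm_mu x : exists mu : {measure set (measurableTypeR R) -> \bar R},
  (forall B, measurable B -> mu B = (nn (pi B x))%:E) /\
  (S x -> mu.-integrable setT (fun t : R => t%:E) /\
          rp (A x) x = Rintegral mu setT (fun t : R => t)).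
Proof. by case: hpi => _ _ _ h; exact: h. Qed.

Lemma sm_T x : S x -> pi setT x = x.
Proof. by case: hpi => _ _ <- _ [y _ <-]; rewrite sm_idem. Qed.
Lemma sm_in B x : measurable B -> S (pi B x).
Proof.
case: hpi => _ _ <- _ mB; exists (pi B x) => //.
by rewrite -sm_I // setTI.
Qed.
Lemma sm_0 x : pi set0 x = 0.
Proof.
have [mu [m _]] := sm_mu x; apply: (nn_eq0 Hip).
by have := m set0 measurable0; rewrite measure0 => -[].
Qed.
Lemma sm_disj B C x : measurable B -> measurable C -> B `&` C = set0 ->
  pi B (pi C x) = 0.
Proof. by move=> mB mC d; rewrite -sm_I // d sm_0. Qed.
Lemma sm_sub B C x : measurable B -> measurable C -> B `<=` C ->
  pi C (pi B x) = pi B x.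
Proof. by move=> mB mC /setIidl BC; rewrite -sm_I // setIC BC. Qed.
Lemma sm_sub' B C x : measurable B -> measurable C -> B `<=` C ->
  pi B (pi C x) = pi B x.
Proof. by move=> mB mC BC; rewrite sm_comm // sm_sub. Qed.
Lemma sm_ran_sub B C x : measurable B -> measurable C -> B `<=` C ->
  pi B x = x -> pi C x = x.
Proof. by move=> mB mC BC <-; rewrite sm_sub. Qed.

Lemma sm_U B C x : measurable B -> measurable C -> B `&` C = set0 ->
  pi (B `|` C) x = pi B x + pi C x.
Proof.
move=> mB mC d.
have d' : C `&` B = set0 by rewrite setIC.
have pS : projection (fun x => pi B x + pi C x).
  split=> [c u v|u v|u].
  - by rewrite !sm_lin // scalerDr addrACA.
  - by rewrite ipDl ipDr !sm_sa.
  - by rewrite !(linD (sm_lin _)) // !sm_idem // !sm_disj // addr0 add0r.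
apply: (projection_eq Hip (sm_proj (measurableU _ _ mB mC)) pS) => u.
have [mu [m _]] := sm_mu u.
have e : mu (B `|` C) = (mu B + mu C)%E by exact: (measureU mu mB mC d).
move: e; rewrite !m //; last exact: measurableU.
rewrite -EFinD => -[->]; rewrite nnD_orth //.
by rewrite sm_sa // sm_disj // ip0r.
Qed.

Lemma sm_split B x : measurable B -> S x -> x = pi B x + pi (~` B) x.
Proof.
move=> mB Sx; rewrite -sm_U ?setUv ?sm_T //; first exact: measurableC.
exact: setICr.
Qed.

Lemma sm_bigcup_cvg (F : nat -> set R) x : (forall n, measurable (F n)) ->
  (forall n, F n `<=` F n.+1) ->
  cvgH (fun n => pi (F n) x) (pi (\bigcup_n F n) x).
Proof.
move=> mF ndF.
have mU : measurable (\bigcup_n F n) by exact: bigcup_measurable.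
have nd : nondecreasing_seq F.
  move=> i j; move/subnK <-; elim: (j - i)%N => [|k IH]; first exact/subsetPset.
  by move/subsetPset: IH => IH; apply/subsetPset; exact: subset_trans IH (ndF _).
have [mu [m _]] := sm_mu x.
have h := nondecreasing_cvg_mu (mu := mu) mF mU nd.
have h' : (fun n => nn (pi (F n) x)) @ \oo --> nn (pi (\bigcup_n F n) x).
  rewrite m // in h.
  have {}h : (fun n => (nn (pi (F n) x))%:E) @ \oo --> (nn (pi (\bigcup_n F n) x))%:E.
    by apply: cvg_trans h; apply: near_eq_cvg; apply: nearW => n /=; rewrite m.
  exact: fine_cvg h.
move=> e e0; have /cvgrPdist_lt /(_ e e0) [N _ hN] := h'.
exists N => n Nn; have := hN n Nn => /=.
have sF : F n `<=` \bigcup_n F n by move=> t ?; exists n.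
rewrite -(sm_sub' x (mF n) mU sF).
have pn := projection_nn (pi (\bigcup_n F n) x) (sm_proj (mF n)).
rewrite nnBC; have := nn_ge0 (pi (\bigcup_n F n) x - pi (F n) (pi (\bigcup_n F n) x)).
by rewrite ltr_norml; lra.
Qed.

Lemma sm_bigcup0 (F : nat -> set R) x : (forall n, measurable (F n)) ->
  (forall n, pi (F n) x = 0) -> pi (\bigcup_n F n) x = 0.
Proof.
move=> mF h.
have mU : measurable (\bigcup_n F n) by exact: bigcup_measurable.
have [mu [m _]] := sm_mu x; apply: (nn_eq0 Hip).
suff : mu (\bigcup_n F n) = 0%E by rewrite m // => -[].
apply/eqP; rewrite eq_le measure_ge0 andbT.
apply: le_trans (@measure_sigma_subadditive _ _ _ mu _ F mF mU (@subset_refl _ _)) _.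
by rewrite eseries0 // => i _ _; rewrite m // h nn0.
Qed.

(** Only diagonal values of A are given, so the cross term is reached by polarization: the measure
    of x + y is that of x on B and that of y off B, hence the form is additive on x and y.
    Commutation of A with the measure follows from this. *)
Lemma sm_orth B x y : measurable B -> pi B x = x -> pi (~` B) y = y ->
  rp (A x) y = 0.
Proof.
move=> mB Bx By; have mC : measurable (~` B) by exact: measurableC.
have Sx : S x by rewrite -Bx; exact: sm_in.
have Sy : S y by rewrite -By; exact: sm_in.
have Sxy : S (x + y).
  by rewrite -(sm_T Sx) -(sm_T Sy) -(linD (sm_lin _)) //; exact: sm_in.
have [m [hm /(_ Sxy)[im em]]] := sm_mu (x + y).
have [m1 [hm1 /(_ Sx)[im1 em1]]] := sm_mu x.
have [m2 [hm2 /(_ Sy)[im2 em2]]] := sm_mu y.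
have CBx : pi (~` B) x = 0 by rewrite -Bx sm_disj // setICl.
have BCy : pi B y = 0 by rewrite -By sm_disj // setICr.
have e1 : Rintegral m B (fun t : R => t) = Rintegral m1 B (fun t : R => t).
  apply: Rintegral_id_eq => D mD DB; rewrite hm // hm1 //.
  rewrite (linD (sm_lin _)) // -By sm_disj ?addr0 //.
  by rewrite -subset0 => t [/DB Bt]; exact.
have e2 : Rintegral m (~` B) (fun t : R => t) = Rintegral m2 (~` B) (fun t : R => t).
  apply: Rintegral_id_eq => D mD DB; rewrite hm // hm2 //.
  rewrite (linD (sm_lin _)) // -Bx sm_disj ?add0r //.
  by rewrite -subset0 => t [/DB Bt] Bt'; exact: Bt.
have z1 : Rintegral m1 (~` B) (fun t : R => t) = 0.
  by apply: Rintegral_id_null => //; rewrite hm1 // CBx nn0.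
have z2 : Rintegral m2 B (fun t : R => t) = 0.
  by apply: Rintegral_id_null => //; rewrite hm2 // BCy nn0.
have : rp (A (x + y)) (x + y) = rp (A x) x + rp (A y) y.
  rewrite em em1 em2 (Rintegral_id_split mB im) (Rintegral_id_split mB im1).
  by rewrite (Rintegral_id_split mB im2) e1 e2 z1 z2 addr0 add0r.
rewrite (linD lA) rpDl !rpDr.
have -> : rp (A y) x = rp (A x) y by rewrite rpC rp_sa.
by move=> h; lra.
Qed.

Lemma sm_commA B x : measurable B -> S x -> A (pi B x) = pi B (A x).
Proof.
move=> mB Sx; have mC : measurable (~` B) by exact: measurableC.
have key D y : measurable D -> S y -> pi (~` D) (A (pi D y)) = 0.
  move=> mD Sy; set u := pi D y; set v := pi (~` D) (A u).
  have mD' : measurable (~` D) by exact: measurableC.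
  have [_ s i] := sm_proj mD'.
  apply: (nn_eq0 Hip); rewrite /sqn.
  have -> : ip v v = ip (A u) v by rewrite {1}/v s /v i.
  by apply: (@sm_orth D); rewrite ?sm_idem.
rewrite {2}(sm_split mB Sx) (linD lA) (linD (sm_lin mB)).
have := key (~` B) x mC Sx; rewrite setCK => ->; rewrite addr0.
have Su : S (A (pi B x)) by apply: AS; exact: sm_in.
by rewrite {1}(sm_split mB Su) key // addr0.
Qed.

Lemma sm_le B x (c : R) : measurable B -> (forall t, B t -> t <= c) ->
  pi B x = x -> rp (A x) x <= c * nn x.
Proof.
move=> mB Bc Bx; have Sx : S x by rewrite -Bx; exact: sm_in.
have mC : measurable (~` B) by exact: measurableC.
have [mu [m /(_ Sx)[i ->]]] := sm_mu x.
rewrite (Rintegral_id_split mB i) (@Rintegral_id_null _ _ (~` B)) ?addr0 //; last first.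
  by rewrite m // -Bx sm_disj ?nn0 // setICl.
apply: le_trans (Rintegral_id_le (c := c) mB _ i Bc) _; first by rewrite m // ltry.
by rewrite m // Bx.
Qed.

Lemma sm_ge B x (c : R) : measurable B -> (forall t, B t -> c <= t) ->
  pi B x = x -> c * nn x <= rp (A x) x.
Proof.
move=> mB Bc Bx; have Sx : S x by rewrite -Bx; exact: sm_in.
have mC : measurable (~` B) by exact: measurableC.
have [mu [m /(_ Sx)[i ->]]] := sm_mu x.
rewrite (Rintegral_id_split mB i) (@Rintegral_id_null _ _ (~` B)) ?addr0 //; last first.
  by rewrite m // -Bx sm_disj ?nn0 // setICl.
apply: le_trans (Rintegral_id_ge (c := c) mB _ i Bc); last by rewrite m // ltry.
by rewrite m // Bx.
Qed.

Lemma sm_perp x z : S x -> (forall y, S y -> ip z y = 0) -> forall B,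
  measurable B -> pi B z = 0.
Proof.
move=> _ hz B mB; apply: (nn_eq0 Hip); rewrite /sqn.
by rewrite sm_sa // sm_idem // hz ?Re0 //; exact: sm_in.
Qed.

(** The orthogonal complement of S is invariant under the self-adjoint A and killed by the measure,
    so commutation on S extends to all vectors. *)
Lemma sm_commA_all B : measurable B -> commutes A (pi B).
Proof.
move=> mB x.
have mT : measurable (setT : set R) by [].
have Sp : S (pi setT x) by exact: sm_in.
pose z := x - pi setT x.
have hz y : S y -> ip z y = 0.
  move=> Sy; rewrite -(sm_T Sy) -sm_sa // /z (linB (sm_lin mT)).
  by rewrite sm_idem // subrr ip0l.
have hAz y : S y -> ip (A z) y = 0 by move=> Sy; rewrite sA hz //; exact: AS.
have e : x = pi setT x + z by rewrite /z addrC subrK.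
have zB := sm_perp Sp hz mB; have AzB := sm_perp Sp hAz mB.
clearbody z; move: e Sp {hz hAz}; move: (pi setT x) => w -> Sp.
rewrite (linD lA) !(linD (sm_lin mB)) zB AzB.
by rewrite !addr0 sm_commA.
Qed.

Section HalfLine.
Variable P : R -> H -> H.
Hypothesis hP : halfline_projection ip A P.

(** Ties every spectral measure to the canonical half-line projections. A vector of []t, +oo[] fixed
    by P t has no part in any closed ray starting above t, by the two form bounds. A vector of
    []-oo, t]] killed by P t has form value t |z|^2, is therefore an eigenvector for t, and is fixed
    by P t. *)
Lemma sm_halfline t x : pi `]-oo, t] x = P t (pi setT x).
Proof.
have [pP h1 h2 h3 h4] := hP.
have mL : measurable (`]-oo, t] : set R) by exact: measurable_itv.
have mU : measurable (`]t, +oo[ : set R) by exact: measurable_itv.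
have cP B : measurable B -> commutes (pi B) (P t).
  move=> mB; apply: h4.
  - exact: sm_lin.
  - exact: sm_sa.
  - by exists 1; apply: (projection_bounded Hip); exact: sm_proj.
  - by move=> y; rewrite sm_commA_all.
have [lP sP iP] := pP t.
set w := pi setT x; have Sw : S w by exact: sm_in.
have -> : pi `]-oo, t] x = pi `]-oo, t] w by rewrite /w sm_sub'.
have eU : ~` `]-oo, t]%classic = `]t, +oo[%classic :> set R.
  by rewrite setCitvl.
rewrite {2}(sm_split mL Sw) eU (linD lP).
have -> : P t (pi `]t, +oo[ w) = 0.
  set y := P t _.
  have Uy : pi `]t, +oo[ y = y by rewrite /y cP // sm_idem.
  have Py : P t y = y by rewrite /y iP.
  rewrite -Uy ray_bigcup.
  apply: sm_bigcup0 => n; first exact: measurable_itv.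
  pose D : set R := `[t + n.+1%:R^-1, +oo[%classic; rewrite -/D.
  have mD : measurable D by exact: measurable_itv.
  have Py' : P t (pi D y) = pi D y by rewrite -cP // Py.
  have Dy : pi D (pi D y) = pi D y by exact: sm_idem.
  apply: (nn_eq0 Hip); have a := h1 _ _ Py'.
  have b : (t + n.+1%:R^-1) * nn (pi D y) <= rp (A (pi D y)) (pi D y).
    by apply: (sm_ge mD) => // s; rewrite /D /= in_itv /= andbT.
  have n0 : 0 < n.+1%:R^-1 :> R by rewrite invr_gt0.
  move: (n.+1%:R^-1) n0 b a => r r0 b a.
  by have := nn_ge0 (pi D y); nra.
rewrite addr0; set v := pi `]-oo, t] w; apply/eqP; rewrite -subr_eq0; apply/eqP.
set z := v - P t v.
have Pz : P t z = 0 by rewrite /z (linB lP) iP subrr.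
have Lz : pi `]-oo, t] z = z.
  by rewrite /z (linB (sm_lin mL)) cP // /v sm_idem.
rewrite -Pz; apply/esym; apply: h3; apply/eqP; rewrite -subr_eq0; apply/eqP.
pose T y := t%:C *: pi `]-oo, t] y - A (pi `]-oo, t] y).
have lT : linear T.
  move=> c y y'; rewrite /T (sm_lin mL) lA scalerDr opprD addrACA scalerBr.
  by congr (_ - _ + _); rewrite !scalerA mulrC.
have sT : sa T.
  move=> y y'; rewrite /T ipBl ipBr ipZl ipZr conjc_real (sm_sa mL).
  by rewrite sA (sm_sa mL) (sm_commA_all mL).
have rT y : rp (T y) y = t * nn (pi `]-oo, t] y) - rp (A (pi `]-oo, t] y)) (pi `]-oo, t] y).
  rewrite /T rpDl rpNl rpZl projection_rp; last exact: sm_proj.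
  congr (_ - _); rewrite -{1}(sm_idem y mL) (sm_commA_all mL) rp_sa //.
  exact: sm_sa.
have pT y : 0 <= rp (T y) y.
  rewrite rT subr_ge0; apply: (sm_le mL); last exact: sm_idem.
  by move=> s; rewrite /= in_itv.
have Tz : T z = 0.
  apply: (nn_eq0 Hip); have := psd_CS lT sT pT z (T z).
  have -> : rp (T z) z = 0.
    by apply/eqP; rewrite eq_le pT andbT rT Lz subr_le0; exact: h2.
  rewrite mul0r => h; have /ab2_eq0 : ab2 (ip (T z) (T z)) = 0.
    by apply/eqP; rewrite eq_le h ab2_ge0.
  by rewrite /sqn => ->.
by move: Tz; rewrite /T Lz => /eqP; rewrite subr_eq0 => /eqP ->; rewrite subrr.
Qed.
End HalfLine.

End Properties.

(** Agreement on half-lines gives agreement of the scalar measures on half-open intervals, hence on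
    all measurable sets, and a projection is determined by the squared norms of its values. *)
Lemma smeas_unique A S pi pi' : bsa A -> (forall x, S x -> S (A x)) ->
  smeas A S pi -> smeas A S pi' ->
  forall B, measurable B -> forall x, pi B x = pi' B x.
Proof.
move=> hA AS h h' B mB.
have [lA sA [M bA]] := hA.
have [P hP] := halfline_projection_exists Hip lA sA bA.
have eT x : pi setT x = pi' setT x.
  have mT : measurable (setT : set R) by [].
  have Sx : S (pi setT x) by exact: (sm_in h).
  apply/eqP; rewrite -subr_eq0; apply/eqP; apply: (nn_eq0 Hip).
  have Sx' : S (pi' setT x) by exact: (sm_in h').
  have key y : S y -> ip (pi setT x - pi' setT x) y = 0.
    move=> Sy; rewrite ipBl (sm_sa h mT) (sm_sa h' mT).
    by rewrite (sm_T h Sy) (sm_T h' Sy) subrr.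
  by rewrite /sqn ipBr !key // subrr Re0.
have eL (t : R) x : pi `]-oo, t]%classic x = pi' `]-oo, t]%classic x.
  by rewrite (sm_halfline hA h AS hP) (sm_halfline hA h' AS hP) eT.
apply: (projection_eq Hip (sm_proj h mB) (sm_proj h' mB)) => x.
have [mu [m _]] := sm_mu h x; have [mu' [m' _]] := sm_mu h' x.
suff : mu B = mu' B by rewrite m // m' // => -[].
apply: (@measure_unique _ R (measurableTypeR R) (@ocitv R)
  (fun n : nat => `](- n%:R), n%:R]%classic)) => //.
- exact: ocitvI.
- by move=> n; exact: is_ocitv.
- rewrite -subTset => t _; exists (Num.bound `|t : R|) => //=.
  have := archi_boundP (normr_ge0 (t : R)); rewrite in_itv /= ltr_norml => /andP[a b].
  by rewrite a ltW.
- move=> X /ocitvP[->|[[a b] /= ab ->]]; first by rewrite !measure0.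
  have mab : measurable (`]a, b]%classic : set R) by exact: measurable_itv.
  rewrite m // m' //; congr (sqn ip _)%:E.
  have key (p : set R -> H -> H) : smeas A S p -> p `]a, b]%classic x = p `]-oo, b]%classic x - p `]-oo, a]%classic x.
    move=> hp; rewrite (_ : `]-oo, b]%classic = `]-oo, a]%classic `|` `]a, b]%classic).
      have mLa : measurable (`]-oo, a]%classic : set R) by exact: measurable_itv.
      rewrite (sm_U hp x mLa mab); first by rewrite addrAC subrr add0r.
      rewrite -subset0 => t /= []; rewrite !in_itv /= => ta /andP[at_ _].
      by move: ta; rewrite leNgt at_.
    by rewrite -itv_bndbnd_setU // bnd_simp ltW.
  by rewrite !key // !eL.
- by move=> k; rewrite m ?ltry //; exact: measurable_itv.
Qed.

End SpectralMeasures.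

Section GoodPairs.
Context {R : realType} {H : completeNormedModType R[i]}.
Variable ip : {dot H for Num.conj}.
Hypothesis Hip : inner_product_norm ip.
Implicit Types (x y z : H) (T : H -> H) (B C D : set R) (p : @pair R H).

Local Notation nn := (sqn ip).
Local Notation rp := (rip ip).
Local Notation cvgH := (cvgn ip).
Local Notation sa := (self_adjoint ip).
Local Notation projection := (projection ip).
Local Notation bsa := (bsa ip).
Local Notation smeas := (smeas ip).

Definition sm p : set R -> H -> H := spectral_measure ip p.

Definition good p :=
  [/\ bsa (op p), forall x, space p x -> space p (op p x) &
      smeas (op p) (space p) (sm p)].

(** As [sm] is picked by choice, its values become accessible only by exhibiting a candidate and
    invoking uniqueness; restrictions and affine images are treated in this way. *)
Lemma good_intro p pi : bsa (op p) ->
  (forall x, space p x -> space p (op p x)) -> smeas (op p) (space p) pi ->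
  good p /\ forall B, measurable B -> forall x, sm p B x = pi B x.
Proof.
move=> hA AS hpi; have [_ sA _] := hA.
have h : smeas (op p) (space p) (sm p).
  apply/(smeasP (space p) (term p) (idx p) (sm p) sA).
  have -> : Pair (op p) (space p) (term p) (idx p) = p by case: p {hA AS hpi sA}.
  apply: (@xgetPex _ _ [set pi | is_spectral_measure ip p pi]).
  exists pi; have := (smeasP (space p) (term p) (idx p) pi sA).2 hpi.
  by case: p {hA AS hpi sA}.
by split => // B mB x; exact: (smeas_unique Hip hA AS h hpi).
Qed.

Lemma pvm_smeas A pi : pvm ip A pi -> smeas A setT pi.
Proof.
case=> h1 h2 h3 h4; split => // [|x].
  by apply/seteqP; split=> // x _; exists x.
have [mu [m [i e]]] := h4 x; exists mu; split => // _; split => //.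
Qed.

Lemma good_full A t J : bsa A -> good (Pair A setT t J).
Proof.
move=> hA; have [lA sA [M bA]] := hA; have [pi hpi] := pvm_exists Hip lA sA bA.
by have [] := @good_intro (Pair A setT t J) pi hA (fun _ _ => Logic.I) (pvm_smeas hpi).
Qed.

Lemma good_restr p q I : good p -> measurable I -> op q = op p ->
  space q = range (sm p I) ->
  good q /\ forall B, measurable B -> forall x, sm q B x = sm p (B `&` I) x.
Proof.
move=> [hA AS h] mI oq sq.
have mBI B : measurable B -> measurable (B `&` I) by move=> ?; exact: measurableI.
apply: (@good_intro q (fun B => sm p (B `&` I))); rewrite oq ?sq //.
  by move=> _ [y _ <-]; exists (op p y) => //; rewrite -(sm_commA_all Hip hA h AS mI).
split.
- by move=> B mB; exact: (sm_proj h) (mBI _ mB).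
- move=> B C mB mC x; rewrite -(sm_I h); try exact: mBI.
  by congr (sm p _ x); rewrite setIACA setIid.
- by rewrite setTI.
- move=> x; have [mu [m i]] := sm_mu h (sm p I x); exists mu; split.
    by move=> B mB; rewrite m // -(sm_I h).
  move=> [y _ e]; have Ix : sm p I x = x by rewrite -e (sm_idem h).
  by rewrite Ix in i; apply: i; rewrite -Ix; exact: (sm_in h).
Qed.

Lemma measurable_affine (c e : R) : measurable_fun [set: measurableTypeR R] (fun t : measurableTypeR R => (c * t + e) : measurableTypeR R).
Proof.
apply: measurable_funD => //; exact: measurable_funM.
Qed.

Lemma preimage_affine (c e : R) B : measurable B ->
  measurable ((fun t => c * t + e) @^-1` B : set R).
Proof.
by move=> mB; rewrite -[X in measurable X]setTI; exact: (@measurable_affine c e measurableT).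
Qed.

Lemma good_affine p q (c e : R) : good p ->
  (forall x, op q x = c%:C *: op p x + e%:C *: x) -> space q = space p ->
  good q /\ forall B, measurable B -> forall x,
    sm q B x = sm p ((fun t => c * t + e) @^-1` B) x.
Proof.
move=> [hA AS h] oq sq; have [lA sA [M bA]] := hA.
have mg := @measurable_affine c e.
have mB B := @preimage_affine c e B.
have cS := (sm_proj h (@measurableT _ R)).
have SD x y : space p x -> space p y -> space p (x + y).
  move=> Sx Sy; rewrite -(sm_T h Sx) -(sm_T h Sy) -(linD (sm_lin h _)) //.
  exact: (sm_in h).
have SZ (k : R[i]) x : space p x -> space p (k *: x).
  by move=> Sx; rewrite -(sm_T h Sx) -(linZ (sm_lin h _)) //; exact: (sm_in h).
apply: (@good_intro q (fun B => sm p ((fun t => c * t + e) @^-1` B))).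
- split.
  + move=> k x y; rewrite !oq lA !scalerDr !scalerA addrACA.
    by congr (_ + _ + (_ + _)); rewrite mulrC.
  + by move=> x y; rewrite !oq ipDl ipDr !ipZl !ipZr !conjc_real sA.
  + exists (2 * c ^+ 2 * M + 2 * e ^+ 2).
    case: bA => M0 bA; split=> [|x].
      by have := sqr_ge0 c; have := sqr_ge0 e; nra.
    rewrite oq; apply: le_trans (nnD_le Hip _ _) _; rewrite !nnZr.
    by have := bA x; have := sqr_ge0 c; nra.
- by move=> x; rewrite sq oq => Sx; apply: SD; apply: SZ => //; exact: AS.
rewrite sq; split.
- by move=> B /mB /(sm_proj h).
- by move=> B C /mB hB /mB hC x; rewrite preimage_setI (sm_I h).
- by rewrite preimage_setT; case: h.
move=> x; have [mu [m i]] := sm_mu h x.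
exists (pushforward mu (fun t : measurableTypeR R => (c * t + e) : measurableTypeR R)); split.
  by move=> B /mB hB; rewrite /pushforward; exact: m.
move=> Sx; have [im em] := i Sx.
have fm : (mu setT < +oo)%E by rewrite m // ltry.
have i1 : mu.-integrable setT (fun t : R => (c * t)%:E).
  exact: (integrableZl measurableT c im).
have i2 : mu.-integrable setT (fun t : R => e%:E).
  apply: (measurable_bounded_integrable (f := fun=> e)) => //.
  by exists `|e|; split => // M' hM t _; exact: ltW.
have i3 : mu.-integrable setT (fun t : R => (c * t + e)%:E).
  exact: (integrableD measurableT i1 i2).
split.
  by apply: (integrable_pushforward mg) => //; exact: measurable_id_EFin.
have -> : Rintegral (pushforward mu (fun t : measurableTypeR R => (c * t + e) : measurableTypeR R)) setT (fun t : R => t) = Rintegral mu setT (fun t : R => c * t + e).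
  move=> m0; rewrite /Rintegral; congr fine.
  by rewrite (@integral_pushforward _ _ _ _ _ _ m0 mu setT EFin) //; exact: measurable_id_EFin.
rewrite (RintegralD measurableT i1 i2) RintegralZl // -em oq.
rewrite rpDl !rpZl; congr (_ + _).
by rewrite Rintegral_cst // m //= (sm_T h Sx).
Unshelve. exact: mg.
Qed.

End GoodPairs.

(** Dependent choice in which the next term may depend on all earlier ones. *)
Lemma prefix_rec (T : Type) (t0 : T) (P : seq T -> Prop) : P [::] ->
  (forall s, P s -> exists x, P (rcons s x)) ->
  exists u : nat -> T, forall n, P (mkseq u n).
Proof.
move=> P0 PS.
have /choice[f hf] : forall s, exists x, P s -> P (rcons s x).
  by move=> s; have [/PS[x ?]|?] := pselect (P s); [exists x|exists t0].
pose S n := iter n (fun s => rcons s (f s)) [::].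
have PSn n : P (S n) by elim: n => [//|n IH]; exact: hf.
exists (fun n => f (S n)) => n.
suff -> : mkseq (fun n => f (S n)) n = S n by [].
by elim: n => [//|n IH]; rewrite mkseqS IH.
Qed.

(** Dependent choice with a state: P is the invariant at step n, Q the relation between consecutive
    states. *)
Lemma state_rec (T : Type) (P : nat -> T -> Prop) (Q : nat -> T -> T -> Prop) x0 :
  P 0%N x0 -> (forall n x, P n x -> exists2 y, Q n x y & P n.+1 y) ->
  exists u : nat -> T, [/\ u 0%N = x0, forall n, P n (u n) &
    forall n, Q n (u n) (u n.+1)].
Proof.
move=> P0 h.
have /choice[f hf] : forall nx : nat * T, exists y,
    P nx.1 nx.2 -> Q nx.1 nx.2 y /\ P nx.1.+1 y.
  move=> [n x] /=; have [/h[y ? ?]|?] := pselect (P n x); first by exists y.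
  by exists x.
pose u := fix u n := if n is n'.+1 then f (n', u n') else x0.
have Pu n : P n (u n) by elim: n => [//|n /(hf (n, u n))[]].
by exists u; split => // n; have [] := hf (n, u n) (Pu n).
Qed.

(** * Spectral subspaces and their dimensions *)

Section Dimension.
Context {R : realType} {H : completeNormedModType R[i]}.
Variable ip : {dot H for Num.conj}.
Hypothesis Hip : inner_product_norm ip.
Implicit Types (x y z v : H) (V W : set H) (F : nat -> H) (n : nat).

Local Notation nn := (sqn ip).
Local Notation rp := (rip ip).
Local Notation cvgH := (cvgn ip).
Local Notation orthn := (orthn ip).
Local Notation nn_ge0 := (nn_ge0 Hip).

Lemma orthn_sub (J K : set nat) (u : nat -> H) : J `<=` K -> orthn K u -> orthn J u.
Proof. by move=> JK h i j /JK Ki /JK Kj; exact: h. Qed.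

Lemma orthn_extend n (u : nat -> H) v : orthn `I_n u -> nn v = 1 ->
  (forall i, (i < n)%N -> ip v (u i) = 0) ->
  orthn `I_n.+1 (fun i => if i == n then v else u i).
Proof.
move=> ou v1 vu i j /= hi hj.
have {}hi : (i == n) || (i < n)%N by rewrite -leq_eqVlt.
have {}hj : (j == n) || (j < n)%N by rewrite -leq_eqVlt.
case: (eqVneq i n) hi => [->|ni] /= hi; case: (eqVneq j n) hj => [->|nj] /= hj.
- by rewrite ipnn v1.
- by rewrite vu // eq_sym (negbTE nj).
- by rewrite (negbTE ni); apply: ip_eq0C; rewrite vu.
- by rewrite ou.
Qed.

Lemma unit_of V v : subsp V -> V v -> v <> 0 ->
  exists k : R[i], nn (k *: v) = 1 /\ V (k *: v).
Proof.
move=> sV Vv v0; exists ((Num.sqrt (nn v))^-1)%:C; split; last exact: subspZ.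
have nv := nn_gt0 Hip v0.
rewrite nnZr exprVn sqr_sqrtr ?ltW // mulVf // gt_eqF //.
Qed.

(** One linear condition costs one dimension: if some v k violates it, the other vectors are
    corrected by multiples of v k. *)
Lemma dim_ge_perp1 V n (f : H) : subsp V -> dim_ge V n.+1 ->
  dim_ge [set v | V v /\ ip v f = 0] n.
Proof.
move=> sV [v [Vv iv]].
have [[k hk]|h0] := pselect (exists k, ip (v k) f <> 0); last first.
  have {}h0 k : ip (v k) f = 0 by apply: contrapT => hk; apply: h0; exists k.
  exists (fun i => v (lift ord0 i)); split => // c hc i.
  have := iv (fun j => if unlift ord0 j is Some j' then c j' else 0).
  rewrite big_ord_recl unlift_none scale0r add0r.
  under eq_bigr do rewrite liftK.
  by move=> /(_ hc (lift ord0 i)); rewrite liftK.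
pose a i := ip (v (lift k i)) f / ip (v k) f.
exists (fun i => v (lift k i) - a i *: v k); split.
  move=> i; split; first by apply: subspB => //; exact: subspZ.
  by rewrite ipBl ipZl /a divfK ?subrr //; exact/eqP.
move=> c hc i.
have := iv (fun j => if unlift k j is Some j' then c j' else - \sum_l c l * a l).
have -> : \sum_j (if unlift k j is Some j' then c j' else - \sum_l c l * a l) *: v j =
    \sum_j c j *: (v (lift k j) - a j *: v k).
  rewrite (bigD1_ord k) //= unlift_none scaleNr scaler_suml.
  rewrite -sumrN -big_split /=; apply: eq_bigr => j _.
  by rewrite liftK scalerBr scalerA addrC.
by move=> /(_ hc (lift k i)); rewrite liftK.
Qed.

Lemma dim_ge_perp V n F : subsp V -> dim_ge V n.+1 ->
  exists v, [/\ V v, nn v = 1 & forall i, (i < n)%N -> ip v (F i) = 0].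
Proof.
elim: n F V => [|n IH] F V sV dV.
  case: dV => v [Vv iv].
  have v0 : v ord0 <> 0.
    move=> e; have := iv (fun=> 1); rewrite big_ord1 e scaler0.
    by move=> /(_ erefl ord0) /eqP; rewrite oner_eq0.
  by have [k [h1 h2]] := unit_of sV (Vv ord0) v0; exists (k *: v ord0).
have sW : subsp [set v | V v /\ ip v (F 0%N) = 0].
  split; first by split; [case: sV|rewrite ip0l].
  move=> c x y /= [Vx x0] [Vy y0]; split; first by case: sV => _; exact.
  by rewrite ipDl ipZl x0 y0 mulr0 addr0.
have [v [[Vv v0] v1 hv]] := IH (fun i => F i.+1) _ sW (dim_ge_perp1 (F 0%N) sV dV).
by exists v; split => // -[|i] //; rewrite ltnS; exact: hv.
Qed.

Lemma orthn_dim_ge V n (u : nat -> H) : orthn `I_n u ->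
  (forall i, (i < n)%N -> V (u i)) -> dim_ge V n.
Proof.
move=> ou Vu; exists (fun i : 'I_n => u i); split => [i|c hc k]; first exact: Vu.
have := congr1 (fun x => ip x (u k)) hc; rewrite ip_suml ip0l (bigD1 k) //=.
rewrite ipZl ou //= eqxx mulr1 big1 ?addr0 // => i ik.
by rewrite ipZl ou //= (negbTE (_ : i != k :> nat)) ?mulr0.
Qed.

Lemma dim_ge_le V n k : (n <= k)%N -> dim_ge V k -> dim_ge V n.
Proof.
move/subnK <-; elim: (k - n)%N => [//|j IH] d; apply: IH.
move: d; rewrite addSn => -[v [Vv iv]].
exists (fun i => v (lift ord0 i)); split => // c hc i.
have := iv (fun j => if unlift ord0 j is Some j' then c j' else 0).
rewrite big_ord_recl unlift_none scale0r add0r.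
under eq_bigr do rewrite liftK.
by move=> /(_ hc (lift ord0 i)); rewrite liftK.
Qed.

(** Finite dimension through a finite separating family, whose members may lie outside V; in this
    form it passes to subspaces without a new basis. *)
Definition findim V := exists N F, forall v, V v ->
  (forall i, (i < N)%N -> ip v (F i) = 0) -> v = 0.

Lemma findim_sub V W : V `<=` W -> findim W -> findim V.
Proof. by move=> VW [N [F h]]; exists N, F => v /VW; exact: h. Qed.

Lemma not_findimP V : subsp V -> dim_infinite V <->  ~ findim V.
Proof.
move=> sV; split => [iV [N [F h]]|h n].
  have [v [Vv v1 /h -/(_ Vv) e]] := dim_ge_perp F sV (iV N.+1).
  by move: v1; rewrite e nn0 => /eqP; rewrite eq_sym oner_eq0.
suff [u [ou Vu]] : exists u : nat -> H, orthn `I_n u /\ forall i, (i < n)%N -> V (u i).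
  exact: orthn_dim_ge ou Vu.
elim: n => [|n [u [ou Vu]]]; first by exists (fun=> 0); split.
have [v [Vv vu v0]] : exists v, [/\ V v, forall i, (i < n)%N -> ip v (u i) = 0 & v <> 0].
  apply: contrapT => h'; apply: h; exists n, u => v Vv vu.
  by apply: contrapT => v0; apply: h'; exists v.
have [k [k1 Vk]] := unit_of sV Vv v0.
exists (fun i => if (i == n) then k *: v else u i); split; last first.
  move=> i; rewrite ltnS leq_eqVlt; case: eqP => [->|_] //=; exact: Vu.
by apply: orthn_extend => // i /vu h'; rewrite ipZl h' mulr0.
Qed.

Lemma findimP V : subsp V -> findim V <-> ~ dim_infinite V.
Proof.
move=> sV; split; first by move=> f /(not_findimP sV).
by move=> h; apply: contrapT => /(not_findimP sV).
Qed.

(** A maximal orthonormal family in V, whose length cannot exceed that of the separating family. *)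
Lemma findim_basis V : subsp V -> findim V -> exists n u,
  [/\ orthn `I_n u, forall i, (i < n)%N -> V (u i),
     forall v, V v -> (forall i, (i < n)%N -> ip v (u i) = 0) -> v = 0 &
     forall k, dim_ge V k <-> (k <= n)%N].
Proof.
move=> sV fV.
have [N [F hF]] := fV.
pose P n := `[< exists u : nat -> H, orthn `I_n u /\ forall i, (i < n)%N -> V (u i) >].
have bP n : P n -> (n <= N)%N.
  move=> /asboolP[u [ou Vu]]; rewrite leqNgt; apply/negP => Nn.
  have d : dim_ge V N.+1.
    apply: (@orthn_dim_ge V N.+1 u) => [|i iN]; last exact/Vu/(leq_trans iN).
    by apply: orthn_sub ou => i /= iN; exact: leq_trans Nn.
  have [v [Vv v1 /hF -/(_ Vv) e]] := dim_ge_perp F sV d.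
  by move: v1; rewrite e nn0 => /eqP; rewrite eq_sym oner_eq0.
have P0 : exists n, P n by exists 0%N; apply/asboolP; exists (fun=> 0); split.
case: (ex_maxnP P0 bP) => n /asboolP[u [ou Vu]] hn.
exists n, u.
have cu v : V v -> (forall i, (i < n)%N -> ip v (u i) = 0) -> v = 0.
  move=> Vv vu; apply: contrapT => v0; have [k [k1 Vk]] := unit_of sV Vv v0.
  suff /hn : P n.+1 by rewrite ltnn.
  apply/asboolP; exists (fun i => if (i == n) then k *: v else u i); split; last first.
    move=> i; rewrite ltnS leq_eqVlt; case: eqP => [->|_] //=; exact: Vu.
  by apply: orthn_extend => // i /vu h'; rewrite ipZl h' mulr0.
split => // k; split => [dk|kn]; last first.
  apply: (@orthn_dim_ge V k u) => [|i ik]; last exact/Vu/(leq_trans ik).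
  by apply: orthn_sub ou => i /= ik; exact: leq_trans kn.
rewrite leqNgt; apply/negP => nk.
have d : dim_ge V n.+1 by exact: dim_ge_le dk.
have [v [Vv v1 /cu -/(_ Vv) e]] := dim_ge_perp u sV d.
by move: v1; rewrite e nn0 => /eqP; rewrite eq_sym oner_eq0.
Qed.

End Dimension.

Lemma lray_bigcup {R : realType} (t : R) :
  `]-oo, t[%classic = \bigcup_n `]-oo, t - n.+1%:R^-1]%classic :> set R.
Proof.
apply/seteqP; split=> s /=; rewrite ?in_itv /=.
  move=> ts; have st : 0 < t - s by rewrite subr_gt0.
  have [N _ hN] := near_infty_natSinv_lt (PosNum st).
  exists N => //=; rewrite in_itv /=.
  by have := hN N (leqnn _) => /= /ltW; rewrite !lerBrDl addrC.
case=> n _ /=; rewrite in_itv /= => h; apply: le_lt_trans h _.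
by rewrite ltrBlDr ltrDl invr_gt0.
Qed.

Section SpectralRange.
Context {R : realType} {H : completeNormedModType R[i]}.
Variable ip : {dot H for Num.conj}.
Hypothesis Hip : inner_product_norm ip.
Implicit Types (x y z v : H) (B C D : set R).

Local Notation nn := (sqn ip).
Local Notation rp := (rip ip).
Local Notation cvgH := (cvgn ip).
Local Notation orthn := (orthn ip).
Local Notation nn_ge0 := (nn_ge0 Hip).

Definition spr (p : @pair R H) B : set H := range (sm ip p B).

Variable p : @pair R H.
Hypothesis gp : good ip p.
Local Notation S := (space p).
Local Notation A := (op p).
Local Notation P := (sm ip p).

Let hA : bsa ip A. Proof. by case: gp. Qed.
Let AS x : S x -> S (A x). Proof. by case: gp => _ h _; exact: h. Qed.
Let hP : smeas ip A S P. Proof. by case: gp. Qed.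
Let lA : linear A. Proof. by case: hA. Qed.
Let sA : self_adjoint ip A. Proof. by case: hA. Qed.

Lemma sprP B x : measurable B -> spr p B x <-> P B x = x.
Proof.
by move=> mB; split=> [[y _ <-]|<-]; [rewrite (sm_idem hP)|exists x].
Qed.

Lemma spr_sm B x : spr p B (P B x). Proof. by exists x. Qed.

Lemma spr_csub B : measurable B -> csub ip (spr p B).
Proof.
move=> mB; have pB := sm_proj hP mB.
rewrite (_ : spr p B = [set x | x - P B x = 0]).
  apply: (@csub_ker _ _ ip Hip _ 4) => // [c x y|x].
    by rewrite (sm_lin hP mB) scalerBr opprD addrACA.
  apply: le_trans (nnB_le Hip _ _) _.
  by have := projection_le Hip x pB; lra.
apply/seteqP; split=> x /=; first by move=> /(sprP _ mB) ->; rewrite subrr.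
by move=> /eqP; rewrite subr_eq0 => /eqP e; exists x.
Qed.

Lemma spr_subsp B : measurable B -> subsp (spr p B).
Proof. by move=> /spr_csub[]. Qed.

Lemma spr_sub B C x : measurable B -> measurable C -> B `<=` C ->
  spr p B x -> spr p C x.
Proof. by move=> mB mC BC /(sprP _ mB) h; apply/sprP => //; exact: (sm_ran_sub hP mB). Qed.

Lemma spr_T x : spr p setT x <-> S x.
Proof. by case: hP => _ _ <- _. Qed.

Lemma spr_S B x : measurable B -> spr p B x -> S x.
Proof. by move=> mB /(sprP _ mB) <-; exact: (sm_in hP). Qed.

Lemma spr_A B x : measurable B -> spr p B x -> spr p B (A x).
Proof.
by move=> mB /(sprP _ mB) h; apply/sprP => //; rewrite -(sm_commA_all Hip hA hP AS mB) h.
Qed.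

Lemma spr_disj B C x : measurable B -> measurable C -> B `&` C = set0 ->
  spr p C x -> P B x = 0.
Proof. by move=> mB mC d [y _ <-]; rewrite (sm_disj Hip hP). Qed.

Lemma spr_perp B C x y : measurable B -> measurable C -> B `&` C = set0 ->
  spr p B x -> spr p C y -> ip x y = 0.
Proof.
move=> mB mC d /(sprP _ mB) <- Cy.
by rewrite (sm_sa hP mB) (spr_disj mB mC d Cy) ip0r.
Qed.

Lemma spr_le B x (c : R) : measurable B -> (forall t, B t -> t <= c) ->
  spr p B x -> rp (A x) x <= c * nn x.
Proof. by move=> mB Bc /(sprP _ mB) h; exact: (sm_le Hip hP mB). Qed.

Lemma spr_ge B x (c : R) : measurable B -> (forall t, B t -> c <= t) ->
  spr p B x -> c * nn x <= rp (A x) x.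
Proof. by move=> mB Bc /(sprP _ mB) h; exact: (sm_ge Hip hP mB). Qed.

Lemma spr_setC B x : measurable B -> S x -> spr p (~` B) x <-> P B x = 0.
Proof.
move=> mB Sx; have mC : measurable (~` B) by exact: measurableC.
split=> [h|h]; first exact: (spr_disj mB mC (setICr _)).
by apply/sprP => //; rewrite {2}(sm_split Hip hP mB Sx) h add0r.
Qed.

Lemma spr_rp_split B x : measurable B -> S x ->
  rp (A x) x = rp (A (P B x)) (P B x) + rp (A (P (~` B) x)) (P (~` B) x).
Proof.
move=> mB Sx; have mC : measurable (~` B) by exact: measurableC.
rewrite {1 2}(sm_split Hip hP mB Sx) (linD lA) rpDl !rpDr.
have e : rp (A (P B x)) (P (~` B) x) = 0.
  by rewrite /rip (spr_perp mB mC (setICr _)) ?Re0 //; [apply: spr_A => //; exact: spr_sm|exact: spr_sm].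
by rewrite [rp (A (P (~` B) x)) (P B x)]rpC -(rp_sa _ _ sA) e; ring.
Qed.

Lemma spr_nn_split B x : measurable B -> S x ->
  nn x = nn (P B x) + nn (P (~` B) x).
Proof.
move=> mB Sx; have mC : measurable (~` B) by exact: measurableC.
rewrite {1}(sm_split Hip hP mB Sx) nnD_orth //.
by apply: (spr_perp mB mC (setICr _)); exact: spr_sm.
Qed.

(** The open half-line is the union of the closed ones ending at t - 1 / (n + 1). One of them
    carries a nonzero part of x, on which the form bound improves strictly. *)
Lemma spr_lray_gt x (t c : R) : spr p `]-oo, t[ x -> t <= c -> x <> 0 ->
  rp (A x) x < c * nn x.
Proof.
move=> hx tc x0.
have mt : measurable (`]-oo, t[ : set R) by exact: measurable_itv.
suff h : rp (A x) x < t * nn x.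
  by have := nn_ge0 x; nra.
have [n hn] : exists n : nat, P `]-oo, t - n.+1%:R^-1] x <> 0.
  apply: contrapT => hn; apply: x0; rewrite -((sprP _ mt).1 hx) lray_bigcup.
  apply: (sm_bigcup0 Hip hP) => n; first exact: measurable_itv.
  by apply: contrapT => h; apply: hn; exists n.
set B : set R := `]-oo, t - n.+1%:R^-1]%classic in hn.
have mB : measurable B by exact: measurable_itv.
have Sx := spr_S mt hx.
rewrite (spr_rp_split mB Sx) (spr_nn_split mB Sx).
have h1 : rp (A (P B x)) (P B x) <= (t - n.+1%:R^-1) * nn (P B x).
  by apply: (spr_le mB) => [s|]; [rewrite /B /= in_itv|exact: spr_sm].
have h2 : rp (A (P (~` B) x)) (P (~` B) x) <= t * nn (P (~` B) x).
  apply: (@spr_le `]-oo, t[) => // [s|]; first by rewrite /= in_itv /=; exact: ltW.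
  by apply/sprP => //; rewrite (sm_comm hP) ?((sprP _ mt).1 hx) //; exact: measurableC.
have h3 : 0 < nn (P B x) by exact: nn_gt0.
have h4 : 0 < n.+1%:R^-1 :> R by rewrite invr_gt0.
by move: (n.+1%:R^-1) h4 h1 => r r0 h1; nra.
Qed.

Lemma spr_rray_gt x (t c : R) : spr p `]t, +oo[ x -> c <= t -> x <> 0 ->
  c * nn x < rp (A x) x.
Proof.
move=> hx tc x0.
have mt : measurable (`]t, +oo[ : set R) by exact: measurable_itv.
suff h : t * nn x < rp (A x) x.
  by have := nn_ge0 x; nra.
have [n hn] : exists n : nat, P `[t + n.+1%:R^-1, +oo[ x <> 0.
  apply: contrapT => hn; apply: x0; rewrite -((sprP _ mt).1 hx) ray_bigcup.
  apply: (sm_bigcup0 Hip hP) => n; first exact: measurable_itv.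
  by apply: contrapT => h; apply: hn; exists n.
set B : set R := `[t + n.+1%:R^-1, +oo[%classic in hn.
have mB : measurable B by exact: measurable_itv.
have Sx := spr_S mt hx.
rewrite (spr_rp_split mB Sx) (spr_nn_split mB Sx).
have h1 : (t + n.+1%:R^-1) * nn (P B x) <= rp (A (P B x)) (P B x).
  by apply: (spr_ge mB) => [s|]; [rewrite /B /= in_itv /= andbT|exact: spr_sm].
have h2 : t * nn (P (~` B) x) <= rp (A (P (~` B) x)) (P (~` B) x).
  apply: (@spr_ge `]t, +oo[) => // [s|]; first by rewrite /= in_itv /= andbT; exact: ltW.
  by apply/sprP => //; rewrite (sm_comm hP) ?((sprP _ mt).1 hx) //; exact: measurableC.
have h3 : 0 < nn (P B x) by exact: nn_gt0.
have h4 : 0 < n.+1%:R^-1 :> R by rewrite invr_gt0.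
by move: (n.+1%:R^-1) h4 h1 => r r0 h1; nra.
Qed.

(** On the range for {t} the form of A is t |x|^2, and polarizing against (A - t) x gives A x = t x.
    Conversely, the parts of an eigenvector in the two open half-lines are again eigenvectors for t,
    which the strict bounds there exclude. *)
Lemma spr_set1 t x : spr p [set t] x <-> S x /\ A x = t%:C *: x.
Proof.
have mt : measurable ([set t] : set R) by exact: measurable_set1.
split=> [hx|[Sx e]].
  split; first exact: spr_S hx.
  have key z : spr p [set t] z -> rp (A z) z = t * nn z.
    move=> hz; apply/eqP; rewrite eq_le (spr_le mt _ hz) ?(spr_ge mt _ hz) //.
      by move=> s /= ->.
    by move=> s /= ->.
  have sV := spr_subsp mt.
  have [y ey] : exists y, y = A x - t%:C *: x by exists (A x - t%:C *: x).
  have hy : spr p [set t] y.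
    by rewrite ey; apply: subspB => //; [exact: spr_A|exact: subspZ].
  apply/eqP; rewrite -subr_eq0; apply/eqP; apply: (nn_eq0 Hip); rewrite -ey.
  have := key _ (subspD sV hx hy); rewrite (linD lA) rpDl !rpDr key // key // nnD.
  rewrite [rp (A y) x]rpC -(rp_sa x y sA) => h.
  by rewrite nnE {1}ey rpDl rpNl rpZl; lra.
have mR : measurable (`]t, +oo[ : set R) by exact: measurable_itv.
have mL : measurable (`]-oo, t[ : set R) by exact: measurable_itv.
have comm B : measurable B -> A (P B x) = t%:C *: P B x.
  by move=> mB; rewrite (sm_commA_all Hip hA hP AS mB) e (linZ (sm_lin hP mB)).
have hR : P `]t, +oo[ x = 0.
  apply: contrapT => /(@spr_rray_gt (P `]t, +oo[ x) t t (spr_sm _ _) (lexx _)).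
  by rewrite comm // rpZl ltxx.
have hL : P `]-oo, t[ x = 0.
  apply: contrapT => /(@spr_lray_gt (P `]-oo, t[ x) t t (spr_sm _ _) (lexx _)).
  by rewrite comm // rpZl ltxx.
apply/sprP => //; rewrite {2}(sm_split Hip hP mt Sx).
have -> : ~` [set t] = `]-oo, t[ `|` `]t, +oo[ :> set R.
  apply/seteqP; split => s /=; rewrite !in_itv /= ?andbT.
    by move=> /eqP; rewrite neq_lt => /orP[]; [left|right].
  by case=> [h|h] est; move: h; rewrite est ltxx.
rewrite (sm_U Hip hP) // ?hR ?hL ?addr0 //.
rewrite -subset0 => s /= []; rewrite !in_itv /= andbT => h1 h2.
by have := lt_trans h1 h2; rewrite ltxx.
Qed.

Lemma spr_eigenspace t : eigenspace p t = spr p [set t].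
Proof. by apply/seteqP; split=> x /=; rewrite spr_set1. Qed.

Lemma findim_spr_sub B C : measurable B -> measurable C -> B `<=` C ->
  findim ip (spr p C) -> findim ip (spr p B).
Proof. by move=> mB mC BC; apply: findim_sub => x; exact: spr_sub. Qed.

Lemma findim_spr_U B C : measurable B -> measurable C ->
  findim ip (spr p B) -> findim ip (spr p C) -> findim ip (spr p (B `|` C)).
Proof.
move=> mB mC [N [F hF]] [M [G hG]].
exists (N + M)%N, (fun i => if (i < N)%N then P B (F i) else P C (G (i - N)%N)).
move=> v hv h.
have mU : measurable (B `|` C) by exact: measurableU.
have Bv : P B v = 0.
  apply: hF; first exact: spr_sm.
  move=> i iN; have := h i (ltn_addr _ iN); rewrite iN => <-.
  by rewrite (sm_sa hP mB).
have Cv : P C v = 0.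
  apply: hG; first exact: spr_sm.
  move=> i iM; have := h (N + i)%N; rewrite ltn_add2l iM ltnNge leq_addr /= => /(_ erefl).
  by rewrite addKn (sm_sa hP mC).
have Sv := spr_S mU hv.
rewrite (sm_split Hip hP mB Sv) Bv add0r.
have -> : P (~` B) v = P (~` B `&` C) v.
  rewrite -{1}((sprP _ mU).1 hv) -(sm_I hP) //; last exact: measurableC.
  by congr (P _ v); rewrite setIUr setICl set0U.
by rewrite (sm_I hP) // ?Cv ?(lin0 (sm_lin hP _)) //; exact: measurableC.
Qed.

(* On a finite-dimensional spectral subspace a decreasing sequence of spectral
   projections tending to 0 vanishes eventually, by comparing traces. *)
Lemma findim_shrink I (D : nat -> set R) : measurable I ->
  (forall n, measurable (D n)) -> (forall n, D n.+1 `<=` D n) ->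
  \bigcap_n D n = set0 -> findim ip (spr p I) ->
  exists n, forall x, P (I `&` D n) x = 0.
Proof.
move=> mI mD nD D0 fI.
have [N [u [ou Vu cu _]]] := findim_basis Hip (spr_subsp mI) fI.
have mC n : measurable (~` D n) by exact: measurableC.
have cD x (e : R) : S x -> 0 < e -> exists n0, forall n, (n0 <= n)%N -> nn (P (D n) x) < e.
  move=> Sx e0; have h := @sm_bigcup_cvg _ _ ip Hip A S P hP (fun n => ~` D n) x mC.
  have [|n0 hn0] := h _ e e0; first by move=> n; exact/subsetC/nD.
  exists n0 => n nn0; have := hn0 n nn0.
  have -> : \bigcup_n ~` D n = setT by rewrite -setC_bigcap D0 setC0.
  by rewrite (sm_T hP Sx) {2}(sm_split Hip hP (mD n) Sx) opprD addrCA subrr addr0 nnN.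
have Su i : (i < N)%N -> S (u i) by move=> /Vu; exact: spr_S.
(* Each of the N basis vectors keeps less than 1 / (N + 1) of its squared norm in D n; a unit vector
   common to both ranges would then satisfy 1 <= N / (N + 1). *)
have [n hn] : exists n, forall i, (i < N)%N -> nn (P (D n) (u i)) < N.+1%:R^-1.
  suff : exists n, forall i, (i < N)%N -> forall m, (n <= m)%N ->
      nn (P (D m) (u i)) < N.+1%:R^-1.
    by case=> n hn; exists n => i iN; exact: hn.
  have r0 : 0 < N.+1%:R^-1 :> R by rewrite invr_gt0.
  move: (N.+1%:R^-1) r0 => r r0.
  elim: N Su {Vu cu ou} => [|N IH] Su; first by exists 0%N.
  have [|n hn] := IH; first by move=> i iN; apply: Su; exact: ltnW.
  have [n0 hn0] := cD (u N) r (Su N (ltnSn N)) r0.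
  exists (maxn n n0) => i; rewrite ltnS leq_eqVlt => /orP[/eqP -> m|iN m]; rewrite geq_max => /andP[h1 h2].
    exact: hn0.
  exact: hn.
exists n => x; set v0 := P _ x; apply: contrapT => v00.
have mID : measurable (I `&` D n) by exact: measurableI.
have [k [k1 hk]] := unit_of Hip (spr_subsp mID) (spr_sm _ x) v00.
set v := k *: v0 in k1 hk.
have Iv : spr p I v by apply: spr_sub hk => //; exact: subIsetl.
have Dv : P (D n) v = v by apply/sprP => //; apply: spr_sub hk => //; exact: subIsetr.
have e : psum ip `I_N u v N = v.
  apply/eqP; rewrite eq_sym -subr_eq0; apply/eqP; apply: cu.
    apply: subspB => //; first exact: spr_subsp.
    apply: subsp_sum; first exact: spr_subsp.
    by move=> i _; apply: subspZ; [exact: spr_subsp|exact/Vu/ltn_ord].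
  by move=> i iN; rewrite ipBl psum_ip // iN mul1r subrr.
have := nn_psum ou v N; rewrite e subrr nn0 k1 => /eqP; rewrite eq_sym subr_eq0.
move=> /eqP h; have : (1 : R) < 1; last by rewrite ltxx.
rewrite {1}h /psq.
apply: (@le_lt_trans _ _ (\sum_(i < N) N.+1%:R^-1)).
  apply: (@le_trans _ _ (\sum_(i < N | `[< `I_N i >]) N.+1%:R^-1)).
    apply: ler_sum => i _; rewrite -Dv (sm_sa hP (mD n)).
    apply: le_trans (CS Hip _ _) _; rewrite k1 mul1r ltW // hn //.
  by rewrite le_eqVlt; apply/orP; left; apply/eqP; apply: eq_bigl => i; apply/asboolP => /=.
rewrite sumr_const card_ord -[X in X < _]mulr_natl ltr_pdivrMr ?ltr0n // mul1r ltr_nat //.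
Qed.

End SpectralRange.

(** * Excess sums and orthonormal families over arbitrary index sets *)

Section Excess.
Context {R : realType} {K : choiceType}.
Implicit Types (J : set K) (x : K -> R) (a c : R) (s : seq K).

(** Finite subfamilies as duplicate-free lists; bounds for all sums over them replace statements on
    sums in the extended reals. *)
Definition seq_in J s := uniq s /\ forall i, i \in s -> J i.

Lemma esum_seq_le J (g : K -> R) s : (forall i, J i -> 0 <= g i) -> seq_in J s ->
  ((\sum_(i <- s) g i)%:E <= \esum_(i in J) (g i)%:E)%E.
Proof.
move=> g0 [us sJ]; apply: esum_ge; exists [set` s].
  by split => // i /=; exact: sJ.
by rewrite -fsbig_seq // sumEFin.
Qed.

Lemma esum_le_seq J (g : K -> R) (c : \bar R) :
  (forall s, seq_in J s -> ((\sum_(i <- s) g i)%:E <= c)%E) ->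
  (\esum_(i in J) (g i)%:E <= c)%E.
Proof.
move=> h; apply: ge_ereal_sup => _ [X [fX XJ] <-].
have [s sX] := (finite_seqP X).1 fX.
have -> : X = [set` undup s] by rewrite sX; apply/seteqP; split=> i /=; rewrite mem_undup.
rewrite -fsbig_seq ?undup_uniq // sumEFin; apply: h; split; first exact: undup_uniq.
by move=> i; rewrite mem_undup => si; apply: XJ; rewrite sX.
Qed.

Lemma esum_seqE J (g : K -> R) s : (forall i, J i -> 0 <= g i) ->
  uniq s -> (forall i, J i <-> i \in s) ->
  \esum_(i in J) (g i)%:E = (\sum_(i <- s) g i)%:E.
Proof.
move=> g0 us Js; have -> : J = [set` s] by apply/seteqP; split=> i /Js.
rewrite esum_fset.
- by rewrite -fsbig_seq // sumEFin.
- exact: finite_seq.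
- by move=> i; rewrite inE lee_fin => /= /Js; exact: g0.
Qed.

Lemma pos_sum_filter x a s :
  \sum_(i <- s) maxr 0 (a - x i) = \sum_(i <- s | x i <= a) (a - x i).
Proof.
rewrite [RHS]big_mkcond; apply: eq_bigr => i _.
by rewrite maxEle subr_ge0.
Qed.

Lemma lexc_seq J x a s : seq_in J s ->
  ((\sum_(i <- s) maxr 0 (a - x i))%:E <= lower_excess J x a)%E.
Proof.
move=> [us sJ]; rewrite pos_sum_filter -big_filter; apply: esum_seq_le.
  by move=> i [_]; rewrite subr_ge0.
split; first exact: filter_uniq.
by move=> i; rewrite mem_filter => /andP[h /sJ].
Qed.

Lemma lexc_le J x a (c : \bar R) :
  (forall s, seq_in J s -> ((\sum_(i <- s) maxr 0 (a - x i))%:E <= c)%E) ->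
  (lower_excess J x a <= c)%E.
Proof.
move=> h; apply: esum_le_seq => s [us sJ].
apply: (le_trans _ (h s _)); last by split => // i /sJ[].
rewrite lee_fin pos_sum_filter [X in _ <= X]big_mkcond big_seq [X in _ <= X]big_seq.
by apply: ler_sum => i /sJ[_ ->].
Qed.

Lemma lexc_ge0 J x a : (0 <= lower_excess J x a)%E.
Proof. by apply: esum_ge0 => i [_ h]; rewrite lee_fin subr_ge0. Qed.

End Excess.

Lemma infinite_seq (K : choiceType) (X : set K) : infinite_set X ->
  exists g : nat -> K, injective g /\ forall n, X (g n).
Proof.
move=> iX; have [k0 _] := infinite_setN0 iX.
have [||g hg] := @prefix_rec K k0 (fun s => seq_in X s) => [//|s [us sX]|].
  have iD : infinite_set (X `\` [set` s]) by apply: infinite_setD.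
  have [x [Xx xs]] := infinite_setN0 iD.
  exists x; split; first by rewrite rcons_uniq us andbT; apply/negP.
  by move=> i; rewrite mem_rcons inE => /orP[/eqP ->|/sX].
exists g; split => [i j e|n]; last first.
  by have [_ h] := hg n.+1; apply: h; rewrite mkseqS mem_rcons inE eqxx.
have [u _] := hg (maxn i j).+1; move/mkseq_uniqP: u; apply => //=;
  by rewrite inE /= ltnS ?leq_maxl ?leq_maxr.
Qed.

Section Families.
Context {R : realType} {H : completeNormedModType R[i]} {K : choiceType}.
Variable ip : {dot H for Num.conj}.
Hypothesis Hip : inner_product_norm ip.
Implicit Types (x y z v : H) (V : set H) (X : set K) (f : K -> H) (s : seq K).

Local Notation nn := (sqn ip).
Local Notation rp := (rip ip).

Definition onf X f := forall i j, X i -> X j -> ip (f i) (f j) = (i == j)%:R.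

Lemma onf_nn X f i : onf X f -> X i -> nn (f i) = 1.
Proof. by move=> h Xi; rewrite /sqn h // eqxx Re1. Qed.

Definition fsum f s x := \sum_(j <- s) ip x (f j) *: f j.

Lemma fsum_ip X f s x i : onf X f -> seq_in X s -> X i ->
  ip (fsum f s x) (f i) = (i \in s)%:R * ip x (f i).
Proof.
move=> of_ [us sX] Xi; elim: s us sX => [|a s IH] /=.
  by rewrite /fsum big_nil ip0l mul0r.
move=> /andP[as_ us] sX; rewrite /fsum big_cons ipDl -/(fsum f s x) IH //; last first.
  by move=> j js; apply: sX; rewrite inE js orbT.
rewrite ipZl of_ //; last by apply: sX; rewrite inE eqxx.
rewrite inE eq_sym; case: (eqVneq i a) => [->|_] /=.
  by rewrite mulr1 (negbTE as_) mul0r addr0 mul1r.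
by rewrite mulr0 add0r.
Qed.

Lemma nn_fsum X f s x : onf X f -> seq_in X s ->
  nn (x - fsum f s x) = nn x - \sum_(j <- s) ab2 (ip x (f j)).
Proof.
move=> of_ [us sX]; elim: s us sX => [|a s IH] /=.
  by rewrite /fsum !big_nil !subr0.
move=> /andP[as_ us] sX; have sX' j : j \in s -> X j.
  by move=> js; apply: sX; rewrite inE js orbT.
have Xa : X a by apply: sX; rewrite inE eqxx.
have := IH us sX'; rewrite /fsum !big_cons -/(fsum f s x) => IH'.
rewrite [_ + fsum f s x]addrC opprD addrA nnB IH' // nnZ (onf_nn of_ Xa).
have -> : rp (x - fsum f s x) (ip x (f a) *: f a) = ab2 (ip x (f a)).
  rewrite /rip ipZr ipBl (fsum_ip x of_ (conj us sX') Xa) (negbTE as_) mul0r subr0.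
  by rewrite mulrC mulJ_ab2 ReR.
ring.
Qed.

Lemma bessel X f s x : onf X f -> seq_in X s ->
  \sum_(j <- s) ab2 (ip x (f j)) <= nn x.
Proof.
by move=> of_ sX; have := nn_ge0 Hip (x - fsum f s x); rewrite (nn_fsum x of_ sX) subr_ge0.
Qed.

Lemma fsum_complete X f s V x : onf X f -> seq_in X s -> subsp V ->
  (forall j, j \in s -> V (f j)) ->
  (forall v, V v -> (forall j, j \in s -> ip v (f j) = 0) -> v = 0) ->
  V x -> fsum f s x = x.
Proof.
move=> of_ sX sV Vf cf Vx; apply/eqP; rewrite eq_sym -subr_eq0; apply/eqP; apply: cf.
  apply: subspB => //; rewrite /fsum big_seq; apply: subsp_sum => // j js.
  by apply: subspZ => //; exact: Vf.
move=> j js; rewrite ipBl (fsum_ip x of_ sX); last exact: sX.2.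
by rewrite js mul1r subrr.
Qed.

Lemma onf_findim X f V : subsp V -> onf X f -> (forall j, X j -> V (f j)) -> findim ip V ->
  finite_set X.
Proof.
move=> sV of_ Vf [N [F hF]]; apply: contrapT => iX.
have [g [ig Xg]] := infinite_seq iX.
have /(not_findimP Hip sV) : dim_infinite V; last by apply; exists N, F.
move=> n; apply: (@orthn_dim_ge _ _ ip V n (f \o g)) => [i j _ _|i _] /=.
  by rewrite of_ // (inj_eq ig).
exact: Vf.
Qed.

End Families.

(** * Discreteness of the spectrum below the essential spectrum *)

Section LowEnd.
Context {R : realType} {H : completeNormedModType R[i]}.
Variable ip : {dot H for Num.conj}.
Hypothesis Hip : inner_product_norm ip.
Implicit Types (x y z v : H) (B C D : set R).

Local Notation nn := (sqn ip).
Local Notation rp := (rip ip).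
Local Notation nn_ge0 := (nn_ge0 Hip).
Local Notation spr := (spr ip).

Variable p : @pair R H.
Hypothesis gp : good ip p.
Local Notation S := (space p).
Local Notation A := (op p).
Local Notation P := (sm ip p).

Let hA : bsa ip A. Proof. by case: gp. Qed.
Let hP : smeas ip A S P. Proof. by case: gp. Qed.
Lemma rp_bound : exists2 M : R, 0 <= M & forall x, `|rp (A x) x| <= M * nn x.
Proof.
have [_ _ [M [M0 bA]]] := hA; exists (M + 1); first by rewrite addr_ge0.
move=> x; have h := CSr Hip (A x) x; have := bA x; have := nn_ge0 x => x0 b.
have h2 : rp (A x) x ^+ 2 <= ((M + 1) * nn x) ^+ 2.
  apply: le_trans h _; rewrite expr2; apply: le_trans (ler_wpM2r x0 b) _.
  by have := mulr_ge0 x0 x0; nra.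
rewrite -(@ler_pXn2r _ 2) ?nnegrE ?real_normK ?num_real //.
by rewrite mulr_ge0 // addr_ge0.
Qed.

Lemma spr_low0 : exists a : R, forall x, P `]-oo, a] x = 0.
Proof.
have [M M0 hM] := rp_bound; exists (- M - 1) => x.
have mB : measurable (`]-oo, (- M - 1)] : set R) by exact: measurable_itv.
apply: (nn_eq0 Hip); apply/eqP; rewrite eq_le nn_ge0 andbT.
have h : rp (A (P `]-oo, (- M - 1)] x)) (P `]-oo, (- M - 1)] x) <= (- M - 1) * nn (P `]-oo, (- M - 1)] x).
  by apply: (spr_le Hip gp mB) => [t|]; [rewrite /= in_itv|exact: spr_sm].
by have := hM (P `]-oo, (- M - 1)] x); rewrite ler_norml => /andP[]; lra.
Qed.

Lemma not_essP l : ~ ess ip p l ->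
  exists2 e : R, 0 < e & findim ip (spr p `]l - e, l + e[).
Proof.
move=> h; apply: contrapT => h'; apply: h => e e0.
have mB : measurable (`]l - e, l + e[ : set R) by exact: measurable_itv.
apply/(not_findimP Hip (spr_subsp Hip gp mB)) => f.
by apply: h'; exists e.
Qed.

(** Compactness by a supremum: let T collect the t for which [[a, t]] has finite rank. The supremum
    of T is not essential, so a neighbourhood of finite rank extends the interval past it unless it
    is already b. *)
Lemma findim_itv (a b : R) : (forall l, a <= l <= b -> ~ ess ip p l) ->
  findim ip (spr p `[a, b]).
Proof.
move=> hn; case: (leP a b) => [ab|ba]; last first.
  exists 0%N, (fun=> 0) => v hv _.
  have e : `[a, b]%classic = set0 :> set R.
    by apply/seteqP; split=> t //=; rewrite in_itv /= => /andP[h1 h2]; have := lt_le_trans ba (le_trans h1 h2); rewrite ltxx.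
  by move: hv; rewrite e => -[y _ <-]; exact: (sm_0 Hip hP).
have mI (s t : R) : measurable (`[s, t] : set R) by exact: measurable_itv.
have mO (s t : R) : measurable (`]s, t[ : set R) by exact: measurable_itv.
pose T := [set t | a <= t <= b /\ findim ip (spr p `[a, t])].
have Ta : T a.
  split; first by rewrite lexx.
  have [|e e0 fe] := @not_essP a; first by apply: hn; rewrite lexx.
  apply: findim_spr_sub fe => // t /=; rewrite !in_itv /= => /andP[h1 h2].
  by apply/andP; split; lra.
have uT : has_sup T by split; [exists a|exists b => t [/andP[]]].
have sb : sup T <= b by apply: ge_sup; [exists a|move=> t [/andP[]]].
have as_ : a <= sup T by apply: (ub_le_sup uT.2).
have [|e e0 fe] := @not_essP (sup T); first by apply: hn; rewrite as_.
have [t [Tab ft] st] := sup_adherent e0 uT.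
case/andP: Tab => at_ tb.
pose t' := Num.min (sup T + e / 2) b.
have t'e : t' <= sup T + e / 2 by rewrite ge_min lexx.
have Tt' : T t'.
  split; first by rewrite ge_min lexx orbT andbT le_min ab andbT; lra.
  apply: findim_spr_sub (findim_spr_U Hip gp (mI _ _) (mO _ _) ft fe) => //.
    exact: measurableU.
  move=> s /=; rewrite !in_itv /= => /andP[h1 h2].
  case: (leP s t) => hs; [left; rewrite h1|right]; lra.
have := ub_le_sup uT.2 Tt'; rewrite /t' ge_min => /orP[h|bs]; first by exfalso; lra.
suff <- : t' = b by case: Tt'.
by rewrite /t'; apply/min_idPr; lra.
Qed.

Hypothesis noness : forall l : R, l < 0 -> ~ ess ip p l.

Lemma findim_low (a : R) : a < 0 -> findim ip (spr p `]-oo, a]).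
Proof.
move=> a0; have [b hb] := spr_low0.
have mL (t : R) : measurable (`]-oo, t] : set R) by exact: measurable_itv.
have f1 : findim ip (spr p `]-oo, b]).
  by exists 0%N, (fun=> 0) => v [y _ <-] _.
have f2 : findim ip (spr p `[b, a]).
  by apply: findim_itv => l /andP[_ la]; apply: noness; exact: le_lt_trans a0.
apply: findim_spr_sub (findim_spr_U Hip gp _ _ f1 f2) => //.
  exact: measurableU.
move=> t /=; rewrite !in_itv /= => ta.
by case: (leP t b) => h; [left|right; rewrite ltW].
Qed.

(** The punctured neighbourhoods of s decrease to the empty set inside a half-line of finite rank,
    so by [findim_shrink] one of them carries nothing. *)
Lemma isolated_low (s : R) : s < 0 -> exists2 e : R, 0 < e &
  forall B, measurable B -> B `<=` `]s - e, s + e[ `\ s -> forall x, P B x = 0.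
Proof.
move=> s0; pose D (n : nat) : set R := `]s - n.+1%:R^-1, s + n.+1%:R^-1[ `\ s.
have mD n : measurable (D n) by apply: measurableD => //; exact: measurable_set1.
have mI : measurable (`]-oo, s / 2] : set R) by exact: measurable_itv.
have h2 : s / 2 < 0 by lra.
have h3 : forall n : nat, 0 < n.+1%:R^-1 :> R by move=> n; rewrite invr_gt0.
have [||n hn] := findim_shrink Hip gp mI mD _ _ (findim_low h2).
- move=> n t [] /=; rewrite !in_itv /= => /andP[h4 h5] h; split => //=.
  have h6 : n.+2%:R^-1 <= n.+1%:R^-1 :> R.
    by rewrite lef_pV2 ?posrE ?ltr0n // ler_nat.
  rewrite in_itv /=; move: (n.+1%:R^-1) (n.+2%:R^-1) h4 h5 h6 => u w; lra.
- rewrite -subset0 => t h; have [_ ts] := h 0%N Logic.I.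
  have d0 : 0 < `|t - s| by rewrite normr_gt0 subr_eq0; exact/eqP.
  have [N _ hN] := near_infty_natSinv_lt (PosNum d0).
  have := hN N (leqnn _) => /=.
  have [] := h N Logic.I; rewrite /= in_itv /= => hh _.
  have : `|t - s| < N.+1%:R^-1 by rewrite ltr_norml; move: (N.+1%:R^-1) hh => r; lra.
  by move=> h' /(lt_trans h'); rewrite ltxx.
(* The second bound keeps the neighbourhood inside []-oo, s / 2]]. *)
exists (Num.min n.+1%:R^-1 (- s / 2)).
  by rewrite lt_min h3 /=; lra.
move=> B mB BD x.
have mID : measurable (`]-oo, s / 2] `&` D n) by exact: measurableI.
rewrite -(sm_sub' hP x mB mID) ?hn ?(lin0 (sm_lin hP mB)) //.
move=> t /BD [] /=; rewrite !in_itv /= => /andP[h4 h5] ts.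
have h6 : Num.min n.+1%:R^-1 (- s / 2) <= n.+1%:R^-1 by rewrite ge_min lexx.
have h7 : Num.min n.+1%:R^-1 (- s / 2) <= - s / 2 by rewrite ge_min lexx orbT.
split; first by move: (Num.min _ _) h5 h7 => m *; lra.
split => //=; rewrite in_itv /=.
by move: (n.+1%:R^-1) (Num.min _ _) h4 h5 h6 => r m h4 h5 h6; apply/andP; split; lra.
Qed.

(** The infimum of the t for which x has a part in []-oo, t]] is isolated, hence an atom for x. This
    is what makes the eigenvectors complete below the essential spectrum. *)
Lemma lowest_point (a : R) x : a < 0 -> P `]-oo, a] x <> 0 ->
  exists2 s, s <= a & P [set s] x <> 0.
Proof.
move=> a0 Pa.
have mL (t : R) : measurable (`]-oo, t] : set R) by exact: measurable_itv.
pose T := [set t : R | P `]-oo, t] x <> 0].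
have Tmono s t : s <= t -> P `]-oo, t] x = 0 -> P `]-oo, s] x = 0.
  move=> st h; rewrite -(sm_sub' hP x (mL s) (mL t)) ?h ?(lin0 (sm_lin hP _)) //.
  by move=> u /=; rewrite !in_itv /= => /le_trans; exact.
have [b hb] := spr_low0.
have iT : has_inf T.
  split; first by exists a.
  exists b => t Tt; rewrite leNgt; apply/negP => tb; apply: Tt.
  by apply: Tmono (hb x); exact: ltW.
have sa : inf T <= a by apply: (ge_inf iT.2).
have [e e0 he] := isolated_low (le_lt_trans sa a0).
exists (inf T) => // z.
have [t Tt tT] := inf_adherent e0 iT.
have l0 : P `]-oo, (inf T - e / 2)] x = 0.
  by apply: contrapT => h; have := ge_inf iT.2 h; lra.
have Tt' : inf T - e / 2 < t by have := ge_inf iT.2 Tt; lra.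
apply: Tt.
have e1 : `]-oo, t]%classic = `]-oo, (inf T - e / 2)]%classic `|` `](inf T - e / 2), t]%classic.
  by rewrite -itv_bndbnd_setU // bnd_simp ltW.
have mJ : measurable (`](inf T - e / 2), t] : set R) by exact: measurable_itv.
have m1 : measurable ([set inf T] : set R) by exact: measurable_set1.
rewrite e1 (sm_U Hip hP) //; last first.
  rewrite -subset0 => u /= []; rewrite !in_itv /= => h /andP[h' _].
  by have := le_lt_trans h h'; rewrite ltxx.
rewrite l0 add0r.
have -> : `](inf T - e / 2), t]%classic = (`](inf T - e / 2), t]%classic `&` [set inf T]) `|` (`](inf T - e / 2), t]%classic `\ inf T).
  by rewrite -{1}(setUIDK `](inf T - e / 2), t]%classic [set inf T]) setUC.
have mI1 : measurable (`](inf T - e / 2), t]%classic `&` [set inf T]) by exact: measurableI.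
have mD1 : measurable (`](inf T - e / 2), t]%classic `\ inf T) by exact: measurableD.
rewrite (sm_U Hip hP) //; last by rewrite -subset0 => u [[_ h] [_ h']].
rewrite (sm_I hP) // z (lin0 (sm_lin hP _)) // add0r.
apply: he => // u [] /=; rewrite !in_itv /= => /andP[h1 h2] h3; split => //=.
by apply/andP; split; lra.
Qed.

End LowEnd.

(** * Eigenvalues below the essential spectrum *)

Section EigenFamily.
Context {R : realType} {H : completeNormedModType R[i]}.
Variable ip : {dot H for Num.conj}.
Hypothesis Hip : inner_product_norm ip.
Implicit Types (x y z v : H) (B C D : set R).

Local Notation nn := (sqn ip).
Local Notation rp := (rip ip).
Local Notation nn_ge0 := (nn_ge0 Hip).
Local Notation spr := (spr ip).

(** Total excess of the eigenvalues below a, as a real number; it is finite for a < 0 once nothing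
    essential lies below 0 ([lower_excess_lam]). *)
Definition lam (p : @pair R H) (a : R) : R := fine (lower_excess (eig_index p) fst a).

(* The quadratic form of the negative part of [op p - a]. *)
Definition negform (p : @pair R H) (a : R) x : R :=
  a * nn (sm ip p `]-oo, a] x) - rp (op p (sm ip p `]-oo, a] x)) (sm ip p `]-oo, a] x).

Variable p : @pair R H.
Hypothesis gp : good ip p.
Local Notation S := (space p).
Local Notation A := (op p).
Local Notation P := (sm ip p).

Let hA : bsa ip A. Proof. by case: gp. Qed.
Let hP : smeas ip A S P. Proof. by case: gp. Qed.
Let lA : linear A. Proof. by case: hA. Qed.
Let mL (t : R) : measurable (`]-oo, t] : set R). Proof. exact: measurable_itv. Qed.
Let m1 (t : R) : measurable ([set t] : set R). Proof. exact: measurable_set1. Qed.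

Lemma negform_ge (a : R) x : S x -> a * nn x - rp (A x) x <= negform p a x.
Proof.
move=> Sx; rewrite /negform (spr_rp_split Hip gp (mL a) Sx) (spr_nn_split Hip gp (mL a) Sx).
have : a * nn (P (~` `]-oo, a]) x) <= rp (A (P (~` `]-oo, a]) x)) (P (~` `]-oo, a]) x).
  apply: (@spr_ge _ _ ip Hip p gp (~` `]-oo, a])) => [|t|]; [exact: measurableC| |exact: spr_sm].
  by rewrite /= in_itv /= => /negP; rewrite -ltNge => /ltW.
by move: (nn _) (nn _) (rp _ _) (rp _ _) => *; lra.
Qed.

Lemma negform_ge0 (a : R) x : 0 <= negform p a x.
Proof.
by rewrite subr_ge0; apply: (spr_le Hip gp (mL a)) => [t|]; [rewrite /= in_itv|exact: spr_sm].
Qed.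

Lemma negform_mono (a b : R) x : a <= b -> negform p a x <= negform p b x.
Proof.
move=> ab; have e : P `]-oo, a] x = P `]-oo, a] (P `]-oo, b] x).
  by rewrite (sm_sub' hP) // => t /=; rewrite !in_itv /= => /le_trans; exact.
have Sy : S (P `]-oo, b] x) by exact: (sm_in hP).
have := negform_ge0 b (P (~` `]-oo, a]) (P `]-oo, b] x)).
rewrite /negform e; set y := P `]-oo, b] x in Sy *.
have mC : measurable (~` `]-oo, a] : set R) by exact: measurableC.
have -> : P `]-oo, b] (P (~` `]-oo, a]) y) = P (~` `]-oo, a]) y.
  by rewrite (sm_comm hP) // /y (sm_idem hP).
rewrite (spr_rp_split Hip gp (mL a) Sy) (spr_nn_split Hip gp (mL a) Sy).
have := nn_ge0 (P `]-oo, a] y).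
by move: (nn _) (nn _) (rp _ _) (rp _ _) => *; nra.
Qed.

Lemma negform_gt0 x : spr p `]-oo, 0[ x -> x <> 0 ->
  exists2 a, a < 0 & 0 < negform p a x.
Proof.
move=> hx x0; have m0 : measurable (`]-oo, 0[ : set R) by exact: measurable_itv.
have [n hn] : exists n : nat, P `]-oo, 0 - n.+1%:R^-1] x <> 0.
  apply: contrapT => hn; apply: x0; rewrite -((sprP gp _ m0).1 hx) lray_bigcup.
  apply: (sm_bigcup0 Hip hP) => n; first exact: measurable_itv.
  by apply: contrapT => h; apply: hn; exists n.
have h4 : 0 < n.+1%:R^-1 :> R by rewrite invr_gt0.
move: (n.+1%:R^-1) h4 hn => r r0; rewrite sub0r => hn.
(* At a = -r / 2 the nonzero part of x in []-oo, -r]] contributes at least r / 2 times its squared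
   norm. *)
exists (- (r / 2)); first by lra.
have e : P `]-oo, (- r)] x = P `]-oo, (- r)] (P `]-oo, (- (r / 2))] x).
  rewrite (sm_sub' hP) // => t /=; rewrite !in_itv /=; lra.
rewrite /negform; set y := P `]-oo, (- (r / 2))] x.
have Sy : S y by exact: (sm_in hP).
have h1 : 0 < nn (P `]-oo, (- r)] y) by apply: nn_gt0 => //; rewrite -e.
rewrite (spr_rp_split Hip gp (mL (- r)) Sy) (spr_nn_split Hip gp (mL (- r)) Sy).
have h2 : rp (A (P `]-oo, (- r)] y)) (P `]-oo, (- r)] y) <= - r * nn (P `]-oo, (- r)] y).
  by apply: (spr_le Hip gp (mL _)) => [t|]; [rewrite /= in_itv|exact: spr_sm].
have h3 : rp (A (P (~` `]-oo, (- r)]) y)) (P (~` `]-oo, (- r)]) y) <= - (r / 2) * nn (P (~` `]-oo, (- r)]) y).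
  apply: (spr_le Hip gp (mL (- (r / 2)))) => [t|]; first by rewrite /= in_itv.
  apply/(sprP gp) => //; rewrite (sm_comm hP) //; last exact: measurableC.
  by rewrite /y (sm_idem hP).
by move: (nn _) (nn _) (rp _ _) (rp _ _) h1 h2 h3 => *; nra.
Qed.

Hypothesis noness : forall l : R, l < 0 -> ~ ess ip p l.

Definition eigneg : set (R * nat) := [set j | eig_index p j /\ j.1 < 0].
Definition eigle (a : R) : set (R * nat) := [set j | eig_index p j /\ j.1 <= a].

(** Orthonormal bases of the eigenspaces, whose lengths match [eig_index] because (t, k) is listed
    exactly for k below the dimension. A vector of []-oo, a]] orthogonal to all of them has no
    lowest spectral point and vanishes. *)
Lemma eigen_family : exists f : R * nat -> H,
  [/\ forall j, eigneg j -> spr p [set j.1] (f j),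
      onf ip eigneg f &
      forall a, a < 0 -> forall x, spr p `]-oo, a] x ->
        (forall j, eigle a j -> ip x (f j) = 0) -> x = 0].
Proof.
have /choice[u hu] : forall t, exists u : nat -> H, t < 0 ->
    [/\ forall k, eig_index p (t, k) -> spr p [set t] (u k),
        forall k l, eig_index p (t, k) -> eig_index p (t, l) -> ip (u k) (u l) = (k == l)%:R &
        forall x, spr p [set t] x -> (forall k, eig_index p (t, k) -> ip x (u k) = 0) -> x = 0].
  move=> t; have [t0|nt0] := pselect (t < 0); last by exists (fun=> 0) => /nt0.
  have ft : findim ip (spr p [set t]).
    apply: (findim_spr_sub gp (m1 t) (mL t) _ (findim_low Hip gp noness t0)).
    by move=> s /= ->; rewrite in_itv /=.
  have [n [u [ou Vu cu du]]] := findim_basis Hip (spr_subsp Hip gp (m1 t)) ft.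
  have he k : eig_index p (t, k) <-> (k < n)%N.
    by rewrite /eig_index /= (spr_eigenspace Hip gp); exact: du.
  exists u => _; split.
  - by move=> k /he /Vu.
  - by move=> k l /he kn /he ln; rewrite ou.
  - by move=> x hx h; apply: cu => // i /he; exact: h.
exists (fun j => u j.1 j.2); split.
- by move=> [t k] [ej t0]; have [h _ _] := hu t t0; exact: h.
- move=> [t k] [s l] [/= ej t0] [/= el s0].
  have [h1 h2 _] := hu t t0; have [h3 _ _] := hu s s0.
  have [est|/eqP ts] := eqVneq t s.
    by rewrite -est in el *; rewrite h2 // xpair_eqE eqxx.
  rewrite xpair_eqE (introF eqP ts) /=.
  apply: (spr_perp Hip gp (m1 t) (m1 s)); [|exact: h1|exact: h3].
  by rewrite -subset0 => r /= [-> ].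
- move=> a a0 x hx h; apply: contrapT => x0.
  have [|s sa Ps] := @lowest_point _ _ ip Hip p gp noness a x a0.
    by rewrite ((sprP gp x (mL a)).1 hx).
  have [_ _ h3] := hu s (le_lt_trans sa a0).
  apply: Ps; apply: h3 => [|k ek]; first exact: spr_sm.
  have [h1 _ _] := hu s (le_lt_trans sa a0).
  have := (sprP gp _ (m1 s)).1 (h1 k ek).
  by rewrite (sm_sa hP (m1 s)) => ->; exact: (h (s, k)).
Qed.

Section WithFamily.
Variable f : R * nat -> H.
Hypothesis f_spr : forall j, eigneg j -> spr p [set j.1] (f j).
Hypothesis f_on : onf ip eigneg f.
Hypothesis f_complete : forall a, a < 0 -> forall x, spr p `]-oo, a] x ->
  (forall j, eigle a j -> ip x (f j) = 0) -> x = 0.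

Lemma eigle_neg a j : a < 0 -> eigle a j -> eigneg j.
Proof. by move=> a0 [h ja]; split=> //; exact: le_lt_trans a0. Qed.

Lemma f_sprle a j : a < 0 -> eigle a j -> spr p `]-oo, a] (f j).
Proof.
move=> a0 ej; apply: (spr_sub gp (m1 j.1)) (f_spr (eigle_neg a0 ej)) => //.
by move=> t /= ->; rewrite in_itv /=; case: ej.
Qed.

Lemma f_eigen j : eigneg j -> A (f j) = (j.1)%:C *: f j.
Proof. by move=> /f_spr /(spr_set1 Hip gp)[]. Qed.

Lemma eigle_seq (a : R) : a < 0 ->
  exists s, uniq s /\ forall j, eigle a j <-> j \in s.
Proof.
move=> a0; have fX : finite_set (eigle a).
  apply: (@onf_findim _ _ _ ip Hip _ f (spr p `]-oo, a])).
  - exact: spr_subsp.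
  - by move=> i j hi hj; apply: f_on; exact: (eigle_neg a0).
  - by move=> j; exact: f_sprle.
  - exact: findim_low.
have [s sX] := (finite_seqP _).1 fX.
exists (undup s); split; first exact: undup_uniq.
by move=> j; rewrite mem_undup sX.
Qed.

Lemma lamE (a : R) s : uniq s -> (forall j, eigle a j <-> j \in s) ->
  lower_excess (eig_index p) fst a = (\sum_(j <- s) (a - j.1))%:E.
Proof. by move=> us hs; apply: esum_seqE => // j []; rewrite subr_ge0. Qed.

Lemma lam_fin (a : R) : a < 0 ->
  lower_excess (eig_index p) fst a = (lam p a)%:E.
Proof. by move=> /eigle_seq[s [us hs]]; rewrite /lam (lamE us hs). Qed.

Lemma low_expand (a : R) s x : a < 0 -> uniq s -> (forall j, eigle a j <-> j \in s) ->
  spr p `]-oo, a] x -> fsum ip f s x = x.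
Proof.
move=> a0 us hs hx.
apply: (fsum_complete (X := eigneg) (V := spr p `]-oo, a])) => //.
- by split => // j /hs; exact: (eigle_neg a0).
- exact: spr_subsp.
- by move=> j /hs; exact: f_sprle.
- by move=> v hv h; apply: (f_complete a0 hv) => j /hs; exact: h.
Qed.

Lemma negformE (a : R) s x : a < 0 -> uniq s -> (forall j, eigle a j <-> j \in s) ->
  negform p a x = \sum_(j <- s) (a - j.1) * ab2 (ip x (f j)).
Proof.
move=> a0 us hs; rewrite /negform; set y := P _ x.
have hy : spr p `]-oo, a] y by exact: spr_sm.
have sX : seq_in eigneg s by split => // j /hs; exact: (eigle_neg a0).
have e := low_expand a0 us hs hy.
have eip j : j \in s -> ip y (f j) = ip x (f j).
  move=> /hs /(f_sprle a0) /(sprP gp _ (mL a)) {2}<-.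
  by rewrite -(sm_sa hP).
have n : nn y = \sum_(j <- s) ab2 (ip x (f j)).
  have := nn_fsum y f_on sX; rewrite e subrr nn0 => /eqP.
  rewrite eq_sym subr_eq0 => /eqP ->; rewrite big_seq [RHS]big_seq.
  by apply: eq_bigr => j js; rewrite eip.
have q : rp (A y) y = \sum_(j <- s) j.1 * ab2 (ip x (f j)).
  rewrite -{1}e /fsum (lin_sum lA) /rip ip_suml Re_sum big_seq [RHS]big_seq.
  apply: eq_bigr => j js; rewrite (linZ lA) f_eigen; last exact: sX.2.
  rewrite scalerA ipZl [ip (f j) y]ipC mulrAC mulJ_ab2 eip // ReM !ReR ImR.
  by rewrite mul0r subr0 mulrC.
rewrite n q mulr_sumr -sumrB; apply: eq_bigr => j _; ring.
Qed.

(** The trace inequality. After exchanging the sums, the weights a - lambda_j are nonnegative, and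
    Bessel bounds the total overlap of each eigenvector with the orthonormal family by 1. *)
Lemma trace_bound (a : R) (K : choiceType) (X : set K) (e : K -> H) s : a < 0 ->
  onf ip X e -> (forall i, X i -> S (e i)) -> seq_in X s ->
  \sum_(i <- s) negform p a (e i) <= lam p a.
Proof.
move=> a0 oe Se sX; have [r [ur hr]] := eigle_seq a0.
have -> : lam p a = \sum_(j <- r) (a - j.1) by rewrite /lam (lamE ur hr).
under eq_bigr do rewrite (negformE _ a0 ur hr).
rewrite exchange_big /= big_seq [X in _ <= X]big_seq; apply: ler_sum => j jr.
have ej := (hr j).2 jr; have nj := eigle_neg a0 ej.
rewrite -mulr_sumr -[X in _ <= X]mulr1 ler_wpM2l //.
  by rewrite subr_ge0; case: ej.
rewrite -(onf_nn f_on nj); apply: le_trans (bessel Hip (f j) oe sX).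
apply: ler_sum => i _; by rewrite ipC ab2J.
Qed.

End WithFamily.

Lemma negform_trace (a : R) (K : choiceType) (X : set K) (e : K -> H) s : a < 0 ->
  onf ip X e -> (forall i, X i -> S (e i)) -> seq_in X s ->
  \sum_(i <- s) negform p a (e i) <= lam p a.
Proof. by have [f [h1 h2 h3]] := eigen_family; exact: trace_bound h1 h2 h3 _ _ _ _ _. Qed.

Lemma lower_excess_lam (a : R) : a < 0 ->
  lower_excess (eig_index p) fst a = (lam p a)%:E.
Proof. by have [f [h1 h2 h3]] := eigen_family; exact: (lam_fin h1 h2). Qed.

End EigenFamily.

(** * Prescribing diagonal entries *)

Section Rotations.
Context {R : realType} {H : completeNormedModType R[i]}.
Variable ip : {dot H for Num.conj}.
Hypothesis Hip : inner_product_norm ip.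
Implicit Types (x y z u v w : H).

Local Notation nn := (sqn ip).
Local Notation rp := (rip ip).
Local Notation nn_ge0 := (nn_ge0 Hip).
Local Notation orthn := (orthn ip).

Variable A : H -> H.
Hypotheses (lA : linear A) (sA : self_adjoint ip A).

Local Notation q x := (rp (A x) x).

Lemma q_comb (a b : R) x y : rp (A x) y = 0 ->
  q (a%:C *: x + b%:C *: y) = a ^+ 2 * q x + b ^+ 2 * q y.
Proof.
move=> h; rewrite (linD lA) !(linZ lA) rpDl !rpDr !rpZl !rpZr h.
rewrite [rp (A y) x]rpC -(rp_sa x y sA) h; ring.
Qed.

Lemma nn_comb (a b : R) x y : rp x y = 0 ->
  nn (a%:C *: x + b%:C *: y) = a ^+ 2 * nn x + b ^+ 2 * nn y.
Proof. by move=> h; rewrite nnD !nnZr rpZl rpZr h !mulr0 addr0. Qed.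

(** Makes the cross term of the form purely imaginary, so that on real combinations of x and t y the
    form has only its two diagonal contributions. *)
Lemma phase_orth x y : exists2 t : R[i], ab2 t = 1 & rp (A x) (t *: y) = 0.
Proof.
have [t [t1 [tI _]]] := phase_exists (ip (A x) y).
exists ((t * 'i)^*%C).
  rewrite ab2J ab2M t1 mul1r /ab2 /=; ring.
rewrite /rip ipZr conjcK -mulrA [_ * ip _ _]mulrC mulrA ReM tI /=; ring.
Qed.

Lemma phaseZ (t : R[i]) x : ab2 t = 1 -> q (t *: x) = q x /\ nn (t *: x) = nn x.
Proof.
move=> t1; rewrite nnZ t1 mul1r; split => //.
by rewrite (linZ lA) /rip ipZl ipZr mulrA mulJ_ab2 t1 mul1r.
Qed.

(** A plane rotation by the angle with squared sine s, after a phase change of w; the value at h is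
    forced by the trace. The last clause says that the part of y along w passes to g, up to the part
    of y along u; it measures progress in [absorb]. *)
Lemma rotation (s : R) u w : 0 <= s <= 1 -> nn u = 1 -> nn w = 1 -> ip u w = 0 ->
  exists g h, [/\ [/\ nn g = 1, nn h = 1 & ip g h = 0],
    q g = q u + s * (q w - q u), q h = q w - s * (q w - q u),
    forall V, subsp V -> V u -> V w -> V g /\ V h &
    forall y, s / 2 * ab2 (ip y w) <= ab2 (ip y g) + ab2 (ip y u)].
Proof.
move=> /andP[s0 s1] u1 w1 uw.
have [t t1 tq] := phase_orth u w.
have [qt nt] := phaseZ w t1.
have utw : ip u (t *: w) = 0 by rewrite ipZr uw mulr0.
have twu : ip (t *: w) u = 0 by exact: ip_eq0C.
have ab2w y : ab2 (ip y (t *: w)) = ab2 (ip y w) by rewrite ipZr ab2M ab2J t1 mul1r.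
have Vt V : subsp V -> V w -> V (t *: w) by move=> sV; exact: subspZ.
have [w' [e1 [e2 [e3 [e4 [e5 [e6 e7]]]]]]] : exists w', q w' = q w /\ nn w' = 1 /\ ip u w' = 0 /\
   ip w' u = 0 /\ (forall y, ab2 (ip y w') = ab2 (ip y w)) /\
   rp (A u) w' = 0 /\ forall V, subsp V -> V w -> V w'.
  by exists (t *: w); rewrite qt nt w1.
have e3' : rp u w' = 0 by rewrite /rip e3.
have sq0 : Num.sqrt s ^+ 2 = s by rewrite sqr_sqrtr.
have sq1 : Num.sqrt (1 - s) ^+ 2 = 1 - s by rewrite sqr_sqrtr // subr_ge0.
move: (Num.sqrt s) (Num.sqrt (1 - s)) sq0 sq1 => a b sa sb.
exists (b%:C *: u + a%:C *: w'), (a%:C *: u + (- b)%:C *: w'); split; first split.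
- by rewrite nn_comb // sa sb u1 e2; ring.
- by rewrite nn_comb // sqrrN sa sb u1 e2; ring.
- rewrite ipDl !ipDr !ipZl !ipZr e3 e4 !conjc_real !ipnn u1 e2.
  by apply: complexP => /=; ring.
- by rewrite q_comb // sa sb e1; ring.
- by rewrite q_comb // sqrrN sa sb e1; ring.
- move=> V sV Vu Vw; have Vw' := e7 V sV Vw.
  by split; apply: subspD => //; exact: subspZ.
move=> y; rewrite -e5 ipDr !ipZr !conjc_real.
set z := ip y w'; set r := ip y u.
have h := ab2D_le (b%:C * r + a%:C * z) (- (b%:C * r)).
have e : b%:C * r + a%:C * z + - (b%:C * r) = a%:C * z by rewrite addrAC subrr add0r.
rewrite e ab2N !ab2M !ab2R sa sb in h.
have := ab2_ge0 r; have := ab2_ge0 z; move: h.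
by move: (ab2 (_ + _)) (ab2 z) (ab2 r) => *; nra.
Qed.

Variable V : set H.
Hypothesis sV : subsp V.

Section Prescribe.
Variables (J : set nat) (tau : nat -> R).

Let Pn (n : nat) (U : nat -> H) :=
  [/\ orthn setT U, forall k, V (U k),
    forall s, seq_in [set i | J i /\ (n <= i)%N] s ->
      \sum_(k < size s) q (U k) <= \sum_(i <- s) tau i &
    forall i, J i -> (n <= i)%N -> forall N, exists2 k, (N <= k)%N & tau i <= q (U k)].

Let Qn (n : nat) (U U' : nat -> H) g :=
  (forall z, (forall k, ip z (U k) = 0) -> forall k, ip z (U' k) = 0) /\
  (J n -> [/\ V g, nn g = 1, q g = tau n, forall k, ip g (U' k) = 0 &
    forall z, (forall k, ip z (U k) = 0) -> ip z g = 0]).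

Let step n U : Pn n U -> exists U' g, Qn n U U' g /\ Pn n.+1 U'.
Proof.
move=> [oU VU hs hinf].
have hs' s : seq_in [set i | J i /\ (n.+1 <= i)%N] s -> seq_in [set i | J i /\ (n <= i)%N] s.
  by move=> [us sJ]; split => // i /sJ /= [Ji /ltnW].
have [Jn|nJ] := pselect (J n); last first.
  exists U, 0; split; first by split.
  split => // [s /hs'|i Ji ni]; first exact: hs.
  by apply: hinf => //; exact: ltnW.
set t := tau n.
have h0 : q (U 0%N) <= t.
  have := hs [:: n]; rewrite big_ord1 big_seq1; apply; split => // i.
  by rewrite inE => /eqP ->.
(* The partial-sum condition for the single target n gives q (U 0) <= t, so the least j with t <= q
   (U j.+1) satisfies q (U j) <= t as well. *)
have ex : exists k, t <= q (U k.+1).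
  have [k] := hinf n Jn (leqnn n) 1%N; case: k => // k _ hk; by exists k.
case: (ex_minnP ex) => j tj jmin.
have jt : q (U j) <= t.
  case: j tj jmin => [//|j] _ jmin; rewrite leNgt; apply/negP => /ltW /jmin.
  by rewrite ltnn.
pose s := (t - q (U j)) / (q (U j.+1) - q (U j)).
have se : s * (q (U j.+1) - q (U j)) = t - q (U j).
  have [e|ne] := eqVneq (q (U j.+1) - q (U j)) 0; last by rewrite divfK.
  by rewrite e mulr0; lra.
have s01 : 0 <= s <= 1.
  apply/andP; split; first by rewrite divr_ge0 // subr_ge0 // (le_trans jt).
  have [e|ne] := eqVneq (q (U j.+1) - q (U j)) 0.
    by rewrite /s e invr0 mulr0.
  by rewrite ler_pdivrMr ?mul1r; [lra|rewrite lt_def ne subr_ge0 (le_trans jt)].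
have [|||g [h [[g1 h1 gh] qg qh Vgh _]]] := @rotation s (U j) (U j.+1) s01.
- by rewrite /sqn oU // eqxx.
- by rewrite /sqn oU // eqxx.
- by rewrite oU // ltn_eqF.
have [Vg Vh] := Vgh V sV (VU j) (VU j.+1).
have span z : (forall k, ip z (U k) = 0) -> ip z g = 0 /\ ip z h = 0.
  move=> hz; have [] := Vgh (fun x => ip z x = 0) => //.
  split; first by rewrite ip0r.
  by move=> c x y zx zy; rewrite ipDr ipZr zx zy mulr0 addr0.
have spanj z : ip z (U j) = 0 -> ip z (U j.+1) = 0 -> ip z g = 0 /\ ip z h = 0.
  move=> hz hz'; have [] := Vgh (fun x => ip z x = 0) => //.
  split; first by rewrite ip0r.
  by move=> c x y zx zy; rewrite ipDr ipZr zx zy mulr0 addr0.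
(* U j and U j.+1 are replaced by the single vector h. Beyond position j a partial sum of new values
   is the next partial sum of old values minus the target, so the old condition for s with n added
   is the new condition for s. *)
pose U' k := if (k < j)%N then U k else if k == j then h else U k.+1.
have Ug k : ip g (U' k) = 0.
  rewrite /U'; case: ltnP => [kj|jk].
    apply: ip_eq0C; have [] // := spanj (U k); rewrite oU //.
      by rewrite (ltn_eqF kj).
    by rewrite ltn_eqF // ltnW.
  case: eqP => [//|/eqP kj].
  apply: ip_eq0C; have [] // := spanj (U k.+1); rewrite oU //.
    by rewrite gtn_eqF // ltnS.
  by rewrite eqSS (negbTE kj).
have qg' : q g = t by rewrite qg se; ring.
have qh' : q h = q (U j) + q (U j.+1) - t by rewrite qh se; ring.
exists U', g; split.
  split=> [z hz k|_]; last by split => // z /span[].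
  by rewrite /U'; case: ifP => // _; case: ifP => // _; case: (span z hz).
split.
- have Uh k : (k < j)%N || (j.+1 < k)%N -> ip (U k) h = 0.
    move=> hk; have [] // := spanj (U k); rewrite oU //.
      by case/orP: hk => hk; rewrite ?(ltn_eqF hk) // gtn_eqF // ltnW.
    by case/orP: hk => hk; rewrite ?(gtn_eqF hk) // ltn_eqF // ltnW.
  move=> k l _ _; rewrite /U'.
  case: (ltngtP k j) => kj; case: (ltngtP l j) => lj; rewrite ?oU //.
  + by rewrite (ltn_eqF (leq_trans kj (leq_trans (ltnW lj) (leqnSn l)))) (ltn_eqF (ltn_trans kj lj)).
  + by rewrite lj (ltn_eqF kj) Uh // kj.
  + by rewrite gtn_eqF ?(gtn_eqF (ltn_trans lj kj)) // (ltn_trans lj (ltn_trans kj _)).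
  + by rewrite lj (gtn_eqF kj) Uh // ltnS kj orbT.
  + by rewrite kj (gtn_eqF lj); apply: ip_eq0C; rewrite Uh // lj.
  + by rewrite kj (ltn_eqF lj); apply: ip_eq0C; rewrite Uh // ltnS lj orbT.
  + by rewrite kj lj eqxx ipnn h1.
- by move=> k; rewrite /U'; do 2!case: ifP => // _.
- have S' N : \sum_(k < N) q (U' k) =
      if (N <= j)%N then \sum_(k < N) q (U k) else \sum_(k < N.+1) q (U k) - t.
    elim: N => [|N IH]; first by rewrite !big_ord0.
    rewrite big_ord_recr /= IH /U'; case: (ltngtP N j) => Nj.
    + by rewrite [in RHS]big_ord_recr.
    + by rewrite [in RHS]big_ord_recr /=; ring.
    + by rewrite Nj !big_ord_recr /= qh'; ring.
  move=> r hr; have [ur rJ] := hr; rewrite S'; case: ifP => _; first exact/hs/hs'.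
  have := hs (n :: r); rewrite big_cons /= => h'.
  rewrite lerBlDl; apply: h'; split => [/=|i].
    by rewrite ur andbT; apply/negP => /rJ[_]; rewrite ltnn.
  by rewrite inE => /orP[/eqP ->|/rJ[Ji /ltnW]].
- move=> i Ji ni N; have [k] := hinf i Ji (ltnW ni) (maxn N j).+2.
  case: k => // k; rewrite ltnS => hk tk; exists k.
    by rewrite (leq_trans _ hk) // ltnW // ltnS leq_maxl.
  have kj : (j < k)%N by rewrite (leq_trans _ hk) // ltnS leq_maxr.
  by rewrite /U' ltnNge (ltnW kj) /= (gtn_eqF kj).
Qed.

(* Prescribing values one at a time: rotating the two consecutive vectors
   whose values enclose the target keeps the partial-sum conditions for the
   remaining targets. *)
Lemma prescribe_values (f : nat -> H) :
  orthn setT f -> (forall k, V (f k)) ->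
  (forall s, seq_in J s -> \sum_(k < size s) q (f k) <= \sum_(i <- s) tau i) ->
  (forall i, J i -> forall N, exists2 k, (N <= k)%N & tau i <= q (f k)) ->
  exists g, orthn J g /\ forall i, J i -> V (g i) /\ q (g i) = tau i.
Proof.
move=> of_ Vf hs hinf.
have [||u [_ hP hQ]] := @state_rec ((nat -> H) * H) (fun n X => Pn n X.1)
   (fun n X Y => Qn n X.1 Y.1 Y.2) (f, 0).
- split => //= [s [us sJ]|i Ji _]; last exact: hinf.
  by apply: hs; split => // i /sJ[].
- by move=> n [U g0] /= /step[U' [g [h1 h2]]]; exists (U', g).
exists (fun i => (u i.+1).2); split; last first.
  by move=> i Ji; have [_ /(_ Ji)[]] := hQ i.
have key i j : J i -> J j -> (i < j)%N -> ip (u i.+1).2 (u j.+1).2 = 0.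
  move=> Ji Jj ij; have [_ /(_ Ji)[_ _ _ hk _]] := hQ i.
  have {}hk k : ip (u i.+1).2 ((u j).1 k) = 0.
    move/subnK: ij => <-; elim: (j - i.+1)%N k => [//|l IH] k.
    by rewrite addSn; have [h _] := hQ (l + i.+1)%N; exact: h.
  by have [_ /(_ Jj)[_ _ _ _]] := hQ j; exact.
move=> i j Ji Jj; case: (ltngtP i j) => ij; first exact: key.
  by apply: ip_eq0C; exact: key.
by rewrite ij ipnn; have [_ /(_ Jj)[_ -> _ _ _]] := hQ j.
Qed.

End Prescribe.
End Rotations.

(** The divergent series is cut into blocks of sum at least 1, and block n is served to the target
    [logn 2 n.+1]. Every 2-adic valuation occurs infinitely often, so each target receives a
    divergent subseries. *)
Lemma block_schedule {R : realType} (r : nat -> R) : (forall n, 0 <= r n) ->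
  (forall B N : nat, exists N', B%:R <= \sum_(N <= l < N') r l) ->
  exists j : nat -> nat, forall k (B N : nat), exists N',
    B%:R <= \sum_(N <= l < N' | j l == k) r l.
Proof.
move=> r0 div.
have [||b [b0 _ hb]] := @state_rec nat (fun _ _ => True)
    (fun n x y => (x < y)%N /\ 1 <= \sum_(x <= l < y) r l) 0%N; first by [].
  move=> n x _; have [N' hN'] := div 1%N x; exists N' => //; split => //.
  rewrite ltnNge; apply/negP => h; move: hN'; rewrite big_geq // => h1.
  by have := lt_le_trans ltr01 h1; rewrite ltxx.
have bS n : (b n < b n.+1)%N by have [] := hb n.
have bmono m n : (m <= n)%N -> (b m <= b n)%N.
  move/subnK <-; elim: (n - m)%N => [//|i IH]; rewrite addSn.
  by apply: leq_trans IH (ltnW (bS _)).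
have bge n : (n <= b n)%N by elim: n => [//|n IH]; exact: leq_ltn_trans IH (bS n).
have ex l : exists n, (l < b n.+1)%N by exists l; exact: bge.
pose blk l := ex_minn (ex l).
have blkE n l : (b n <= l)%N -> (l < b n.+1)%N -> blk l = n.
  move=> h1 h2; rewrite /blk; case: ex_minnP => m hm /(_ n h2) mn.
  apply/eqP; rewrite eqn_leq mn /= leqNgt; apply/negP => /bmono h.
  by have := leq_trans hm (leq_trans h h1); rewrite ltnn.
exists (fun l => logn 2 (blk l).+1) => k B N.
have blk_sum n : logn 2 n.+1 = k -> 1 <= \sum_(b n <= l < b n.+1 | logn 2 (blk l).+1 == k) r l.
  move=> e; have [_ h] := hb n; apply: le_trans h _.
  rewrite [X in _ <= X]big_mkcond [X in X <= _]big_nat_cond [X in _ <= X]big_nat_cond.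
  by apply: ler_sum => l /andP[/andP[h1 h2] _]; rewrite (blkE n) // e eqxx.
(* The number 2^k (2 M + 1) has valuation k and exceeds M; the predecessor accounts for the shift in
   [n.+1]. *)
have far : forall M, exists2 n, (M <= n)%N & logn 2 n.+1 = k.
  move=> M; exists ((2 ^ k * (2 * M).+1).-1)%N.
    have p2 : (0 < 2 ^ k)%N by rewrite expn_gt0.
    rewrite -ltnS prednK ?muln_gt0 ?p2 //.
    by apply: leq_trans (leq_pmull _ p2); rewrite ltnS leq_pmull.
  rewrite prednK ?muln_gt0 ?expn_gt0 // lognM ?expn_gt0 // pfactorK //.
  by rewrite logn_coprime ?addn0 // coprime2n /= oddM.
suff [m [Nm hm]] : exists m, (N <= b m)%N /\ B%:R <= \sum_(N <= l < b m | logn 2 (blk l).+1 == k) r l.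
  by exists (b m).
elim: B => [|B [m [Nm hm]]].
  by exists N; split => //; apply: sumr_ge0.
have [n mn en] := far m; exists n.+1; have h1 := bmono _ _ mn; have h2 := bS n.
split; first by apply: leq_trans Nm (leq_trans h1 (ltnW h2)).
rewrite (big_cat_nat _ (n := b n)) /=; last 2 first.
- exact: leq_trans Nm h1.
- exact: ltnW.
rewrite -natr1 lerD // ?blk_sum // (big_cat_nat _ (n := b m)) //=.
by apply: le_trans hm _; rewrite lerDl sumr_ge0.
Qed.

Lemma small_weight {R : realType} (m c M : R) : 0 < c -> 0 <= M ->
  exists2 b : R, 0 < b < 1 & b * (`|m| + c + M) <= c.
Proof.
move=> c0 M0; have n0 := normr_ge0 m.
have h : 0 < `|m| + c + M + 1 by lra.
exists (c / (`|m| + c + M + 1)).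
  by rewrite divr_gt0 //= ltr_pdivrMr // mul1r; lra.
by rewrite mulrAC ler_pdivrMr // ler_pM2l //; lra.
Qed.

(** * Rotating an orthonormal family until it spans the space *)

Section Absorb.
Context {R : realType} {H : completeNormedModType R[i]}.
Variable ip : {dot H for Num.conj}.
Hypothesis Hip : inner_product_norm ip.
Hypothesis sepH : separable H.
Implicit Types (x y z u v w : H).

Local Notation nn := (sqn ip).
Local Notation rp := (rip ip).
Local Notation nn_ge0 := (nn_ge0 Hip).
Local Notation orthn := (orthn ip).

Variable A : H -> H.
Hypotheses (lA : linear A) (sA : self_adjoint ip A).
Local Notation q x := (rp (A x) x).
Variable M : R.
Hypotheses (M0 : 0 <= M) (qM : forall x, `|q x| <= M * nn x).

Variable S : set H.
Hypothesis cS : csub ip S.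
Variables (J : set nat) (d : nat -> R) (m c : R) (g : nat -> H) (V W : set H).
Hypothesis c0 : 0 < c.
Hypotheses (og : orthn J g) (Sg : forall i, J i -> S (g i)).
Hypothesis g_low : forall i, J i -> d i < m -> q (g i) <= d i.
Hypothesis g_high : forall i, J i -> m <= d i -> d i <= q (g i).
Hypothesis g_div : forall B N : nat, exists N',
  B%:R <= \sum_(N <= l < N' | `[< J l >]) `|q (g l) - d l|.
Hypotheses (sV : subsp V) (iV : dim_infinite V) (VS : V `<=` S)
  (Vg : forall v i, V v -> J i -> ip v (g i) = 0)
  (Vq : forall v, V v -> q v <= (m - c) * nn v).
Hypotheses (sW : subsp W) (iW : dim_infinite W) (WS : W `<=` S)
  (Wg : forall v i, W v -> J i -> ip v (g i) = 0)
  (Wq : forall v, W v -> (m + c) * nn v <= q v).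

Let comp (E : nat -> H) := S `&` [set x | forall y, (exists2 i, J i & y = E i) -> ip x y = 0].
Let ccomp E : csub ip (comp E).
Proof. by apply: csubI => //; exact: (csub_perp Hip). Qed.
Let pc E := proj Hip (ccomp E).

Let compP E x : comp E x <-> S x /\ forall i, J i -> ip x (E i) = 0.
Proof.
split=> -[Sx h]; split => //; first by move=> i Ji; apply: h; exists i.
by move=> _ [i Ji ->]; exact: h.
Qed.

(** The vector e lies in the sum of the uncovered space and the line of E n, so exchanging E n for e
    only moves weight within that sum: the residual of y gains its part along E n and loses its part
    along e. *)
Let pc_update E E' n x' e y : J n -> orthn J E -> (forall i, J i -> S (E i)) -> orthn J E' ->
  (forall i, i != n -> E' i = E i) -> E' n = e -> comp E x' ->
  (forall T, subsp T -> T (E n) -> T x' -> T e) ->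
  nn (pc E' y) = nn (pc E y) + ab2 (ip y (E n)) - ab2 (ip y e).
Proof.
move=> Jn oE SE oE' eE En Kx' he.
have [Sx' px'] := (compP E x').1 Kx'.
have e1 : nn e = 1 by rewrite -En /sqn oE' // eqxx.
have g1 : nn (E n) = 1 by rewrite /sqn oE // eqxx.
have sS := cS.1.
have [Sz pz] := (compP E _).1 (proj_in Hip (ccomp E) y); rewrite -/(pc E y) in Sz pz.
set z := pc E y in Sz pz *.
have eip i : J i -> i != n -> ip e (E i) = 0.
  by move=> Ji ni; rewrite -En -(eE i ni) oE' // eq_sym (negbTE ni).
have ye : ip y e = ip (z + ip y (E n) *: E n) e.
  apply/eqP; rewrite -subr_eq0 -ipBl; apply/eqP.
  apply: (he (fun t => ip (y - (z + ip y (E n) *: E n)) t = 0)).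
  - split; first by rewrite ip0r.
    by move=> k a b ha hb; rewrite ipDr ipZr ha hb mulr0 addr0.
  - by rewrite ipBl ipDl ipZl pz // ipnn g1 mulr1 add0r subrr.
  - rewrite ipBl ipDl ipZl (ip_eq0C (px' n Jn)) mulr0 addr0 -ipBl.
    exact: (proj_perp Hip (ccomp E)).
have Se : S e by apply: he => //; exact: SE.
set w := z + ip y (E n) *: E n in ye.
have ez : pc E' y = w - ip y e *: e.
  apply/esym; apply: proj_uniq.
    apply/compP; split.
      by apply: subspB; [|apply: subspD => //; apply: subspZ => //; exact: SE|exact: subspZ].
    move=> i Ji; have [->|ni] := eqVneq i n.
      by rewrite En ipBl ipZl ipnn e1 mulr1 -ye subrr.
    rewrite eE // ipBl ipZl eip // mulr0 subr0 /w ipDl ipZl pz // oE //.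
    by rewrite eq_sym (negbTE ni) mulr0 addr0.
  move=> k /compP[Sk pk].
  have ke : ip k e = 0 by rewrite -En pk.
  pose k0 := k - ip k (E n) *: E n.
  have Kk0 : comp E k0.
    apply/compP; split; first by apply: subspB => //; apply: subspZ => //; exact: SE.
    move=> i Ji; rewrite /k0 ipBl ipZl; have [->|ni] := eqVneq i n.
      by rewrite ipnn g1 mulr1 subrr.
    by rewrite -(eE i ni) pk // eE // oE // eq_sym (negbTE ni) mulr0 subr0.
  have ek : k = k0 + ip k (E n) *: E n by rewrite /k0 subrK.
  have h1 : ip (y - z) k0 = 0 by exact: (proj_perp Hip (ccomp E)).
  have h2 : ip (E n) k0 = 0 by apply: ip_eq0C; exact: ((compP E k0).1 Kk0).2.
  rewrite opprB addrCA ipDl ipZl (ip_eq0C ke) mulr0 add0r.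
  rewrite /w opprD addrA ipBl ipZl {1}ek ipDr h1 add0r ipZr ipBl pz // subr0.
  rewrite [ip (E n) k]ipC mulrC subrr //.
rewrite ez nnB nnZ e1 mulr1.
have -> : rp w (ip y e *: e) = ab2 (ip y e).
  by rewrite /rip ipZr -ye mulrC mulJ_ab2 ReR.
rewrite /w nnD_orth ?nnZ ?g1; last by rewrite ipZr pz // mulr0.
ring.
Qed.

(** x' is mainly a unit vector v of W or V, chosen orthogonal to the residual z of y and to the
    vectors already rotated, with a share b of the direction of z. The margin c around m leaves room
    for this share, whose overlap with y is b |z|^2. *)
Let test_vector (b : R) : 0 < b < 1 -> b * (`|m| + c + M) <= c ->
  forall E n y, (forall i, J i -> (n <= i)%N -> E i = g i) ->
  exists x', [/\ comp E x', nn x' = 1, b * nn (pc E y) <= ab2 (ip y x') &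
    if d n < m then m <= q x' else q x' <= m].
Proof.
move=> /andP[b0 b1] bc E n y hE; set z := pc E y.
have Kz : comp E z by exact: proj_in.
have [v [Xv v1 vF]] : exists v, [/\ if d n < m then W v else V v, nn v = 1 &
    forall i, (i < n.+1)%N -> ip v (if i == n then z else E i) = 0].
  by case: (d n < m);
    [have := dim_ge_perp Hip (fun i => if i == n then z else E i) sW (iW n.+2)
    |have := dim_ge_perp Hip (fun i => if i == n then z else E i) sV (iV n.+2)].
have vz : ip v z = 0 by have := vF n (ltnSn n); rewrite eqxx.
have Kv : comp E v.
  apply/compP; split; first by case: ifP Xv => _ /=; [exact: WS|exact: VS].
  move=> i Ji; case: (ltnP i n) => hi.
    by have := vF i (leqW hi); rewrite (ltn_eqF hi).
  rewrite hE //; move: Xv; case: ifP => _ hv; [exact: Wg|exact: Vg].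
have qv : if d n < m then m + c <= q v else q v <= m - c.
  case: ifP Xv => _ hv; first by have := Wq hv; rewrite v1 mulr1.
  by have := Vq hv; rewrite v1 mulr1.
have [z0|z0] := pselect (z = 0).
  exists v; split => //; first by rewrite z0 nn0 mulr0 ab2_ge0.
  by have := c0; move: qv; case: ifP => _ qv; lra.
have sK := (ccomp E).1.
have [k [u1 Ku]] := unit_of Hip sK Kz z0; set u := k *: z in u1 Ku.
have [t t1 ut] := phase_orth ip A u v.
have [qt nt] := phaseZ ip lA v t1.
have uv : rp u (t *: v) = 0.
  by rewrite /rip ipZr /u ipZl (ip_eq0C vz) !mulr0 Re0.
have sb : Num.sqrt b ^+ 2 = b by rewrite sqr_sqrtr // ltW.
have sb1 : Num.sqrt (1 - b) ^+ 2 = 1 - b by rewrite sqr_sqrtr // subr_ge0 ltW.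
have Ktv : comp E (t *: v) by exact: subspZ.
have Kx : comp E ((Num.sqrt b)%:C *: u + (Num.sqrt (1 - b))%:C *: (t *: v)).
  by apply: subspD => //; exact: subspZ.
exists ((Num.sqrt b)%:C *: u + (Num.sqrt (1 - b))%:C *: (t *: v)); split => //.
- by rewrite nn_comb // sb sb1 u1 nt v1; ring.
- rewrite -(proj_ip Hip (ccomp E) y Kx) -/(pc E y) -/z.
  rewrite ipDr !ipZr (ip_eq0C vz) !mulr0 addr0 ipnn.
  rewrite !ab2M !ab2J !ab2R sb ler_pM2l // expr2 mulrA -nnZ -/u u1 mul1r //.
rewrite q_comb // sb sb1 qt.
have := qM u; rewrite u1 mulr1 ler_norml => /andP[qu1 qu2].
have h1 := ler_norm m; have h2 := lerNnormlW (lexx `|m|).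
have h3 := normr_ge0 m.
move: qv; case: ifP => _ qv.
  have : (1 - b) * (m + c) <= (1 - b) * q v by rewrite ler_pM2l // subr_gt0.
  have : b * - M <= b * q u by rewrite ler_pM2l.
  have : b * m <= b * `|m| by rewrite ler_pM2l.
  by move: bc; lra.
have : (1 - b) * q v <= (1 - b) * (m - c) by rewrite ler_pM2l // subr_gt0.
have : b * q u <= b * M by rewrite ler_pM2l.
have : b * - m <= b * `|m| by rewrite ler_pM2l // lerNl.
by move: bc; lra.
Qed.

Definition absorb_rate l : R := if `[< J l >] then `|q (g l) - d l| else 0.

Let Pn (n : nat) (E : nat -> H) :=
  [/\ orthn J E, forall i, J i -> S (E i) & forall i, J i -> (n <= i)%N -> E i = g i].

(** The corrections 2 |<y, g n>|^2 have a sum bounded by Bessel, so they cannot offset a divergent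
    total of decreases at the scheduled vector Y n. *)
Let Qn (b : R) (Y : nat -> H) (n : nat) (E E' : nat -> H) :=
  [/\ forall i, i != n -> E' i = E i, ~ J n -> E' = E &
    J n -> [/\ q (E' n) = d n,
      forall y, nn (pc E' y) <= nn (pc E y) + 2 * ab2 (ip y (g n)) &
      nn (pc E' (Y n)) <= nn (pc E (Y n)) - b * absorb_rate n * nn (pc E (Y n)) +
         2 * ab2 (ip (Y n) (g n))]].

Let absorb_step : exists2 b : R, 0 < b & forall Y n E, Pn n E ->
  exists2 E', Qn b Y n E E' & Pn n.+1 E'.
Proof.
have [b b01 bc] := small_weight m c0 M0.
have b0 : 0 < b by case/andP: b01.
(* The rotation passes on half of s times the overlap, and s is at least the rate divided by 2 M + 1
   because |q x' - q (g n)| <= 2 M + 1. *)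
exists (b / (2 * (2 * M + 1))).
  by rewrite divr_gt0 // mulr_gt0 //; have := M0; lra.
move=> Y n E [oE SE gE].
have [Jn|nJ] := pselect (J n); last first.
  exists E; split => // i Ji ni; apply: gE => //; exact: ltnW.
have [x' [Kx x1 hx qx]] := test_vector b01 bc (Y n) gE.
have En : E n = g n by rewrite gE.
have g1 : nn (g n) = 1 by rewrite /sqn og // eqxx.
have gx : ip (g n) x' = 0.
  by apply: ip_eq0C; rewrite -En; exact: ((compP E x').1 Kx).2.
have qgM := qM (g n); have qxM := qM x'; rewrite g1 x1 mulr1 in qgM qxM.
have [s [s01 sq sr]] : exists s, [/\ 0 <= s <= 1, s * (q x' - q (g n)) = d n - q (g n) &
   absorb_rate n <= s * (2 * M + 1)].
  exists ((d n - q (g n)) / (q x' - q (g n))).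
  have hdir : (q (g n) <= d n <= q x') \/ (q x' <= d n <= q (g n)).
    move: qx; case: ltP => dm qx.
      by left; rewrite g_low //= (le_trans (ltW dm)).
    by right; rewrite g_high // andbT (le_trans qx).
  rewrite /absorb_rate asboolT // -normrN opprB.
  have [e|ne] := eqVneq (q x' - q (g n)) 0.
    have -> : d n - q (g n) = 0 by case: hdir => /andP[]; lra.
    by rewrite mul0r lexx ler01 e mulr0 normr0 mul0r.
  have bd : `|q x' - q (g n)| <= 2 * M + 1.
    by apply: le_trans (ler_normB _ _) _; lra.
  split; last 2 first.
  - by rewrite divfK.
  - rewrite -{1}(divfK ne (d n - q (g n))) normrM ler_pM //.
    rewrite ger0_norm //; case: hdir => /andP[h1 h2].
      by rewrite divr_ge0 // subr_ge0 // (le_trans h1).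
    by rewrite -mulrNN -invrN !opprB divr_ge0 // subr_ge0 // (le_trans h1).
  case: hdir => /andP[h1 h2].
    have pos : 0 < q x' - q (g n) by rewrite lt_def ne subr_ge0 (le_trans h1).
    by rewrite divr_ge0 ?subr_ge0 ?(ltW pos) //= ?ler_pdivrMr ?mul1r ?(le_trans h1) //; lra.
  have pos : 0 < q (g n) - q x' by rewrite lt_def -oppr_eq0 opprB ne subr_ge0 (le_trans h1).
  rewrite -mulrNN -invrN !opprB divr_ge0 ?subr_ge0 ?(ltW pos) //=; last exact: le_trans h2.
  by rewrite ler_pdivrMr // mul1r; lra.
have [e [h [[e1 _ _] qe _ he ov]]] := rotation lA sA s01 g1 x1 gx.
have heT T : subsp T -> T (g n) -> T x' -> T e by move=> sT Tg Tx; case: (he T sT Tg Tx).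
pose E' i := if i == n then e else E i.
have E'n : E' n = e by rewrite /E' eqxx.
have E'i i : i != n -> E' i = E i by rewrite /E' => /negbTE ->.
have eE i : J i -> i != n -> ip e (E i) = 0.
  move=> Ji ni; apply: (heT (fun t => ip t (E i) = 0)).
  - split; first by rewrite ip0l.
    by move=> k u v hu hv; rewrite ipDl ipZl hu hv mulr0 addr0.
  - by rewrite -En oE // eq_sym (negbTE ni).
  - exact: ((compP E x').1 Kx).2.
have oE' : orthn J E'.
  move=> i j Ji Jj; have [ei|ni] := eqVneq i n; have [ej|nj] := eqVneq j n.
  - by rewrite ei ej E'n ipnn e1 eqxx.
  - by rewrite ei E'n E'i // eE // eq_sym (negbTE nj).
  - by rewrite ej E'n E'i // (ip_eq0C (eE i Ji ni)) (negbTE ni).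
  - by rewrite !E'i // oE.
have upd y := @pc_update E E' n x' e y Jn oE SE oE' E'i E'n Kx.
rewrite En in upd.
exists E'; last first.
  split => // [i Ji|i Ji ni]; last by rewrite E'i ?gE ?gtn_eqF // ltnW.
  have [->|ni] := eqVneq i n; last by rewrite E'i //; exact: SE.
  rewrite E'n; apply: heT; [exact: cS.1|exact: Sg|exact: Kx.1].
split => // _; split.
- by rewrite E'n qe sq; ring.
- move=> y; rewrite (upd y heT).
  by have := ab2_ge0 (ip y e); have := ab2_ge0 (ip y (g n)); lra.
rewrite (upd (Y n) heT).
have hM : 0 < 2 * M + 1 by have := M0; lra.
have := ov (Y n); have p0 := nn_ge0 (pc E (Y n)); have s0 : 0 <= s by case/andP: s01.
move: hx p0; set p := nn _; set a := ab2 (ip (Y n) x').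
move=> hx p0 ov'.
have h1 : b / (2 * (2 * M + 1)) * absorb_rate n * p <= s / 2 * a.
  apply: (@le_trans _ _ (s / 2 * (b * p))); last first.
    by rewrite ler_wpM2l // divr_ge0.
  have -> : s / 2 * (b * p) = b / (2 * (2 * M + 1)) * (s * (2 * M + 1)) * p.
    by field; rewrite gt_eqF.
  rewrite ler_wpM2r // ler_wpM2l // divr_ge0 ?ltW //; lra.
by move: h1 ov'; lra.
Qed.

(* Each g_i is rotated towards a unit vector having a fixed overlap with the
   residual of a scheduled target vector; since the total rotation diverges,
   all residuals tend to 0. *)
Lemma absorb : exists e, [/\ orthn J e, forall i, J i -> S (e i) /\ q (e i) = d i &
  forall x, S x -> (forall i, J i -> ip x (e i) = 0) -> x = 0].
Proof.
have [b b0 step] := absorb_step.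
have [Y hY] := separable_seq Hip sepH.
have [||j hj] := @block_schedule R absorb_rate.
- by move=> n; rewrite /absorb_rate; case: ifP.
- move=> B N; have [N' hN'] := g_div B N; exists N'.
  by rewrite /absorb_rate -big_mkcond.
have [||u [u0 hP hQ]] := @state_rec (nat -> H) Pn (Qn b (Y \o j)) g.
- by split.
- by move=> n E; exact: step.
pose e i := u i.+1 i.
have ue N i : (i < N)%N -> u N i = e i.
  move/subnK <-; elim: (N - i.+1)%N => [//|l IH].
  rewrite addSn; have [h _ _] := hQ (l + i.+1)%N; rewrite h //.
  by rewrite neq_ltn ltn_addl.
have oe : orthn J e.
  move=> i k Ji Jk; rewrite -(ue (maxn i k).+1) ?ltnS ?leq_maxl //.
  by rewrite -(ue (maxn i k).+1 k) ?ltnS ?leq_maxr //; have [h _ _] := hP (maxn i k).+1; exact: h.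
exists e; split => //.
  move=> i Ji; split; first by have [_ h _] := hP i.+1; exact: h.
  by have [_ _ /(_ Ji)[]] := hQ i.
move=> x Sx xe.
suff h k : ip x (Y k) = 0.
  apply: (nn_eq0 Hip); apply/eqP; rewrite eq_le nn_ge0 andbT leNgt; apply/negP => x0.
  have [k hk] := hY x _ x0.
  have e1 : nn x = rp x (x - Y k) by rewrite /rip ipBr h subr0.
  have := CSr Hip x (x - Y k); rewrite -e1 expr2 ler_pM2l // => h2.
  by have := le_lt_trans h2 hk; rewrite ltxx.
set y := Y k.
pose G n : R := if `[< J n >] then ab2 (ip y (g n)) else 0.
have GS N N' : (N <= N')%N -> \sum_(N <= l < N') G l <= nn y.
  move=> NN; apply: le_trans (psq_le Hip og y N').
  have -> : psq ip J g y N' = \sum_(0 <= l < N') G l by rewrite big_mkord /psq big_mkcond.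
  by rewrite (@big_cat_nat _ _ _ N 0 N') //= lerDr sumr_ge0 // => l _; rewrite /G; case: ifP => // _; exact: ab2_ge0.
pose rho n := nn (pc (u n) y).
(* If the residual of y stayed above e0, the scheduled steps would decrease it by a divergent total,
   against increases of at most 2 |y|^2 in all. *)
have rho_small (e0 : R) N : 0 < e0 -> exists2 n, (N <= n)%N & rho n < e0.
  move=> e00; apply: contrapT => hn.
  have {}hn n : (N <= n)%N -> e0 <= rho n.
    by move=> Nn; rewrite leNgt; apply/negP => h; apply: hn; exists n.
  have dec n : (N <= n)%N -> rho n.+1 <= rho n + 2 * G n - (if j n == k then b * absorb_rate n * e0 else 0).
    move=> Nn; rewrite /rho /G; have [_ h1 h2] := hQ n.
    case: asboolP => Jn; last first.
      rewrite h1 // /absorb_rate asboolF //; case: ifP => _; lra.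
    have [_ h3 h4] := h2 Jn; case: eqP => jn; last by have := h3 y; lra.
    have r0 : 0 <= b * absorb_rate n by rewrite mulr_ge0 ?(ltW b0) // /absorb_rate; case: ifP.
    move: h4; rewrite /= jn -/y => h4.
    have : b * absorb_rate n * e0 <= b * absorb_rate n * nn (pc (u n) y).
      by rewrite ler_wpM2l //; exact: hn.
    by move: h4; lra.
  have tot n : (N <= n)%N -> rho n <= rho N + 2 * \sum_(N <= l < n) G l -
      b * e0 * \sum_(N <= l < n | j l == k) absorb_rate l.
    move/subnK <-; elim: (n - N)%N => [|i IH].
      by rewrite add0n !big_geq //; lra.
    have S2 : \sum_(N <= l < (i + N).+1 | j l == k) absorb_rate l =
        \sum_(N <= l < i + N | j l == k) absorb_rate l +
        (if j (i + N)%N == k then absorb_rate (i + N) else 0).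
      by rewrite big_mkcond big_nat_recr ?leq_addl //= -big_mkcond.
    rewrite addSn S2 big_nat_recr ?leq_addl //=.
    have := dec (i + N)%N (leq_addl _ _); move: IH.
    case: ifP => _; last by lra.
    by move: (absorb_rate _) (rho _) (rho _) (rho _) (\sum_(_ <= _ < _ | _) _) (\sum_(_ <= _ < _) _) => *; lra.
  pose C := (rho N + 2 * nn y) / (b * e0).
  have [N' hN'] := hj k (Num.bound C) N.
  have be : 0 < b * e0 by rewrite mulr_gt0.
  have C0 : 0 <= C.
    by apply: divr_ge0; [apply: addr_ge0; [exact: nn_ge0|rewrite mulr_ge0 // nn_ge0]|exact: ltW].
  have NN : (N <= N')%N.
    rewrite leqNgt; apply/negP => h; move: hN'; rewrite big_geq ?(ltnW h) //.
    by move=> h'; have := le_lt_trans C0 (archi_boundP C0); rewrite ltNge h'.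
  have := tot _ NN; have := GS _ _ NN; have := nn_ge0 (pc (u N') y); rewrite -/(rho N').
  have : C < \sum_(N <= l < N' | j l == k) absorb_rate l by apply: lt_le_trans hN'; exact: archi_boundP.
  rewrite /C ltr_pdivrMr // mulrC; move: (rho N) (rho N') (\sum_(_ <= _ < _ | _) _) (\sum_(_ <= _ < _) _) => *; lra.
apply: ab2_eq0; apply/eqP; rewrite eq_le ab2_ge0 andbT; apply/ler_addgt0Pr => e0 e00.
rewrite add0r.
have ny := nn_ge0 y; have nx := nn_ge0 x.
have e1 : 0 < e0 / (4 * (nn y + 1)) by rewrite divr_gt0 // mulr_gt0 //; lra.
have e2 : 0 < e0 / (4 * (nn x + 1)) by rewrite divr_gt0 // mulr_gt0 //; lra.
(* Beyond N the Bessel tail of x along g is small. As x is orthogonal to the final vectors, its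
   covered part x - z at a stage n >= N has coefficients only at i >= n, where the family is still
   g. *)
have [N hN] := bounded_nondecreasing_cauchy (psq_mono ip J g x) (psq_le Hip og x) e1.
have [n Nn rn] := rho_small _ N e2.
have [oE SE gE] := hP n.
set z := pc (u n) x.
have [Sz pz] := (compP _ _).1 (proj_in Hip (ccomp (u n)) x); rewrite -/(pc (u n) x) -/z in Sz pz.
have wc : in_cspan ip J (u n) (x - z).
  move=> v hv; have Kv : comp (u n) (proj Hip cS v).
    apply/compP; split; first exact: proj_in.
    by move=> i Ji; rewrite proj_ip ?hv //; exact: SE.
  have Sw : S (x - z) by apply: subspB => //; exact: cS.1.
  rewrite -(proj_id Hip cS Sw) (proj_sa Hip cS).
  exact: (proj_perp Hip (ccomp (u n))).
have ipw i : J i -> ip (x - z) (u n i) = ip x (u n i) by move=> Ji; rewrite ipBl pz // subr0.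
have w0 : psum ip J (u n) (x - z) n = 0.
  rewrite /psum big1 // => i /asboolP Ji; rewrite ipw // ue // xe // scale0r //.
have hw : nn (x - z) <= e0 / (4 * (nn y + 1)).
  have := @psum_tail _ _ ip Hip J (u n) oE (x - z) n (e0 / (4 * (nn y + 1))) wc.
  rewrite w0 subr0; apply => N' nN'.
  have -> : psq ip J (u n) (x - z) N' - psq ip J (u n) (x - z) n = psq ip J g x N' - psq ip J g x n.
    move: nN' => /subnK <-; elim: (N' - n)%N => [|i IH]; first by rewrite !subrr.
    rewrite addSn !psqS; case: asboolP => Ji; last by rewrite !addr0.
    by rewrite ipw // gE ?leq_addl // addrAC IH addrAC.
  exact/ltW/hN.
have exy : ip x y = ip (x - z) y + ip x (pc (u n) y).
  by rewrite -(proj_sa Hip (ccomp (u n))) -/(pc (u n) x) -/z -ipDl subrK.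
rewrite exy; apply: le_trans (ab2D_le _ _) _.
have h1 := CS Hip (x - z) y; have h2 := CS Hip x (pc (u n) y); rewrite -/(rho n) in h2.
have h3 : nn (x - z) * nn y <= e0 / 4.
  apply: (@le_trans _ _ (e0 / (4 * (nn y + 1)) * nn y)); first by rewrite ler_wpM2r.
  by rewrite mulrAC ler_pdivrMr; [nra|lra].
have h4 : nn x * rho n <= e0 / 4.
  apply: (@le_trans _ _ (nn x * (e0 / (4 * (nn x + 1))))); first by rewrite ler_wpM2l // ltW.
  by rewrite mulrA ler_pdivrMr; [nra|lra].
by move: h1 h2 h3 h4; lra.
Qed.

End Absorb.

Lemma sum_subset {R : realType} {K : eqType} (F : K -> R) (r t : seq K) :
  uniq r -> uniq t -> {subset r <= t} -> (forall j, j \in t -> 0 <= F j) ->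
  \sum_(j <- r) F j <= \sum_(j <- t) F j.
Proof.
move=> ur ut rt F0.
have e : perm_eq r [seq j <- t | j \in r].
  apply: uniq_perm => //; first exact: filter_uniq.
  by move=> j; rewrite mem_filter; case: (boolP (j \in r)) => // /rt ->.
rewrite (perm_big _ e) /= big_filter [X in _ <= X](bigID (mem r)) /=.
by rewrite lerDl big_seq_cond sumr_ge0 // => j /andP[/F0].
Qed.

Lemma seq_argmin {R : realType} (K : eqType) (val : K -> R) (s : seq K) :
  s != [::] -> exists2 x, x \in s & forall y, y \in s -> val x <= val y.
Proof.
elim: s => [//|a [|b l] IH] _.
  by exists a; rewrite ?inE // => y; rewrite inE => /eqP ->.
have [//|x xl hx] := IH.
case: (leP (val a) (val x)) => ax.
  exists a; first by rewrite inE eqxx.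
  by move=> y; rewrite inE => /orP[/eqP ->|/hx] //; exact: le_trans.
exists x; first by rewrite inE xl orbT.
by move=> y; rewrite inE => /orP[/eqP ->|/hx] //; exact: ltW.
Qed.

Lemma sorted_enum {R : realType} (K : choiceType) (X : set K) (val : K -> R) :
  infinite_set X ->
  (forall j, X j -> finite_set [set k | X k /\ val k <= val j]) ->
  exists o : nat -> K, [/\ injective o, forall j, X j <-> exists n, o n = j &
    forall m n, (m <= n)%N -> val (o m) <= val (o n)].
Proof.
move=> iX fX; have [k0 _] := infinite_setN0 iX.
have [||o ho] := @prefix_rec K k0 (fun s => seq_in X s /\
    forall x y, X x -> x \notin s -> y \in s -> val y <= val x); first by split.
  move=> s [[us sX] hs].
  have [j0 [Xj0 j0s]] := infinite_setN0 (infinite_setD iX (finite_seq s)).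
  have [r hr] := (finite_seqP _).1 (fX j0 Xj0).
  pose r' := [seq k <- r | k \notin s].
  have hr' k : X k -> k \notin s -> val k <= val j0 -> k \in r'.
    move=> Xk ks vk; rewrite mem_filter ks /=.
    by have : [set` r] k by rewrite -hr.
  have r'X k : k \in r' -> X k /\ k \notin s.
    rewrite mem_filter => /andP[ks kr]; split => //.
    by have : [set` r] k by []; rewrite -hr => -[].
  have j0r : j0 \in r' by apply: hr' => //; exact/negP.
  have [x xr hx] : exists2 x, x \in r' & forall y, y \in r' -> val x <= val y.
    by apply: seq_argmin; apply/eqP => e; rewrite e in j0r.
  have [Xx xs] := r'X x xr.
  exists x; split.
    split; first by rewrite rcons_uniq us andbT.
    by move=> i; rewrite mem_rcons inE => /orP[/eqP ->|/sX].
  move=> k y Xk; rewrite mem_rcons inE negb_or => /andP[kx ks].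
  rewrite mem_rcons inE => /orP[/eqP ->|ys]; last exact: hs.
  case: (leP (val k) (val j0)) => h; first exact/hx/hr'.
  by apply: le_trans (ltW h); apply: hx.
have Xo n : X (o n).
  by have [[_ h] _] := ho n.+1; apply: h; rewrite mkseqS mem_rcons inE eqxx.
have io : injective o.
  move=> i j e; have [[u _] _] := ho (maxn i j).+1.
  by move/mkseq_uniqP: u; apply => //=; rewrite inE /= ltnS ?leq_maxl ?leq_maxr.
have memo n k : (k < n)%N -> o k \in mkseq o n.
  by move=> kn; apply/mapP; exists k; rewrite ?mem_iota.
have mo m n : (m <= n)%N -> val (o m) <= val (o n).
  rewrite leq_eqVlt => /orP[/eqP -> //|mn].
  have [_ h] := ho n; apply: h => //; last exact: memo.
  by apply/mapP => -[k]; rewrite mem_iota /= add0n => kn /io e; rewrite e ltnn in kn.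
exists o; split => // j; split => [Xj|[n <-]//].
apply: contrapT => hn.
have nj n : j \notin mkseq o n.
  by apply/mapP => -[k _ e]; apply: hn; exists k.
apply: (infinite_nat); apply: (@sub_finite_set _ _ (o @^-1` [set k | X k /\ val k <= val j])).
  move=> n _; split => //; have [_ h] := ho n.+1.
  by apply: h => //; exact: memo.
by apply: finite_preimage; [move=> x y _ _; exact: io|exact: fX].
Qed.

Section Prescribe.
Context {R : realType} {H : completeNormedModType R[i]}.
Variable ip : {dot H for Num.conj}.
Hypothesis Hip : inner_product_norm ip.
Implicit Types (x y z v : H) (B C D : set R).

Local Notation nn := (sqn ip).
Local Notation rp := (rip ip).
Local Notation nn_ge0 := (nn_ge0 Hip).
Local Notation spr := (spr ip).
Local Notation orthn := (orthn ip).

Variable p : @pair R H.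
Hypothesis gp : good ip p.
Local Notation S := (space p).
Local Notation A := (op p).
Local Notation P := (sm ip p).
Local Notation q x := (rp (A x) x).

Let hA : bsa ip A. Proof. by case: gp. Qed.
Let lA : linear A. Proof. by case: hA. Qed.
Let sA : self_adjoint ip A. Proof. by case: hA. Qed.
Let mO (t : R) : measurable (`]-oo, t[ : set R). Proof. exact: measurable_itv. Qed.
Let m1 (t : R) : measurable ([set t] : set R). Proof. exact: measurable_set1. Qed.

Hypothesis noness : forall l : R, l < 0 -> ~ ess ip p l.

Local Notation eigneg := (eigneg p).
Local Notation eigle := (eigle p).
Local Notation lam := (lam p).

Lemma eigle_finite (a : R) : a < 0 -> finite_set (eigle a).
Proof.
move=> a0; have [f [h1 h2 h3]] := eigen_family Hip gp noness.
have [s [_ hs]] := eigle_seq Hip gp noness h1 h2 a0.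
by apply/finite_seqP; exists s; apply/seteqP; split => j /hs.
Qed.

(* If n eigenvalues in increasing order precede the value a, the excess below
   a only involves them. *)
Lemma lam_prefix (a : R) (o : nat -> R * nat) n : a < 0 ->
  (forall j, eigneg j -> j.1 < a -> exists2 k, (k < n)%N & o k = j) ->
  (forall k, (k < n)%N -> (o k).1 <= a) ->
  {in [pred k | (k < n)%N] &, injective o} ->
  lam a <= \sum_(k < n) (a - (o k).1).
Proof.
move=> a0 ho oa io.
have [f [h1 h2 h3]] := eigen_family Hip gp noness.
have [r [ur hr]] := eigle_seq Hip gp noness h1 h2 a0.
rewrite /lam (lamE ur hr) /=.
rewrite -(big_mkord xpredT (fun k => a - (o k).1)) /index_iota subn0.
rewrite -(big_map o xpredT (fun j => a - j.1)).
apply: (@le_trans _ _ (\sum_(j <- [seq j <- r | j.1 < a]) (a - j.1))).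
  rewrite big_filter [X in _ <= X]big_mkcond big_seq [X in _ <= X]big_seq.
  by apply: ler_sum => j _; case: ltP => // h; rewrite subr_le0.
apply: sum_subset.
- exact: filter_uniq.
- rewrite map_inj_in_uniq ?iota_uniq // => k l; rewrite !mem_iota !add0n /= => kn ln.
  exact: io.
- move=> j; rewrite mem_filter => /andP[ja /hr ej].
  have [k kn <-] := ho j (eigle_neg a0 ej) ja.
  by apply/mapP; exists k; rewrite ?mem_iota.
- by move=> j /mapP[k]; rewrite mem_iota /= add0n => kn ->; rewrite subr_ge0; exact: oa.
Qed.

Lemma sum_pos_ge (tau : nat -> R) (a : R) s :
  (size s)%:R * a - \sum_(i <- s) tau i <= \sum_(i <- s) maxr 0 (a - tau i).
Proof.
elim: s => [|i s IH]; first by rewrite !big_nil mul0r subrr.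
rewrite !big_cons /= -natr1.
have : a - tau i <= maxr 0 (a - tau i) by rewrite le_max lexx orbT.
move: IH; move: (\sum_(_ <- _) _) (\sum_(_ <- _) _) (_%:R) (maxr _ _) => *; lra.
Qed.

(** With the negative eigenvalues in increasing order, the partial-sum condition for n targets is
    the excess inequality at a = (en n).1: one has n a - sum tau <= lam a, while lam a is at most
    the sum of a - (en k).1 over k < n. *)
Lemma prescribe_excess (J : set nat) (tau : nat -> R) : infinite_set eigneg ->
  (forall i, J i -> tau i < 0) ->
  (forall b s, b < 0 -> seq_in J s -> \sum_(i <- s) maxr 0 (b - tau i) <= lam b) ->
  exists g, orthn J g /\ forall i, J i -> spr p `]-oo, 0[ (g i) /\ q (g i) = tau i.
Proof.
move=> iE tn ht.
have [f [h1 h2 h3]] := eigen_family Hip gp noness.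
have [en [ien enE enmono]] : exists en : nat -> R * nat, [/\ injective en,
    forall j, eigneg j <-> exists n, en n = j &
    forall m n, (m <= n)%N -> (en m).1 <= (en n).1].
  apply: sorted_enum => // j [ej j0].
  by apply: sub_finite_set (eigle_finite j0) => k [[ek k0] kj].
have enN n : eigneg (en n) by apply/enE; exists n.
have qf n : q (f (en n)) = (en n).1.
  by rewrite (f_eigen Hip gp h1 (enN n)) rpZl -nnE (onf_nn h2 (enN n)) mulr1.
apply: (@prescribe_values _ _ ip _ lA sA (spr p `]-oo, 0[) (spr_subsp Hip gp (mO 0)) J tau (f \o en)).
- by move=> i j _ _ /=; rewrite h2 // (inj_eq ien).
- move=> k; apply: (spr_sub gp (m1 _) (mO 0)) (h1 _ (enN k)).
  by move=> t /= ->; rewrite in_itv /=; case: (enN k).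
- move=> s sJ; set n := size s; pose a := (en n).1.
  have a0 : a < 0 by case: (enN n).
  have l1 := ht a s a0 sJ; have l2 := sum_pos_ge tau a s.
  have l3 : lam a <= \sum_(k < n) (a - (en k).1).
    apply: lam_prefix => //; last by move=> k l _ _; exact: ien.
      move=> j ej ja; have [k ek] := (enE j).1 ej; exists k => //.
      rewrite ltnNge; apply/negP => /enmono; rewrite ek => h.
      by have := lt_le_trans ja h; rewrite ltxx.
    by move=> k kn; apply: enmono; exact: ltnW.
  rewrite /=; under eq_bigr do rewrite qf.
  move: l3; rewrite sumrB sumr_const card_ord -mulr_natl -/n.
  by move: l1 l2; rewrite -/n; lra.
- move=> i Ji N /=; apply: contrapT => hn.
  have {}hn k : (N <= k)%N -> (en k).1 < tau i.
    by move=> Nk; rewrite ltNge; apply/negP => h; apply: hn; exists k; rewrite ?qf.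
  apply: infinite_nat.
  apply: (@sub_finite_set _ _ (en @^-1` eigle (tau i) `|` `I_N)).
    move=> k _; case: (leqP N k) => Nk; [left|by right].
    by split; [case: (enN k)|exact/ltW/hn].
  rewrite finite_setU; split; last exact: finite_II.
  by apply: finite_preimage; [move=> x y _ _; exact: ien|exact/eigle_finite/tn].
Qed.

(** Two orthonormal sequences with values just above 0, built alternately in one recursion. The even
    vectors use the kernel as long as it lasts; the odd ones are kept orthogonal to a
    finite-dimensional kernel, since they would otherwise consume vectors that the even ones
    need. *)
Lemma near_kernel (ez ew : nat -> R) : right_ess ip p 0 ->
  (forall k, 0 < ez k) -> (forall k, 0 < ew k) ->
  exists z w : nat -> H, [/\ orthn setT z, orthn setT w, forall k l, ip (z k) (w l) = 0,
    forall k, spr p `[0, ez k] (z k) /\ (dim_ge (spr p [set 0]) k.+1 -> spr p [set 0] (z k)) &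
    forall k, spr p `[0, ew k] (w k)].
Proof.
move=> re ez0 ew0.
pose ep i := if odd i then ew i./2 else ez i./2.
have ep0 i : 0 < ep i by rewrite /ep; case: ifP.
have mI i : measurable (`[0, ep i] : set R) by exact: measurable_itv.
have iI i : dim_infinite (spr p `[0, ep i]) by have := re (ep i) (ep0 i); rewrite add0r.
pose K := spr p [set 0].
have sK : subsp K by exact: spr_subsp.
pose Pr (s : nat -> H) i := [/\ nn (s i) = 1, forall j, (j < i)%N -> ip (s i) (s j) = 0,
   spr p `[0, ep i] (s i), odd i -> findim ip K -> forall x, K x -> ip (s i) x = 0 &
   ~~ odd i -> dim_ge K (i./2).+1 -> K (s i)].
have [||u hu] := @prefix_rec H 0 (fun s => forall i, (i < size s)%N -> Pr (nth 0 s) i).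
- by [].
- move=> s hs; set n := size s.
  suff [v [v1 vs vI vo ve]] : exists v, [/\ nn v = 1, forall j, (j < n)%N -> ip v (nth 0 s j) = 0,
     spr p `[0, ep n] v, odd n -> findim ip K -> forall x, K x -> ip v x = 0 &
     ~~ odd n -> dim_ge K (n./2).+1 -> K v].
    exists v => i; rewrite size_rcons ltnS leq_eqVlt => /orP[/eqP ->|iN].
      split; rewrite ?nth_rcons ?ltnn ?eqxx // => j jn.
      by rewrite nth_rcons jn vs.
    have [a1 a2 a3 a4 a5] := hs i iN.
    split; rewrite ?nth_rcons ?iN // => j ji.
    by rewrite nth_rcons (ltn_trans ji iN) a2.
  have KI v : K v -> spr p `[0, ep n] v.
    apply: (spr_sub gp (m1 0) (mI n)) => t /= ->.
    by rewrite in_itv /= lexx ltW.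
  case: (boolP (odd n)) => on.
    have [fK|nK] := pselect (findim ip K); last first.
      have [v [h h1 h2]] := dim_ge_perp Hip (nth 0 s) (spr_subsp Hip gp (mI n)) (iI n n.+1).
      by exists v; split.
    have [N [F [oF KF cF _]]] := findim_basis Hip sK fK.
    have [v [h h1 h2]] := dim_ge_perp Hip (fun i => if (i < n)%N then nth 0 s i else F (i - n)%N)
      (spr_subsp Hip gp (mI n)) (iI n (n + N).+1).
    exists v; split => // [j jn|_ _ x Kx].
      by have := h2 j (ltn_addr _ jn); rewrite jn.
    have vF i : (i < N)%N -> ip v (F i) = 0.
      by move=> iN; have := h2 (n + i)%N; rewrite ltn_add2l iN ltnNge leq_addr /= addKn; exact.
    pose X : set nat := `I_N.
    have sX : seq_in X (iota 0 N).
      by split; [exact: iota_uniq|move=> i; rewrite mem_iota].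
    rewrite -(@fsum_complete _ _ _ ip X F (iota 0 N) K x oF sX sK) //.
    + rewrite /fsum ip_sumr big_seq big1 // => i; rewrite mem_iota => /= iN.
      by rewrite ipZr vF // mulr0.
    + by move=> j; rewrite mem_iota; exact: KF.
    + by move=> y Ky hy; apply: cF => // i iN; apply: hy; rewrite mem_iota.
  have [dK|nK] := pselect (dim_ge K (n./2).+1); last first.
    have [v [h h1 h2]] := dim_ge_perp Hip (nth 0 s) (spr_subsp Hip gp (mI n)) (iI n n.+1).
    by exists v; split.
  have [fK|iK] := pselect (findim ip K); last first.
    have [v [h h1 h2]] := dim_ge_perp Hip (nth 0 s) sK ((not_findimP Hip sK).2 iK n.+1).
    by exists v; split => //; exact: KI.
  have [v [h h1 h2]] := dim_ge_perp Hip (fun i => nth 0 s i.*2) sK dK.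
  exists v; split => //; last exact: KI.
  move=> j jn; case: (boolP (odd j)) => oj.
    by have [_ _ _ h4 _] := hs j jn; apply: ip_eq0C; exact: h4.
  have := h2 j./2; rewrite -[in X in _ -> X](odd_double_half j) (negbTE oj) add0n; apply.
  by rewrite ltn_half_double [(_./2).*2]even_halfK.
have hu' i : Pr u i.
  have := hu i.+1 i; rewrite size_mkseq => /(_ (ltnSn i)).
  have e j : (j <= i)%N -> nth 0 (mkseq u i.+1) j = u j by move=> ji; rewrite nth_mkseq.
  case=> a1 a2 a3 a4 a5; rewrite e // in a1 a2 a3 a4 a5; split => // j ji.
  by rewrite -(e j (ltnW ji)) a2.
have ou i j : ip (u i) (u j) = (i == j)%:R.
  case: (ltngtP i j) => ij.
  - by apply: ip_eq0C; have [_ h _ _ _] := hu' j; exact: h.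
  - by have [_ h _ _ _] := hu' i; exact: h.
  - by rewrite ij ipnn; have [-> _ _ _ _] := hu' j.
exists (fun k => u k.*2), (fun k => u k.*2.+1); split.
- by move=> i j _ _; rewrite ou -!muln2 eqn_pmul2r.
- by move=> i j _ _; rewrite ou eqSS -!muln2 eqn_pmul2r.
- move=> k l; rewrite ou; case: eqP => // e.
  by have := congr1 odd e; rewrite /= !odd_double.
- move=> k; have [_ _ h1 _ h2] := hu' k.*2; move: h1 h2.
  by rewrite /ep odd_double doubleK => h1 h2; split => //; exact: h2.
- move=> k; have [_ _ h1 _ _] := hu' k.*2.+1; move: h1.
  by rewrite /ep /= odd_double /= uphalf_double.
Qed.

End Prescribe.

(** The position of i within J; it assigns distinct kernel vectors or list entries to the members of
    J. *)
Definition rank (J : set nat) i := size [seq k <- iota 0 i | `[< J k >]].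

Lemma rank_seq (J : set nat) i : J i ->
  exists2 s, seq_in J s & size s = (rank J i).+1.
Proof.
move=> Ji; exists (rcons [seq k <- iota 0 i | `[< J k >]] i); last by rewrite size_rcons.
split.
  by rewrite rcons_uniq mem_filter mem_iota /= add0n ltnn andbF filter_uniq // iota_uniq.
by move=> k; rewrite mem_rcons inE mem_filter => /orP[/eqP ->|/andP[/asboolP]].
Qed.

Lemma rankS (J : set nat) i : rank J i.+1 = (rank J i + `[< J i >])%N.
Proof.
by rewrite /rank -addn1 iotaD filter_cat size_cat add0n /=; case: asboolP.
Qed.

Lemma rank_inj (J : set nat) i j : J i -> J j -> rank J i = rank J j -> i = j.
Proof.
have lt i' j' : J i' -> (i' < j')%N -> (rank J i' < rank J j')%N.
  move=> Ji /subnK <-; elim: (j' - i'.+1)%N => [|n IH].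
    by rewrite add0n rankS asboolT // addn1.
  by rewrite addSn rankS (leq_trans IH) // leq_addr.
move=> Ji Jj e; case: (ltngtP i j) => // h.
  by have := lt i j Ji h; rewrite e ltnn.
by have := lt j i Jj h; rewrite e ltnn.
Qed.

Lemma card_le_size {R : realType} (J : set nat) (X : set (R * nat)) r s :
  J #<= X -> (forall j, X j -> j \in r) -> seq_in J s -> (size s <= size r)%N.
Proof.
move=> /pcard_leP[f] Xr [us sJ].
rewrite -(size_map f); apply: uniq_leq_size.
  rewrite map_inj_in_uniq // => i j /sJ Ji /sJ Jj; apply: (@inj _ _ _ f); exact/mem_set.
by move=> _ /mapP[i /sJ Ji ->]; apply: Xr; exact: (@funS _ _ _ _ f).
Qed.

Lemma lim_neg {R : realType} (b0 c x y : R) : b0 < 0 ->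
  (forall b, b0 < b < 0 -> c * b + x <= y) -> x <= y.
Proof.
move=> b00 h; apply/ler_addgt0Pr => e e0.
have c1 : 0 < `|c| + 1 by have := normr_ge0 c; lra.
pose b := Num.max (b0 / 2) (- (e / (`|c| + 1))).
have bn : b < 0.
  by rewrite gt_max; apply/andP; split; [lra|rewrite oppr_lt0 divr_gt0].
have b0b : b0 < b by rewrite lt_max; apply/orP; left; lra.
have be : - (e / (`|c| + 1)) <= b by rewrite le_max lexx orbT.
have := h b; rewrite b0b bn => /(_ erefl).
have h1 : `|c| * (- b) <= e.
  have : (`|c| + 1) * (- b) <= e.
    by rewrite -ler_pdivlMl // mulrC lerNl.
  by have := normr_ge0 c; nra.
have h2 : c * (- b) <= `|c| * (- b).
  by rewrite ler_wpM2r ?oppr_ge0 ?(ltW bn) // ler_norm.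
by lra.
Qed.

Lemma sum_geometric_le {R : realType} (e : R) (u : nat -> R) n : 0 < e ->
  (forall k, u k <= e / 2 ^+ k.+1) -> \sum_(k < n) u k <= e.
Proof.
move=> e0 hu.
suff : \sum_(k < n) u k <= e - e / 2 ^+ n.
  by move=> h; apply: le_trans h _; rewrite gerBl divr_ge0 ?exprn_ge0 // ltW.
elim: n => [|n IH]; first by rewrite big_ord0 expr0 divr1 subrr.
rewrite big_ord_recr /=; have := hu n; rewrite exprS invfM.
move: IH; move: (2 ^+ n)^-1 (\sum_(_ < _) _) => r t; lra.
Qed.

Definition divergent {R : realType} (J : set nat) (F : nat -> R) :=
  forall B : R, exists2 s, seq_in J s & B <= \sum_(i <- s) F i.

(** * An orthonormal family with values at or below the low entries *)

Section LowPreparation.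
Context {R : realType} {H : completeNormedModType R[i]}.
Variable ip : {dot H for Num.conj}.
Hypothesis Hip : inner_product_norm ip.
Implicit Types (x y z v : H) (B C D : set R).

Local Notation nn := (sqn ip).
Local Notation rp := (rip ip).
Local Notation nn_ge0 := (nn_ge0 Hip).
Local Notation spr := (spr ip).
Local Notation orthn := (orthn ip).

Variable p : @pair R H.
Hypothesis gp : good ip p.
Local Notation S := (space p).
Local Notation A := (op p).
Local Notation P := (sm ip p).
Local Notation q x := (rp (A x) x).
Local Notation d := (term p).

Let hA : bsa ip A. Proof. by case: gp. Qed.
Let lA : linear A. Proof. by case: hA. Qed.
Let sA : self_adjoint ip A. Proof. by case: hA. Qed.
Let mO (t : R) : measurable (`]-oo, t[ : set R). Proof. exact: measurable_itv. Qed.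
Let m1 (t : R) : measurable ([set t] : set R). Proof. exact: measurable_set1. Qed.
Let mI (s t : R) : measurable (`[s, t] : set R). Proof. exact: measurable_itv. Qed.

Hypothesis noness : forall l : R, l < 0 -> ~ ess ip p l.

Local Notation eigneg := (eigneg p).
Local Notation eigle := (eigle p).
Local Notation lam := (lam p).

Lemma kernel_findim_index : ~ dim_infinite (spr p [set 0]) ->
  exists n, forall k, (dim_ge (spr p [set 0]) k <-> (k <= n)%N) /\
    (eig_index p (0, k) <-> (k < n)%N).
Proof.
move=> /(findimP Hip (spr_subsp Hip gp (m1 0))) fK.
have [n [u [_ _ _ h]]] := findim_basis Hip (spr_subsp Hip gp (m1 0)) fK.
exists n => k; split => //; rewrite /eig_index /= (spr_eigenspace Hip gp).
exact: h.
Qed.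

Lemma kernel_count (J : set nat) i : J #<= lambda_in p (fun t => t = 0) -> J i ->
  dim_ge (spr p [set 0]) (rank J i).+1.
Proof.
move=> hJ Ji; apply: contrapT => nd.
have [|n hn] := kernel_findim_index; first by move=> h; apply: nd; exact: h.
have [s sJ es] := rank_seq Ji.
have := @card_le_size _ J _ [seq (0, k) | k <- iota 0 n] s hJ _ sJ.
rewrite es size_map size_iota => h; apply: nd; apply/(hn _).1; apply: h.
move=> [t k] [/= ek e]; rewrite e in ek *.
by apply/mapP; exists k; rewrite ?mem_iota //=; exact/(hn k).2.
Qed.

(** Finitely many negative eigenvalues give []-oo, 0[] finite rank, so the infinite rank near 0 must
    lie on its right. *)
Lemma right_ess_of_finite : finite_set eigneg -> ess ip p 0 -> right_ess ip p 0.
Proof.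
move=> fE e0 e he.
have [f [h1 h2 h3]] := eigen_family Hip gp noness.
apply: contrapT => nf.
have mU : measurable (`]-oo, 0[ `|` `[0, 0 + e] : set R).
  by apply: measurableU => //; exact: measurable_itv.
have /(not_findimP Hip (spr_subsp Hip gp (measurable_itv _))) := e0 e he; apply.
apply: findim_spr_sub (findim_spr_U Hip gp (mO 0) (mI 0 (0 + e)) _ _) => //.
- move=> t /=; rewrite !in_itv /= => /andP[_ te].
  by case: (ltP t 0) => h; [left|right; rewrite ltW].
- have [r hr] := (finite_seqP _).1 fE.
  pose j0 : R * nat := (0, 0%N).
  exists (size r), (fun k => if `[< eigneg (nth j0 r k) >] then f (nth j0 r k) else 0) => v hv vf.
  apply: contrapT => v0.
  have [a a0] := negform_gt0 Hip gp hv v0.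
  suff -> : negform ip p a v = 0 by rewrite ltxx.
  have [s [us hs]] := eigle_seq Hip gp noness h1 h2 a0.
  rewrite (negformE Hip gp h1 h2 h3 v a0 us hs) big_seq big1 // => j /hs ej.
  have nj := eigle_neg a0 ej.
  have jr : j \in r by have : [set` r] j by rewrite -hr.
  have := vf (index j r); rewrite index_mem nth_index // asboolT // => /(_ jr) ->.
  by rewrite ab20 mulr0.
- by apply/(findimP Hip (spr_subsp Hip gp (mI _ _))).
Qed.

Lemma lam_le_finite r (b : R) : uniq r -> (forall j, eigneg j <-> j \in r) ->
  b < 0 -> lam b <= - \sum_(j <- r) j.1.
Proof.
move=> ur hr b0.
have [f [h1 h2 h3]] := eigen_family Hip gp noness.
have [s [us hs]] := eigle_seq Hip gp noness h1 h2 b0.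
rewrite /lam (lamE us hs) /= -sumrN.
apply: (@le_trans _ _ (\sum_(j <- s) - j.1)).
  by apply: ler_sum => j _; lra.
apply: sum_subset => // j; first by move=> /hs /(eigle_neg b0) /hr.
by move=> /hr[_]; rewrite oppr_ge0; exact: ltW.
Qed.

(** The excess gap is at least e just below 0, phrased with finite sums; in this form it is
    manipulated in place of lower bounds on [deltaL]. *)
Definition slackL (e : R) := exists2 b0 : R, b0 < 0 & forall b, b0 < b < 0 ->
  forall s, seq_in (idx p) s -> \sum_(i <- s) maxr 0 (b - d i) + e <= lam b.

Hypothesis excess_le : forall b s, b < 0 -> seq_in (idx p) s ->
  \sum_(i <- s) maxr 0 (b - d i) <= lam b.

Variable N : set nat.
Hypothesis Nidx : N `<=` idx p.

Let seqN s : seq_in N s -> seq_in (idx p) s.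
Proof. by move=> [us sN]; split => // i /sN /Nidx. Qed.

(** The halving clause makes the deviation at a positive entry at least d i / 2, so divergence of a
    sum of positive entries passes to the deviations. *)
Definition low_prepared (k : R) g := orthn N g /\ forall i, N i ->
  [/\ spr p `]-oo, k[ (g i), q (g i) <= d i & 0 < d i -> q (g i) <= d i / 2].

Let glue (k : R) (J : set nat) (g0 w : nat -> H) (ew : nat -> R) :
  orthn J g0 -> orthn setT w -> (forall i, N i -> J i \/ 0 < d i) ->
  (forall i, J i -> [/\ spr p `]-oo, k[ (g0 i), q (g0 i) <= d i, d i <= 0 & forall l, ip (g0 i) (w l) = 0]) ->
  (forall i, spr p `[0, ew i] (w i)) ->
  (forall i, ew i < k /\ (0 < d i -> ew i <= d i / 2)) ->
  exists g, low_prepared k g.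
Proof.
move=> og ow NJ hg hw hew; exists (fun i => if `[< J i >] then g0 i else w i).
split=> [i j _ _|i Ni].
  case: asboolP => Ji; case: asboolP => Jj.
  - exact: og.
  - have [_ _ _ ->] := hg i Ji; case: eqP => // e; by rewrite e in Ji.
  - have [_ _ _ h] := hg j Jj; rewrite (ip_eq0C (h i)); case: eqP => // e; by rewrite e in Ji.
  - exact: ow.
case: asboolP => Ji.
  have [a b c _] := hg i Ji; split => // di.
  by have := lt_le_trans di c; rewrite ltxx.
have d0 : 0 < d i by case: (NJ i Ni).
have [ek ed] := hew i.
have qw : q (w i) <= ew i.
  have := spr_le Hip gp (mI 0 (ew i)) (c := ew i) _ (hw i).
  rewrite [nn _]/sqn ow // eqxx mulr1; apply.
  by move=> t; rewrite /= in_itv /= => /andP[].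
have e2 := ed d0; split => [||_]; [|lra|lra].
apply: (spr_sub gp (mI _ _) (mO _)) (hw i) => t /=; rewrite !in_itv /=.
by move=> /andP[_ h]; exact: le_lt_trans ek.
Qed.

(** The finitely many negative eigenvectors are followed by vectors near the kernel. With slack e
    the values of the latter may add up to e; in the other alternative the count of nonpositive
    entries shows that only genuine kernel vectors enter the partial sums. *)
Lemma low_prepare_finite (k : R) : 0 < k -> finite_set eigneg -> right_ess ip p 0 ->
  (exists2 e, 0 < e & slackL e) \/
    d_in p (fun t => t <= 0) #<= lambda_in p (fun t => t <= 0) ->
  exists g, low_prepared k g.
Proof.
move=> k0 fE re alt.
have [f [h1 h2 h3]] := eigen_family Hip gp noness.
have [r0 hr0] := (finite_seqP _).1 fE.
pose r := sort (fun i j : R * nat => i.1 <= j.1) (undup r0).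
have ur : uniq r by rewrite sort_uniq undup_uniq.
have hr j : eigneg j <-> j \in r by rewrite mem_sort mem_undup hr0.
pose j0 : R * nat := (0, 0%N).
set n0 := size r.
have mono a b : (a <= b)%N -> (b < n0)%N -> (nth j0 r a).1 <= (nth j0 r b).1.
  move=> ab bn; apply: (sorted_leq_nth (leT := fun i j : R * nat => i.1 <= j.1)) => //.
  - by move=> x y z; exact: le_trans.
  - apply: sort_sorted => x y; exact: le_total.
  - by rewrite inE (leq_ltn_trans ab).
have rN a : (a < n0)%N -> eigneg (nth j0 r a) by move=> an; apply/hr; exact: mem_nth.
have [e [e0 he]] : exists e : R, 0 < e /\ (slackL e \/ d_in p (fun t => t <= 0) #<= lambda_in p (fun t => t <= 0)).
  case: alt => [[e e0 he]|h]; first by exists e; split => //; left.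
  by exists 1; split => //; right.
(* Geometric weights: all values of the z together use up at most the slack e. *)
pose ez (a : nat) : R := Num.min (k / 2) (e / 2 ^+ a.+1).
pose ew (i : nat) : R := Num.min (k / 2) (if 0 < d i then d i / 2 else 1).
have ez0 a : 0 < ez a.
  by rewrite lt_min divr_gt0 //= divr_gt0 // exprn_gt0.
have ew0 i : 0 < ew i by rewrite lt_min divr_gt0 //=; case: ifP => // h; rewrite divr_gt0.
have ewk i : ew i < k by rewrite gt_min; apply/orP; left; lra.
have ezk a : ez a < k by rewrite gt_min; apply/orP; left; lra.
have [z [w [oz ow zw hz hw]]] := near_kernel Hip gp re ez0 ew0.
pose J := [set i | N i /\ d i <= 0].
pose V := spr p `]-oo, k[ `&` [set x | forall y, (exists l, y = w l) -> ip x y = 0].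
have sV : subsp V.
  apply: (csubI (ip := ip) _ _).1; first exact: spr_csub.
  exact: csub_perp.
pose F a := if (a < n0)%N then f (nth j0 r a) else z (a - n0)%N.
have qF a : q (F a) = if (a < n0)%N then (nth j0 r a).1 else q (z (a - n0)%N).
  rewrite /F; case: ifP => // an; have nj := rN a an.
  by rewrite (f_eigen Hip gp h1 nj) rpZl -nnE (onf_nn h2 nj) mulr1.
have qz a : 0 <= q (z a) <= ez a.
  have nz : nn (z a) = 1 by rewrite /sqn oz // eqxx.
  have [sz _] := hz a.
  have b1 := spr_le Hip gp (mI 0 (ez a)) (c := ez a) _ sz.
  have b2 := spr_ge Hip gp (mI 0 (ez a)) (c := 0) _ sz.
  rewrite nz mulr1 in b1; rewrite mul0r in b2.
  by apply/andP; split; [apply: b2|apply: b1] => t; rewrite /= in_itv /= => /andP[].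
have qz0 a : dim_ge (spr p [set 0]) a.+1 -> q (z a) = 0.
  by have [_ h] := hz a; move=> /h /(spr_set1 Hip gp)[_ ->]; rewrite rpZl mul0r.
have fperp j y t : eigneg j -> spr p `[0, t] y -> ip (f j) y = 0.
  move=> nj hy; apply: (spr_perp Hip gp (m1 j.1) (mI 0 t) _ (h1 j nj) hy).
  rewrite -subset0 => u /= [-> ]; rewrite in_itv /= => /andP[h _].
  by case: nj => _; rewrite ltNge h.
have [||||g0 [og hg]] := @prescribe_values _ _ ip _ lA sA V sV J d F _ _ _ _.
- move=> a b _ _; rewrite /F; case: ltnP => an; case: ltnP => bn.
  + rewrite h2; [|exact: rN|exact: rN].
    by congr (_%:R); rewrite nth_uniq.
  + rewrite (fperp _ _ (ez (b - n0)%N)); [|exact: rN|by case: (hz (b - n0)%N)].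
    by rewrite ltn_eqF // (leq_trans an).
  + rewrite (ip_eq0C (fperp _ _ (ez (a - n0)%N) _ _)); [|exact: rN|by case: (hz (a - n0)%N)].
    by rewrite gtn_eqF // (leq_trans bn).
  + by rewrite oz // -(eqn_add2r n0) !subnK.
- move=> a; rewrite /F; case: ltnP => an; split.
  + apply: (spr_sub gp (m1 _) (mO _)) (h1 _ (rN a an)) => t /= ->.
    by rewrite in_itv /=; case: (rN a an) => _ h; exact: lt_trans k0.
  + by move=> _ [l ->]; apply: (fperp _ _ (ew l)) => //; exact: rN.
  + have [h _] := hz (a - n0)%N; apply: (spr_sub gp (mI _ _) (mO _)) h => t /=.
    by rewrite !in_itv /= => /andP[_ h]; exact: le_lt_trans h (ezk _).
  + by move=> _ [l ->].
- move=> s sJ; set n := size s.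
  have sN : seq_in N s by case: sJ => us sJ; split => // i /sJ[].
  have sI := seqN sN.
  under eq_bigr do rewrite qF.
  case: (ltnP n n0) => nn0.
    pose a := (nth j0 r n).1; have [_ a0] := rN n nn0.
    have l1 := excess_le a0 sI; have l2 := sum_pos_ge d a s.
    have l3 : lam a <= \sum_(i < n) (a - (nth j0 r i).1).
      apply: (lam_prefix Hip gp noness (o := nth j0 r)) => //.
      * move=> j ej ja; have jr := (hr j).1 ej.
        exists (index j r); last by rewrite nth_index.
        rewrite ltnNge; apply/negP => h.
        have := mono n (index j r) h; rewrite index_mem nth_index // => /(_ jr) h'.
        by have := lt_le_trans ja h'; rewrite ltxx.
      * by move=> i iN; apply: mono => //; exact: ltnW.
      * move=> i j; rewrite !inE => iN jN /eqP.
        by rewrite nth_uniq ?(ltn_trans _ nn0) // => /eqP.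
    rewrite (eq_bigr (fun i : 'I_n => (nth j0 r i).1)); last first.
      by move=> i _; rewrite (ltn_trans (ltn_ord i) nn0).
    move: l3; rewrite sumrB sumr_const card_ord -mulr_natl.
    by move: l1 l2; rewrite -/a -/n; lra.
  pose L := \sum_(j <- r) j.1.
  have -> : \sum_(i < n) (if (i < n0)%N then (nth j0 r i).1 else q (z (i - n0)%N)) =
      L + \sum_(i < (n - n0)%N) q (z i).
    rewrite -(big_mkord xpredT (fun i => if (i < n0)%N then (nth j0 r i).1 else q (z (i - n0)%N))).
    rewrite (@big_cat_nat _ _ _ n0 0 n) //=; congr (_ + _).
      rewrite /L (big_nth j0) big_nat [RHS]big_nat; apply: eq_bigr => i /andP[_ h].
      by rewrite h.
    rewrite -{1}(add0n n0) big_addn big_mkord; apply: eq_bigr => i _.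
    by rewrite ltnNge leq_addl /= addnK.
  have Lb b : b < 0 -> lam b <= - L by move=> b0; exact: lam_le_finite.
  case: he => [[b0 b00 hb]|hc].
    have zs : \sum_(i < (n - n0)%N) q (z i) <= e.
      apply: (@sum_geometric_le _ e (fun i => q (z i))) => // a; have /andP[_ h] := qz a.
      by apply: le_trans h _; rewrite ge_min lexx orbT.
    suff : L + e <= \sum_(i <- s) d i by lra.
    (* The inequality is known up to the term n b for b just below 0; letting b tend to 0 removes
       it. *)
    apply: (lim_neg (b0 := b0) (c := n%:R)) => // b hbb.
    have bn : b < 0 by case/andP: hbb.
    have := hb b hbb s sI; have := Lb b bn; have := sum_pos_ge d b s.
    by rewrite -/n; lra.
  have -> : \sum_(i < (n - n0)%N) q (z i) = 0.
    apply: big1 => i _; apply: qz0; apply: contrapT => nd.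
    have [|m hm] := kernel_findim_index; first by move=> h; apply: nd; exact: h.
    have mi : (m <= i)%N by rewrite leqNgt; apply/negP => h; apply: nd; exact/(hm _).1.
    have sd : seq_in (d_in p (fun t => t <= 0)) s.
      by case: sJ => us sJ; split => // l /sJ[/Nidx].
    have := @card_le_size _ _ _ (r ++ [seq (0, l) | l <- iota 0 m]) s hc _ sd.
    rewrite size_cat size_map size_iota -/n -/n0 => h.
    have {}h : (n <= n0 + m)%N.
      apply: h => -[t l] [/= el]; rewrite le_eqVlt => /orP[/eqP t0|t0].
        rewrite t0 in el *; rewrite mem_cat; apply/orP; right; apply/mapP; exists l => //.
        by rewrite mem_iota /=; exact/(hm l).2.
      by rewrite mem_cat; apply/orP; left; apply/hr; split.
    have := ltn_ord i; rewrite ltn_subRL => h'.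
    by have := leq_trans h' h; rewrite ltn_add2l ltnNge mi.
  rewrite addr0; apply: (lim_neg (b0 := -1) (c := n%:R)); first by lra.
  move=> b /andP[_ bn].
  have := excess_le bn sI; have := Lb b bn; have := sum_pos_ge d b s.
  by rewrite -/n; lra.
- move=> i [Ni di] M; exists (M + n0)%N; first exact: leq_addr.
  rewrite qF ltnNge leq_addl /= addnK; case/andP: (qz M) => h _.
  exact: le_trans h.
apply: (glue (J := J) (g0 := g0) (w := w) (ew := ew)) => //.
- by move=> i Ni; case: (leP (d i) 0) => h; [left|right].
- move=> i Ji; have [[Vi pi] ->] := hg i Ji; split => //; first by case: Ji.
  by move=> l; apply: pi; exists l.
- move=> i; split => // di; by rewrite /ew di ge_min lexx orbT.
Qed.

(** The construction for an end without slack, where no nonpositive entry may be lowered: negative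
    entries are realized exactly from eigenvectors, zero entries by kernel vectors, which suffice by
    the count, and positive entries by vectors just right of 0. *)
Lemma low_prepare_closed (k : R) : 0 < k -> infinite_set eigneg -> right_ess ip p 0 ->
  d_in p (fun t => t = 0) #<= lambda_in p (fun t => t = 0) ->
  exists g, low_prepared k g.
Proof.
move=> k0 iE re hc.
have [||g [og hg]] := @prescribe_excess _ _ ip Hip p gp noness [set i | N i /\ d i < 0] d iE.
- by move=> i [].
- move=> b s b0 [us sJ]; apply: excess_le => //; split => // i /sJ[]; by move=> /Nidx.
pose ew (i : nat) : R := Num.min (k / 2) (if 0 < d i then d i / 2 else 1).
have ew0 i : 0 < ew i by rewrite lt_min divr_gt0 //=; case: ifP => // h; rewrite divr_gt0.
have ewk i : ew i < k by rewrite gt_min; apply/orP; left; lra.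
have k20 (a : nat) : 0 < k / 2 by rewrite divr_gt0.
have [z [w [oz ow zw hz hw]]] := near_kernel Hip gp re k20 ew0.
pose K0 := d_in p (fun t => t = 0).
have perp i t y : N i -> d i < 0 -> spr p `[0, t] y -> ip (g i) y = 0.
  move=> Ni di hy; apply: (spr_perp Hip gp (mO 0) (mI 0 t) _ _ hy); last by case: (hg i (conj Ni di)).
  rewrite -subset0 => u /= []; rewrite !in_itv /= => h /andP[h' _].
  by have := lt_le_trans h h'; rewrite ltxx.
apply: (glue (J := [set i | N i /\ d i <= 0])
  (g0 := fun i => if d i < 0 then g i else z (rank K0 i)) (w := w) (ew := ew)) => //.
- move=> i j [Ni di] [Nj dj]; case: ltP => hi; case: ltP => hj.
  + by rewrite og.
  + rewrite (perp _ (k / 2)) //; last by case: (hz (rank K0 j)).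
    by case: eqP => // e; rewrite e ltNge hj in hi.
  + rewrite (ip_eq0C (perp _ (k / 2) _ _ _ _)) //; last by case: (hz (rank K0 i)).
    by case: eqP => // e; rewrite e leNgt hj in hi.
  + have Ki : K0 i by split; [exact: Nidx|apply/eqP; rewrite eq_le di hi].
    have Kj : K0 j by split; [exact: Nidx|apply/eqP; rewrite eq_le dj hj].
    rewrite oz //; case: (eqVneq i j) => [->|ne]; first by rewrite eqxx.
    by case: eqP => // /(rank_inj Ki Kj) e; rewrite e eqxx in ne.
- by move=> i Ni; case: (leP (d i) 0) => h; [left|right].
- move=> i [Ni di]; case: ltP => hi.
    have [h1 h2] := hg i (conj Ni hi); rewrite h2; split => //.
      apply: (spr_sub gp (mO 0) (mO k)) h1 => t /=; rewrite !in_itv /= => h.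
      exact: lt_trans k0.
    by move=> l; apply: (perp _ (ew l)).
  have d0 : d i = 0 by apply/eqP; rewrite eq_le di hi.
  have Ki : K0 i by split => //; exact: Nidx.
  have [h1 h2] := hz (rank K0 i).
  have [_ Az] := (spr_set1 Hip gp _ _).1 (h2 (kernel_count hc Ki)).
  split => //; last by rewrite Az rpZl mul0r d0.
  apply: (spr_sub gp (mI _ _) (mO k)) h1 => t /=; rewrite !in_itv /= => /andP[_ h].
  by apply: le_lt_trans h _; rewrite ltr_pdivrMr // ltr_pMr // ltr1n.
- move=> i; split => // di; by rewrite /ew di ge_min lexx orbT.
Qed.

Lemma half_small (e : R) : 0 < e -> exists k : nat, (2^-1 : R) ^+ k <= e.
Proof.
move=> e0; exists (Num.bound e^-1); rewrite exprVn -[X in _ <= X]invrK.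
rewrite lef_pV2 ?posrE ?invr_gt0 ?exprn_gt0 //.
apply: (le_trans (ltW (archi_boundP _))); first by rewrite invr_ge0 ltW.
by rewrite -natrX ler_nat ltnW // ltn_expl.
Qed.

(** Increase of the excess at b caused by lowering the target from d i to min (d i, 0) - eta i. For
    b < 0 the passage from d i to min (d i, 0) is free. *)
Let inc (eta : nat -> R) i b :=
  maxr 0 (b - (Num.min (d i) 0 - eta i)) - maxr 0 (b - d i).

Let inc_eq eta i b : b < 0 -> inc eta i b =
  maxr 0 (b - Num.min (d i) 0 + eta i) - maxr 0 (b - Num.min (d i) 0).
Proof.
move=> b0; rewrite /inc opprB addrA addrAC; congr (_ - _).
case: (leP (d i) 0) => // h; rewrite subr0 !(max_idPl _) //; last by lra.
exact: ltW.
Qed.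

Let pos_inc (a e : R) : 0 <= e -> 0 <= maxr 0 (a + e) - maxr 0 a <= e.
Proof. by move=> e0; rewrite !maxEle; case: ifP => h1; case: ifP => h2; lra. Qed.

Let inc_bounds eta i b : b < 0 -> 0 <= eta i -> 0 <= inc eta i b <= eta i.
Proof. by move=> b0 e0; rewrite inc_eq //; exact: pos_inc. Qed.

Let inc0 eta i b : b < 0 -> 0 <= eta i -> b <= Num.min (d i) 0 - eta i -> inc eta i b = 0.
Proof. by move=> b0 e0 hb; rewrite inc_eq // !(max_idPl _) ?subrr //; lra. Qed.

Let pre n := [seq i <- iota 0 n | `[< N i >]].

(* Each target is lowered by a power of 1/2, as large as the remaining slack
   near 0 permits, so that the excess inequalities are preserved. *)
Lemma low_prepare_open (k : R) : 0 < k -> infinite_set eigneg ->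
  (exists2 e, 0 < e & slackL e) ->
  exists2 g, low_prepared k g & (forall e, slackL e) -> infinite_set N ->
    divergent N (fun i => `|q (g i) - d i|).
Proof.
move=> k0 iE [e0 e00 he0].
pose slk (eta : nat -> R) n (e b0 : R) := forall b, b0 < b < 0 -> forall s, seq_in (idx p) s ->
  \sum_(i <- s) maxr 0 (b - d i) + \sum_(i <- pre n) inc eta i b + e <= lam b.
pose Pn n (eta : nat -> R) := [/\ forall i, 0 <= eta i,
  forall b s, b < 0 -> seq_in (idx p) s ->
    \sum_(i <- s) maxr 0 (b - d i) + \sum_(i <- pre n) inc eta i b <= lam b,
  exists e b0 : R, [/\ 0 < e, b0 < 0 & slk eta n e b0] &
  forall i, (i < n)%N -> N i -> 0 < eta i \/ d i < 0].
pose ok eta n (a : nat) := slk eta n (2 * 2^-1 ^+ a) (- (2 * 2^-1 ^+ a)).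
pose Qn n (eta eta' : nat -> R) := (forall i, i != n -> eta' i = eta i) /\
  (N n -> exists a : nat, (forall a', ok eta n a' -> (a <= a')%N) /\
     (eta' n = 2^-1 ^+ a \/ (eta' n = 0 /\ d n <= - 2^-1 ^+ a))).
have preS n : pre n.+1 = pre n ++ (if `[< N n >] then [:: n] else [::]).
  by rewrite /pre -addn1 iotaD filter_cat add0n /=; case: asboolP.
have pre_lt n i : i \in pre n -> (i < n)%N by rewrite mem_filter mem_iota => /andP[].
have pw a : 0 < 2^-1 ^+ a :> R by rewrite exprn_gt0 // invr_gt0.
have stepP n eta : Pn n eta -> exists2 eta', Qn n eta eta' & Pn n.+1 eta'.
  move=> [eta0 hall [e [b0 [e1 b01 hs]]] hd].
  have [Nn|nN] := pselect (N n); last first.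
    exists eta; first by split.
    have ep : pre n.+1 = pre n by rewrite preS asboolF // cats0.
    split; rewrite /slk ?ep //; first by exists e, b0; split => //; rewrite /slk ep.
    by move=> i; rewrite ltnS leq_eqVlt => /orP[/eqP ->|] //; exact: hd.
  have ex : exists a, `[< ok eta n a >].
    have m0 : 0 < Num.min e (- b0) / 2 by rewrite divr_gt0 // lt_min e1 oppr_gt0.
    have [a ha] := half_small m0; exists a; apply/asboolP => b /andP[h1 h2] s sI.
    have a1 : 2 * 2^-1 ^+ a <= e.
      have : Num.min e (- b0) <= e by rewrite ge_min lexx.
      by move: ha; move: (Num.min _ _) (2^-1 ^+ a) => *; lra.
    have a2 : 2 * 2^-1 ^+ a <= - b0.
      have : Num.min e (- b0) <= - b0 by rewrite ge_min lexx orbT.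
      by move: ha; move: (Num.min _ _) (2^-1 ^+ a) => *; lra.
    have := hs b _ s sI; rewrite h2 andbT => /(_ _).
    by move: h1 a1 a2; move: (2^-1 ^+ a) => r h1 a1 a2 h; apply: le_trans (h _); lra.
  case: (ex_minnP ex) => a /asboolP oka amin.
  (* An entry at or below -2^-a is not lowered. Otherwise a lowering by 2^-a changes the excess only
     for b > -2 2^-a, where the slack is at least 2 2^-a, so half of the slack survives. *)
  pose r : R := if d n <= - 2^-1 ^+ a then 0 else 2^-1 ^+ a.
  have r0 : 0 <= r by rewrite /r; case: ifP => // _; exact: ltW.
  pose eta' i := if i == n then r else eta i.
  have eta'n : eta' n = r by rewrite /eta' eqxx.
  have eta'i i : i != n -> eta' i = eta i by rewrite /eta' => /negbTE ->.
  have eta'0 i : 0 <= eta' i by rewrite /eta'; case: ifP.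
  have sumE b : \sum_(i <- pre n.+1) inc eta' i b =
      \sum_(i <- pre n) inc eta i b + inc eta' n b.
    rewrite preS asboolT // big_cat big_seq1 /=; congr (_ + _).
    rewrite big_seq [RHS]big_seq; apply: eq_bigr => i /pre_lt hi.
    by rewrite /inc eta'i // neq_ltn hi.
  have incn b : b < 0 -> inc eta' n b <= (if b <= - (2 * 2^-1 ^+ a) then 0 else 2^-1 ^+ a).
    move=> bn; have ra : r <= 2^-1 ^+ a by rewrite /r; case: ifP => // _; exact: ltW.
    case: ifP => hb; last first.
      by have /andP[_ h] := inc_bounds bn (eta'0 n); apply: le_trans h _; rewrite eta'n.
    rewrite /r in ra eta'n; case: ifP eta'n => hd' en.
      by have /andP[_ h] := inc_bounds bn (eta'0 n); apply: le_trans h _; rewrite en.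
    rewrite inc0 // en.
    have : - 2^-1 ^+ a <= Num.min (d n) 0.
      rewrite le_min; apply/andP; split; first by rewrite leNgt; apply/negP => /ltW; rewrite hd'.
      by rewrite oppr_le0 ltW.
    by move: hb; move: (Num.min _ _) (2^-1 ^+ a) => *; lra.
  exists eta'.
    split => // _; exists a; split; first by move=> a' /asboolP /amin.
    by rewrite eta'n /r; case: ifP => h; [right|left].
  split => //.
  - move=> b s bn sI; rewrite sumE addrA; have := incn b bn; case: ifP => hb h.
      by have := hall b s bn sI; lra.
    have := oka b _ s sI; rewrite bn andbT ltNge hb => /(_ erefl).
    by move: h (pw a); move: (2^-1 ^+ a) (inc _ _ _) => *; lra.
  - exists (2^-1 ^+ a), (- (2 * 2^-1 ^+ a)); split => //.
    move=> b hb s sI; have bn : b < 0 by case/andP: hb.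
    rewrite sumE addrA; have := incn b bn; case: ifP => hb'.
      by case/andP: hb; rewrite ltNge hb'.
    have := oka b hb s sI.
    by move: (2^-1 ^+ a) (inc _ _ _) => *; lra.
  - move=> i; rewrite ltnS leq_eqVlt => /orP[/eqP -> _|ii Ni].
      rewrite eta'n /r; case: ifP => h; last by left.
      by right; apply: le_lt_trans h _; rewrite oppr_lt0.
    by rewrite eta'i ?neq_ltn ?ii //; exact: hd.
have [||u [u0 huP huQ]] := @state_rec (nat -> R) Pn Qn (fun=> 0).
- have z0 b : \sum_(i <- pre 0) inc (fun=> 0) i b = 0 by rewrite /pre /= big_nil.
  split => //.
    by move=> b s b0 sI; rewrite z0 addr0; exact: excess_le.
  have [b0 b00 hb] := he0; exists e0, b0; split => // b hbb s sI.
  by rewrite z0 addr0; exact: hb.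
- exact: stepP.
pose eta i := u i.+1 i.
have ue n i : (i < n)%N -> u n i = eta i.
  move/subnK <-; elim: (n - i.+1)%N => [//|l IH].
  by rewrite addSn; have [h _] := huQ (l + i.+1)%N; rewrite h // neq_ltn ltn_addl.
have eta0 i : 0 <= eta i by have [h _ _ _] := huP i.+1; exact: h.
have sumu n b : \sum_(i <- pre n) inc (u n) i b = \sum_(i <- pre n) inc eta i b.
  rewrite big_seq [RHS]big_seq; apply: eq_bigr => i /pre_lt hi.
  by rewrite /inc ue.
pose tau i := Num.min (d i) 0 - eta i.
have pre_in s : seq_in N s -> exists n, {subset s <= pre n}.
  move=> [us sN]; exists (\max_(i <- s) i).+1 => i si.
  rewrite mem_filter; apply/andP; split; first by apply/asboolP; exact: sN.
  by rewrite mem_iota add0n ltnS; exact: (@leq_bigmax_seq _ s xpredT (fun j => j) i si isT).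
have [||g [og hg]] := @prescribe_excess _ _ ip Hip p gp noness N tau iE.
- move=> i Ni; have [_ _ _ /(_ i (ltnSn i) Ni)] := huP i.+1; rewrite -/(eta i) /tau.
  have h1 : Num.min (d i) 0 <= d i by rewrite ge_min lexx.
  have h2 : Num.min (d i) 0 <= 0 by rewrite ge_min lexx orbT.
  by have := eta0 i; case; move: (Num.min _ _) h1 h2 => *; lra.
- move=> b s b0 sN; have [n hn] := pre_in s sN.
  have [_ h _ _] := huP n; have := h b s b0 (seqN sN); rewrite sumu; apply: le_trans.
  apply: (@le_trans _ _ (\sum_(i <- s) maxr 0 (b - d i) + \sum_(i <- s) inc eta i b)).
    by rewrite -big_split /=; apply: ler_sum => i _; rewrite /inc addrCA subrr addr0.
  rewrite lerD2l; apply: sum_subset => //; first by case: sN.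
    by rewrite filter_uniq // iota_uniq.
  by move=> i _; have /andP[] := inc_bounds b0 (eta0 i).
have taud i : tau i <= d i /\ tau i <= 0.
  have h1 : Num.min (d i) 0 <= d i by rewrite ge_min lexx.
  have h2 : Num.min (d i) 0 <= 0 by rewrite ge_min lexx orbT.
  by rewrite /tau; have := eta0 i; move: (Num.min _ _) h1 h2 => *; split; lra.
exists g.
  split => // i Ni; have [h1 h2] := hg i Ni; have [t1 t2] := taud i; rewrite h2.
  split => //; last by move=> di; apply: le_trans t2 _; rewrite divr_ge0 // ltW.
  apply: (spr_sub gp (mO 0) (mO k)) h1 => t /=; rewrite !in_itv /= => h.
  exact: lt_trans k0.
(* If the deviations had bounded sums, unlimited slack would make one exponent K admissible at every
   step. Each entry would then be lowered by at least 2^-K or lie at or below -2^-K, and the finite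
   excess at -2^-K / 2 permits only finitely many of the latter. *)
move=> hC iN B; apply: contrapT => hB.
have {}hB s : seq_in N s -> \sum_(i <- s) `|q (g i) - d i| < B.
  by move=> sN; rewrite ltNge; apply/negP => h; apply: hB; exists s.
have etaB i : N i -> eta i <= `|q (g i) - d i|.
  move=> Ni; have [_ ->] := hg i Ni; rewrite -normrN opprB.
  apply: le_trans (ler_norm _); rewrite /tau.
  have : Num.min (d i) 0 <= d i by rewrite ge_min lexx.
  by move: (Num.min _ _) => *; lra.
have preN n : seq_in N (pre n).
  by split; [rewrite filter_uniq // iota_uniq|move=> i; rewrite mem_filter => /andP[/asboolP]].
have [b0 b00 hb] := hC (B + 2).
have [K hK] : exists K : nat, 2^-1 ^+ K <= Num.min (- b0 / 2) 1.
  by apply: half_small; rewrite lt_min ltr01 andbT; lra.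
have [K1 K2] : 2^-1 ^+ K <= - b0 / 2 /\ (2^-1 : R) ^+ K <= 1.
  by move: hK; rewrite le_min => /andP[].
have okK n : ok (u n) n K.
  move=> b /andP[h1 h2] s sI; rewrite sumu.
  have b0b : b0 < b by move: K1 h1; move: (2^-1 ^+ K) => *; lra.
  have := hb b; rewrite b0b h2 => /(_ erefl s sI).
  have : \sum_(i <- pre n) inc eta i b <= B.
    apply: le_trans (ltW (hB _ (preN n))).
    rewrite big_seq [X in _ <= X]big_seq; apply: ler_sum => i ip'.
    have Ni : N i by have [_ h] := preN n; exact: h.
    by have /andP[_ h] := inc_bounds h2 (eta0 i); apply: le_trans h _; exact: etaB.
  by move: K2; move: (2^-1 ^+ K) (\sum_(_ <- pre n) _) => *; lra.
pose b := - (2^-1 ^+ K / 2) : R.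
have bn : b < 0 by rewrite oppr_lt0 divr_gt0.
have term_ge i : N i -> 2^-1 ^+ K <= `|q (g i) - d i| + 2 * maxr 0 (b - d i).
  move=> Ni; have [_ /(_ Ni)[a [amin alt]]] := huQ i.
  have aK : (2^-1 : R) ^+ K <= 2^-1 ^+ a.
    by rewrite ler_wiXn2l ?invr_ge0 //; [rewrite invf_le1 // ler1n|exact/amin/okK].
  have m0 : 0 <= maxr 0 (b - d i) by rewrite le_max lexx.
  case: alt => [ei|[_ di]].
    have := etaB i Ni; rewrite /eta ei; move: (maxr _ _) m0 => *; lra.
  have h : b - d i <= maxr 0 (b - d i) by rewrite le_max lexx orbT.
  have := normr_ge0 (q (g i) - d i); move: h; rewrite {1}/b.
  by move: aK di; move: (maxr _ _) (2^-1 ^+ a) (2^-1 ^+ K) => *; lra.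
have [en [ien enN]] := infinite_seq iN.
pose C := B + 2 * lam b.
have tot m : m%:R * 2^-1 ^+ K <= C.
  pose s := mkseq en m.
  have sN : seq_in N s.
    split; first by rewrite mkseq_uniq.
    by move=> _ /mapP[i _ ->].
  have := hB s sN; have := excess_le bn (seqN sN).
  have : \sum_(i <- s) 2^-1 ^+ K <= \sum_(i <- s) `|q (g i) - d i| + 2 * \sum_(i <- s) maxr 0 (b - d i).
    rewrite mulr_sumr -big_split /= big_seq [X in _ <= X]big_seq.
    by apply: ler_sum => i is_; apply: term_ge; case: sN => _; apply.
  rewrite big_const_seq count_predT size_mkseq iter_addr_0 -[_ *+ m]mulr_natl /C.
  by move: (_%:R * _) => *; lra.
have C0 : 0 <= C by have := tot 0%N; rewrite mul0r.
have := tot (Num.bound (C / 2^-1 ^+ K)); apply/negP; rewrite -ltNge.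
rewrite -ltr_pdivrMr //; apply: archi_boundP; by rewrite divr_ge0 // ltW.
Qed.

(** Finitely many negative eigenvalues bound the excess near 0, so unlimited slack forces infinitely
    many; divergence is therefore at stake only in the construction with slack. *)
Lemma low_prepare (k : R) : 0 < k -> ess ip p 0 ->
  (exists2 e, 0 < e & slackL e) \/ [/\ right_ess ip p 0,
    d_in p (fun t => t = 0) #<= lambda_in p (fun t => t = 0) &
    d_in p (fun t => t <= 0) #<= lambda_in p (fun t => t <= 0)] ->
  exists2 g, low_prepared k g & (forall e, slackL e) -> infinite_set N ->
    divergent N (fun i => `|q (g i) - d i|).
Proof.
move=> k0 e0 alt.
have [fE|iE] := pselect (finite_set eigneg).
  have [|g hg] := low_prepare_finite k0 fE (right_ess_of_finite fE e0).
    by case: alt => [h|[_ _ h]]; [left|right].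
  exists g => // hC; exfalso.
  have [r0 hr0] := (finite_seqP _).1 fE.
  have hr j : eigneg j <-> j \in undup r0 by rewrite mem_undup hr0.
  have [b0 b00 hb] := hC (1 - \sum_(j <- undup r0) j.1).
  have b2 : b0 < b0 / 2 < 0 by lra.
  have s0 : seq_in (idx p) [::] by split.
  have := hb _ b2 [::] s0; rewrite big_nil add0r.
  have b3 : b0 / 2 < 0 by case/andP: b2.
  by have := lam_le_finite (undup_uniq r0) hr b3; lra.
have [hs|ns] := pselect (exists2 e, 0 < e & slackL e); first exact: low_prepare_open.
case: alt => [//|[re hc _]].
have [g hg] := low_prepare_closed k0 iE re hc.
by exists g => // hC; exfalso; apply: ns; exists 1.
Qed.

End LowPreparation.

(** * Sufficiency of the test *)

Section LowerLimits.
Context {R : realType}.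
Implicit Types (f : R -> \bar R) (V : set R) (x c : R).

Lemma at_left_setP x V : at_left x V <->
  exists2 e : R, 0 < e & forall b, x - e < b < x -> V b.
Proof.
split=> [/nbhs_ballP[e /= e0 h]|[e e0 h]].
  exists e => // b /andP[h1 h2]; apply: h => //.
  by rewrite /ball /= ltr_norml; apply/andP; split; lra.
apply/nbhs_ballP; exists e => //= b; rewrite /ball /= ltr_norml => /andP[h1 h2] bx.
by apply: h; apply/andP; split; lra.
Qed.

Lemma at_right_setP x V : at_right x V <->
  exists2 e : R, 0 < e & forall b, x < b < x + e -> V b.
Proof.
split=> [/nbhs_ballP[e /= e0 h]|[e e0 h]].
  exists e => // b /andP[h1 h2]; apply: h => //.
  by rewrite /ball /= ltr_norml; apply/andP; split; lra.
apply/nbhs_ballP; exists e => //= b; rewrite /ball /= ltr_norml => /andP[h1 h2] bx.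
by apply: h; apply/andP; split; lra.
Qed.

Lemma limf_einf_ge (F : set_system R) f V (c : \bar R) : F V ->
  (forall b, V b -> (c <= f b)%E) -> (c <= limf_einf f F)%E.
Proof.
move=> FV h; rewrite limf_einfE; apply: (@le_trans _ _ (ereal_inf (f @` V))).
  by apply: le_ereal_inf_tmp => _ [b Vb <-]; exact: h.
by apply: ereal_sup_ubound; exists V.
Qed.

Lemma limf_einf_gt (F : set_system R) f (c : \bar R) : (c < limf_einf f F)%E ->
  exists2 V, F V & forall b, V b -> (c < f b)%E.
Proof.
rewrite limf_einfE => /ereal_sup_gt[_ [V FV <-] h]; exists V => // b Vb.
by apply: lt_le_trans h _; apply: ereal_inf_lbound; exists b.
Qed.

Lemma limf_einf_comp (F G : set_system R) (phi psi : R -> R) f :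
  cancel phi psi -> cancel psi phi -> (forall V, G V <-> F (phi @^-1` V)) ->
  limf_einf (f \o phi) F = limf_einf f G.
Proof.
move=> c1 c2 FG; apply/eqP; rewrite eq_le; apply/andP; split.
  rewrite [X in (X <= _)%E]limf_einfE; apply: ge_ereal_sup => _ [V FV <-].
  apply: (@limf_einf_ge _ _ (psi @^-1` V)).
    apply/FG; rewrite (_ : _ @^-1` _ = V) //.
    by apply/seteqP; split => b /=; rewrite c1.
  by move=> b Vb; apply: ereal_inf_lbound; exists (psi b) => //=; rewrite c2.
rewrite [X in (X <= _)%E]limf_einfE; apply: ge_ereal_sup => _ [V GV <-].
apply: (@limf_einf_ge _ _ (phi @^-1` V)); first exact/FG.
by move=> b Vb; apply: ereal_inf_lbound; exists (phi b).
Qed.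

Lemma left_limit_gt f x (c : \bar R) : (c < limf_einf f (at_left x))%E ->
  exists2 e : R, 0 < e & forall b, x - e < b < x -> (c < f b)%E.
Proof. by move=> /limf_einf_gt[V /at_left_setP[e e0 h] hV]; exists e => // b /h /hV. Qed.

Lemma left_limit_ge f x (c : \bar R) e : 0 < e ->
  (forall b, x - e < b < x -> (c <= f b)%E) -> (c <= limf_einf f (at_left x))%E.
Proof.
move=> e0 h; apply: (@limf_einf_ge _ _ [set b | x - e < b < x]) => //.
by apply/at_left_setP; exists e.
Qed.

Lemma left_limit_lt f x (c : \bar R) e : (limf_einf f (at_left x) < c)%E -> 0 < e ->
  exists2 b, x - e < b < x & (f b < c)%E.
Proof.
move=> h e0; apply: contrapT => hn.
suff : (c <= limf_einf f (at_left x))%E by rewrite leNgt h.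
apply: (left_limit_ge e0) => b hb; rewrite leNgt; apply/negP => hb'.
by apply: hn; exists b.
Qed.

Lemma le_left_limit f g x e : 0 < e -> (forall b, x - e < b < x -> (f b <= g b)%E) ->
  (limf_einf f (at_left x) <= limf_einf g (at_left x))%E.
Proof.
move=> e0 h; rewrite [X in (X <= _)%E]limf_einfE; apply: ge_ereal_sup => _ [V FV <-].
have [e1 e10 h1] := (at_left_setP _ _).1 FV.
have m0 : 0 < Num.min e e1 by rewrite lt_min e0.
apply: (left_limit_ge m0) => b /andP[b1 b2].
have m1 : Num.min e e1 <= e by rewrite ge_min lexx.
have m2 : Num.min e e1 <= e1 by rewrite ge_min lexx orbT.
apply: le_trans (h b _); last by move: (Num.min _ _) b1 m1 m2 => *; apply/andP; split; lra.
apply: ereal_inf_lbound; exists b => //; apply: h1.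
by move: (Num.min _ _) b1 m1 m2 => *; apply/andP; split; lra.
Qed.

Lemma eq_left_limit f g x e : 0 < e -> (forall b, x - e < b < x -> f b = g b) ->
  limf_einf f (at_left x) = limf_einf g (at_left x).
Proof.
move=> e0 h; apply/eqP; rewrite eq_le !(le_left_limit e0) // => b hb; by rewrite h.
Qed.

End LowerLimits.

(** * Exchange of the two ends of the spectrum *)

Section Reflection.
Context {R : realType} {H : completeNormedModType R[i]}.
Variable ip : {dot H for Num.conj}.
Hypothesis Hip : inner_product_norm ip.
Implicit Types (x y z v : H) (B C D : set R) (p : @pair R H).

Local Notation nn := (sqn ip).
Local Notation rp := (rip ip).
Local Notation spr := (spr ip).

(** E becomes 1 - E and d becomes 1 - d, an involution exchanging the ends 0 and 1 of a normalized
    pair. *)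
Definition reflect p : pair :=
  Pair (fun x => x - op p x) (space p) (fun i => 1 - term p i) (idx p).

Lemma reflectK p : reflect (reflect p) = p.
Proof.
case: p => A S t J; rewrite /reflect /=; congr Pair; apply/funext => x.
  by rewrite opprB addrCA subrr addr0.
by rewrite opprB addrCA subrr addr0.
Qed.

Lemma reflect_op p x : op (reflect p) x = (-1)%:C *: op p x + 1%:C *: x.
Proof. by rewrite /= rmorphN /= scaleNr !scale1r addrC. Qed.

Lemma good_reflect p : good ip p -> good ip (reflect p).
Proof. by move=> gp; have [] := good_affine Hip gp (reflect_op p) (erefl (space p)). Qed.

Lemma spr_reflect p B : good ip p -> measurable B ->
  spr (reflect p) B = spr p [set t | B (1 - t)].
Proof.
move=> gp mB; have [_ h] := good_affine Hip gp (reflect_op p) (erefl (space p)).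
rewrite /spr; apply: (congr1 (fun f : H -> H => range f)); apply/funext => x; rewrite h //.
by congr (sm ip p _ x); apply/seteqP; split=> t /=; rewrite mulN1r addrC.
Qed.

Lemma ess_reflect p l : good ip p -> ess ip (reflect p) l <-> ess ip p (1 - l).
Proof.
move=> gp; have e (s : R) : spr (reflect p) `]l - s, l + s[ = spr p `](1 - l) - s, (1 - l) + s[.
  rewrite spr_reflect //; congr (spr p _).
  by apply/seteqP; split=> t /=; rewrite !in_itv /= => /andP[a b]; apply/andP; split; lra.
split=> h s s0; have := h s s0; rewrite -/(spr _ _) -/(spr _ _);
  by [rewrite -e|rewrite -[spectral_range _ p _]e].
Qed.

Lemma left_ess_reflect p : good ip p -> left_ess ip p 1 <-> right_ess ip (reflect p) 0.
Proof.
move=> gp.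
pose p' := Pair (fun x => - op p x) (space p) (term p) (idx p).
have o' x : op p' x = (-1)%:C *: op p x + 0%:C *: x.
  by rewrite /= rmorphN /= scaleNr scale1r scale0r addr0.
have [_ h] := good_affine Hip gp o' (erefl (space p)).
have e (s : R) : spectral_range ip p' `[- 1, (- 1) + s] = spectral_range ip (reflect p) `[0, 0 + s].
  rewrite -[RHS]/(spr (reflect p) _) spr_reflect //.
  rewrite -[LHS]/(spr p' _) /spr; apply: (congr1 (fun f : H -> H => range f)); apply/funext => x; rewrite h //.
  congr (sm ip p _ x); apply/seteqP; split=> t /=; rewrite !in_itv /= => /andP[a b]; apply/andP; split; lra.
by split=> hh s s0; have := hh s s0; [rewrite -e|rewrite -[spectral_range ip (reflect p) _]e].
Qed.

Lemma eigenspace_reflect p t : eigenspace (reflect p) t = eigenspace p (1 - t).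
Proof.
apply/seteqP; split=> x [Sx /= e]; split => //=.
  rewrite rmorphB rmorph1 scalerBl scale1r -e opprB addrCA subrr addr0 //.
by rewrite e rmorphB rmorph1 scalerBl scale1r opprB addrCA subrr addr0.
Qed.

Lemma eig_index_reflect p t k : eig_index (reflect p) (t, k) = eig_index p (1 - t, k).
Proof. by rewrite /eig_index /= eigenspace_reflect. Qed.

Let flip (j : R * nat) : R * nat := (1 - j.1, j.2).
Let flipK : involutive flip.
Proof. by case=> t k; rewrite /flip /= opprB addrCA subrr addr0. Qed.

Lemma card_reflect_lambda p (Q : R -> Prop) :
  lambda_in (reflect p) Q #= lambda_in p (fun t => Q (1 - t)).
Proof.
have -> : lambda_in (reflect p) Q = flip @` lambda_in p (fun t => Q (1 - t)).
  apply/seteqP; split=> [[t k] [e Qt]|_ [[t k] [/= e Qt] <-]].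
    exists (1 - t, k); last by rewrite -[RHS]flipK.
    by split => /=; rewrite -?eig_index_reflect // opprB addrCA subrr addr0.
  by split; rewrite //= eig_index_reflect opprB addrCA subrr addr0.
by apply: inj_card_eq => x y _ _; exact: (can_inj flipK).
Qed.

Lemma d_in_reflect p (Q : R -> Prop) : d_in (reflect p) Q = d_in p (fun t => Q (1 - t)).
Proof. by []. Qed.

Lemma lower_excess_reflect {K : choiceType} (J : set K) (x : K -> R) (a : R) :
  lower_excess J (fun i => 1 - x i) a = upper_excess J x (1 - a).
Proof.
rewrite /lower_excess /upper_excess; congr (esum _ _).
  by apply/seteqP; split=> i /= [Ji h]; split => //; lra.
by apply/funext => i; congr (_%:E); ring.
Qed.

Lemma eig_excess_reflect p (a : R) :
  lower_excess (eig_index (reflect p)) fst a = upper_excess (eig_index p) fst (1 - a).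
Proof.
rewrite /lower_excess /upper_excess.
rewrite (reindex_esum [set i | eig_index p i /\ 1 - a <= i.1] _ flip).
  by apply: eq_esum => -[t k] _ /=; congr (_%:E); ring.
split.
- move=> [t k] [/= e h]; split; last by rewrite /=; lra.
  by rewrite eig_index_reflect opprB addrCA subrr addr0.
- by move=> x y _ _; exact: (can_inj flipK).
- move=> [t k] [/= e h]; exists (1 - t, k); last by rewrite -[RHS]flipK.
  by split; [rewrite -eig_index_reflect|rewrite /=; lra].
Qed.

Lemma f_d_reflect p (b : R) : b < 0 -> f_d (reflect p) b = f_d p (1 - b).
Proof.
move=> b0; rewrite /f_d /majorization /= ltW //.
have -> : (1 - b <= 0) = false by apply/negbTE; rewrite -ltNge; lra.
have -> : (1 - b < 1) = false by apply/negbTE; rewrite -leNgt; lra.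
exact: lower_excess_reflect.
Qed.

Lemma f_lambda_reflect p (b : R) : b < 0 -> f_lambda (reflect p) b = f_lambda p (1 - b).
Proof.
move=> b0; rewrite /f_lambda /majorization /= ltW //.
have -> : (1 - b <= 0) = false by apply/negbTE; rewrite -ltNge; lra.
have -> : (1 - b < 1) = false by apply/negbTE; rewrite -leNgt; lra.
exact: eig_excess_reflect.
Qed.

Lemma deltaU_reflect p : deltaU p = deltaL (reflect p).
Proof.
rewrite /deltaU /deltaL.
rewrite -(@limf_einf_comp _ (at_left (0 : R)) (at_right (1 : R)) (fun b => 1 - b) (fun b => 1 - b)).
- apply: (eq_left_limit (e := 1)) => // b /andP[_ b0] /=.
  by rewrite f_d_reflect // f_lambda_reflect.
- by move=> b; rewrite opprB addrCA subrr addr0.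
- by move=> b; rewrite opprB addrCA subrr addr0.
- move=> V; split=> [/at_right_setP[e e0 h]|/at_left_setP[e e0 h]].
    apply/at_left_setP; exists e => // b /andP[h1 h2]; apply: h => /=.
    by apply/andP; split; lra.
  apply/at_right_setP; exists e => // b /andP[h1 h2].
  have -> : b = 1 - (1 - b) by ring.
  by apply: h; apply/andP; split; lra.
Qed.

Lemma prunable_reflect p : good ip p -> prunable1 ip p <-> prunable0 ip (reflect p).
Proof.
move=> gp; rewrite /prunable1 /prunable0 deltaU_reflect.
by split=> -[h1 h2]; split => // h3; apply: h2; apply/(left_ess_reflect gp).
Qed.

End Reflection.

Section Divergence.
Context {R : realType}.
Implicit Types (J K : set nat) (F G : nat -> R).

Lemma divergent_le J K F G (c : R) : 0 < c -> J `<=` K ->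
  (forall i, J i -> c * F i <= G i) -> divergent J F -> divergent K G.
Proof.
move=> c0 JK FG dF B; have [s [us sJ] hs] := dF (B / c).
exists s; first by split => // i /sJ /JK.
apply: (@le_trans _ _ (\sum_(i <- s) c * F i)).
  by rewrite -mulr_sumr mulrC -ler_pdivrMr.
by rewrite big_seq [X in _ <= X]big_seq; apply: ler_sum => i /sJ /FG.
Qed.

Lemma divergent_split J K F : divergent J F ->
  divergent (J `&` K) F \/ divergent (J `\` K) F.
Proof.
move=> dF; apply: contrapT => /not_orP[/existsNP[B1 h1] /existsNP[B2 h2]].
have [s [us sJ] hs] := dF (B1 + B2).
have : \sum_(i <- s) F i < B1 + B2; last by rewrite ltNge hs.
rewrite (bigID (fun i => `[< K i >])) /= -big_filter -[X in _ + X]big_filter.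
apply: ltrD; rewrite ltNge; apply/negP => h.
  apply: h1; exists [seq i <- s | `[< K i >]] => //; split; first exact: filter_uniq.
  by move=> i; rewrite mem_filter => /andP[/asboolP Ki /sJ Ji].
apply: h2; exists [seq i <- s | ~~ `[< K i >]] => //; split; first exact: filter_uniq.
by move=> i; rewrite mem_filter => /andP[/asboolPn Ki /sJ Ji].
Qed.

Lemma not_divergent_finite J F : finite_set J -> (forall i, J i -> 0 <= F i) ->
  ~ divergent J F.
Proof.
move=> fJ F0 dF; have [r hr] := (finite_seqP _).1 fJ.
have [s [us sJ] hs] := dF (1 + \sum_(i <- undup r) F i).
have : \sum_(i <- s) F i <= \sum_(i <- undup r) F i.
  apply: sum_subset => //; first exact: undup_uniq.
    by move=> i /sJ; rewrite hr mem_undup.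
  by move=> i; rewrite mem_undup => ir; apply: F0; rewrite hr.
by lra.
Qed.

Lemma esum_divergent J F :
  (\esum_(i in J) (F i)%:E = +oo)%E -> divergent J F.
Proof.
move=> h B; apply: contrapT => hB.
suff : (\esum_(i in J) (F i)%:E <= B%:E)%E by rewrite h.
apply: esum_le_seq => s sJ; rewrite lee_fin leNgt; apply/negP => /ltW hs.
by apply: hB; exists s.
Qed.

Lemma divergent_tail J F : (forall i, J i -> 0 <= F i) -> divergent J F ->
  forall B N : nat, exists N', B%:R <= \sum_(N <= l < N' | `[< J l >]) F l.
Proof.
move=> F0 dF B N.
pose C := \sum_(0 <= l < N | `[< J l >]) F l.
have [s [us sJ] hs] := dF (B%:R + C).
pose N' := maxn N (\max_(i <- s) i).+1; exists N'.
have : \sum_(i <- s) F i <= \sum_(0 <= l < N' | `[< J l >]) F l.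
  rewrite -[X in _ <= X]big_filter; apply: sum_subset => //.
  - by rewrite filter_uniq // iota_uniq.
  - move=> i si; rewrite mem_filter; apply/andP; split; first by apply/asboolP; exact: sJ.
    rewrite mem_index_iota /= /N' leq_max; apply/orP; right; rewrite ltnS.
    exact: (@leq_bigmax_seq _ s xpredT (fun j => j) i si isT).
  - by move=> i; rewrite mem_filter => /andP[/asboolP /F0].
by rewrite (@big_cat_nat _ _ _ N 0 N') ?leq_maxl //= -/C; lra.
Qed.

End Divergence.

(** * Realizing a pair whose ends are ready *)

Section Realization.
Context {R : realType} {H : completeNormedModType R[i]}.
Variable ip : {dot H for Num.conj}.
Hypothesis Hip : inner_product_norm ip.
Implicit Types (x y z v : H) (p : @pair R H).

Local Notation nn := (sqn ip).
Local Notation rp := (rip ip).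
Local Notation spr := (spr ip).
Local Notation orthn := (orthn ip).

(** [is_diagonal] for a pair living on a subspace: vectors are indexed by [idx], and completeness
    refers to [space]. *)
Definition realizable p := exists e : nat -> H, [/\ orthn (idx p) e,
  forall i, idx p i -> space p (e i) /\ rp (op p (e i)) (e i) = term p i &
  forall x, space p x -> (forall i, idx p i -> ip x (e i) = 0) -> x = 0].

Definition low_ready p := (exists2 e, 0 < e & slackL p e) \/ [/\ right_ess ip p 0,
  d_in p (fun t => t = 0) #<= lambda_in p (fun t => t = 0) &
  d_in p (fun t => t <= 0) #<= lambda_in p (fun t => t <= 0)].

Definition excess_below p := forall b s, b < 0 -> seq_in (idx p) s ->
  \sum_(i <- s) maxr 0 (b - term p i) <= lam p b.

Lemma f_d_low p (b : R) : b < 0 -> f_d p b = lower_excess (idx p) (term p) b.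
Proof. by move=> b0; rewrite /f_d /majorization ltW. Qed.

Lemma f_lambda_low p (b : R) : good ip p -> (forall l, l < 0 -> ~ ess ip p l) ->
  b < 0 -> f_lambda p b = (lam p b)%:E.
Proof.
by move=> gp ne b0; rewrite /f_lambda /majorization ltW // (lower_excess_lam Hip gp ne).
Qed.

Section Low.
Variable p : @pair R H.
Hypotheses (gp : good ip p) (ne : forall l, l < 0 -> ~ ess ip p l).

Lemma excess_belowP :
  (forall b : R, b < 0 -> (f_d p b <= f_lambda p b)%E) <-> excess_below p.
Proof.
split=> h b.
  move=> s b0 sI; have := h b b0; rewrite f_d_low // f_lambda_low // => h'.
  by rewrite -lee_fin; apply: le_trans (lexc_seq _ _ sI) h'.
move=> b0; rewrite f_d_low // f_lambda_low //; apply: lexc_le => s sI.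
by rewrite lee_fin; exact: h.
Qed.

Hypothesis hx : excess_below p.

Lemma f_d_fin (b : R) : b < 0 -> f_d p b = (fine (f_d p b))%:E.
Proof.
move=> b0; rewrite fineK // ge0_fin_numE; last by rewrite f_d_low // lexc_ge0.
by apply: le_lt_trans ((excess_belowP.2 hx) b b0) _; rewrite f_lambda_low // ltry.
Qed.

Lemma f_d_seq (b : R) s : b < 0 -> seq_in (idx p) s ->
  \sum_(i <- s) maxr 0 (b - term p i) <= fine (f_d p b).
Proof.
by move=> b0 sI; rewrite -lee_fin -f_d_fin // f_d_low //; exact: lexc_seq.
Qed.

Lemma deltaL_ge0 : (0 <= deltaL p)%E.
Proof.
apply: (@left_limit_ge _ _ _ _ 1) => // b /andP[_ b0].
rewrite f_d_fin // f_lambda_low // -EFinB lee_fin subr_ge0 -lee_fin -f_d_fin //.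
by have := (excess_belowP.2 hx) b b0; rewrite f_lambda_low.
Qed.

Lemma slackL_of_deltaL (e : R) : (e%:E < deltaL p)%E -> slackL p e.
Proof.
move=> /left_limit_gt[b0 b00 h]; exists (- b0); first by lra.
move=> b hb s sI; have bn : b < 0 by case/andP: hb.
have := h b; rewrite sub0r hb => /(_ erefl).
rewrite f_d_fin // f_lambda_low // -EFinB lte_fin.
by have := f_d_seq bn sI; lra.
Qed.

Lemma deltaL_slack : deltaL p <> 0%E -> exists2 e, 0 < e & slackL p e.
Proof.
move=> n0; have : (0 < deltaL p)%E by rewrite lt_def deltaL_ge0 andbT; apply/eqP.
case e : (deltaL p) => [r| |] //.
  rewrite lte_fin => r0; exists (r / 2); first by lra.
  by apply: slackL_of_deltaL; rewrite e lte_fin; lra.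
by move=> _; exists 1 => //; apply: slackL_of_deltaL; rewrite e ltry.
Qed.

Lemma deltaL_oo : deltaL p = +oo%E -> forall e, slackL p e.
Proof. by move=> h e; apply: slackL_of_deltaL; rewrite h ltry. Qed.

End Low.

Hypothesis sepH : separable H.

Theorem realization p (a b : R) : good ip p ->
  (forall l, l < 0 -> ~ ess ip p l) -> (forall l, 1 < l -> ~ ess ip p l) ->
  ess ip p 0 -> ess ip p 1 -> 0 < a -> a < b -> b < 1 -> ess ip p a -> ess ip p b ->
  excess_below p -> excess_below (reflect p) ->
  low_ready p -> low_ready (reflect p) -> infinite_set (idx p) ->
  [\/ (forall e, slackL p e) /\ (forall e, slackL (reflect p) e),
      (forall e, slackL (reflect p) e) /\ divergent (d_in p (fun t => 0 < t)) (term p),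
      (forall e, slackL p e) /\ divergent (d_in p (fun t => t < 1)) (fun i => 1 - term p i) |
      divergent (d_in p (fun t => 0 <= t <= 1)) (fun i => Num.min (term p i) (1 - term p i))] ->
  realizable p.
Proof.
move=> gp ne0 ne1 e0 e1 a0 ab b1 ea eb xL xU rL rU iI dv.
have gr := good_reflect Hip gp.
have nr l : l < 0 -> ~ ess ip (reflect p) l.
  by move=> l0 /(ess_reflect Hip _ gp); apply: ne1; lra.
have er : ess ip (reflect p) 0 by apply/(ess_reflect Hip _ gp); rewrite subr0.
have [hA AS hP] := gp; have [lA sA _] := hA.
pose m := (a + b) / 2; pose c := (b - a) / 4.
(* Small enough that the windows of radius k around a and b miss []-oo, k[] and []1 - k, +oo[], and
   that the form is at most m - c on the first window and at least m + c on the second. *)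
pose k := Num.min (Num.min a (1 - b)) (b - a) / 4.
have [k0 k1 k2 k3] : [/\ 0 < k, 2 * k < a, 2 * k < 1 - b & k <= (b - a) / 4].
  have h0 : 0 < Num.min (Num.min a (1 - b)) (b - a) by rewrite !lt_min a0 !subr_gt0 b1 ab.
  have h1 : Num.min (Num.min a (1 - b)) (b - a) <= a by rewrite !ge_min lexx.
  have h2 : Num.min (Num.min a (1 - b)) (b - a) <= 1 - b by rewrite !ge_min lexx orbT.
  have h3 : Num.min (Num.min a (1 - b)) (b - a) <= b - a by rewrite ge_min lexx orbT.
  by rewrite /k; move: (Num.min _ _) h0 h1 h2 h3 => *; split; lra.
pose NL := [set i | idx p i /\ term p i < m].
pose NU := [set i | idx p i /\ m <= term p i].
have NLi : NL `<=` idx p by move=> i [].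
have NUi : NU `<=` idx (reflect p) by move=> i [].
have [gL [oL hL] dL] := low_prepare Hip gp ne0 xL NLi k0 e0 rL.
have [gU [oU hU] dU] := low_prepare Hip gr nr xU NUi k0 er rU.
have mk : measurable (`]-oo, k[ : set R) by exact: measurable_itv.
have mk' : measurable (`](1 - k), +oo[ : set R) by exact: measurable_itv.
have qr x : rp (op (reflect p) x) x = nn x - rp (op p x) x by rewrite /= rpDl rpNl -nnE.
have hU' i : NU i -> [/\ spr p `](1 - k), +oo[ (gU i), term p i <= rp (op p (gU i)) (gU i) &
    term p i < 1 -> (1 - term p i) / 2 <= rp (op p (gU i)) (gU i) - term p i].
  move=> Ni; have [h1 h2 h3] := hU i Ni.
  have n1 : nn (gU i) = 1 by rewrite /sqn oU // eqxx.
  rewrite qr n1 /= in h2 h3; split.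
  - move: h1; rewrite (spr_reflect Hip gp mk).
    suff -> : [set t | `]-oo, k[%classic (1 - t)] = `](1 - k), +oo[%classic :> set R by [].
    by apply/seteqP; split => t /=; rewrite !in_itv /= ?andbT; lra.
  - by lra.
  - move=> ti; have : 0 < 1 - term p i by lra.
    by move=> /h3; lra.
pose g i := if term p i < m then gL i else gU i.
have og : orthn (idx p) g.
  have perp i j : NL i -> NU j -> ip (gL i) (gU j) = 0.
    move=> Ni Nj; have [h1 _ _] := hL i Ni; have [h2 _ _] := hU' j Nj.
    apply: (spr_perp Hip gp mk mk' _ h1 h2).
    by rewrite -subset0 => t /= []; rewrite !in_itv /= andbT; lra.
  move=> i j Ii Ij; rewrite /g; case: ltP => hi; case: ltP => hj.
  - exact: oL.
  - by rewrite perp //; case: eqP => // e; rewrite e ltNge hj in hi.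
  - by rewrite (ip_eq0C (perp j i _ _)) //; case: eqP => // e; rewrite e leNgt hj in hi.
  - exact: oU.
have Sg i : idx p i -> space p (g i).
  move=> Ii; rewrite /g; case: ltP => hi; first by have [h _ _] := hL i (conj Ii hi); exact: spr_S h.
  by have [h _ _] := hU' i (conj Ii hi); exact: spr_S h.
have glow i : idx p i -> term p i < m -> rp (op p (g i)) (g i) <= term p i.
  by move=> Ii hi; rewrite /g hi; have [] := hL i.
have ghigh i : idx p i -> m <= term p i -> term p i <= rp (op p (g i)) (g i).
  by move=> Ii hi; rewrite /g ltNge hi /=; have [] := hU' i.
pose F i := `|rp (op p (g i)) (g i) - term p i|.
have F0 i : 0 <= F i by exact: normr_ge0.
have FL i : NL i -> 0 < term p i -> term p i / 2 <= F i.
  move=> [Ii hi] ti; rewrite /F /g hi -normrN opprB; apply: le_trans (ler_norm _).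
  by have [_ _ /(_ ti)] := hL i (conj Ii hi); lra.
have FU i : NU i -> term p i < 1 -> (1 - term p i) / 2 <= F i.
  move=> [Ii hi] ti; rewrite /F /g ltNge hi /=; apply: le_trans (ler_norm _).
  by have [_ _ /(_ ti)] := hU' i (conj Ii hi).
have dvL : (forall e, slackL p e) -> infinite_set NL -> divergent (idx p) F.
  move=> h1 h2; apply: divergent_le NLi _ (dL h1 h2) => // i [Ii hi].
  by rewrite mul1r /F /g hi.
have dvU : (forall e, slackL (reflect p) e) -> infinite_set NU -> divergent (idx p) F.
  move=> h1 h2; apply: divergent_le (ltr01) NUi _ (dU h1 h2) => i [Ii hi].
  rewrite mul1r qr /F /g ltNge hi /= (_ : nn (gU i) = 1); last by rewrite /sqn oU // eqxx.
  move: (rp _ _) => Q; rewrite -normrN.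
  by have -> : - (1 - Q - (1 - term p i)) = Q - term p i by ring.
have IU : idx p = NL `|` NU.
  apply/seteqP; split => i; last by case=> -[].
  by move=> Ii; case: (ltP (term p i) m) => h; [left|right].
(* Unlimited slack at an end gives divergence from the preparation when infinitely many entries
   belong to that end; otherwise almost all entries belong to the other end, and the halving clause
   turns the divergent sum of the hypothesis into divergent deviations. *)
have dvF : divergent (idx p) F.
  case: dv => [[h1 h2]|[h1 h2]|[h1 h2]|h].
  - have : infinite_set NL \/ infinite_set NU.
      apply: contrapT => /not_orP[/contrapT f1 /contrapT f2]; apply: iI.
      by rewrite IU finite_setU.
    by case; [exact: dvL|exact: dvU].
  - have [fU|iU] := pselect (finite_set NU); last exact: dvU.
    case: (divergent_split NU h2) => h.
      exfalso; apply: (not_divergent_finite _ _ h); last by move=> i [[_ /ltW]].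
      by apply: sub_finite_set fU => i [].
    apply: (divergent_le (c := 2^-1)) h => //; first by move=> i [[]].
    move=> i [[Ii ti] nU]; rewrite mulrC; apply: FL => //; split => //.
    by rewrite ltNge; apply/negP => hh; apply: nU.
  - have [fL|iL] := pselect (finite_set NL); last exact: dvL.
    case: (divergent_split NL h2) => h.
      exfalso; apply: (not_divergent_finite _ _ h).
        by apply: sub_finite_set fL => i [].
      by move=> i [[_ ti] _]; lra.
    apply: (divergent_le (c := 2^-1)) h => //; first by move=> i [[]].
    move=> i [[Ii ti] nL]; rewrite mulrC; apply: FU => //; split => //.
    by rewrite leNgt; apply/negP => hh; apply: nL.
  - apply: (divergent_le (c := 2^-1)) h => //; first by move=> i [].
    move=> i [Ii /andP[t0 t1]]; rewrite mulrC.
    case: (ltP (term p i) m) => hi.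
      have h1 : Num.min (term p i) (1 - term p i) <= term p i by rewrite ge_min lexx.
      move: t0; rewrite le_eqVlt => /orP[/eqP t0|t0].
        by have := F0 i; move: (F i) (Num.min _ _) h1 t0 => *; lra.
      by have := FL i (conj Ii hi) t0; move: (F i) (Num.min _ _) h1 => *; lra.
    have h1 : Num.min (term p i) (1 - term p i) <= 1 - term p i by rewrite ge_min lexx orbT.
    move: t1; rewrite le_eqVlt => /orP[/eqP t1|t1].
      by have := F0 i; move: (F i) (Num.min _ _) h1 t1 => *; lra.
    by have := FU i (conj Ii hi) t1; move: (F i) (Num.min _ _) h1 => *; lra.
have [M M0 qM] := rp_bound Hip gp.
have mT : measurable (setT : set R) by [].
have cS : csub ip (space p).
  rewrite (_ : space p = spr p setT); first exact: spr_csub.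
  by apply/seteqP; split => x /(spr_T gp).
have mi (s : R) : measurable (`]s - k, s + k[ : set R) by exact: measurable_itv.
have mid i s x : idx p i -> 2 * k < s -> 2 * k < 1 - s -> spr p `]s - k, s + k[ x -> ip x (g i) = 0.
  move=> Ii s1 s2 hx; apply: ip_eq0C; rewrite /g; case: ltP => hi.
    have [h _ _] := hL i (conj Ii hi); apply: (spr_perp Hip gp mk (mi s) _ h hx).
    by rewrite -subset0 => t /= []; rewrite !in_itv /= => h1 /andP[h2 h3]; lra.
  have [h _ _] := hU' i (conj Ii hi); apply: (spr_perp Hip gp mk' (mi s) _ h hx).
  by rewrite -subset0 => t /= []; rewrite !in_itv /= andbT => h1 /andP[h2 h3]; lra.
have c0 : 0 < c by rewrite /c; lra.
have hva v : spr p `]a - k, a + k[ v -> rp (op p v) v <= (m - c) * nn v.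
  move=> hv; apply: (spr_le Hip gp (mi a)) hv => t; rewrite /= in_itv /= /m /c => /andP[_ h].
  by lra.
have hvb v : spr p `]b - k, b + k[ v -> (m + c) * nn v <= rp (op p v) v.
  move=> hv; apply: (spr_ge Hip gp (mi b)) hv => t; rewrite /= in_itv /= /m /c => /andP[h _].
  by lra.
have k1' : 2 * k < 1 - a by lra.
have k2' : 2 * k < b by lra.
have [e [oe he ce]] := @absorb _ _ ip Hip sepH (op p) lA sA M M0 qM (space p) cS (idx p)
  (term p) m c g (spr p `]a - k, a + k[) (spr p `]b - k, b + k[) c0 og Sg glow ghigh
  (divergent_tail (fun i _ => F0 i) dvF)
  (spr_subsp Hip gp (mi a)) (ea k k0) (fun x => spr_S gp (mi a) (x := x))
  (fun v i hv Ii => mid i a v Ii k1 k1' hv) hva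
  (spr_subsp Hip gp (mi b)) (eb k k0) (fun x => spr_S gp (mi b) (x := x))
  (fun v i hv Ii => mid i b v Ii k2' k2 hv) hvb.
by exists e.
Qed.

End Realization.

Section FromTest.
Context {R : realType} {H : completeNormedModType R[i]}.
Variable ip : {dot H for Num.conj}.
Hypothesis Hip : inner_product_norm ip.
Implicit Types (x y z v : H) (p : @pair R H).

Local Notation nn := (sqn ip).
Local Notation rp := (rip ip).
Local Notation spr := (spr ip).
Local Notation orthn := (orthn ip).

Lemma excess_below_reflect p : good ip p -> (forall l, 1 < l -> ~ ess ip p l) ->
  (excess_below (reflect p) <-> forall a : R, 1 < a -> (f_d p a <= f_lambda p a)%E).
Proof.
move=> gp ne; have gr := good_reflect Hip gp.
have nr l : l < 0 -> ~ ess ip (reflect p) l.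
  by move=> l0 /(ess_reflect Hip _ gp); apply: ne; lra.
rewrite -(excess_belowP Hip gr nr); split=> h a ha.
  have -> : a = 1 - (1 - a) by ring.
  have a0 : 1 - a < 0 by lra.
  by rewrite -f_d_reflect // -f_lambda_reflect //; exact: h.
by rewrite f_d_reflect // f_lambda_reflect //; apply: h; lra.
Qed.

Lemma low_ready_of_delta p : good ip p -> (forall l, l < 0 -> ~ ess ip p l) ->
  excess_below p -> ~ prunable0 ip p ->
  (deltaL p = 0%E -> d_in p (fun t => t = 0) #<= lambda_in p (fun t => t = 0) /\
     d_in p (fun t => t <= 0) #<= lambda_in p (fun t => t <= 0)) -> low_ready ip p.
Proof.
move=> gp ne hx np hc; have [d0|dn] := pselect (deltaL p = 0%E); last first.
  by left; exact: (deltaL_slack Hip gp ne hx dn).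
right; have [c1 c2] := hc d0; split => //.
by apply: contrapT => nr; apply: np.
Qed.

Hypothesis sepH : separable H.

Lemma realizable_of_test p (a b : R) : good ip p ->
  (forall l, l < 0 -> ~ ess ip p l) -> (forall l, 1 < l -> ~ ess ip p l) ->
  ess ip p 0 -> ess ip p 1 -> 0 < a -> a < b -> b < 1 -> ess ip p a -> ess ip p b ->
  necessity_test p -> ~ prunable0 ip p -> ~ prunable1 ip p -> realizable ip p.
Proof.
move=> gp ne0 ne1 e0 e1 a0 ab b1 ea eb [iI h1 h2 h3 h4] np0 np1.
have gr := good_reflect Hip gp.
have nr l : l < 0 -> ~ ess ip (reflect p) l.
  by move=> l0 /(ess_reflect Hip _ gp); apply: ne1; lra.
have xL : excess_below p.
  by apply/(excess_belowP Hip gp ne0) => c c0; apply: h1; rewrite negb_and -ltNge c0.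
have xU : excess_below (reflect p).
  by apply/(excess_below_reflect gp ne1) => c c1; apply: h1; rewrite negb_and -!ltNge c1 orbT.
have rL : low_ready ip p by exact: low_ready_of_delta.
have rU : low_ready ip (reflect p).
  apply: low_ready_of_delta => //; first by move=> /(prunable_reflect Hip gp).
  rewrite -deltaU_reflect => /h3[c1 c2]; rewrite !d_in_reflect.
  have e (Q Q' : R -> Prop) : (forall t, Q t <-> Q' (1 - t)) ->
      d_in p Q #<= lambda_in p Q -> d_in p (fun t => Q' (1 - t)) #<= lambda_in (reflect p) Q'.
    move=> QQ; rewrite (card_le_eqr (card_reflect_lambda p Q')).
    by have -> : Q = (fun t => Q' (1 - t)) by apply/funext => t; apply/propext/QQ.
  split; first by apply: e c1 => t; split=> [->|]; [rewrite subrr|lra].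
  by apply: e c2 => t; split; lra.
apply: (realization Hip sepH gp ne0 ne1 e0 e1 a0 ab b1 ea eb xL xU rL rU iI).
case: h4 => [[d1 d2]|[d1 d2 d3]|[d1 d2 d3]|[d1 d2]].
- apply: Or41; split; first exact: (deltaL_oo Hip gp ne0 xL d1).
  by apply: (deltaL_oo Hip gr nr xU); rewrite -deltaU_reflect.
- apply: Or42; split; last exact: esum_divergent.
  by apply: (deltaL_oo Hip gr nr xU); rewrite -deltaU_reflect.
- apply: Or43; split; last exact: esum_divergent.
  exact: (deltaL_oo Hip gp ne0 xL d2).
apply: Or44; move: d2; rewrite /f_d /majorization.
have -> : (2^-1 <= 0 :> R) = false by apply/negbTE; rewrite -ltNge invr_gt0.
have -> : (2^-1 < 1 :> R) = true by rewrite invf_lt1 // ltr1n.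
move=> d2.
have [h|h] : (lower_sum (idx p) (term p) (2^-1) = +oo \/ upper_sum (idx p) (term p) (2^-1) = +oo)%E.
  apply: contrapT => /not_orP[n1 n2]; move: d2.
  have l0 : (0 <= lower_sum (idx p) (term p) (2^-1))%E.
    by apply: esum_ge0 => i [_ /andP[]]; rewrite lee_fin.
  have u0 : (0 <= upper_sum (idx p) (term p) (2^-1))%E.
    by apply: esum_ge0 => i [_ /andP[]]; rewrite lee_fin subr_ge0.
  by case: (lower_sum _ _ _) l0 n1 => // r _ _; case: (upper_sum _ _ _) u0 n2.
- apply: (divergent_le (c := 1)) (esum_divergent h) => //.
    by move=> i [Ii /andP[t0 t1]]; split => //; rewrite t0 /=; lra.
  by move=> i [Ii /andP[t0 t1]]; rewrite mul1r le_min lexx /=; lra.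
apply: (divergent_le (c := 1)) (esum_divergent h) => //.
  by move=> i [Ii /andP[t0 t1]]; split => //; rewrite t1 andbT; lra.
by move=> i [Ii /andP[t0 t1]]; rewrite mul1r le_min lexx andbT; lra.
Qed.

Section Block.
Variable p : @pair R H.
Hypotheses (gp : good ip p) (ne : forall l, l < 0 -> ~ ess ip p l).
Hypothesis hx : excess_below p.
Let mO (t : R) : measurable (`]-oo, t[ : set R). Proof. exact: measurable_itv. Qed.
Lemma deltaL_lt (e e0 : R) : (deltaL p < e%:E)%E -> 0 < e0 ->
  exists2 b : R, - e0 < b < 0 & lam p b - fine (f_d p b) < e.
Proof.
move=> h /(left_limit_lt h)[b]; rewrite sub0r => hb h'; exists b => //.
have bn : b < 0 by case/andP: hb.
by move: h'; rewrite (f_d_fin Hip gp ne hx bn) (f_lambda_low Hip gp ne bn) -EFinB lte_fin.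
Qed.

(** A unit vector v left over in []-oo, 0[] could be added to the family in the trace inequality.
    The gap at b would then be at least the negative form of v at b, which is nondecreasing in b and
    somewhere positive, whereas the gap comes arbitrarily close to 0. *)
Lemma block : ess ip p 0 -> prunable0 ip p ->
  exists g, [/\ orthn (d_in p (fun t => t < 0)) g,
    forall i, d_in p (fun t => t < 0) i -> spr p `]-oo, 0[ (g i) /\ rp (op p (g i)) (g i) = term p i &
    forall x, spr p `]-oo, 0[ x -> (forall i, d_in p (fun t => t < 0) i -> ip x (g i) = 0) -> x = 0].
Proof.
move=> e0 [d0 nr].
have iE : infinite_set (eigneg p).
  by move=> fE; apply: nr; exact: (right_ess_of_finite Hip gp ne fE e0).
set J := d_in p (fun t => t < 0).
have JI s : seq_in J s -> seq_in (idx p) s by move=> [us sJ]; split => // i /sJ[].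
have [||g [og hg]] := @prescribe_excess _ _ ip Hip p gp ne J (term p) iE.
- by move=> i [].
- by move=> b s b0 /JI; exact: hx.
exists g; split => // x hxx xg; apply: contrapT => x0.
have [k [k1 hk]] := unit_of Hip (spr_subsp Hip gp (mO 0)) hxx x0.
set v := k *: x in k1 hk.
have vg i : J i -> ip v (g i) = 0 by move=> Ji; rewrite ipZl xg // mulr0.
have v0 : v <> 0 by move=> e; move: k1; rewrite e nn0 => /eqP; rewrite eq_sym oner_eq0.
have [a a0 ha] := negform_gt0 Hip gp hk v0.
have key b s : b < 0 -> seq_in J s ->
    \sum_(i <- s) maxr 0 (b - term p i) + negform ip p b v <= lam p b.
  move=> b0 [us sJ].
  (* [None] indexes the extra vector v. *)
  pose X : set (option nat) := [set o | if o is Some i then J i else True].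
  pose e (o : option nat) := if o is Some i then g i else v.
  have oe : onf ip X e.
    move=> [i|] [j|] /= Xi Xj; rewrite ?(inj_eq Some_inj) //.
    - exact: og.
    - exact: ip_eq0C (vg i Xi).
    - exact: vg.
    - by rewrite ipnn k1.
  have Se o : X o -> space p (e o).
    case: o => [i|] /= Xi; last exact: (spr_S gp (mO 0)) hk.
    by have [h _] := hg i Xi; exact: (spr_S gp (mO 0)) h.
  have sX : seq_in X (None :: map Some s).
    split; last first.
      move=> [i|] //=; rewrite inE /= => /mapP[j js [->]]; exact: sJ.
    rewrite /= map_inj_uniq ?us ?andbT; last exact: Some_inj.
    by apply/mapP => -[].
  have := negform_trace Hip gp ne b0 oe Se sX; apply: le_trans.
  rewrite big_cons big_map addrC lerD2l big_seq [X in _ <= X]big_seq.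
  apply: ler_sum => i is_; have Ji := sJ i is_; have [h1 h2] := hg i Ji.
  rewrite ge_max (negform_ge0 Hip gp) /=.
  have := negform_ge Hip gp b (spr_S gp (mO 0) h1).
  by rewrite h2 (onf_nn og Ji) mulr1.
have [b /andP[ab b0] hb] : exists2 b : R, a < b < 0 & lam p b - fine (f_d p b) < negform ip p a v.
  have := @deltaL_lt (negform ip p a v) (- a); rewrite opprK; apply; last by lra.
  by rewrite d0 lte_fin.
have : fine (f_d p b) <= lam p b - negform ip p b v.
  rewrite -lee_fin -(f_d_fin Hip gp ne hx b0) f_d_low //; apply: lexc_le => s [us sI].
  rewrite lee_fin; pose s' := [seq i <- s | term p i < 0].
  have hs' : seq_in J s'.
    split; first exact: filter_uniq.
    by move=> i; rewrite mem_filter => /andP[ti /sI].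
  have := key b s' b0 hs'; rewrite big_filter.
  suff -> : \sum_(i <- s) maxr 0 (b - term p i) = \sum_(i <- s | term p i < 0) maxr 0 (b - term p i) by lra.
  rewrite [RHS]big_mkcond; apply: eq_bigr => i _; case: ltP => // ti.
  by apply/max_idPl; lra.
by have := negform_mono Hip gp v (ltW ab); lra.
Qed.

End Block.
End FromTest.

(** In the finite alternative [rank] embeds J into the list: an entry of rank k ends a finite part
    of J with k + 1 members. *)
Lemma card_le_sizes {R : realType} (J : set nat) (X : set (R * nat)) :
  (infinite_set X \/ exists r, [/\ uniq r, forall j, j \in r -> X j &
     forall s, seq_in J s -> (size s <= size r)%N]) -> J #<= X.
Proof.
case=> [/infiniteP h|[r [ur rX hs]]]; first exact: card_le_trans (card_leT J) h.
pose j0 : R * nat := (0, 0%N).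
have rk i : J i -> (rank J i < size r)%N.
  by move=> Ji; have [s sJ es] := rank_seq Ji; rewrite -es; exact: hs.
have inj_f : {in J &, injective (fun i => nth j0 r (rank J i))}.
  move=> i j /set_mem Ji /set_mem Jj /eqP; rewrite nth_uniq ?rk // => /eqP.
  exact: rank_inj.
rewrite -(card_le_eql (inj_card_eq inj_f)).
by apply: subset_card_le => _ [i Ji <-]; apply/rX/mem_nth/rk.
Qed.

(** * Necessity of the test *)

Section Necessity.
Context {R : realType} {H : completeNormedModType R[i]}.
Variable ip : {dot H for Num.conj}.
Hypothesis Hip : inner_product_norm ip.
Implicit Types (x y z v : H) (p : @pair R H).

Local Notation nn := (sqn ip).
Local Notation rp := (rip ip).
Local Notation spr := (spr ip).
Local Notation orthn := (orthn ip).

(** A finite-dimensional defect is allowed because the final prunings may leave the retained basis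
    vectors incomplete in the cut space. *)
Definition realizing p (e : nat -> H) := [/\ orthn (idx p) e,
  forall i, idx p i -> space p (e i) /\ rp (op p (e i)) (e i) = term p i &
  findim ip [set x | space p x /\ forall i, idx p i -> ip x (e i) = 0]].

Lemma realizing_reflect p e : realizing p e -> realizing (reflect p) e.
Proof.
case=> oe he fe; split => // i Ii; have [h1 h2] := he i Ii; split => //.
by rewrite /= rpDl rpNl -nnE (onf_nn oe Ii) h2.
Qed.

Lemma orthn_of_dim_infinite (V : set H) : subsp V -> dim_infinite V ->
  exists u : nat -> H, orthn setT u /\ forall k, V (u k).
Proof.
move=> sV iV.
have [||u hu] := @prefix_rec H 0 (fun s => forall i, (i < size s)%N ->
    [/\ V (nth 0 s i), nn (nth 0 s i) = 1 & forall j, (j < i)%N -> ip (nth 0 s i) (nth 0 s j) = 0]).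
- by [].
- move=> s hs; have [v [Vv v1 vs]] := dim_ge_perp Hip (nth 0 s) sV (iV (size s).+1).
  exists v => i; rewrite size_rcons ltnS leq_eqVlt => /orP[/eqP ->|iN].
    split; rewrite ?nth_rcons ?ltnn ?eqxx // => j jn.
    by rewrite nth_rcons jn vs.
  have [a1 a2 a3] := hs i iN.
  split; rewrite ?nth_rcons ?iN // => j ji.
  by rewrite nth_rcons (ltn_trans ji iN) a3.
have hu' i : [/\ V (u i), nn (u i) = 1 & forall j, (j < i)%N -> ip (u i) (u j) = 0].
  have := hu i.+1 i; rewrite size_mkseq => /(_ (ltnSn i)).
  have e j : (j <= i)%N -> nth 0 (mkseq u i.+1) j = u j by move=> ji; rewrite nth_mkseq.
  by case; rewrite e // => a1 a2 a3; split => // j ji; rewrite -(a3 j ji) e // ltnW.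
exists u; split; last by move=> k; have [] := hu' k.
move=> i j _ _; case: (ltngtP i j) => ij.
- by apply: ip_eq0C; have [_ _] := hu' j; exact.
- by have [_ _] := hu' i; exact.
- by rewrite ij ipnn; have [_ -> _] := hu' j.
Qed.

Section LowNecessity.
Variables (p : @pair R H) (e : nat -> H).
Hypotheses (gp : good ip p) (ne : forall l, l < 0 -> ~ ess ip p l).
Hypotheses (oe : orthn (idx p) e)
  (he : forall i, idx p i -> space p (e i) /\ rp (op p (e i)) (e i) = term p i).
Local Notation S := (space p).
Local Notation A := (op p).
Local Notation P := (sm ip p).
Local Notation q x := (rp (A x) x).
Let hP : smeas ip A S P. Proof. by case: gp. Qed.
Let mO (t : R) : measurable (`]-oo, t[ : set R). Proof. exact: measurable_itv. Qed.
Let mL (t : R) : measurable (`]-oo, t] : set R). Proof. exact: measurable_itv. Qed.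
Let mP (t : R) : measurable (`[t, +oo[ : set R). Proof. exact: measurable_itv. Qed.
Let mQ (t : R) : measurable (`]t, +oo[ : set R). Proof. exact: measurable_itv. Qed.
Let m1 (t : R) : measurable ([set t] : set R). Proof. exact: measurable_set1. Qed.

Let n1 i : idx p i -> nn (e i) = 1. Proof. exact: onf_nn. Qed.

Lemma negform_exceeds b i : idx p i -> maxr 0 (b - term p i) <= negform ip p b (e i).
Proof.
move=> Ii; have [h1 h2] := he Ii.
rewrite ge_max (negform_ge0 Hip gp) /=.
by have := negform_ge Hip gp b h1; rewrite h2 n1 // mulr1.
Qed.

Lemma excess_below_realizing : excess_below p.
Proof.
move=> b s b0 sI; apply: le_trans (negform_trace Hip gp ne b0 oe _ sI); last first.
  by move=> i /he[].
by rewrite big_seq [X in _ <= X]big_seq; apply: ler_sum => i is_; apply: negform_exceeds; exact: sI.2.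
Qed.

Let hx := excess_below_realizing.

(** Whatever the negative form of the vectors exceeds their diagonal excess by is paid for by the
    gap: any finite s can be enlarged by t, and the trace inequality holds for the union. *)
Lemma excess_gap b t : b < 0 -> seq_in (idx p) t ->
  \sum_(i <- t) (negform ip p b (e i) - maxr 0 (b - term p i)) <= lam p b - fine (f_d p b).
Proof.
move=> b0 [ut tI].
suff : fine (f_d p b) <= lam p b - \sum_(i <- t) (negform ip p b (e i) - maxr 0 (b - term p i)) by lra.
rewrite -lee_fin -(f_d_fin Hip gp ne hx b0) f_d_low //; apply: lexc_le => s [us sI].
rewrite lee_fin; pose w := undup (s ++ t).
have wI : seq_in (idx p) w.
  split; first exact: undup_uniq.
  by move=> i; rewrite mem_undup mem_cat => /orP[/sI|/tI].
have g0 i : i \in w -> 0 <= negform ip p b (e i) - maxr 0 (b - term p i).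
  by move=> iw; rewrite subr_ge0; apply: negform_exceeds; exact: wI.2.
have h1 : \sum_(i <- s) maxr 0 (b - term p i) <= \sum_(i <- w) maxr 0 (b - term p i).
  apply: sum_subset => //; first exact: undup_uniq.
    by move=> i is_; rewrite mem_undup mem_cat is_.
  by move=> i _; rewrite le_max lexx.
have h2 : \sum_(i <- t) (negform ip p b (e i) - maxr 0 (b - term p i)) <=
    \sum_(i <- w) (negform ip p b (e i) - maxr 0 (b - term p i)).
  apply: sum_subset => //; first exact: undup_uniq.
  by move=> i it; rewrite mem_undup mem_cat it orbT.
have h3 : \sum_(i <- w) negform ip p b (e i) <= lam p b.
  by apply: (negform_trace Hip gp ne b0 oe _ wI) => i /he[].
have h4 : \sum_(i <- w) (negform ip p b (e i) - maxr 0 (b - term p i)) = \sum_(i <- w) negform ip p b (e i) - \sum_(i <- w) maxr 0 (b - term p i) by rewrite sumrB.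
by lra.
Qed.

Let gap1 b i : b < 0 -> idx p i ->
  negform ip p b (e i) - maxr 0 (b - term p i) <= lam p b - fine (f_d p b).
Proof.
move=> b0 Ii; have := @excess_gap b [:: i] b0; rewrite big_seq1; apply.
by split => // j; rewrite inE => /eqP ->.
Qed.

Let neg_spr b x : b < 0 -> negform ip p b (P `]-oo, 0[ x) = negform ip p b x.
Proof.
move=> b0; rewrite /negform; suff -> : P `]-oo, b] (P `]-oo, 0[ x) = P `]-oo, b] x by [].
by rewrite (sm_sub' hP) // => t /=; rewrite !in_itv /=; lra.
Qed.

Let C0 : ~` `]-oo, 0[%classic = `[0, +oo[%classic :> set R.
Proof. by apply/seteqP; split=> t /=; rewrite !in_itv /= ?andbT leNgt => /negP. Qed.

(** As the gap comes arbitrarily close to 0, no e i can have a negative form exceeding its diagonal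
    excess. For d i >= 0 this kills the part of e i in []-oo, 0[]. For d i < 0 it shows that this
    part has form value at least d i, so the remaining part has value at most 0 and lies in the
    kernel. *)
Lemma decouple i : deltaL p = 0%E -> idx p i ->
  [/\ 0 <= term p i -> spr p `[0, +oo[ (e i), term p i < 0 -> spr p `]-oo, 0] (e i) &
      term p i = 0 -> spr p [set 0] (e i)].
Proof.
move=> d0 Ii; have [Si qi] := he Ii.
have freq (r r0 : R) : 0 < r -> 0 < r0 -> exists2 b : R, - r0 < b < 0 & lam p b - fine (f_d p b) < r.
  by move=> r1 r2; apply: (deltaL_lt Hip gp ne hx) => //; rewrite d0 lte_fin.
set y := P `]-oo, 0[ (e i); set z := P (~` `]-oo, 0[) (e i).
have hy : spr p `]-oo, 0[ y by exact: spr_sm.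
have mC := measurableC (mO 0).
have hz : spr p `[0, +oo[ z by rewrite -C0; exact: spr_sm.
have ez : e i = y + z by exact: (sm_split Hip hP (mO 0) Si).
have qyz : term p i = q y + q z by rewrite -qi (spr_rp_split Hip gp (mO 0) Si).
have pos : 0 <= term p i -> spr p `[0, +oo[ (e i).
  move=> ti; suff y0 : y = 0 by rewrite ez y0 add0r.
  apply: contrapT => y0; have [a a0 ha] := negform_gt0 Hip gp hy y0.
  have [b /andP[ab b0] hb] := freq _ (- a) ha ltac:(lra).
  have := gap1 b0 Ii; have := negform_mono Hip gp (e i) (b := b) (a := a).
  rewrite (max_idPl _); last by lra.
  rewrite neg_spr // in ha hb => h1 h2; have := h1 ltac:(lra); lra.
have kerz : q z <= 0 -> spr p [set 0] z.
  move=> qz; have hz0 : P `]0, +oo[ z = 0.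
    apply: contrapT => w0.
    have := spr_rray_gt Hip gp (spr_sm ip p _ z) (lexx 0) w0; rewrite mul0r => hw.
    have Sz : S z by exact: (spr_S gp (mP 0)) hz.
    have := spr_rp_split Hip gp (mQ 0) Sz.
    have h0 : 0 * nn (P (~` `]0, +oo[) z) <= q (P (~` `]0, +oo[) z).
      apply: (spr_ge Hip gp (mP 0)) => [t|]; first by rewrite /= in_itv /= andbT.
      apply/(sprP gp) => //; rewrite (sm_comm hP) //; last exact: measurableC.
      by rewrite ((sprP gp _ (mP 0)).1 hz).
    by rewrite mul0r in h0; lra.
  apply/(sprP gp) => //.
  have e0 : `[0, +oo[%classic = [set 0] `|` `]0, +oo[%classic :> set R.
    apply/seteqP; split=> t /=; rewrite !in_itv /= ?andbT.
      by rewrite le_eqVlt => /orP[/eqP <-|]; [left|right].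
    by case=> [->|/ltW].
  rewrite -[RHS]((sprP gp _ (mP 0)).1 hz) e0 (sm_U Hip hP) // ?hz0 ?addr0 //.
  by rewrite -subset0 => t /= [->]; rewrite in_itv /= ltxx.
split => // [ti|ti].
  have qy : term p i <= q y.
    suff : - q y <= - term p i by lra.
    apply/ler_addgt0Pr => r r0.
    (* The bound -d i on |b| keeps b above d i, so that the positive part equals b - d i. *)
    have [b /andP[ab b0] hb] := freq (r / 2) (Num.min (r / 2) (- term p i)) ltac:(lra) ltac:(by rewrite lt_min; apply/andP; split; lra).
    have m1' : Num.min (r / 2) (- term p i) <= r / 2 by rewrite ge_min lexx.
    have m2' : Num.min (r / 2) (- term p i) <= - term p i by rewrite ge_min lexx orbT.
    have := gap1 b0 Ii; have := negform_ge Hip gp b (spr_S gp (mO 0) hy).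
    rewrite neg_spr // (max_idPr _); last by move: (Num.min _ _) ab m2' => *; lra.
    have yn : nn y <= 1 by rewrite -(n1 Ii); apply: projection_le => //; exact: (sm_proj hP).
    have := nn_ge0 Hip y => y0.
    by move: (Num.min _ _) ab m1' m2' => *; nra.
  have hz0 := kerz ltac:(lra).
  rewrite ez; apply: subspD; first exact: (spr_subsp Hip gp (mL 0)).
    by apply: (spr_sub gp (mO 0)) hy => // t /=; rewrite !in_itv /=; exact: ltW.
  by apply: (spr_sub gp (m1 0)) hz0 => // t /= ->; rewrite in_itv /=.
have hp := pos ltac:(by rewrite ti).
have y0 : y = 0.
  by apply: (spr_disj Hip gp (mO 0) (mP 0) _ hp); rewrite -C0 setICr.
have -> : e i = z by rewrite ez y0 add0r.
by apply: kerz; rewrite -ti qyz y0 (lin0 _) ?rip ?ip0l; [rewrite /rip ip0l Re0; lra|case: gp => -[]].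
Qed.

Lemma card_kernel : deltaL p = 0%E ->
  d_in p (fun t => t = 0) #<= lambda_in p (fun t => t = 0).
Proof.
move=> d0; apply: card_le_sizes.
have sK := spr_subsp Hip gp (m1 0).
have [iK|fK] := pselect (dim_infinite (spr p [set 0])).
  left; apply/infiniteP.
  have inj : {in [set: nat] &, injective (fun k : nat => (0, k) : R * nat)} by move=> a b _ _ [].
  rewrite -(card_le_eql (inj_card_eq inj)); apply: subset_card_le => _ [k _ <-].
  by split => //; rewrite /eig_index /= (spr_eigenspace Hip gp); exact: iK.
right; have [n hn] := kernel_findim_index Hip gp fK.
exists [seq (0, k) | k <- iota 0 n]; split.
- by rewrite map_inj_uniq ?iota_uniq // => a b [].
- by move=> j /mapP[k]; rewrite mem_iota /= => kn ->; split => //; exact/(hn k).2.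
- move=> s [us sJ]; rewrite size_map size_iota; apply/(hn _).1.
  apply: (@orthn_dim_ge _ _ ip _ _ (fun k => e (nth 0%N s k))).
    move=> a b an bn; have Ia := (sJ _ (mem_nth 0%N an)).1; have Ib := (sJ _ (mem_nth 0%N bn)).1.
    by rewrite oe // nth_uniq.
  move=> k ks; have [Ik tk] := sJ _ (mem_nth 0%N ks).
  by have [_ _] := decouple d0 Ik; exact.
Qed.

(** If only finitely many eigenvalues are at or below 0, their eigenvectors exhaust the range of
    []-oo, 0]], which by decoupling contains all e i with d i <= 0. *)
Lemma card_nonpos : deltaL p = 0%E ->
  d_in p (fun t => t <= 0) #<= lambda_in p (fun t => t <= 0).
Proof.
move=> d0; apply: card_le_sizes.
have sK := spr_subsp Hip gp (m1 0).
have [iX|/contrapT fX] := pselect (infinite_set (lambda_in p (fun t => t <= 0))); [by left|right].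
have fK : ~ dim_infinite (spr p [set 0]).
  move=> iK; apply: infinite_nat.
  have := finite_image (fun j : R * nat => j.2) fX; apply: sub_finite_set => k _.
  exists (0, k) => //; split => //=.
  by rewrite /eig_index /= (spr_eigenspace Hip gp); exact: iK.
have [n [u [ou Ku cu _]]] := findim_basis Hip sK ((findimP Hip sK).2 fK).
have [m hm] := kernel_findim_index Hip gp fK.
have [f [h1 h2 h3]] := eigen_family Hip gp ne.
have [r0 hr0] := (finite_seqP _).1 fX.
pose r := undup r0.
have hr j : lambda_in p (fun t => t <= 0) j <-> j \in r by rewrite mem_undup hr0.
exists r; split; first exact: undup_uniq.
  by move=> j /hr.
move=> s [us sJ]; rewrite leqNgt; apply/negP => rs.
pose j0 : R * nat := (0, 0%N).
pose g (j : R * nat) := if j.1 < 0 then f j else u j.2.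
have dV : dim_ge (spr p `]-oo, 0]) (size s).
  apply: (@orthn_dim_ge _ _ ip _ _ (fun k => e (nth 0%N s k))).
    move=> a b an bn; have Ia := (sJ _ (mem_nth 0%N an)).1; have Ib := (sJ _ (mem_nth 0%N bn)).1.
    by rewrite oe // nth_uniq.
  move=> k ks; have [Ik tk] := sJ _ (mem_nth 0%N ks).
  have [_ h4 h5] := decouple d0 Ik; move: tk; rewrite le_eqVlt => /orP[/eqP /h5 hk|/h4 //].
  by apply: (spr_sub gp (m1 0)) hk => // t /= ->; rewrite in_itv /=.
have [v [Vv v1 vg]] := dim_ge_perp Hip (fun k => g (nth j0 r k)) (spr_subsp Hip gp (mL 0))
  (dim_ge_le rs dV).
have vj j : j \in r -> ip v (g j) = 0.
  by move=> jr; have := vg (index j r); rewrite nth_index // index_mem; exact.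
suff v0 : v = 0 by move: v1; rewrite v0 nn0 => /eqP; rewrite eq_sym oner_eq0.
have e0 : `]-oo, 0]%classic = `]-oo, 0[%classic `|` [set 0] :> set R.
  apply/seteqP; split=> t /=; rewrite !in_itv /=.
    by rewrite le_eqVlt => /orP[/eqP ->|]; [right|left].
  by case=> [/ltW|->].
rewrite -((sprP gp _ (mL 0)).1 Vv) e0 (sm_U Hip hP) //; last first.
  by rewrite -subset0 => t /= [+ tt]; rewrite tt in_itv /= ltxx.
have -> : P [set 0] v = 0.
  apply: cu; first exact: spr_sm.
  move=> k kn; rewrite (sm_sa hP (m1 0)) ((sprP gp _ (m1 0)).1 (Ku k kn)).
  have := vj (0, k); rewrite /g /= ltxx; apply; apply/hr; split => //=.
  rewrite /eig_index /= (spr_eigenspace Hip gp).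
  by apply: (orthn_dim_ge (u := u) (ip := ip)) => [|i ik]; [apply: orthn_sub ou => i /= ik; exact: leq_trans kn|exact/Ku/(leq_trans ik)].
rewrite addr0; apply: contrapT => w0.
have [a a0 ha] := negform_gt0 Hip gp (spr_sm ip p _ v) w0.
have [t [ut ht]] := eigle_seq Hip gp ne h1 h2 a0.
move: ha; rewrite neg_spr // (negformE Hip gp h1 h2 h3 v a0 ut ht) big_seq big1 ?ltxx // => j /ht ej.
have [nj1 nj2] := eigle_neg a0 ej.
have := vj j; rewrite /g nj2 => ->; first by rewrite ab20 mulr0.
by apply/hr; split => //; exact: ltW.
Qed.

(** A finite lower limit of the gap bounds the total by which the negative parts exceed the diagonal
    excesses; the form of E on its positive part is then controlled by the positive entries up to a
    constant independent of t. *)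
Lemma trace_above (k : R) B : (deltaL p < +oo)%E -> 0 < k -> measurable B ->
  (forall t, B t -> k <= t) ->
  exists C, forall t, seq_in (idx p) t ->
    \sum_(i <- t) k * nn (P B (e i)) <= C + \sum_(i <- t) maxr 0 (term p i).
Proof.
move=> dl k0 mB Bk.
have [C hC] : exists C : R, (deltaL p < C%:E)%E.
  have := deltaL_ge0 Hip gp ne hx; case: (deltaL p) dl => // r _ _.
  by exists (r + 1); rewrite lte_fin; lra.
exists (C + 1) => t tI.
have r0 : 0 < (size t)%:R + 1 :> R by rewrite ltr_wpDl // ler0n.
(* With |b| below 1 / (|t| + 1), an error |b| in each of the |t| terms adds up to at most 1. *)
have [b /andP[b1 b0] hb] := deltaL_lt Hip gp ne hx hC (e0 := ((size t)%:R + 1)^-1) ltac:(by rewrite invr_gt0).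
have h1 := excess_gap b0 tI.
have key i : idx p i -> k * nn (P B (e i)) <= maxr 0 (term p i) +
    (negform ip p b (e i) - maxr 0 (b - term p i)) - b.
  move=> Ii; have [Si qi] := he Ii.
  have mC := measurableC (mO 0).
  have := spr_rp_split Hip gp (mO 0) Si; rewrite qi C0 => e1.
  have e2 := negform_ge Hip gp b (spr_S gp (mO 0) (spr_sm ip p `]-oo, 0[ (e i))).
  rewrite neg_spr // in e2.
  have yn : nn (P `]-oo, 0[ (e i)) <= 1.
    by rewrite -(n1 Ii); apply: projection_le => //; exact: (sm_proj hP).
  have y0 := nn_ge0 Hip (P `]-oo, 0[ (e i)).
  have e3 : k * nn (P B (e i)) <= q (P `[0, +oo[ (e i)).
    have Sz : S (P `[0, +oo[ (e i)) by exact: (sm_in hP).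
    rewrite (spr_rp_split Hip gp mB Sz).
    have eB : P B (P `[0, +oo[ (e i)) = P B (e i).
      rewrite (sm_sub' hP) // => s /Bk ks; rewrite /= in_itv /= andbT.
      exact: le_trans (ltW k0) ks.
    rewrite eB; have h2 := spr_ge Hip gp mB Bk (spr_sm ip p B (e i)).
    have h3 : 0 * nn (P (~` B) (P `[0, +oo[ (e i))) <= q (P (~` B) (P `[0, +oo[ (e i))).
      apply: (spr_ge Hip gp (mP 0)) => [s|]; first by rewrite /= in_itv /= andbT.
      apply/(sprP gp) => //; rewrite (sm_comm hP) //; last exact: measurableC.
      by rewrite (sm_idem hP).
    by rewrite mul0r in h3; lra.
  have m2 : maxr 0 (b - term p i) <= maxr 0 (term p i) + b - term p i - b + (- b) + b.
    by rewrite !maxEle; case: ifP => h2; case: ifP => h3; lra.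
  by move: (maxr 0 (b - _)) (maxr 0 (term _ _)) m2 => *; nra.
apply: (@le_trans _ _ (\sum_(i <- t) (maxr 0 (term p i) +
    (negform ip p b (e i) - maxr 0 (b - term p i)) - b))).
  by rewrite big_seq [X in _ <= X]big_seq; apply: ler_sum => i it; apply: key; exact: tI.2.
rewrite big_split /= big_split /= big_const_seq count_predT iter_addr_0 -mulr_natl.
have : (size t)%:R * - b <= 1.
  have s0 : 0 <= (size t)%:R :> R by [].
  have : - b <= ((size t)%:R + 1)^-1 by lra.
  move=> hb'; apply: (@le_trans _ _ ((size t)%:R * ((size t)%:R + 1)^-1)).
    by rewrite ler_wpM2l.
  by rewrite ler_pdivrMr //; lra.
by move: hb h1; lra.
Qed.

(** Orthonormal vectors v k in the range of B and orthogonal to the finite-dimensional defect lie in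
    the closed span of the e i; a common finite part of the family captures at least half of the
    squared norm of each. *)
Lemma trace_infinite B : measurable B -> dim_infinite (spr p B) ->
  findim ip [set x | S x /\ forall i, idx p i -> ip x (e i) = 0] ->
  forall n : nat, exists2 t, seq_in (idx p) t & n%:R / 2 <= \sum_(i <- t) nn (P B (e i)).
Proof.
move=> mB iB fZ n; set Z := [set x | _] in fZ.
have mT : measurable (setT : set R) by [].
have cS : csub ip S.
  rewrite (_ : S = spr p setT); first exact: spr_csub.
  by apply/seteqP; split => x /(spr_T gp).
have sZ : subsp Z.
  split; first by split; [exact: cS.1.1|move=> i _; rewrite ip0l].
  move=> c x y [Sx hx1] [Sy hy1]; split; first by case: cS.1 => _; exact.
  by move=> i Ii; rewrite ipDl ipZl hx1 // hy1 // mulr0 addr0.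
have [r [z [oz Zz cz _]]] := findim_basis Hip sZ fZ.
have sB := spr_subsp Hip gp mB.
pose W := spr p B `&` [set x | forall y, (exists2 k, (k < r)%N & y = z k) -> ip x y = 0].
have cW : csub ip W by apply: csubI; [exact: spr_csub|exact: (csub_perp Hip)].
have iW : dim_infinite W.
  apply/(not_findimP Hip cW.1) => -[N [F hF]].
  have /(not_findimP Hip sB) := iB; apply.
  exists (N + r)%N, (fun k => if (k < N)%N then F k else z (k - N)%N) => v Bv hv.
  apply: hF; last by move=> k kN; have := hv k (ltn_addr _ kN); rewrite kN.
  split => // _ [k kr ->]; have := hv (N + k)%N; rewrite ltn_add2l kr => /(_ erefl).
  by rewrite ltnNge leq_addr /= addKn.
have [v [ov Wv]] := orthn_of_dim_infinite cW.1 iW.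
have vc k : in_cspan ip (idx p) e (v k).
  move=> y hy; have [Bv vz] := Wv k; have Sv := spr_S gp mB Bv.
  rewrite -(proj_id Hip cS Sv) (proj_sa Hip cS); set w := proj Hip cS y.
  have Zw : Z w.
    split; first exact: proj_in.
    by move=> i Ii; rewrite proj_ip ?hy //; case: (he Ii).
  pose X : set nat := `I_r.
  have sX : seq_in X (iota 0 r) by split; [exact: iota_uniq|move=> i; rewrite mem_iota].
  rewrite -(@fsum_complete _ _ _ ip X z (iota 0 r) Z w oz sX sZ) //.
  + rewrite /fsum ip_sumr big_seq big1 // => i; rewrite mem_iota => /= ir.
    by rewrite ipZr vz ?mulr0 //; exists i.
  + by move=> i; rewrite mem_iota; exact: Zz.
  + by move=> x Zx hx1; apply: cz => // i ir; apply: hx1; rewrite mem_iota.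
have [N hN] : exists N, forall k, (k < n)%N -> 2^-1 <= psq ip (idx p) e (v k) N.
  elim: n => [|n [N hN]]; first by exists 0%N.
  have h2 : 0 < 2^-1 :> R by rewrite invr_gt0.
  have [N' hN'] := psum_cvg Hip oe (vc n) h2.
  have mono M M' k : (M <= M')%N -> psq ip (idx p) e (v k) M <= psq ip (idx p) e (v k) M'.
    by move/subnK <-; elim: (M' - M)%N => [//|i IH]; rewrite addSn; apply: le_trans IH (psq_mono _ _ _ _ _).
  exists (maxn N N') => k; rewrite ltnS leq_eqVlt => /orP[/eqP ->|kn].
    have := hN' (maxn N N') (leq_maxr _ _); rewrite nnBC nn_psum // (onf_nn ov Logic.I).
    by lra.
  by apply: le_trans (hN k kn) (mono _ _ _ (leq_maxl _ _)).
pose t := [seq i <- iota 0 N | `[< idx p i >]].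
have tI : seq_in (idx p) t.
  by split; [rewrite filter_uniq // iota_uniq|move=> i; rewrite mem_filter => /andP[/asboolP]].
exists t => //.
apply: (@le_trans _ _ (\sum_(i <- t) \sum_(k <- iota 0 n) ab2 (ip (P B (e i)) (v k)))); last first.
  apply: ler_sum => i _; apply: (bessel Hip _ ov); split => //; exact: iota_uniq.
rewrite exchange_big /=.
apply: (@le_trans _ _ (\sum_(k <- iota 0 n) 2^-1)).
  by rewrite big_const_seq count_predT size_iota iter_addr_0 mulr_natl.
rewrite big_seq [X in _ <= X]big_seq; apply: ler_sum => k; rewrite mem_iota => /= kn.
apply: le_trans (hN k kn) _; rewrite /psq /t big_filter -(big_mkord (fun i => `[< idx p i >]) (fun i => ab2 (ip (v k) (e i)))).
rewrite /index_iota subn0 le_eqVlt; apply/orP; left; apply/eqP; apply: eq_bigr => i _.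
have [Bv _] := Wv k.
by rewrite (sm_sa hP mB) ((sprP gp _ mB).1 Bv) ipC ab2J.
Qed.

End LowNecessity.

(** The divergence alternatives come from a spectral window B around the interior essential point a:
    its trace along the family is infinite, while a finite gap limit and convergent sums would bound
    it through [trace_above]. *)
Lemma necessity p e (a : R) : good ip p ->
  (forall l, l < 0 -> ~ ess ip p l) -> (forall l, 1 < l -> ~ ess ip p l) ->
  0 < a < 1 -> ess ip p a -> realizing p e -> necessity_test p.
Proof.
move=> gp ne0 ne1 /andP[a0 a1] ea re.
have gr := good_reflect Hip gp.
have nr l : l < 0 -> ~ ess ip (reflect p) l.
  by move=> l0 /(ess_reflect Hip _ gp); apply: ne1; lra.
have [oe he fZ] := re; have [or hr frZ] := realizing_reflect re.
have xL := excess_below_realizing gp ne0 oe he.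
have xU := excess_below_realizing gr nr or hr.
pose k := Num.min a (1 - a) / 2.
have [k0 k1 k2] : [/\ 0 < k, 2 * k <= a & 2 * k <= 1 - a].
  have h0 : 0 < Num.min a (1 - a) by rewrite lt_min a0 subr_gt0.
  have h1 : Num.min a (1 - a) <= a by rewrite ge_min lexx.
  have h2 : Num.min a (1 - a) <= 1 - a by rewrite ge_min lexx orbT.
  by rewrite /k; move: (Num.min _ _) h0 h1 h2 => *; split; lra.
pose B : set R := `]a - k, a + k[%classic.
have mB : measurable B by exact: measurable_itv.
have iB : dim_infinite (spr p B) := ea k k0.
have tinf := trace_infinite gp oe he mB iB fZ.
pose B' : set R := `](1 - a) - k, (1 - a) + k[%classic.
have mB' : measurable B' by exact: measurable_itv.
have eB x : sm ip (reflect p) B' x = sm ip p B x.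
  have [_ h] := good_affine Hip gp (reflect_op p) (erefl (space p)); rewrite h //.
  congr (sm ip p _ x); apply/seteqP; split=> t; rewrite /B /B' /= !in_itv /= => /andP[h1 h2];
  by apply/andP; split; lra.
have Bk t : B t -> k <= t by rewrite /B /= in_itv /= => /andP[h _]; lra.
have Bk' t : B' t -> k <= t by rewrite /B' /= in_itv /= => /andP[h _]; lra.
have contra C : (forall t, seq_in (idx p) t -> \sum_(i <- t) k * nn (sm ip p B (e i)) <= C) -> False.
  move=> hC.
  have [t tI ht] := tinf (Num.bound (2 * `|C| / k)).
  have := hC t tI; rewrite -mulr_sumr.
  have c0 : 0 <= 2 * `|C| / k by apply: divr_ge0; [rewrite mulr_ge0|exact: ltW].
  have := archi_boundP c0; rewrite ltr_pdivrMr // => h1.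
  have : k * ((Num.bound (2 * `|C| / k))%:R / 2) <= k * \sum_(i <- t) nn (sm ip p B (e i)).
    by rewrite ler_pM2l.
  have := ler_norm C; move: h1; move: (Num.bound _)%:R (\sum_(_ <- _) _) => N S hC' h1 h2 h3.
  have e2 : k * (N / 2) = N * k / 2 by rewrite mulrA [k * N]mulrC.
  have := le_trans (le_trans h2 h3) h1; rewrite e2 ler_pdivrMr // => h4.
  by have := lt_le_trans hC' h4; rewrite mulrC ltxx.
have claimL : (deltaL p < +oo)%E -> \esum_(i in d_in p (fun t => 0 < t)) (term p i)%:E = +oo%E.
  move=> dl; apply: contrapT => nd.
  have [C hC] := trace_above gp ne0 oe he dl k0 mB Bk.
  set E := (esum _ _) in nd.
  have E0 : (0 <= E)%E by apply: esum_ge0 => i [_ ti]; rewrite lee_fin ltW.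
  have [D hD] : exists D : R, E = D%:E by move: nd E0; case: (E) => // D _ _; exists D.
  apply: (contra (C + D)) => t tI; apply: le_trans (hC t tI) _; rewrite lerD2l.
  rewrite -lee_fin -hD.
  have -> : \sum_(i <- t) maxr 0 (term p i) = \sum_(i <- [seq i <- t | 0 < term p i]) term p i.
    rewrite big_filter [RHS]big_mkcond; apply: eq_bigr => i _; rewrite maxElt; case: ifP => //.
  apply: esum_seq_le; first by move=> i [_ /ltW].
  case: tI => ut tI; split; first exact: filter_uniq.
  by move=> i; rewrite mem_filter => /andP[ti /tI].
have claimU : (deltaU p < +oo)%E -> \esum_(i in d_in p (fun t => t < 1)) (1 - term p i)%:E = +oo%E.
  rewrite deltaU_reflect => dl; apply: contrapT => nd.
  have [C hC] := trace_above gr nr or hr dl k0 mB' Bk'.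
  set E := (esum _ _) in nd.
  have E0 : (0 <= E)%E by apply: esum_ge0 => i [_ ti]; rewrite lee_fin; lra.
  have [D hD] : exists D : R, E = D%:E by move: nd E0; case: (E) => // D _ _; exists D.
  apply: (contra (C + D)) => t tI; have := hC t tI; under eq_bigr do rewrite eB.
  move=> h; apply: le_trans h _; rewrite lerD2l.
  rewrite -lee_fin -hD.
  have -> : \sum_(i <- t) maxr 0 (term (reflect p) i) = \sum_(i <- [seq i <- t | term p i < 1]) (1 - term p i).
    rewrite big_filter [RHS]big_mkcond; apply: eq_bigr => i _; rewrite maxElt /= subr_gt0; case: ifP => //.
  apply: esum_seq_le; first by move=> i [_ h']; lra.
  case: tI => ut tI; split; first exact: filter_uniq.
  by move=> i; rewrite mem_filter => /andP[ti /tI].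
have claimB : (deltaL p < +oo)%E -> (deltaU p < +oo)%E -> (f_d p 2^-1 = +oo)%E.
  rewrite deltaU_reflect => dl du; apply: contrapT => nd.
  have [C hC] := trace_above gp ne0 oe he dl k0 mB Bk.
  have [C' hC'] := trace_above gr nr or hr du k0 mB' Bk'.
  have half0 : 0 < 2^-1 :> R by rewrite invr_gt0.
  have half1 : 2^-1 < 1 :> R by rewrite invf_lt1 // ltr1n.
  have l0 : (0 <= lower_sum (idx p) (term p) (2^-1))%E.
    by apply: esum_ge0 => i [_ /andP[]]; rewrite lee_fin.
  have u0 : (0 <= upper_sum (idx p) (term p) (2^-1))%E.
    by apply: esum_ge0 => i [_ /andP[]]; rewrite lee_fin subr_ge0.
  have [[D hD] [D' hD']] : (exists D : R, lower_sum (idx p) (term p) (2^-1) = D%:E) /\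
     (exists D : R, upper_sum (idx p) (term p) (2^-1) = D%:E).
    move: nd; rewrite /f_d /majorization leNgt half0 /= half1.
    have h1' : 0 < 1 - 2^-1 :> R by lra.
    case: (lower_sum _ _ _) l0 => [x| |] // x0; case: (upper_sum _ _ _) u0 => [y| |] // y0.
    - by move=> _; split; [exists x|exists y].
    - by rewrite gt0_muley ?lte_fin //= => /(_ _) /contrapT; case.
    - by rewrite gt0_muley ?lte_fin //=  => /(_ _) /contrapT; case.
    - by rewrite !gt0_muley ?lte_fin //=  => /(_ _) /contrapT; case.
  apply: (contra (C + D + (C' + D'))) => t [ut tI].
  (* Entries below 1/2 are charged to the lower end, the others to the upper end. *)
  rewrite (bigID (fun i => term p i < 2^-1)) /= -big_filter -[X in _ + X]big_filter; apply: lerD.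
    pose t1 := [seq i <- t | term p i < 2^-1]; rewrite -/t1.
    have t1I : seq_in (idx p) t1.
      by split; [exact: filter_uniq|move=> i; rewrite mem_filter => /andP[_ /tI]].
    apply: le_trans (hC t1 t1I) _; rewrite lerD2l -lee_fin -hD.
    have -> : \sum_(i <- t1) maxr 0 (term p i) = \sum_(i <- [seq i <- t1 | 0 <= term p i]) term p i.
      by rewrite [RHS]big_filter [RHS]big_mkcond; apply: eq_bigr => i _; rewrite maxEle; case: ifP.
    apply: esum_seq_le; first by move=> i [_ /andP[]].
    split; first by rewrite !filter_uniq.
    by move=> i; rewrite !mem_filter => /andP[ti /andP[ti' /tI Ii]]; split => //; rewrite ti.
  pose t1 := [seq i <- t | ~~ (term p i < 2^-1)]; rewrite -/t1.
  have t1I : seq_in (idx p) t1.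
    by split; [exact: filter_uniq|move=> i; rewrite mem_filter => /andP[_ /tI]].
  have -> : \sum_(i <- t1) k * nn (sm ip p B (e i)) = \sum_(i <- t1) k * nn (sm ip (reflect p) B' (e i)).
    by apply: eq_bigr => i _; rewrite eB.
  apply: le_trans (hC' t1 t1I) _; rewrite lerD2l -lee_fin -hD'.
  have -> : \sum_(i <- t1) maxr 0 (term (reflect p) i) = \sum_(i <- [seq i <- t1 | term p i <= 1]) (1 - term p i).
    by rewrite [RHS]big_filter [RHS]big_mkcond; apply: eq_bigr => i _; rewrite maxEle /= subr_ge0; case: ifP.
  apply: esum_seq_le; first by move=> i [_ /andP[_ h']]; lra.
  split; first by rewrite !filter_uniq.
  move=> i; rewrite !mem_filter => /andP[ti /andP[ti' /tI Ii]]; split => //.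
  by rewrite leNgt ti'.
have dL0 := deltaL_ge0 Hip gp ne0 xL.
have dU0 := deltaL_ge0 Hip gr nr xU; rewrite -deltaU_reflect in dU0.
split.
- move=> fI; have /(not_findimP Hip (spr_subsp Hip gp mB)) := iB; apply.
  have [r hr'] := (finite_seqP _).1 fI; have [N [F hF]] := fZ.
  exists (N + size r)%N, (fun k => if (k < N)%N then F k else e (nth 0%N r (k - N))).
  move=> v Bv hv; apply: hF; last by move=> i iN; have := hv i (ltn_addr _ iN); rewrite iN.
  split; first exact: (spr_S gp mB) Bv.
  move=> i; rewrite hr' => ir; have := hv (N + index i r)%N.
  by rewrite ltn_add2l index_mem ir ltnNge leq_addr /= addKn nth_index //; exact.
- move=> c; rewrite negb_and -!ltNge => /orP[c0|c1].
    exact: (excess_belowP Hip gp ne0).2.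
  exact: ((excess_below_reflect Hip gp ne1).1 xU).
- by move=> d0; split; [exact: (card_kernel gp ne0 oe he)|exact: (card_nonpos gp ne0 oe he)].
- rewrite deltaU_reflect => d0.
  have tr (Q Q' : R -> Prop) : (forall t, Q t <-> Q' (1 - t)) ->
      d_in (reflect p) Q' #<= lambda_in (reflect p) Q' -> d_in p Q #<= lambda_in p Q.
    move=> QQ; rewrite (card_le_eqr (card_reflect_lambda p Q')) d_in_reflect.
    by have -> : Q = (fun t => Q' (1 - t)) by apply/funext => t; apply/propext/QQ.
  split.
    apply: (tr _ (fun t => t = 0)); last exact: (card_kernel gr nr or hr).
    by move=> t; split=> [->|]; [rewrite subrr|lra].
  apply: (tr _ (fun t => t <= 0)); last exact: (card_nonpos gr nr or hr).
  by move=> t; split; lra.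
case: (ltP (deltaL p) +oo%E) => dl; case: (ltP (deltaU p) +oo%E) => du.
- by apply: Or44; split; [rewrite lte_add_pinfty|exact: claimB].
- by apply: Or42; split; [|apply/eqP; rewrite -leye_eq|exact: claimL].
- by apply: Or43; split; [|apply/eqP; rewrite -leye_eq|exact: claimU].
- by apply: Or41; split; apply/eqP; rewrite -leye_eq.
Qed.

End Necessity.

(** * Affine changes and cuts at the ends of the essential spectrum *)

Section AffineExcess.
Context {R : realType} {K : choiceType}.
Implicit Types (J : set K) (x : K -> R) (a c e : R).

Let pos_scale c u : 0 < c -> maxr 0 (c * u) = c * maxr 0 u.
Proof. by move=> c0; rewrite maxr_pMr ?ltW // mulr0. Qed.

Let excess_le J x a c e : 0 < c ->
  (lower_excess J (fun i => c * x i + e)%R (c * a + e)%R <= c%:E * lower_excess J x a)%E.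
Proof.
move=> c0; apply: lexc_le => s sJ.
have -> : \sum_(i <- s) maxr 0 (c * a + e - (c * x i + e)) = c * \sum_(i <- s) maxr 0 (a - x i).
  by rewrite mulr_sumr; apply: eq_bigr => i _; rewrite -pos_scale //; congr maxr; ring.
by rewrite EFinM lee_pmul2l ?lte_fin //; exact: lexc_seq.
Qed.

(** The reverse inequality is the first one applied to the inverse affine map. *)
Lemma lower_excess_affine J x a c e : 0 < c ->
  lower_excess J (fun i => c * x i + e) (c * a + e) = (c%:E * lower_excess J x a)%E.
Proof.
move=> c0; apply/eqP; rewrite eq_le excess_le //= -lee_pdivlMl //.
have ci : 0 < c^-1 by rewrite invr_gt0.
have := excess_le J (fun i => c * x i + e) (c * a + e) (- (c^-1 * e)) ci.
have h u : c^-1 * (c * u + e) + - (c^-1 * e) = u by field; rewrite gt_eqF.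
by rewrite h; under eq_fun do rewrite h.
Qed.

End AffineExcess.

Section ScaledLimits.
Context {R : realType}.
Implicit Types (f : R -> \bar R) (c e x : R).

Let scale_le (F : set_system R) f c : 0 < c ->
  (c%:E * limf_einf f F <= limf_einf (fun b => c%:E * f b) F)%E.
Proof.
move=> c0; rewrite -lee_pdivlMl // [X in (X <= _)%E]limf_einfE.
apply: ge_ereal_sup => _ [V FV <-]; rewrite lee_pdivlMl //.
apply: (limf_einf_ge FV) => b Vb; rewrite lee_pmul2l ?lte_fin //.
by apply: ereal_inf_lbound; exists b.
Qed.

Lemma limf_einfZ (F : set_system R) f c : 0 < c ->
  limf_einf (fun b => c%:E * f b)%E F = (c%:E * limf_einf f F)%E.
Proof.
move=> c0; apply/eqP; rewrite eq_le scale_le // andbT -lee_pdivrMl //.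
have ci : 0 < c^-1 by rewrite invr_gt0.
apply: le_trans (scale_le F (fun b => c%:E * f b)%E ci) _.
by under eq_fun do rewrite muleA -EFinM mulVf ?gt_eqF // mul1e.
Qed.

Lemma left_limit_affine f x c e : 0 < c ->
  limf_einf (fun b => f (c * b + e)) (at_left x) = limf_einf f (at_left (c * x + e)).
Proof.
move=> c0; have cn : c != 0 by rewrite gt_eqF.
apply: (@limf_einf_comp _ _ _ (fun b => c * b + e) (fun b => c^-1 * (b - e))).
- by move=> b /=; field.
- by move=> b /=; field.
move=> V; split=> [/at_left_setP[k k0 h]|/at_left_setP[k k0 h]]; apply/at_left_setP.
  exists (c^-1 * k) => [|b /andP[b1 b2] /=]; first by rewrite mulr_gt0 ?invr_gt0.
  have b1' : c * x - k < c * b.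
    by rewrite -(ltr_pM2l c0) mulrBr mulrA divff // mul1r in b1.
  by apply: h; rewrite -(ltr_pM2l c0) in b2; apply/andP; split; lra.
exists (c * k) => [|b /andP[b1 b2]]; first by rewrite mulr_gt0.
have -> : b = c * (c^-1 * (b - e)) + e by field.
apply: h; rewrite -(ltr_pM2l c0) -[X in _ && X](ltr_pM2l c0) mulrA divff // mul1r.
by rewrite mulrBr; apply/andP; split; lra.
Qed.

End ScaledLimits.

Section AffinePairs.
Context {R : realType} {H : completeNormedModType R[i]}.
Variable ip : {dot H for Num.conj}.
Hypothesis Hip : inner_product_norm ip.
Implicit Types (x y z v : H) (B C D : set R) (p q : @pair R H) (c e : R).

Local Notation nn := (sqn ip).
Local Notation rp := (rip ip).
Local Notation spr := (spr ip).

Definition aff c e p : pair :=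
  Pair (fun x => c%:C *: op p x + e%:C *: x) (space p) (fun i => c * term p i + e) (idx p).

Lemma aff_aff c e c' e' p : aff c e (aff c' e' p) = aff (c * c') (c * e' + e) p.
Proof.
rewrite /aff /=; congr Pair; apply/funext => x; last by ring.
by rewrite scalerDr !scalerA -addrA -scalerDl rmorphM rmorphD rmorphM.
Qed.

Lemma aff_id p : aff 1 0 p = p.
Proof.
case: p => A S t J; rewrite /aff /=; congr Pair; apply/funext => x.
  by rewrite scale1r scale0r addr0.
by rewrite mul1r addr0.
Qed.

Lemma reflect_aff c e p : reflect (aff c e p) = aff c (1 - e - c) (reflect p).
Proof.
rewrite /reflect /aff /=; congr Pair; apply/funext => x; last by ring.
rewrite scalerBr opprD addrA !rmorphB rmorph1 !scalerBl scale1r.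
by rewrite [RHS]addrC addrA subrK addrAC.
Qed.

Lemma normalizeE p : normalize ip p =
  aff (ess_max ip p - ess_min ip p)^-1
      (- ((ess_max ip p - ess_min ip p)^-1 * ess_min ip p)) p.
Proof.
rewrite /normalize /aff; congr Pair; apply/funext => x.
  by rewrite scalerBr scalerA -rmorphM rmorphN scaleNr.
by rewrite mulrC mulrBr.
Qed.

Section Fixed.
Variables (c e : R) (p : @pair R H).
Hypotheses (c0 : 0 < c) (gp : good ip p).

Let ha := good_affine (q := aff c e p) Hip gp (fun=> erefl) (erefl _).

Lemma good_aff : good ip (aff c e p).
Proof. by case: ha. Qed.

Lemma sm_aff B x : measurable B ->
  sm ip (aff c e p) B x = sm ip p ((fun t => c * t + e) @^-1` B) x.
Proof. by move=> mB; case: ha => _ ->. Qed.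

Lemma spr_aff B : measurable B ->
  spr (aff c e p) B = spr p ((fun t => c * t + e) @^-1` B).
Proof.
by move=> mB; apply: (congr1 (fun f : H -> H => range f)); apply/funext => x; exact: sm_aff.
Qed.

Lemma ess_aff l : ess ip (aff c e p) (c * l + e) <-> ess ip p l.
Proof.
have cn : c != 0 by rewrite gt_eqF.
have h (s : R) : spectral_range ip (aff c e p) `](c * l + e) - c * s, (c * l + e) + c * s[ = spectral_range ip p `]l - s, l + s[.
  rewrite -[LHS]/(spr _ _) spr_aff //; congr (spr p _); apply/seteqP; split=> t /=; rewrite !in_itv /=.
    move=> /andP[h1 h2]; rewrite -(ltr_pM2l c0) -[X in _ && X](ltr_pM2l c0) mulrBr mulrDr.
    by apply/andP; split; lra.
  rewrite -(ltr_pM2l c0) -[X in _ && X](ltr_pM2l c0) mulrBr mulrDr => /andP[h1 h2].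
  by apply/andP; split; lra.
split=> hh s s0; first by have := hh (c * s) (mulr_gt0 c0 s0); rewrite h.
have := hh (c^-1 * s); rewrite -h mulrA divff // mul1r; apply.
by rewrite mulr_gt0 ?invr_gt0.
Qed.

Lemma right_ess_aff l : right_ess ip (aff c e p) (c * l + e) <-> right_ess ip p l.
Proof.
have cn : c != 0 by rewrite gt_eqF.
have h (s : R) : spectral_range ip (aff c e p) `[c * l + e, (c * l + e) + c * s] = spectral_range ip p `[l, l + s].
  rewrite -[LHS]/(spr _ _) spr_aff //; congr (spr p _); apply/seteqP; split=> t /=; rewrite !in_itv /=.
    move=> /andP[h1 h2]; rewrite -(ler_pM2l c0) -[X in _ && X](ler_pM2l c0) mulrDr.
    by apply/andP; split; lra.
  rewrite -(ler_pM2l c0) -[X in _ && X](ler_pM2l c0) mulrDr => /andP[h1 h2].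
  by apply/andP; split; lra.
split=> hh s s0; first by have := hh (c * s) (mulr_gt0 c0 s0); rewrite h.
have := hh (c^-1 * s); rewrite -h mulrA divff // mul1r; apply.
by rewrite mulr_gt0 ?invr_gt0.
Qed.

Lemma eigenspace_aff t : eigenspace (aff c e p) (c * t + e) = eigenspace p t.
Proof.
have cn : c%:C != 0 :> R[i] by apply/eqP => /(congr1 (@complex.Re R)) /= c1; move: c0; rewrite c1 ltxx.
apply/seteqP; split=> x [Sx /= h]; split => //=; last first.
  by rewrite h scalerA -scalerDl rmorphD rmorphM.
move: h; rewrite rmorphD rmorphM scalerDl => /addIr; rewrite -scalerA => /(scalerI cn) //.
Qed.

Let shift (j : R * nat) : R * nat := (c * j.1 + e, j.2).
Let shift_inj : injective shift.
Proof.
case=> t k [t' k']; rewrite /shift /= => -[/addIr /mulfI h ->].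
by rewrite h // gt_eqF.
Qed.

Lemma eig_excess_aff a : lower_excess (eig_index (aff c e p)) fst (c * a + e) =
  (c%:E * lower_excess (eig_index p) fst a)%E.
Proof.
have cn : c != 0 by rewrite gt_eqF.
rewrite -(lower_excess_affine (eig_index p) fst a e c0) /lower_excess.
rewrite (reindex_esum [set i | eig_index p i /\ c * i.1 + e <= c * a + e] _ shift) //.
split.
- by move=> [t k] [/= h h']; split => //; rewrite /eig_index /= eigenspace_aff.
- by move=> x y _ _; exact: shift_inj.
- move=> [t k] [/= h h']; exists (c^-1 * (t - e), k); last first.
    by rewrite /shift /=; congr (_, _); field.
  have tE : c * (c^-1 * (t - e)) + e = t by field.
  by split; rewrite /= ?tE //; rewrite /eig_index /= -eigenspace_aff tE.
Qed.

End Fixed.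

Lemma realizable_aff c e p : 0 < c -> realizable ip (aff c e p) -> realizable ip p.
Proof.
move=> c0 [u [ou hu cu]]; exists u; split => // i Ji; have [Su] := hu i Ji; split => //.
move: b; rewrite /= rpDl !rpZl -nnE (onf_nn ou Ji) mulr1 => /addIr /mulfI; apply.
by rewrite gt_eqF.
Qed.

Lemma realizing_aff c e p u : realizing ip p u -> realizing ip (aff c e p) u.
Proof.
move=> [ou hu cu]; split => // i Ji; have [Su h] := hu i Ji; split => //.
by rewrite /= rpDl !rpZl -nnE (onf_nn ou Ji) mulr1 h.
Qed.

End AffinePairs.

Section EndsOfSpectrum.
Context {R : realType} {H : completeNormedModType R[i]}.
Variable ip : {dot H for Num.conj}.
Hypothesis Hip : inner_product_norm ip.
Implicit Types (x y z v : H) (B C D : set R) (p q : @pair R H) (c e : R).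

Local Notation nn := (sqn ip).
Local Notation rp := (rip ip).
Local Notation spr := (spr ip).
Local Notation ess := (ess ip).
Local Notation ess_min := (ess_min ip).
Local Notation ess_max := (ess_max ip).

Lemma dim_infinite_sub (V W : set H) : V `<=` W -> dim_infinite V -> dim_infinite W.
Proof. by move=> VW h n; have [v [Vv fv]] := h n; exists v; split => // k; exact: VW. Qed.

Lemma spr_dim_sub p B C : good ip p -> measurable B -> measurable C -> B `<=` C ->
  dim_infinite (spr p B) -> dim_infinite (spr p C).
Proof. by move=> gp mB mC BC; apply: dim_infinite_sub => x; exact: (spr_sub gp mB mC BC). Qed.

Lemma ess_closed p l : good ip p ->
  (forall e, 0 < e -> exists2 l', ess p l' & `|l - l'| < e) -> ess p l.
Proof.
move=> gp h e e0; have [l' el' hl'] := h (e / 2) (divr_gt0 e0 (ltr0Sn R 1)).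
apply: (spr_dim_sub gp _ _ _ (el' (e / 2) (divr_gt0 e0 (ltr0Sn R 1)))); try exact: measurable_itv.
move: hl'; rewrite ltr_norml => /andP[h1 h2] t /=; rewrite !in_itv /= => /andP[h3 h4].
by apply/andP; split; lra.
Qed.

Let ess_low p : good ip p -> exists a : R, forall l, ess p l -> a <= l.
Proof.
move=> gp; have [a ha] := spr_low0 Hip gp; exists (a - 1) => l el.
rewrite leNgt; apply/negP => la; have [v [Vv fv]] := el 1 ltr01 1%N.
have h0 k : v k = 0.
  have : spr p `]-oo, a] (v k).
    apply: (spr_sub gp _ _ _ (Vv k)); try exact: measurable_itv.
    by move=> t /=; rewrite !in_itv /= => /andP[_ h]; lra.
  by move=> /(sprP gp _ (measurable_itv _)); rewrite ha => <-.
have /fv/(_ ord0)/eqP : \sum_(k < 1) (1 : R[i]) *: v k = 0.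
  by rewrite big1 // => k _; rewrite h0 scaler0.
by rewrite oner_eq0.
Qed.

Lemma ess_min_unique p m : ess p m -> (forall l, ess p l -> m <= l) -> ess_min p = m.
Proof.
move=> em hm; apply/eqP; rewrite eq_le; apply/andP; split.
  by apply: ge_inf => //; exists m.
by apply: lb_le_inf; [exists m|exact: hm].
Qed.

Lemma ess_max_unique p m : ess p m -> (forall l, ess p l -> l <= m) -> ess_max p = m.
Proof.
move=> em hm; apply/eqP; rewrite eq_le; apply/andP; split.
  by apply: ge_sup; [exists m|exact: hm].
by apply: ub_le_sup => //; exists m.
Qed.

(** The invariant of all stages. An infinite essential spectrum separates the two ends, supplies
    interior essential points, and stays infinite when a cut removes an end. *)
Definition regular p := good ip p /\ infinite_set (ess p).

Lemma regular_ess p : regular p -> exists l, ess p l.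
Proof.
move=> [_ i]; apply: contrapT => h; apply: i; rewrite (_ : ess p = set0); first exact: finite_set0.
by apply/seteqP; split=> // l el; case: h; exists l.
Qed.

Let least p : regular p -> exists2 m, ess p m & forall l, ess p l -> m <= l.
Proof.
move=> rp; have gp := rp.1; have [a ha] := ess_low gp.
have hi : has_inf (ess p) by split; [exact: regular_ess|exists a].
exists (inf (ess p)) => [|l el]; last by apply: ge_inf => //; exists a.
apply: (ess_closed gp) => e e0; have [l el ll] := inf_adherent e0 hi.
exists l => //; have : inf (ess p) <= l by apply: ge_inf => //; exists a.
by rewrite ltr_norml => h; apply/andP; split; lra.
Qed.

Lemma ess_min_in p : regular p -> ess p (ess_min p).
Proof. by move=> /least[m em hm]; rewrite (ess_min_unique em hm). Qed.

Lemma ess_min_le p l : regular p -> ess p l -> ess_min p <= l.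
Proof. by move=> /least[m em hm]; rewrite (ess_min_unique em hm); exact: hm. Qed.

Lemma regular_reflect p : regular p -> regular (reflect p).
Proof.
move=> [gp ip']; split; first exact: good_reflect.
move=> f; apply: ip'.
have : finite_set ((fun l => 1 - l) @` ess (reflect p)) by exact: finite_image.
apply: sub_finite_set => l el; have l1 : 1 - (1 - l) = l by ring.
by exists (1 - l) => //; apply/(ess_reflect Hip _ gp); rewrite l1.
Qed.

Let greatest p : regular p -> ess p (1 - ess_min (reflect p)) /\
  forall l, ess p l -> l <= 1 - ess_min (reflect p).
Proof.
move=> rp; have rr := regular_reflect rp; have gp := rp.1.
split; first by apply/(ess_reflect Hip _ gp); exact: ess_min_in.
move=> l el; suff : ess_min (reflect p) <= 1 - l by move=> h; lra.
apply: (ess_min_le rr); apply/(ess_reflect Hip _ gp).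
by rewrite opprB addrCA subrr addr0.
Qed.

Lemma ess_min_reflect p : regular p -> ess_min (reflect p) = 1 - ess_max p.
Proof.
by move=> /greatest[h1 h2]; rewrite (ess_max_unique h1 h2) opprB addrCA subrr addr0.
Qed.

Lemma ess_max_reflect p : regular p -> ess_max (reflect p) = 1 - ess_min p.
Proof.
move=> rp; have := ess_min_reflect (regular_reflect rp); rewrite reflectK => ->.
by rewrite opprB addrCA subrr addr0.
Qed.

Lemma ess_max_in p : regular p -> ess p (ess_max p).
Proof. by move=> /greatest[h1 h2]; rewrite (ess_max_unique h1 h2). Qed.

Lemma le_ess_max p l : regular p -> ess p l -> l <= ess_max p.
Proof. by move=> /greatest[h1 h2]; rewrite (ess_max_unique h1 h2); exact: h2. Qed.

Lemma ess_two p (s : seq R) : regular p -> exists2 l, ess p l & l \notin s.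
Proof.
move=> [_ i]; apply: contrapT => h; apply: i; apply: (sub_finite_set _ (finite_seq s)).
by move=> l el /=; apply/negPn/negP => ls; apply: h; exists l.
Qed.

Lemma ess_min_lt_max p : regular p -> ess_min p < ess_max p.
Proof.
move=> rp; have [l el] := ess_two [:: ess_min p] rp; rewrite inE => ln.
apply: (@lt_le_trans _ _ l); last exact: le_ess_max.
by rewrite lt_neqAle eq_sym ln ess_min_le.
Qed.

Lemma regular_aff c e p : 0 < c -> regular p -> regular (aff c e p).
Proof.
move=> c0 [gp i]; split; first exact: good_aff.
move=> f; apply: i; have cn : c != 0 by rewrite gt_eqF.
have : finite_set ((fun l => c^-1 * (l - e)) @` ess (aff c e p)) by exact: finite_image.
apply: sub_finite_set => l el; exists (c * l + e); first exact/ess_aff.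
by field.
Qed.

Lemma ess_min_aff c e p : 0 < c -> regular p -> ess_min (aff c e p) = c * ess_min p + e.
Proof.
move=> c0 rp; have cn : c != 0 by rewrite gt_eqF.
apply: ess_min_unique => [|l]; first by apply/(ess_aff Hip e c0 rp.1)/ess_min_in.
have -> : l = c * (c^-1 * (l - e)) + e by field.
by move=> /(ess_aff Hip e c0 rp.1)/(ess_min_le rp) h; rewrite lerD2r ler_pM2l.
Qed.

Lemma ess_max_aff c e p : 0 < c -> regular p -> ess_max (aff c e p) = c * ess_max p + e.
Proof.
move=> c0 rp; have cn : c != 0 by rewrite gt_eqF.
apply: ess_max_unique => [|l]; first by apply/(ess_aff Hip e c0 rp.1)/ess_max_in.
have -> : l = c * (c^-1 * (l - e)) + e by field.
by move=> /(ess_aff Hip e c0 rp.1)/(le_ess_max rp) h; rewrite lerD2r ler_pM2l.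
Qed.

(** Normalization forgets increasing affine changes; this is what allows the recursion to be
    followed without it. *)
Lemma normalize_aff c e p : 0 < c -> regular p ->
  normalize ip (aff c e p) = normalize ip p.
Proof.
move=> c0 rp; have m := ess_min_lt_max rp; have cn : c != 0 by rewrite gt_eqF.
have mn : ess_max p - ess_min p != 0 by rewrite subr_eq0 gt_eqF.
rewrite !normalizeE aff_aff ess_min_aff // ess_max_aff //.
have -> : (c * ess_max p + e - (c * ess_min p + e)) = c * (ess_max p - ess_min p) by ring.
congr (aff _ _ p); first by rewrite invfM mulrAC mulVf // mul1r.
by field; rewrite mn.
Qed.

Definition normal p := [/\ regular p, ess_min p = 0 & ess_max p = 1].

Lemma normal_normalize p : regular p -> normal (normalize ip p).
Proof.
move=> rp; have m := ess_min_lt_max rp.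
have mn : ess_max p - ess_min p != 0 by rewrite subr_eq0 gt_eqF.
have c0 : 0 < (ess_max p - ess_min p)^-1 by rewrite invr_gt0 subr_gt0.
rewrite normalizeE; split; first exact: regular_aff.
  by rewrite ess_min_aff // subrr.
by rewrite ess_max_aff // -mulrBr mulVf.
Qed.

Lemma normal_reflect p : normal p -> normal (reflect p).
Proof.
move=> [rp h0 h1]; split; first exact: regular_reflect.
  by rewrite ess_min_reflect // h1 subrr.
by rewrite ess_max_reflect // h0 subr0.
Qed.

Lemma normal_low p l : normal p -> l < 0 -> ~ ess p l.
Proof. by move=> [rp h0 _] l0 /(ess_min_le rp); rewrite h0 leNgt l0. Qed.

Lemma normal_high p l : normal p -> 1 < l -> ~ ess p l.
Proof. by move=> [rp _ h1] l0 /(le_ess_max rp); rewrite h1 leNgt l0. Qed.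

Lemma normal_interior p : normal p ->
  exists a b, [/\ 0 < a, a < b, b < 1, ess p a & ess p b].
Proof.
move=> np; have [rp h0 h1] := np.
have [a ea] := ess_two [:: 0; 1] rp; rewrite !inE negb_or => /andP[a0 a1].
have [b eb] := ess_two [:: 0; 1; a] rp; rewrite !inE !negb_or => /and3P[b0 b1 ba].
have h (x : R) : ess p x -> x != 0 -> x != 1 -> 0 < x < 1.
  move=> ex x0 x1; have := ess_min_le rp ex; have := le_ess_max rp ex; rewrite h0 h1 => k1 k0.
  by rewrite !lt_neqAle x1 k1 k0 eq_sym x0.
have /andP[a0' a1'] := h a ea a0 a1; have /andP[b0' b1'] := h b eb b0 b1.
case: (ltP a b) => ab; first by exists a, b.
by exists b, a; split => //; rewrite lt_neqAle ba.
Qed.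

End EndsOfSpectrum.

(** * Prunings in affinely invariant form *)

Section Cuts.
Context {R : realType} {H : completeNormedModType R[i]}.
Variable ip : {dot H for Num.conj}.
Hypothesis Hip : inner_product_norm ip.
Implicit Types (x y z v : H) (B C D : set R) (p q : @pair R H) (a c e : R).

Local Notation nn := (sqn ip).
Local Notation rp := (rip ip).
Local Notation spr := (spr ip).
Local Notation ess := (ess ip).
Local Notation ess_min := (ess_min ip).
Local Notation ess_max := (ess_max ip).
Local Notation regular := (regular ip).
Local Notation normal := (normal ip).

Definition low_gap p a : \bar R :=
  (lower_excess (eig_index p) fst a - lower_excess (idx p) (term p) a)%E.

(* For a normalized pair these are [deltaL], [prunable0], [prune0] and the
   first condition of the necessity test below 0; unlike those they commute
   with affine changes of the pair. *)
Definition low_limit p : \bar R := limf_einf (low_gap p) (at_left (ess_min p)).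

Definition low_closed p : Prop := low_limit p = 0%E /\ ~ right_ess ip p (ess_min p).

Definition low_cut p : pair :=
  Pair (op p) (spr p `[ess_min p, +oo[) (term p) (d_in p (fun t => ess_min p <= t)).

Definition low_dominated p := forall a, a < ess_min p ->
  (lower_excess (idx p) (term p) a <= lower_excess (eig_index p) fst a)%E.

Definition up_closed p := low_closed (reflect p).
Definition up_cut p := reflect (low_cut (reflect p)).

Section Affine.
Variables (c e : R) (p : @pair R H).
Hypotheses (c0 : 0 < c) (rg : regular p).

Lemma low_gap_aff a : low_gap (aff c e p) (c * a + e) = (c%:E * low_gap p a)%E.
Proof.
rewrite /low_gap eig_excess_aff // lower_excess_affine //.
case: (lower_excess (eig_index p) fst a) (lower_excess (idx p) (term p) a) => [x| |] [y| |] //.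
- by rewrite muleBr.
all: by rewrite ?(gt0_muley, gt0_muleNy) ?lte_fin //= ?(gt0_muley, gt0_muleNy) ?lte_fin.
Qed.

Lemma low_limit_aff : low_limit (aff c e p) = (c%:E * low_limit p)%E.
Proof.
rewrite /low_limit ess_min_aff // -left_limit_affine // -limf_einfZ //.
by congr limf_einf; apply/funext => a; rewrite low_gap_aff.
Qed.

Lemma low_closed_aff : low_closed (aff c e p) <-> low_closed p.
Proof.
rewrite /low_closed low_limit_aff ess_min_aff //.
have h : (c%:E * low_limit p = 0)%E <-> low_limit p = 0%E.
  split=> [|->]; last by rewrite mule0.
  by move=> /eqP; rewrite mule_eq0 eqe gt_eqF // => /eqP.
by split=> -[h1 h2]; split; [apply/h| |apply/h|] => //;
  move=> h3; apply: h2; apply/(right_ess_aff Hip e c0 rg.1).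
Qed.

Lemma low_limit_aff_le0 : (low_limit (aff c e p) <= 0)%E <-> (low_limit p <= 0)%E.
Proof. by rewrite low_limit_aff pmule_rle0 // lte_fin. Qed.

Lemma low_cut_aff : low_cut (aff c e p) = aff c e (low_cut p).
Proof.
rewrite /low_cut ess_min_aff // spr_aff //; last exact: rg.1.
rewrite /aff /=; congr Pair.
  congr (spr p _); apply/seteqP; split=> t /=; rewrite !in_itv /= !andbT lerD2r ler_pM2l //.
by apply/seteqP; split=> i [Ji h]; split => //; move: h; rewrite /= lerD2r ler_pM2l.
Qed.

Lemma low_dominated_aff : low_dominated (aff c e p) <-> low_dominated p.
Proof.
have cn : c != 0 by rewrite gt_eqF.
rewrite /low_dominated ess_min_aff //; split=> h a ha.
  have := h (c * a + e); rewrite ltrD2r ltr_pM2l // => /(_ ha).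
  by rewrite eig_excess_aff // lower_excess_affine // lee_pmul2l ?lte_fin.
have aE : a = c * (c^-1 * (a - e)) + e by field.
move: ha; rewrite aE ltrD2r ltr_pM2l // => /h.
by rewrite eig_excess_aff // lower_excess_affine // lee_pmul2l ?lte_fin.
Qed.

End Affine.

Lemma up_closed_aff c e p : 0 < c -> regular p -> up_closed (aff c e p) <-> up_closed p.
Proof.
by move=> c0 rg; rewrite /up_closed reflect_aff; apply: low_closed_aff => //; exact: regular_reflect.
Qed.

Lemma up_cut_aff c e p : 0 < c -> regular p -> up_cut (aff c e p) = aff c e (up_cut p).
Proof.
move=> c0 rg; rewrite /up_cut reflect_aff low_cut_aff //; last exact: regular_reflect.
by rewrite reflect_aff; congr (aff _ _ _); ring.
Qed.

Section LowCut.
Variable p : @pair R H.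
Hypothesis rg : regular p.

Let mI : measurable (`[ess_min p, +oo[ : set R).
Proof. exact: measurable_itv. Qed.

Let hc := good_restr (q := low_cut p) Hip rg.1 mI (erefl _) (erefl _).

Lemma sm_low_cut B x : measurable B ->
  sm ip (low_cut p) B x = sm ip p (B `&` `[ess_min p, +oo[) x.
Proof. by move=> mB; case: hc => _ ->. Qed.

Lemma spr_low_cut B : measurable B ->
  spr (low_cut p) B = spr p (B `&` `[ess_min p, +oo[).
Proof.
by move=> mB; apply: (congr1 (fun f : H -> H => range f)); apply/funext => x; exact: sm_low_cut.
Qed.

Lemma good_low_cut : good ip (low_cut p).
Proof. by case: hc. Qed.

Lemma ess_low_cut l : ess (low_cut p) l -> ess p l.
Proof.
move=> h e e0; have := h e e0; rewrite -[spectral_range _ _ _]/(spr _ _) spr_low_cut; last exact: measurable_itv.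
apply: (spr_dim_sub rg.1); [|exact: measurable_itv|by move=> ? []].
by apply: measurableI; [exact: measurable_itv|].
Qed.

Lemma ess_low_cut_gt l : ess_min p < l -> ess (low_cut p) l <-> ess p l.
Proof.
move=> lm; split; first exact: ess_low_cut.
move=> h e e0; rewrite -[spectral_range _ _ _]/(spr _ _) spr_low_cut; last exact: measurable_itv.
have m0 : 0 < Num.min e (l - ess_min p) by rewrite lt_min e0 subr_gt0.
apply: (spr_dim_sub rg.1 _ _ _ (h _ m0)); first exact: measurable_itv.
  by apply: measurableI; [exact: measurable_itv|].
have h1 : Num.min e (l - ess_min p) <= e by rewrite ge_min lexx.
have h2 : Num.min e (l - ess_min p) <= l - ess_min p by rewrite ge_min lexx orbT.
move=> t /=; rewrite !in_itv /= => /andP[t1 t2].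
by move: (Num.min _ _) h1 h2 t1 t2 => *; split; [apply/andP; split; lra|rewrite andbT; lra].
Qed.

Lemma regular_low_cut : regular (low_cut p).
Proof.
split; first exact: good_low_cut.
move=> f; apply: rg.2; have : finite_set (ess (low_cut p) `|` [set ess_min p]).
  by rewrite finite_setU; split => //; exact: finite_set1.
apply: sub_finite_set => l el; have := ess_min_le Hip rg el.
rewrite le_eqVlt => /orP[/eqP->|/ess_low_cut_gt h]; [by right|by left; apply/h].
Qed.

Lemma ess_max_low_cut : ess_max (low_cut p) = ess_max p.
Proof.
apply: ess_max_unique.
  by apply/(ess_low_cut_gt (ess_min_lt_max Hip rg)); exact: ess_max_in.
by move=> l /ess_low_cut; exact: le_ess_max.
Qed.

Lemma ess_min_low_cut_le : ess_min p <= ess_min (low_cut p).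
Proof. by apply: (ess_min_le Hip rg); apply/ess_low_cut/ess_min_in/regular_low_cut. Qed.

(** If the old end were still essential after the cut, its infinite rank would lie in
    [[ess_min p, ess_min p + e]] for every e. *)
Lemma ess_min_low_cut : ~ right_ess ip p (ess_min p) -> ess_min p < ess_min (low_cut p).
Proof.
move=> nr; rewrite lt_neqAle ess_min_low_cut_le andbT; apply/eqP => mE; apply: nr => e e0.
have := ess_min_in Hip regular_low_cut; rewrite -mE => /(_ e e0).
rewrite -[spectral_range _ _ _]/(spr _ _) spr_low_cut; last exact: measurable_itv.
apply: (spr_dim_sub rg.1); [|exact: measurable_itv|].
  by apply: measurableI; [exact: measurable_itv|].
move=> t /= []; rewrite !in_itv /= andbT => /andP[h1 h2] h3.
by rewrite h3 ltW.
Qed.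

Lemma eigenspace_low_cut t : ess_min p <= t -> eigenspace (low_cut p) t = eigenspace p t.
Proof.
move=> mt; rewrite !(spr_eigenspace Hip) //; try exact: good_low_cut; last exact: rg.1.
rewrite spr_low_cut; last exact: measurable_set1.
by congr (spr p _); apply/seteqP; split=> [s [] //|s /= ->]; split => //=; rewrite in_itv /= mt.
Qed.

Lemma upper_excess_low_cut a : ess_min p <= a ->
  upper_excess (eig_index (low_cut p)) fst a = upper_excess (eig_index p) fst a /\
  upper_excess (idx (low_cut p)) (term p) a = upper_excess (idx p) (term p) a.
Proof.
move=> ma; split; congr (esum _ _); apply/seteqP; split.
- move=> [t k] [/= h ta]; split => //; move: h.
  by rewrite /eig_index /= eigenspace_low_cut // (le_trans ma).
- move=> [t k] [/= h ta]; split => //; move: h.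
  by rewrite /eig_index /= eigenspace_low_cut // (le_trans ma).
- by move=> i [[Ji _] ia].
- by move=> i [Ji ia]; do 2!split => //; exact: le_trans ia.
Qed.

End LowCut.

(* The lower end of [q] does not see whether its upper end is cut. *)
Section UpCut.
Variable q : @pair R H.
Hypothesis rg : regular q.
Let p := reflect q.
Let rr : regular p. Proof. exact: regular_reflect. Qed.

Lemma regular_up_cut : regular (up_cut q).
Proof. exact: (regular_reflect Hip (regular_low_cut rr)). Qed.

Lemma ess_min_up_cut : ess_min (up_cut q) = ess_min q.
Proof.
rewrite /up_cut (ess_min_reflect Hip (regular_low_cut rr)) (ess_max_low_cut rr).
by rewrite (ess_max_reflect Hip rg); ring.
Qed.

Lemma up_cutE : up_cut q =
  Pair (op q) (spr q `]-oo, ess_max q]) (term q) (d_in q (fun t => t <= ess_max q)).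
Proof.
rewrite /up_cut /low_cut ess_min_reflect // spr_reflect //; try exact: rg.1.
rewrite {1}/reflect /=; congr Pair.
- by apply/funext => x; rewrite opprB addrCA subrr addr0.
- by congr (spr q _); apply/seteqP; split=> t /=; rewrite !in_itv /= ?andbT => h; lra.
- by apply/funext => i; rewrite opprB addrCA subrr addr0.
- by apply/seteqP; split=> i [Ji /= h]; split=> //=; lra.
Qed.

Let excess a : a <= ess_max q ->
  lower_excess (eig_index (up_cut q)) fst a = lower_excess (eig_index q) fst a /\
  lower_excess (idx (up_cut q)) (term (up_cut q)) a = lower_excess (idx q) (term q) a.
Proof.
move=> am; have am' : ess_min p <= 1 - a by rewrite /p ess_min_reflect //; lra.
have [h1 h2] := upper_excess_low_cut rr am'.
have aE : a = 1 - (1 - a) by ring.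
rewrite /up_cut eig_excess_reflect -[q in RHS]reflectK.
rewrite eig_excess_reflect h1; split => //.
transitivity (upper_excess (idx (low_cut p)) (term p) (1 - a)); first exact: lower_excess_reflect.
by rewrite h2 -lower_excess_reflect; congr lower_excess; apply/funext => i /=; ring.
Qed.

Lemma low_gap_up_cut a : a <= ess_max q -> low_gap (up_cut q) a = low_gap q a.
Proof. by move=> /excess[h1 h2]; rewrite /low_gap h1 h2. Qed.

Lemma low_limit_up_cut : low_limit (up_cut q) = low_limit q.
Proof.
rewrite /low_limit ess_min_up_cut; apply: (eq_left_limit (e := 1)) => // b /andP[_ bm].
by apply: low_gap_up_cut; apply: ltW; apply: lt_trans bm (ess_min_lt_max Hip rg).
Qed.

Lemma low_dominated_up_cut : low_dominated (up_cut q) <-> low_dominated q.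
Proof.
rewrite /low_dominated ess_min_up_cut; split=> h a am; have := h a am;
have /excess[-> ->] // : a <= ess_max q;
by apply: ltW; apply: lt_trans am (ess_min_lt_max Hip rg).
Qed.

Lemma spr_up_cut B : measurable B ->
  spr (up_cut q) B = spr q (B `&` `]-oo, ess_max q]).
Proof.
move=> mB; have mI : measurable (`]-oo, ess_max q] : set R) by exact: measurable_itv.
rewrite up_cutE; apply: (congr1 (fun f : H -> H => range f)); apply/funext => x.
set q' := Pair _ _ _ _.
by have [_ ->] := good_restr (q := q') Hip rg.1 mI (erefl _) (erefl _).
Qed.

Lemma right_ess_up_cut : right_ess ip (up_cut q) (ess_min q) <-> right_ess ip q (ess_min q).
Proof.
have mI : measurable (`]-oo, ess_max q] : set R) by exact: measurable_itv.
have mm := ess_min_lt_max Hip rg.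
split=> h e e0.
  have := h e e0; rewrite -[spectral_range _ _ _]/(spr _ _) spr_up_cut; last exact: measurable_itv.
  apply: (spr_dim_sub rg.1); [|exact: measurable_itv|by move=> ? []].
  by apply: measurableI; [exact: measurable_itv|].
rewrite -[spectral_range _ _ _]/(spr _ _) spr_up_cut; last exact: measurable_itv.
have m0 : 0 < Num.min e (ess_max q - ess_min q) by rewrite lt_min e0 subr_gt0.
apply: (spr_dim_sub rg.1 _ _ _ (h _ m0)); first exact: measurable_itv.
  by apply: measurableI; [exact: measurable_itv|].
have h1 : Num.min e (ess_max q - ess_min q) <= e by rewrite ge_min lexx.
have h2 : Num.min e (ess_max q - ess_min q) <= ess_max q - ess_min q by rewrite ge_min lexx orbT.
move=> t /=; rewrite !in_itv /= => /andP[t1 t2].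
by move: (Num.min _ _) h1 h2 t1 t2 => *; split; [apply/andP; split; lra|lra].
Qed.

Lemma low_closed_up_cut : low_closed (up_cut q) <-> low_closed q.
Proof.
rewrite /low_closed low_limit_up_cut ess_min_up_cut.
by split=> -[h1 h2]; split => // h; apply: h2; apply/right_ess_up_cut.
Qed.

End UpCut.

(** A cut at one end does not move the other end, so both orders intersect with the same two
    half-lines. *)
Lemma cutC q : regular q -> low_cut (up_cut q) = up_cut (low_cut q).
Proof.
move=> rg; rewrite (up_cutE (regular_low_cut rg)) ess_max_low_cut //.
rewrite {1}/low_cut ess_min_up_cut // spr_up_cut //.
rewrite spr_low_cut //.
rewrite up_cutE //; congr Pair; first by rewrite setIC.
by apply/seteqP; split=> i [[? ?] ?].
Qed.

Lemma up_closed_low_cut p : regular p -> up_closed (low_cut p) <-> up_closed p.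
Proof.
move=> rg; have := low_closed_up_cut (regular_reflect Hip rg).
by rewrite /up_closed /up_cut reflectK.
Qed.

Lemma deltaL_low_limit p : ess_min p = 0 -> deltaL p = low_limit p.
Proof.
move=> m0; rewrite /deltaL /low_limit m0; apply: (eq_left_limit (e := 1)) => // b /andP[_ b0].
by rewrite /f_lambda /f_d /majorization ltW.
Qed.

Section Normal.
Variable p : @pair R H.
Hypothesis np : normal p.
Let rg : regular p. Proof. by case: np. Qed.
Let m0 : ess_min p = 0. Proof. by case: np. Qed.

Lemma prunable0_normal : prunable0 ip p <-> low_closed p.
Proof. by rewrite /prunable0 /low_closed deltaL_low_limit // m0. Qed.

Lemma prune0_normal : prune0 ip p = low_cut p.
Proof. by rewrite /low_cut m0. Qed.

Lemma deltaL'_normal : deltaL' ip p = low_limit (low_cut p).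
Proof. by rewrite /deltaL' prune0_normal. Qed.

Lemma excess_below_normal : excess_below p <-> low_dominated p.
Proof.
split=> [|h].
  move=> /(excess_belowP Hip rg.1 (fun l => normal_low Hip np)) h a; rewrite m0 => a0.
  by have := h a a0; rewrite /f_lambda /f_d /majorization (ltW a0).
apply/(excess_belowP Hip rg.1 (fun l => normal_low Hip np)) => a a0.
by rewrite /f_lambda /f_d /majorization (ltW a0); apply: h; rewrite m0.
Qed.

End Normal.

Lemma prunable1_normal p : normal p -> prunable1 ip p <-> up_closed p.
Proof.
move=> np; have [rg _ _] := np; rewrite (prunable_reflect Hip rg.1).
exact: (prunable0_normal (normal_reflect Hip np)).
Qed.

Lemma prune1_normal p : normal p -> prune1 ip p = up_cut p.
Proof. by move=> [rg _ m1]; rewrite up_cutE // m1. Qed.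

Lemma deltaU'_normal p : normal p -> deltaU' ip p = low_limit (low_cut (reflect p)).
Proof.
move=> np; have [rg _ _] := np; have rr := regular_reflect Hip rg.
rewrite /deltaU' prune1_normal //; set p' := up_cut p.
have rp' : regular p' by exact: regular_up_cut.
have -> : low_cut (reflect p) = reflect p' by rewrite /p' /up_cut reflectK.
rewrite /low_limit ess_min_reflect //.
rewrite -(@limf_einf_comp _ (at_left (1 - ess_max p')) (at_right (ess_max p'))
  (fun b => 1 - b) (fun b => 1 - b)).
- congr limf_einf; apply/funext => b /=.
  by rewrite /low_gap eig_excess_reflect; congr (_ - _)%E; symmetry; exact: lower_excess_reflect.
- by move=> b; ring.
- by move=> b; ring.
- move=> V; split=> [/at_right_setP[e e0 h]|/at_left_setP[e e0 h]].
    apply/at_left_setP; exists e => // b /andP[h1 h2]; apply: h => /=.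
    by apply/andP; split; lra.
  apply/at_right_setP; exists e => // b /andP[h1 h2].
  have -> : b = 1 - (1 - b) by ring.
  by apply: h; apply/andP; split; lra.
Qed.

Definition final_cut p : pair :=
  let q := if `[< low_closed p >] then low_cut p else p in
  if `[< up_closed q >] then up_cut q else q.

Lemma normalize_low_cut p : regular p ->
  normalize ip (low_cut (normalize ip p)) = normalize ip (low_cut p).
Proof.
move=> rg; have m := ess_min_lt_max Hip rg.
have c0 : 0 < (ess_max p - ess_min p)^-1 by rewrite invr_gt0 subr_gt0.
by rewrite (normalizeE ip p) low_cut_aff // normalize_aff //; exact: regular_low_cut.
Qed.

Lemma normalize_up_cut p : regular p ->
  normalize ip (up_cut (normalize ip p)) = normalize ip (up_cut p).
Proof.
move=> rg; have m := ess_min_lt_max Hip rg.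
have c0 : 0 < (ess_max p - ess_min p)^-1 by rewrite invr_gt0 subr_gt0.
by rewrite (normalizeE ip p) up_cut_aff // normalize_aff //; exact: regular_up_cut.
Qed.

Lemma low_closed_normalize p : regular p -> low_closed (normalize ip p) <-> low_closed p.
Proof.
move=> rg; have m := ess_min_lt_max Hip rg.
by rewrite normalizeE; apply: low_closed_aff => //; rewrite invr_gt0 subr_gt0.
Qed.

Lemma up_closed_normalize p : regular p -> up_closed (normalize ip p) <-> up_closed p.
Proof.
move=> rg; have m := ess_min_lt_max Hip rg.
by rewrite normalizeE; apply: up_closed_aff => //; rewrite invr_gt0 subr_gt0.
Qed.

Lemma final_pruning_normalize p : regular p ->
  final_pruning ip (normalize ip p) = normalize ip (final_cut p).
Proof.
move=> rg; have np := normal_normalize Hip rg.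
rewrite /final_pruning /final_cut prune0_normal // normalize_low_cut //.
rewrite (propext (prunable0_normal np)) (propext (low_closed_normalize rg)).
set q := if `[< low_closed p >] then low_cut p else p.
have rq : regular q by rewrite /q; case: ifP => // _; exact: regular_low_cut.
have -> : (if `[< low_closed p >] then normalize ip (low_cut p) else normalize ip p) = normalize ip q.
  by rewrite /q; case: ifP.
have nq := normal_normalize Hip rq.
rewrite (propext (prunable1_normal nq)) (propext (up_closed_normalize rq)).
by rewrite prune1_normal // normalize_up_cut //; case: ifP.
Qed.

End Cuts.

(** * Realizations across a cut *)

Section Steps.
Context {R : realType} {H : completeNormedModType R[i]}.
Variable ip : {dot H for Num.conj}.
Hypothesis Hip : inner_product_norm ip.
Implicit Types (x y z v w : H) (B C D : set R) (p q : @pair R H) (a c : R).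

Local Notation nn := (sqn ip).
Local Notation rp := (rip ip).
Local Notation spr := (spr ip).
Local Notation orthn := (orthn ip).
Local Notation ess_min := (ess_min ip).
Local Notation ess_max := (ess_max ip).
Local Notation regular := (regular ip).
Local Notation normal := (normal ip).
Local Notation low_cut := (low_cut ip).
Local Notation up_cut := (up_cut ip).

Definition realizes p (e : nat -> H) := [/\ orthn (idx p) e,
  forall i, idx p i -> space p (e i) /\ rp (op p (e i)) (e i) = term p i &
  forall x, space p x -> (forall i, idx p i -> ip x (e i) = 0) -> x = 0].

(** [splits] says that a given realization is adapted to q, [removes] that the dropped entries can
    be realized on the complement of q, whatever happens inside q. Negative answers rest on the
    former, positive answers on the latter. *)
Definition splits p q (e : nat -> H) := realizes q e /\
  forall i, (idx p `\` idx q) i -> forall y, space q y -> ip (e i) y = 0.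

Definition removes p q (g : nat -> H) := [/\ orthn (idx p `\` idx q) g,
  forall i, (idx p `\` idx q) i -> [/\ space p (g i), rp (op p (g i)) (g i) = term p i &
    forall y, space q y -> ip (g i) y = 0] &
  forall x, space p x -> (forall y, space q y -> ip x y = 0) ->
    (forall i, (idx p `\` idx q) i -> ip x (g i) = 0) -> x = 0].

Definition test p := necessity_test (normalize ip p).

Lemma affK c e p : 0 < c -> aff c^-1 (- (c^-1 * e)) (aff c e p) = p.
Proof. by move=> c0; rewrite aff_aff mulVf ?gt_eqF // subrr aff_id. Qed.

Lemma normalize_affE p : regular p ->
  exists c e, 0 < c /\ normalize ip p = aff c e p.
Proof.
move=> rg; have m := ess_min_lt_max Hip rg.
by rewrite normalizeE; do 2 eexists; split; last reflexivity; rewrite invr_gt0 subr_gt0.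
Qed.

Section ValueChange.
Variables (p : @pair R H) (c e : R) (J : set nat) (u : nat -> H).

Let form_aff x : nn x = 1 -> rp (op (aff c e p) x) x = c * rp (op p x) x + e.
Proof. by move=> n1; rewrite /= rpDl !rpZl -nnE n1 mulr1. Qed.

Lemma realizes_aff : realizes p u -> realizes (aff c e p) u.
Proof.
move=> [ou hu cu]; split => // i Ji; have [Su h] := hu i Ji; split => //.
by rewrite form_aff ?h //; exact: (onf_nn ou Ji).
Qed.

Lemma removes_aff q : removes p q u -> removes (aff c e p) (aff c e q) u.
Proof.
move=> [ou hu cu]; split => // i Ji; have [Su h pu] := hu i Ji; split => //.
by rewrite form_aff ?h //; exact: (onf_nn ou Ji).
Qed.

End ValueChange.

Lemma splits_aff p q u c e : splits p q u -> splits (aff c e p) (aff c e q) u.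
Proof. by move=> [h1 h2]; split => //; exact: realizes_aff. Qed.

Let form_reflect p x : nn x = 1 -> rp (op (reflect p) x) x = 1 - rp (op p x) x.
Proof. by move=> n1; rewrite /= rpDl rpNl -nnE n1. Qed.

Lemma realizes_reflect p u : realizes p u -> realizes (reflect p) u.
Proof.
move=> [ou hu cu]; split => // i Ji; have [Su h] := hu i Ji; split => //.
by rewrite form_reflect ?h //; exact: (onf_nn ou Ji).
Qed.

Lemma removes_reflect p q u : removes p q u -> removes (reflect p) (reflect q) u.
Proof.
move=> [ou hu cu]; split => // i Ji; have [Su h pu] := hu i Ji; split => //.
by rewrite form_reflect ?h //; exact: (onf_nn ou Ji).
Qed.

Lemma splits_reflect p q u : splits p q u -> splits (reflect p) (reflect q) u.
Proof. by move=> [h1 h2]; split => //; exact: realizes_reflect. Qed.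

Lemma realizes_realizing p u : realizes p u -> realizing ip p u.
Proof.
by move=> [ou hu cu]; split => //; exists 0%N, (fun=> 0) => v [Sv hv] _; exact: cu.
Qed.

Lemma glue p q g : csub ip (space q) -> subsp (space p) -> space q `<=` space p ->
  idx q `<=` idx p -> op q = op p -> term q = term p ->
  removes p q g -> realizable ip q -> realizable ip p.
Proof.
move=> cq sp qp Jqp oq tq [og hg cg] [u [ou hu cu]].
have cases i : idx p i -> idx q i \/ (idx p `\` idx q) i.
  by move=> Ji; case: (pselect (idx q i)) => h; [left|right].
exists (fun i => if `[< idx q i >] then u i else g i); split.
- move=> i j Ji Jj; case: asboolP => hi; case: asboolP => hj; first exact: ou.
  + have [//|h] := cases j Jj; have [_ _ /(_ (u i))] := hg j h.
    have [Su _] := hu i hi => /(_ Su) /ip_eq0C ->.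
    by case: eqP => // ij; move: hj; rewrite -ij.
  + have [//|h] := cases i Ji; have [_ _ /(_ (u j))] := hg i h.
    have [Su _] := hu j hj => /(_ Su) ->.
    by case: eqP => // ij; move: hi; rewrite ij.
  + by apply: og.
- move=> i Ji; case: asboolP => hi.
    by have [Su] := hu i hi; rewrite oq tq => h; split => //; exact: qp.
  by have [//|h] := cases i Ji; have [] := hg i h.
move=> x Sx hx; pose y := proj Hip cq x.
have Sy : space q y by exact: proj_in.
have z0 : x - y = 0.
  apply: cg; first by apply: subspB => //; exact: qp.
    by move=> z Sz; exact: proj_perp.
  move=> i h; have [_ _ pg] := hg i h; have := hx i h.1.
  by case: asboolP h => [? []//|_ h]; rewrite ipBl => ->; rewrite (ip_eq0C (pg _ Sy)) subrr.
have xy : x = y by apply/eqP; rewrite -subr_eq0 z0.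
apply: cu; first by rewrite xy.
move=> i qi; have := hx i (Jqp _ qi); by case: asboolP.
Qed.

Lemma low_cut_sub p : regular p -> space (low_cut p) `<=` space p.
Proof. by move=> rg x; apply: (spr_S rg.1); exact: measurable_itv. Qed.

Lemma low_cut_csub p : regular p -> csub ip (space (low_cut p)).
Proof. by move=> rg; apply: (spr_csub Hip rg.1); exact: measurable_itv. Qed.

Lemma regular_csub p : regular p -> csub ip (space p).
Proof.
move=> rg; have := spr_csub Hip rg.1 (@measurableT _ (measurableTypeR R)).
suff -> : space p = spr p setT by [].
by apply/seteqP; split=> x /(spr_T rg.1).
Qed.

Lemma test_low_dominated p : regular p -> test p ->
  low_dominated ip p /\ low_dominated ip (reflect p).
Proof.
move=> rg; have np := normal_normalize Hip rg.
have [c [e [c0 E]]] := normalize_affE rg.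
rewrite /test; move: np; rewrite E => np [_ h _ _ _].
have gp := (regular_aff Hip e c0 rg).1.
split.
  apply/(low_dominated_aff Hip e c0 rg)/(excess_below_normal Hip np).
  apply/(excess_belowP Hip gp (fun l => normal_low Hip np)) => b b0; apply: h.
  by rewrite negb_and -ltNge b0.
apply/(low_dominated_aff Hip (1 - e - c) c0 (regular_reflect Hip rg)).
rewrite -reflect_aff; apply/(excess_below_normal Hip (normal_reflect Hip np)).
apply/(excess_below_reflect Hip gp (fun l => normal_high Hip np)) => b b1; apply: h.
by rewrite negb_and -!ltNge b1 orbT.
Qed.

Lemma perp_sm p B x : good ip p -> measurable B ->
  (forall y, spr p B y -> ip x y = 0) -> sm ip p B x = 0.
Proof.
move=> [_ _ hP] mB h; apply: (nn_eq0 Hip).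
rewrite nnE /rip (sm_sa hP mB) (sm_idem hP x mB) h //; exact: spr_sm.
Qed.

Lemma low_removes p : regular p -> low_dominated ip p -> low_closed ip p ->
  exists g, removes p (low_cut p) g.
Proof.
move=> rg ld lc; have np := normal_normalize Hip rg.
have [c [e [c0 E]]] := normalize_affE rg; rewrite E in np.
have := affK e p c0; set q := aff c e p; move=> qK.
suff [g hg] : exists g, removes q (low_cut q) g.
  exists g; have := removes_aff c^-1 (- (c^-1 * e)) hg.
  by rewrite /q low_cut_aff // !affK.
have [rq m0 _] := np; have gq := rq.1.
have hx : excess_below q.
  by apply/(excess_below_normal Hip np)/(low_dominated_aff Hip e c0 rg).
have pq : prunable0 ip q.
  by apply/(prunable0_normal np)/(low_closed_aff Hip e c0 rg).
have e0 : ess ip q 0 by rewrite -m0; exact: ess_min_in.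
have [g [og hg cg]] := block Hip gq (fun l => normal_low Hip np) hx e0 pq.
have JE : idx q `\` idx (low_cut q) = d_in q (fun t => t < 0).
  apply/seteqP; split=> i [Ji h]; split => //.
    by rewrite ltNge; apply/negP => h'; apply: h; split => //; rewrite m0.
  by case=> _; rewrite m0 leNgt h.
exists g; rewrite /removes JE; split => //.
  move=> i h; have [Sg vg] := hg i h; split => //.
    by apply: spr_S Sg; [|exact: measurable_itv].
  move=> y; rewrite /= m0 => Sy; apply: (spr_perp Hip gq (measurable_itv _) (measurable_itv _) _ Sg Sy).
  apply/seteqP; split=> t //= []; rewrite !in_itv /= andbT => h1 h2.
  by move: h1; rewrite ltNge h2.
move=> x Sx hx'; apply: cg.
have CE : ~` `[0, +oo[%classic = `]-oo, 0[%classic :> set R.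
  by apply/seteqP; split=> t /=; rewrite !in_itv /= andbT ltNge => /negP.
have mI : measurable (`[0, +oo[ : set R) by exact: measurable_itv.
rewrite -CE; apply/(spr_setC Hip gq mI Sx)/(perp_sm gq mI) => y Sy; apply: hx'.
by rewrite /= m0.
Qed.

(** If no entry were dropped, the complement of the cut would be spanned by an empty family; the cut
    would keep the whole space, and the lower end would be right essential. This strict progress is
    what makes the loop stop. *)
Lemma low_removes_strictly p : regular p -> low_dominated ip p -> low_closed ip p ->
  exists i, (idx p `\` idx (low_cut p)) i.
Proof.
move=> rg ld lc; apply: contrapT => h; have [g [_ _ cg]] := low_removes rg ld lc.
have gp := rg.1; have cq := low_cut_csub rg.
have all x : space p x -> space (low_cut p) x.
  move=> Sx; have z0 : x - proj Hip cq x = 0.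
    apply: cg => [|y|i Ji]; last by case: h; exists i.
      by apply: subspB => //; [case: (regular_csub rg)|apply: low_cut_sub => //; exact: proj_in].
    exact: proj_perp.
  by rewrite -(subrK (proj Hip cq x) x) z0 add0r; exact: proj_in.
apply: lc.2 => e e0; have := ess_min_in Hip rg e0.
apply: dim_infinite_sub => x Bx.
have mB : measurable (`]ess_min p - e, ess_min p + e[ : set R) by exact: measurable_itv.
have mI : measurable (`[ess_min p, +oo[ : set R) by exact: measurable_itv.
have hB := (sprP gp x mB).1 Bx; have hI := (sprP gp x mI).1 (all _ (spr_S gp mB Bx)).
have [_ _ hP] := gp.
have mBI := measurableI _ _ mB mI.
have : spr p (`]ess_min p - e, ess_min p + e[ `&` `[ess_min p, +oo[) x.
  by apply/(sprP gp) => //; rewrite (sm_I hP) // hI hB.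
apply: (spr_sub gp) => //; try exact: measurable_itv.
by move=> t /= []; rewrite !in_itv /= andbT => /andP[_ /ltW h1] ->.
Qed.

Lemma realizing_test p u : regular p -> realizing ip p u -> test p.
Proof.
move=> rg hu; have np := normal_normalize Hip rg; have [[gq _] _ _] := np.
have [a [b [a0 ab b1 ea _]]] := normal_interior Hip np.
apply: (necessity Hip gq (fun l => normal_low Hip np) (fun l => normal_high Hip np) (a := a) (e := u)) => //.
  by rewrite a0 (lt_trans ab b1).
by have [c [e [c0 ->]]] := normalize_affE rg; exact: realizing_aff.
Qed.

Lemma realizable_of_closed_test p : separable H -> regular p -> test p ->
  ~ low_closed ip p -> ~ up_closed ip p -> realizable ip p.
Proof.
move=> sepH rg tp lc uc; have np := normal_normalize Hip rg; have [[gq _] m0 m1] := np.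
have [a [b [a0 ab b1 ea eb]]] := normal_interior Hip np.
have : realizable ip (normalize ip p).
  apply: (realizable_of_test Hip sepH gq (fun l => normal_low Hip np)
    (fun l => normal_high Hip np) _ _ a0 ab b1 ea eb tp).
  - by rewrite -m0; apply: ess_min_in => //; case: np.
  - by rewrite -m1; apply: ess_max_in => //; case: np.
  - by move/(prunable0_normal np)/(low_closed_normalize Hip rg).
  - by move/(prunable1_normal Hip np)/(up_closed_normalize Hip rg).
by have [c [e [c0 ->]]] := normalize_affE rg; exact: realizable_aff.
Qed.

(** A vector of the cut orthogonal to the kernel lies in []0, +oo[], hence is orthogonal to the
    dropped vectors, which decoupling confines to []-oo, 0]]. The kernel is finite-dimensional since
    0 is not right essential, so the defect grows by finitely many dimensions only. *)
Let realizing_low_cut_normal q u : normal q -> low_closed ip q ->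
  realizing ip q u -> realizing ip (low_cut q) u.
Proof.
move=> nq lc [ou hu [N [F hF]]]; have [rg m0 _] := nq; have gq := rg.1.
have [d0 nr] := (prunable0_normal nq).2 lc.
have dec i := decouple Hip gq (fun l => normal_low Hip nq) ou hu d0 (i := i).
have m1 : measurable ([set 0] : set R) by exact: measurable_set1.
have mP : measurable (`[0, +oo[ : set R) by exact: measurable_itv.
have mQ : measurable (`]0, +oo[ : set R) by exact: measurable_itv.
have mL : measurable (`]-oo, 0] : set R) by exact: measurable_itv.
split.
- by apply: orthn_sub ou => i [].
- move=> i [Ji]; rewrite m0 => ti; split; last by case: (hu i Ji).
  by have [h _ _] := dec i Ji; rewrite /= m0; exact: h.
have fK : findim ip (spr q [set 0]).
  have /(findimP Hip) : ~ dim_infinite (spr q [set 0]).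
    move=> dK; apply: nr => e e0; apply: (spr_dim_sub gq m1 (measurable_itv _) _ dK).
    by move=> t /= ->; rewrite in_itv /= lexx add0r ltW.
  by apply; exact: spr_subsp.
have [n [k [_ Kk ck _]]] := findim_basis Hip (spr_subsp Hip gq m1) fK.
have [_ _ hP] := gq.
exists (N + n)%N, (fun j => if (j < N)%N then F j else k (j - N)%N) => v [Sv hv] pv.
rewrite /= m0 in Sv.
have v0 : sm ip q [set 0] v = 0.
  apply: ck; first exact: spr_sm.
  move=> j jn; rewrite (sm_sa hP m1) ((sprP gq _ m1).1 (Kk j jn)).
  have := pv (N + j)%N; rewrite ltn_add2l jn ltnNge leq_addr /= addKn; exact.
have Qv : spr q `]0, +oo[ v.
  have E : `[0, +oo[%classic = `]0, +oo[%classic `|` [set 0] :> set R.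
    apply/seteqP; split=> t /=; rewrite !in_itv /= !andbT.
      by rewrite le_eqVlt => /orP[/eqP->|]; [right|left].
    by case=> [/ltW|->].
  have : sm ip q `[0, +oo[ v = v by apply/(sprP gq).
  rewrite E (sm_U Hip hP) //; last first.
    by apply/seteqP; split=> t //= []; rewrite in_itv /= andbT => /lt0r_neq0/eqP.
  by rewrite v0 addr0 => h; apply/(sprP gq).
apply: hF => [|i iN]; last by have := pv i (ltn_addr _ iN); rewrite iN.
split; first exact: (spr_S gq mP) Sv.
move=> i Ji; case: (leP 0 (term q i)) => ti; first by apply: hv; split; rewrite ?m0.
have [_ h _] := dec i Ji; apply: (spr_perp Hip gq mQ mL _ Qv (h ti)).
by apply/seteqP; split=> t //= []; rewrite !in_itv /= andbT ltNge => /negP.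
Qed.

Lemma realizing_low_cut p u : regular p -> low_closed ip p ->
  realizing ip p u -> realizing ip (low_cut p) u.
Proof.
move=> rg lc hu; have np := normal_normalize Hip rg.
have [c [e [c0 E]]] := normalize_affE rg; rewrite E in np.
have := realizing_low_cut_normal np ((low_closed_aff Hip e c0 rg).2 lc) (realizing_aff c e hu).
rewrite low_cut_aff // => /(realizing_aff c^-1 (- (c^-1 * e))).
by rewrite affK.
Qed.

Lemma extra_vector_limit p u w k (v : R) : good ip p -> (forall l, l < 0 -> ~ ess ip p l) ->
  orthn (idx p) u ->
  (forall i, idx p i -> space p (u i) /\ rp (op p (u i)) (u i) = term p i) ->
  ~ idx p k -> space p w -> nn w = 1 -> (forall i, idx p i -> ip w (u i) = 0) ->
  rp (op p w) w = v -> v < 0 -> ~ (deltaL p <= 0)%E.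
Proof.
move=> gp ne ou hu nk Sw nw pw vw v0 dle.
pose r := Pair (op p) (space p) (fun i => if i == k then v else term p i) (idx p `|` [set k]).
pose u' i := if i == k then w else u i.
have nik i : idx p i -> (i == k) = false by move=> Ji; apply/eqP => ik; apply: nk; rewrite -ik.
have o' : orthn (idx r) u'.
  move=> i j [Ji|->] [Jj|->]; rewrite /u' ?eqxx ?(nik _ Ji) ?(nik _ Jj).
  - exact: ou.
  - by rewrite (ip_eq0C (pw _ Ji)).
  - by rewrite pw // eq_sym nik.
  - by rewrite ipnn // nw.
have h' i : idx r i -> space r (u' i) /\ rp (op r (u' i)) (u' i) = term r i.
  by move=> [Ji|->]; rewrite /u' /= ?eqxx ?(nik _ Ji) //; exact: hu.
have hr := excess_below_realizing Hip (p := r) gp ne o' h'.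
have hx := excess_below_realizing Hip gp ne ou hu.
have bound b s : b < 0 -> seq_in (idx p) s ->
    \sum_(i <- s) maxr 0 (b - term p i) + (b - v) <= lam p b.
  move=> b0 [us sJ]; have := hr b (k :: s) b0.
  have sk : k \notin s by apply/negP => /sJ.
  have h1 : seq_in (idx r) (k :: s).
    split; first by rewrite /= sk.
    by move=> i; rewrite inE => /orP[/eqP->|/sJ]; [right|left].
  move=> /(_ h1); rewrite big_cons /= eqxx.
  have -> : \sum_(j <- s) maxr 0 (b - (if j == k then v else term p j)) =
            \sum_(j <- s) maxr 0 (b - term p j).
    by rewrite big_seq [RHS]big_seq; apply: eq_bigr => j /sJ Jj; rewrite nik.
  have h2 : b - v <= maxr 0 (b - v) by rewrite le_max lexx orbT.
  have -> : lam r b = lam p b by [].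
  by move: (lam p b) (\sum_(_ <- _) _) (maxr _ _) h2 => *; lra.
have v2 : 0 < - v / 2 by lra.
have dlt : (deltaL p < (- v / 2)%:E)%E by apply: le_lt_trans dle _; rewrite lte_fin.
have [b /andP[b1 b0] hb] := deltaL_lt Hip gp ne hx dlt v2.
have : (f_d p b <= (lam p b - (b - v))%:E)%E.
  rewrite f_d_low //; apply: lexc_le => s sJ; rewrite lee_fin.
  by have := bound b s b0 sJ; move: (lam p b) (\sum_(_ <- _) _) => *; lra.
rewrite (f_d_fin Hip gp ne hx b0) lee_fin.
by move: (lam p b) (fine _) hb => *; lra.
Qed.

Let splits_low_cut_normal q u : normal q -> low_closed ip q ->
  (low_limit ip (low_cut q) <= 0)%E -> realizes q u -> splits q (low_cut q) u.
Proof.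
move=> nq lc ll [ou hu cu]; have [rg m0 _] := nq; have gq := rg.1.
have [d0 nr] := (prunable0_normal nq).2 lc.
have ne l := normal_low Hip nq (l := l).
have dec i := decouple Hip gq ne ou hu d0 (i := i).
have m1 : measurable ([set 0] : set R) by exact: measurable_set1.
have mP : measurable (`[0, +oo[ : set R) by exact: measurable_itv.
have mO : measurable (`]-oo, 0[ : set R) by exact: measurable_itv.
have mL : measurable (`]-oo, 0] : set R) by exact: measurable_itv.
have [_ _ hP] := gq.
have rc := regular_low_cut Hip rg.
set a0 := ess_min (low_cut q).
have a0p : 0 < a0 by rewrite -m0; apply: ess_min_low_cut; rewrite ?m0.
have oc : orthn (idx (low_cut q)) u by apply: orthn_sub ou => i [].
have hc i : idx (low_cut q) i -> space (low_cut q) (u i) /\ rp (op q (u i)) (u i) = term q i.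
  move=> [Ji]; rewrite m0 => ti; split; last by case: (hu i Ji).
  by have [h _ _] := dec i Ji; rewrite /= m0; exact: h.
have low i : idx q i -> term q i < 0 -> spr q `]-oo, 0[ (u i).
  move=> Ji ti; have [_ /(_ ti) Li _] := dec i Ji.
  have LE : `]-oo, 0]%classic = `]-oo, 0[%classic `|` [set 0] :> set R.
    apply/seteqP; split=> t /=; rewrite !in_itv /=.
      by rewrite le_eqVlt => /orP[/eqP->|]; [right|left].
    by case=> [/ltW|->].
  have dis : `]-oo, 0[%classic `&` [set 0] = set0 :> set R.
    by apply/seteqP; split=> t //= []; rewrite in_itv /= => /ltr0_neq0/eqP.
  have uE := (sprP gq _ mL).1 Li; rewrite LE (sm_U Hip hP) // in uE.
  apply/(sprP gq) => //; set w := sm ip q [set 0] (u i) in uE.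
  suff w0 : w = 0 by rewrite w0 addr0 in uE.
  apply: contrapT => wn.
  have [z [nz Kz]] := unit_of Hip (spr_subsp Hip gq m1) (spr_sm _ _ _ _ : spr q [set 0] w) wn.
  (* Shifts the lower end of the cut to 0. The kernel vector then has the value -a0, negative
     because the cut moved the end strictly to the right. *)
  pose p := aff 1 (- a0) (low_cut q).
  have c1 : 0 < 1 :> R by [].
  have p0 : ess_min p = 0 by rewrite ess_min_aff // mul1r subrr.
  have rp' : regular p by exact: regular_aff.
  have nep l : l < 0 -> ~ ess ip p l.
    by move=> l0 /(ess_min_le Hip rp'); rewrite p0 leNgt l0.
  have hz : rp (op q (z *: w)) (z *: w) = 0.
    have [_ ->] := (spr_set1 Hip gq 0 _).1 Kz.
    by rewrite scale0r /rip ip0l.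
  have ni : ~ idx p i by move=> [_]; rewrite m0 leNgt ti.
  apply: (extra_vector_limit (p := p) (u := u) (w := z *: w) (k := i) (v := - a0)) => //.
  - exact: rp'.1.
  - move=> j Jj; have [Su h] := hc j Jj; split => //.
    by rewrite /= rpDl !rpZl -nnE (onf_nn ou Jj.1) mulr1 h.
  - by rewrite /= m0; apply: (spr_sub gq m1 mP) Kz => t ->; rewrite /= in_itv /= lexx.
  - move=> j Jj; rewrite ipZl.
    suff -> : ip w (u j) = 0 by rewrite mulr0.
    have -> : w = u i - sm ip q `]-oo, 0[ (u i) by rewrite -[X in X - _]uE addrC addKr.
    rewrite ipBl ou //; last exact: Jj.1.
    have [Pj _] := hc j Jj; rewrite /= m0 in Pj.
    rewrite (spr_perp Hip gq mO mP _ (spr_sm _ _ _ _) Pj) ?subr0.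
      by case: eqP => // ij; case: ni; rewrite ij.
    by apply/seteqP; split=> t //= []; rewrite !in_itv /= andbT ltNge => /negP.
  - by rewrite /= rpDl !rpZl -nnE nz hz mulr1 mulr0 add0r.
  - by rewrite oppr_lt0.
  - by rewrite (deltaL_low_limit p0); apply/low_limit_aff_le0.
have perp i : (idx q `\` idx (low_cut q)) i -> forall y, space (low_cut q) y -> ip (u i) y = 0.
  move=> [Ji ni] y; rewrite /= m0 => Sy.
  have ti : term q i < 0 by rewrite ltNge; apply/negP => ti; apply: ni; split; rewrite ?m0.
  apply: (spr_perp Hip gq mO mP _ (low i Ji ti) Sy).
  by apply/seteqP; split=> t //= []; rewrite !in_itv /= andbT ltNge => /negP.
split => //; split => // x Sx hx; apply: cu => [|i Ji]; first exact: low_cut_sub Sx.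
case: (pselect (idx (low_cut q) i)) => [|ni]; first exact: hx.
exact/ip_eq0C/perp.
Qed.

Lemma splits_low_cut p u : regular p -> low_closed ip p ->
  (low_limit ip (low_cut p) <= 0)%E -> realizes p u -> splits p (low_cut p) u.
Proof.
move=> rg lc ll hu; have np := normal_normalize Hip rg.
have [c [e [c0 E]]] := normalize_affE rg; rewrite E in np.
have ll' : (low_limit ip (low_cut (aff c e p)) <= 0)%E.
  by rewrite low_cut_aff //; apply/low_limit_aff_le0 => //; exact: regular_low_cut.
have := splits_low_cut_normal np ((low_closed_aff Hip e c0 rg).2 lc) ll' (realizes_aff c e hu).
rewrite low_cut_aff // => /(splits_aff c^-1 (- (c^-1 * e))).
by rewrite !affK.
Qed.

End Steps.

(** * One pass of the loop *)

Section Passes.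
Context {R : realType} {H : completeNormedModType R[i]}.
Variable ip : {dot H for Num.conj}.
Hypothesis Hip : inner_product_norm ip.
Implicit Types (p q : @pair R H) (c e : R) (u : nat -> H).

Local Notation regular := (regular ip).
Local Notation low_closed := (low_closed ip).
Local Notation up_closed := (up_closed ip).
Local Notation low_cut := (low_cut ip).
Local Notation up_cut := (up_cut ip).
Local Notation low_limit := (low_limit ip).
Local Notation low_dominated := (low_dominated ip).
Local Notation final_cut := (final_cut ip).
Local Notation test := (test ip).
Local Notation realizing := (realizing ip).
Local Notation realizable := (realizable ip).
Local Notation realizes := (realizes ip).
Local Notation splits := (splits ip).
Local Notation removes := (removes ip).

Lemma realizable_reflect p : realizable p -> realizable (reflect p).
Proof. by move=> [u hu]; exists u; exact: realizes_reflect. Qed.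

Lemma reflect_low_cut p : reflect (low_cut p) = up_cut (reflect p).
Proof. by rewrite /up_cut reflectK. Qed.

Lemma reflect_up_cut p : reflect (up_cut p) = low_cut (reflect p).
Proof. by rewrite /up_cut reflectK. Qed.

Lemma realizable_of_low_cut p : regular p -> low_dominated p -> low_closed p ->
  realizable (low_cut p) -> realizable p.
Proof.
move=> rg ld lc hr; have [g hg] := low_removes Hip rg ld lc.
apply: (glue Hip _ _ _ _ _ _ hg hr) => //.
- exact: low_cut_csub.
- by case: (regular_csub Hip rg).
- exact: low_cut_sub.
- by move=> i [].
Qed.

Lemma realizable_of_up_cut p : regular p -> low_dominated (reflect p) -> up_closed p ->
  realizable (up_cut p) -> realizable p.
Proof.
move=> rg ld lc /realizable_reflect; rewrite reflect_up_cut => hr.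
rewrite -[p]reflectK; apply: realizable_reflect.
by apply: realizable_of_low_cut => //; exact: regular_reflect.
Qed.

Lemma realizing_up_cut p u : regular p -> up_closed p -> realizing p u -> realizing (up_cut p) u.
Proof.
move=> rg uc hu; rewrite /up_cut; apply: realizing_reflect.
apply: realizing_low_cut => //; first exact: regular_reflect.
exact: realizing_reflect.
Qed.

Lemma realizing_final_cut p u : regular p -> realizing p u -> realizing (final_cut p) u.
Proof.
move=> rg hu; rewrite /final_cut; set q := if _ then low_cut p else p.
have [rq hq] : regular q /\ realizing q u.
  rewrite /q; case: asboolP => lc //; split; first exact: regular_low_cut.
  exact: realizing_low_cut.
by case: asboolP => uc //; exact: realizing_up_cut.
Qed.

Lemma regular_final_cut p : regular p -> regular (final_cut p).
Proof.
move=> rg; rewrite /final_cut; set q := if _ then low_cut p else p.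
have rq : regular q by rewrite /q; case: asboolP => lc //; exact: regular_low_cut.
by case: asboolP => uc //; exact: regular_up_cut.
Qed.

Definition low_step p := low_closed p /\ (low_limit (low_cut p) <= 0)%E.

(** When the loop refuses to prune at a closed end, the gap limit after the cut is positive, so the
    cut pair is no longer closed there. Cuts at opposite ends do not interact; hence neither end of
    the final pair is closed and the test is sufficient for it. *)
Lemma realizable_of_final_cut p : separable H -> regular p -> test p ->
  ~ low_step p -> ~ low_step (reflect p) -> test (final_cut p) -> realizable p.
Proof.
move=> sepH rg tp nl nu tf; have [ld ud] := test_low_dominated Hip rg tp.
have rr := regular_reflect Hip rg.
have [q [[rq nlq udq] ucq qp fE]] : exists q, [/\ [/\ regular q, ~ low_closed q & low_dominated (reflect q)],
    up_closed q -> (0 < low_limit (low_cut (reflect q)))%E, realizable q -> realizable p &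
    final_cut p = if `[< up_closed q >] then up_cut q else q].
  exists (if `[< low_closed p >] then low_cut p else p); rewrite /final_cut.
  case: asboolP => lc; split => //.
  - split; [exact: regular_low_cut| |].
      by move=> [l0 _]; apply: nl; rewrite /low_step l0.
    by rewrite reflect_low_cut; apply/(low_dominated_up_cut Hip rr).
  - move=> /(up_closed_low_cut Hip rg) uc.
    rewrite reflect_low_cut (cutC Hip rr) (low_limit_up_cut Hip (regular_low_cut Hip rr)).
    by rewrite ltNge; apply/negP => h; apply: nu.
  - exact: realizable_of_low_cut.
  - by move=> uc; rewrite ltNge; apply/negP => h; apply: nu.
apply: qp; move: tf; rewrite fE; case: asboolP => uc tf; last first.
  exact: (realizable_of_closed_test Hip sepH rq tf nlq uc).
apply: (realizable_of_up_cut rq udq uc).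
apply: (realizable_of_closed_test Hip sepH (regular_up_cut Hip rq) tf).
  by move=> /(low_closed_up_cut Hip rq).
rewrite /up_closed reflect_up_cut => -[l0 _].
by have := ucq uc; rewrite l0 ltxx.
Qed.

(* One pass of the loop without normalization; the pair is unchanged when the
   algorithm stops. *)
Definition shrink p := if ~~ `[< test p >] then p
  else if `[< low_step p >] then low_cut p
  else if `[< low_step (reflect p) >] then up_cut p else p.

Lemma low_step_aff c e p : 0 < c -> regular p -> low_step (aff c e p) <-> low_step p.
Proof.
move=> c0 rg; rewrite /low_step low_cut_aff //.
have h1 := low_closed_aff Hip e c0 rg.
have h2 := low_limit_aff_le0 Hip e c0 (regular_low_cut Hip rg).
by split=> -[k1 k2]; split; [apply/h1|apply/h2|apply/h1|apply/h2].
Qed.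

Lemma test_aff c e p : 0 < c -> regular p -> test (aff c e p) <-> test p.
Proof. by move=> c0 rg; rewrite /test normalize_aff. Qed.

Lemma shrink_aff c e p : 0 < c -> regular p -> shrink (aff c e p) = aff c e (shrink p).
Proof.
move=> c0 rg; rewrite /shrink low_cut_aff // up_cut_aff // reflect_aff.
rewrite (propext (test_aff e c0 rg)) (propext (low_step_aff e c0 rg)).
rewrite (propext (low_step_aff (1 - e - c) c0 (regular_reflect Hip rg))).
by do 3 case: ifP => // _.
Qed.

(** What later arguments use of a pass, stated for the un-normalized [shrink]: a dropped entry on
    continuation, the outcome of the tests on stopping. The four-point answer has no constructor, as
    regular pairs never produce it. *)
Variant pass_spec p : result -> Prop :=
  | PassContinue c e of 0 < c & (exists i, (idx p `\` idx (shrink p)) i) :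
      pass_spec p (Continue (aff c e (shrink p)))
  | PassNotDiagonal of shrink p = p & ~ (test p /\ test (final_cut p)) :
      pass_spec p (Stop NotDiagonal)
  | PassDiagonal of shrink p = p & [/\ test p, ~ low_step p, ~ low_step (reflect p) &
      test (final_cut p)] : pass_spec p (Stop Diagonal).

Lemma one_passP p : regular p -> pass_spec p (one_pass ip p).
Proof.
move=> rg; have np := normal_normalize Hip rg; have rr := regular_reflect Hip rg.
have [c [e [c0 E]]] := normalize_affE Hip rg; rewrite /one_pass.
have -> : (`I_5 #<= ess ip p) = true.
  apply/idP; apply: (@card_le_trans _ _ _ [set: nat]); first exact: subset_card_le.
  exact/infiniteP/rg.2.
rewrite /= -/(test p) final_pruning_normalize // -/(test _).
rewrite (deltaL'_normal np) (deltaU'_normal Hip np) (prune0_normal np) (prune1_normal Hip np).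
have -> : (prunable0 ip (normalize ip p) /\ (low_limit (low_cut (normalize ip p)) <= 0)%E) = low_step p.
  apply/propext; rewrite (propext (prunable0_normal np)) E; exact: low_step_aff.
have -> : (prunable1 ip (normalize ip p) /\
    (low_limit (low_cut (reflect (normalize ip p))) <= 0)%E) = low_step (reflect p).
  apply/propext; rewrite (propext (prunable1_normal Hip np)) E /up_closed reflect_aff.
  exact: low_step_aff.
rewrite E low_cut_aff // up_cut_aff //.
have sE : shrink p = if ~~ `[< test p >] then p
  else if `[< low_step p >] then low_cut p
  else if `[< low_step (reflect p) >] then up_cut p else p by [].
move: sE; case: asboolP => tp /=; last by move=> sE; apply: PassNotDiagonal => // -[].
have [ld ud] := test_low_dominated Hip rg tp.
case: asboolP => lp /=.
  move=> sE; rewrite -sE; apply: PassContinue => //; rewrite sE.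
  by apply: low_removes_strictly => //; case: lp.
case: asboolP => up /=.
  move=> sE; rewrite -sE; apply: PassContinue => //; rewrite sE.
  have [i [h1 h2]] := low_removes_strictly Hip rr ud up.1.
  by exists i; split.
case: asboolP => tf sE; first by apply: PassDiagonal.
by apply: PassNotDiagonal => // -[].
Qed.

Lemma shrink_removes p : regular p -> exists g, removes p (shrink p) g.
Proof.
move=> rg; have rr := regular_reflect Hip rg; rewrite /shrink.
have trivial : exists g, removes p p g.
  exists (fun=> 0); rewrite /removes setDv; split => // x Sx h _.
  by apply: (nn_eq0 Hip); rewrite /sqn h // ?Re0.
case: asboolP => tp //=; have [ld ud] := test_low_dominated Hip rg tp.
case: asboolP => lp; first by apply: low_removes => //; case: lp.
case: asboolP => // up; have [g hg] := low_removes Hip rr ud up.1.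
by exists g; have := removes_reflect hg; rewrite reflectK.
Qed.

Lemma shrink_splits p u : regular p -> realizes p u -> splits p (shrink p) u.
Proof.
move=> rg hu; have rr := regular_reflect Hip rg; rewrite /shrink.
have trivial : splits p p u by split => // i []; rewrite /= => Ji /(_ Ji).
case: asboolP => tp //=; case: asboolP => [[lc ll]|_]; first exact: splits_low_cut.
case: asboolP => // -[lc ll].
by have := splits_reflect (splits_low_cut Hip rr lc ll (realizes_reflect hu)); rewrite reflectK.
Qed.

Lemma shrink_sub p : regular p ->
  space (shrink p) `<=` space p /\ idx (shrink p) `<=` idx p.
Proof.
move=> rg; have rr := regular_reflect Hip rg.
pose sub q := space q `<=` space p /\ idx q `<=` idx p.
rewrite -[_ /\ _]/(sub (shrink p)) /shrink; have triv : sub p by split=> x.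
case: asboolP => tp //=; case: asboolP => _.
  by split; [exact: low_cut_sub|move=> i []].
case: asboolP => // _; split; last by move=> i [].
exact: (low_cut_sub rr).
Qed.

End Passes.

(** * Condensation points of the spectrum *)

Section Condensation.
Context {R : realType}.
Implicit Types (X : set R) (l e : R).

(* If [r l] is rational with [X] countable on [l, r l], then either [X] is
   countable on a rational interval around [l], or [l] is determined by [r l]. *)
Let right_isolated_countable X :
  countable [set l | X l /\ exists2 e, 0 < e & countable (X `&` `]l, l + e[)].
Proof.
set A := [set l | _].
have /choice[r hr] : forall l, exists q : rat, A l -> l < ratr q /\ countable (X `&` `]l, ratr q[).
  move=> l; case: (pselect (A l)) => [[Xl [e e0 ce]]|nA]; last by exists 0.
  have le : l < l + e by rewrite ltrDl.
  have [q] := rat_in_itvoo le; rewrite in_itv /= => /andP[h1 h2].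
  exists q => _; split => //.
  apply: sub_countable ce; apply: subset_card_le => t [Xt]; split => //.
  by move: b; rewrite /= !in_itv /= => /andP[-> /= /lt_trans]; apply.
pose D := [set qq : rat * rat | countable (X `&` `]ratr qq.1, ratr qq.2[)].
pose A2 := [set l | A l /\ forall q : rat, ratr q < l -> ~ countable (X `&` `]ratr q, ratr (r l)[)].
have c1 : countable (\bigcup_(qq in D) (X `&` `]ratr qq.1, ratr qq.2[)).
  by apply: bigcup_countable.
have c2 : countable A2.
  apply: (@sub_countable _ _ _ (r @` A2)); last exact: countableP.
  suff inj : {in A2 &, injective r} by have := inj_card_eq inj; rewrite card_eq_le => /andP[].
  have main x y : A2 x -> A2 y -> r x = r y -> ~ x < y.
    move=> [Ax _] [_ ny] rxy xy; have [q] := rat_in_itvoo xy; rewrite in_itv /= => /andP[h1 h2].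
    apply: (ny q h2); rewrite -rxy; have [_ cx] := hr x Ax.
    apply: sub_countable cx; apply: subset_card_le => t [Xt]; split => //.
    by move: b; rewrite /= !in_itv /= => /andP[h3 ->]; rewrite (lt_trans h1 h3).
  move=> x y; rewrite !inE => Ax Ay rxy.
  by apply/eqP; case: ltgtP => // h; [have := main x y Ax Ay rxy|have := main y x Ay Ax (esym rxy)].
apply: (@sub_countable _ _ _ ((\bigcup_(qq in D) (X `&` `]ratr qq.1, ratr qq.2[)) `|` A2)).
  apply: subset_card_le => l Al; case: (pselect (A2 l)) => [|nA]; first by right.
  left; have [q ql cq] : exists2 q : rat, ratr q < l & countable (X `&` `]ratr q, ratr (r l)[).
    apply: contrapT => h; apply: nA; split => // q ql cq; apply: h; by exists q.
  exists (q, r l) => //; split; first by case: Al.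
  by rewrite /= in_itv /= ql; case: (hr l Al).
by rewrite -bigcup2E; apply: bigcup_countable => // -[|[|]].
Qed.

Lemma countable_opp X : countable X -> countable [set l | X (- l)].
Proof.
move=> cX; have -> : [set l | X (- l)] = (fun l => - l) @` X.
  by apply/seteqP; split=> [l h|_ [l h <-]]; [exists (- l); rewrite ?opprK|rewrite /= opprK].
exact: sub_countable (card_image_le _ _) cX.
Qed.

(** Two-sided, so that infinite rank is available on whichever side another condensation point
    lies. *)
Definition condensation X := [set l | X l /\ forall e, 0 < e ->
  ~ countable (X `&` `]l, l + e[) /\ ~ countable (X `&` `]l - e, l[)].

(** The points failing on the right form a countable set, and so do those failing on the left, by
    reflection at 0; with finitely many condensation points X would be countable. *)
Lemma condensation_infinite X : ~ countable X -> infinite_set (condensation X).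
Proof.
move=> nX /finite_set_countable cK; apply: nX.
pose A := [set l | X l /\ exists2 e, 0 < e & countable (X `&` `]l, l + e[)].
pose Y := [set l | X (- l)].
pose B := [set l | Y l /\ exists2 e, 0 < e & countable (Y `&` `]l, l + e[)].
have cA : countable A := right_isolated_countable X.
have cB : countable [set l | B (- l)] := countable_opp (right_isolated_countable Y).
apply: (@sub_countable _ _ _ (condensation X `|` (A `|` [set l | B (- l)]))); last first.
  rewrite -!bigcup2E; apply: bigcup_countable => // -[|[|]] //= _.
  by apply: bigcup_countable => // -[|[|]].
apply: subset_card_le => l Xl; case: (pselect (A l)) => nA; first by right; left.
case: (pselect (B (- l))) => nB; first by right; right.
left; split => // e e0; split => ce; first by apply: nA; split => //; exists e.
apply: nB; split; first by rewrite /Y /= opprK.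
exists e => //; apply: sub_countable (countable_opp ce); apply: subset_card_le => t [Yt].
by rewrite /= !in_itv /= => /andP[h1 h2]; split => //; apply/andP; split; lra.
Qed.

End Condensation.

(** * The support of the spectral measure and the spectrum *)

Section Support.
Context {R : realType} {H : completeNormedModType R[i]}.
Variable ip : {dot H for Num.conj}.
Hypothesis Hip : inner_product_norm ip.
Implicit Types (x y z v : H) (B C D : set R) (e l : R).

Local Notation nn := (sqn ip).
Local Notation rp := (rip ip).
Local Notation spr := (spr ip).
Local Notation cvgH := (cvgn ip).

(** Replaces the spectrum in the arguments on stages, since it is read off the spectral measure
    directly. *)
Definition support (p : @pair R H) : set R :=
  [set l | forall e, 0 < e -> exists x, sm ip p `]l - e, l + e[ x <> 0].

Variable p : @pair R H.
Hypothesis gp : good ip p.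
Local Notation A := (op p).
Local Notation P := (sm ip p).
Let hP : smeas ip A (space p) P. Proof. by case: gp. Qed.

(** In a window of finite rank every support point is an atom, because [findim_shrink] empties a
    small punctured neighbourhood of it. Distinct atoms give orthonormal eigenvectors, and only
    finitely many fit. *)
Lemma support_finite (u v : R) : findim ip (spr p `]u, v[) ->
  finite_set (support p `&` `]u, v[).
Proof.
move=> fd; have mI : measurable (`]u, v[ : set R) by exact: measurable_itv.
have m1 (l : R) : measurable ([set l] : set R) by exact: measurable_set1.
have atom l : (support p `&` `]u, v[) l -> exists x, nn x = 1 /\ spr p [set l] x.
  move=> [sl]; rewrite /= in_itv /= => /andP[ul lv].
  pose D n : set R := `]l - n.+1%:R^-1, l + n.+1%:R^-1[ `\ l.
  have mD n : measurable (D n) by apply: measurableD => //; exact: measurable_itv.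
  have DS n : D n.+1 `<=` D n.
    move=> t []; rewrite /= !in_itv /= => /andP[h1 h2] tl; split => //=; rewrite in_itv /=.
    have : n.+2%:R^-1 <= n.+1%:R^-1 :> R by rewrite lef_pV2 ?posrE // ler_nat.
    by move: (n.+2%:R^-1) (n.+1%:R^-1) h1 h2 => *; apply/andP; split; lra.
  have D0 : \bigcap_n D n = set0.
    apply/seteqP; split=> t // h; have [_ /= tl] := h 0%N I.
    have /ltr_add_invr[k] : 0 < `|t - l| by rewrite normr_gt0 subr_eq0; apply/eqP.
    rewrite add0r ltNge => /negP; apply; have [] := h k I.
    rewrite /= in_itv /= => /andP[h1 h2] _.
    by move: (k.+1%:R^-1) h1 h2 => z *; rewrite ler_norml; apply/andP; split; lra.
  have [n hn] := findim_shrink Hip gp mI mD DS D0 fd.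
  pose e := Num.min (n.+1%:R^-1) (Num.min (l - u) (v - l)).
  have e0 : 0 < e by rewrite !lt_min invr_gt0 ltr0Sn !subr_gt0 ul.
  have [x Px] := sl e e0.
  have [e1 e2 e3] : [/\ e <= n.+1%:R^-1, e <= l - u & e <= v - l].
    by rewrite /e !ge_min !lexx !orbT.
  have mE : measurable (`]l - e, l + e[ : set R) by exact: measurable_itv.
  have EE : `]l - e, l + e[%classic = (`]l - e, l + e[ `\ l) `|` [set l] :> set R.
    apply/seteqP; split=> [t h|t [[]//|->]].
      by case: (pselect (t = l)) => tl; [right|left].
    by rewrite /= in_itv /=; apply/andP; split; lra.
  have Pl : P [set l] x <> 0.
    move=> P0; apply: Px; rewrite EE (sm_U Hip hP) //; last 2 first.
    - exact: measurableD.
    - by apply/seteqP; split=> t // -[[]].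
    rewrite P0 addr0.
    have sub : `]l - e, l + e[ `\ l `<=` `]u, v[ `&` D n.
      move=> t [] /=; rewrite /D /= !in_itv /= => /andP[h1 h2] tl.
      move: (n.+1%:R^-1) e1 h1 h2 => w *.
      by split; [|split => //=]; rewrite ?in_itv /=; apply/andP; split; lra.
    have mS := measurableD mE (m1 l); have mID := measurableI _ _ mI (mD n).
    by rewrite -(sm_sub' hP x mS mID sub) hn (lin0 (sm_lin hP mS)).
  have [k [k1 k2]] := unit_of Hip (spr_subsp Hip gp (m1 l)) (spr_sm ip p [set l] x) Pl.
  by exists (k *: P [set l] x).
have /choice[f hf] : forall l, exists x, (support p `&` `]u, v[) l -> nn x = 1 /\ spr p [set l] x.
  move=> l; case: (pselect ((support p `&` `]u, v[) l)) => [/atom[x hx]|h]; first by exists x.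
  by exists 0.
apply: (onf_findim Hip (spr_subsp Hip gp mI) (f := f) _ _ fd).
  move=> l l' hl hl'; case: eqP => [<-|ll]; first by rewrite ipnn // (hf l hl).1.
  apply: (spr_perp Hip gp (m1 l) (m1 l') _ (hf l hl).2 (hf l' hl').2).
  by apply/seteqP; split=> t // [-> ?]; case: ll.
move=> l hl; apply: (spr_sub gp (m1 l) mI _ (hf l hl).2).
by move=> t ->; case: hl.
Qed.

End Support.

Section Spectrum.
Context {R : realType} {H : completeNormedModType R[i]}.
Variable ip : {dot H for Num.conj}.
Hypothesis Hip : inner_product_norm ip.
Implicit Types (x y z v : H) (e l s t : R).

Local Notation nn := (sqn ip).
Local Notation rp := (rip ip).
Local Notation spr := (spr ip).
Local Notation cvgH := (cvgn ip).

Variable E : {linear H -> H}.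
Hypotheses (cE : continuous E) (sE : self_adjoint ip E).

Lemma bsa_of_continuous : bsa ip E.
Proof.
split=> //; first exact: linearP.
by have [M hM] := continuous_bounded Hip cE; exists M.
Qed.

(** The lower bound for z makes the range closed, the one for the conjugate makes its orthogonal
    complement zero. The inverse is then defined everywhere, and the first bound makes it
    continuous. *)
Let bounded_below_surjective (z : R[i]) (k : R) : 0 < k ->
  (forall x, k * nn x <= nn (E x - z *: x)) ->
  (forall x, k * nn x <= nn (E x - z^*%C *: x)) -> ~ spectrum E z.
Proof.
move=> k0 hk hkc nz; pose T x := E x - z *: x.
have lT : linear T.
  move=> c x y; rewrite /T linearP scalerBr scalerDr !scalerA [z * c]mulrC.
  by rewrite opprD addrACA.
have injT x : T x = 0 -> x = 0.
  move=> Tx; apply: (nn_eq0 Hip); have := hk x; rewrite -/(T x) Tx nn0 => h.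
  by have := nn_ge0 Hip x; nra.
have [_ _ [M [M0 hM]]] := bsa_of_continuous.
have bT x : nn (T x) <= (2 * M + 2 * ab2 z) * nn x.
  have := nnB_le Hip (E x) (z *: x); rewrite nnZ -/(T x).
  by have := hM x; have := nn_ge0 Hip x; move: (ab2 z) (nn (E x)) => *; nra.
have B0 : 0 <= 2 * M + 2 * ab2 z by have := ab2_ge0 z; lra.
have cW : csub ip (range T).
  split; first split; first by exists 0; rewrite ?(lin0 lT).
    by move=> c _ _ [x _ <-] [y _ <-]; exists (c *: x + y) => //; rewrite lT.
  move=> u l hu cu; have /choice[w hw] : forall n, exists x, T x = u n.
    by move=> n; have [x _ hx] := hu n; exists x.
  have cw : cauchyn ip w.
    move=> e e0; have [N hN] := cu (k * e / 4) (divr_gt0 (mulr_gt0 k0 e0) (ltr0Sn R 3)).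
    exists N => m n Nm Nn; rewrite -(ltr_pM2l k0).
    apply: le_lt_trans (hk _) _; rewrite -/(T _) (linB lT) !hw.
    have -> : u m - u n = (u m - l) - (u n - l) by rewrite opprB addrA subrK.
    apply: le_lt_trans (nnB_le Hip _ _) _.
    by have := hN m Nm; have := hN n Nn; move: (k * e) (nn _) (nn _) => *; lra.
  have [x cx] := cauchyH_cvg Hip cw; exists x => //.
  apply: (cvgH_unique Hip _ cu).
  by have := cvgH_bounded Hip lT B0 bT cx; under eq_fun do rewrite hw.
have perp0 r : (forall x, ip r (T x) = 0) -> r = 0.
  move=> rT; have Er v : ip (E r - z^*%C *: r) v = 0 by rewrite -(rT v) /T ipBl ipBr sE ipZl ipZr.
  apply: (nn_eq0 Hip); have := hkc r; rewrite [nn (_ - _)]nnE /rip Er Re0 => h.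
  by have := nn_ge0 Hip r; nra.
have onto y : exists x, T x = y.
  have z0 : y - proj Hip cW y = 0 by apply: perp0 => x; apply: proj_perp; exists x.
  have [x _ hx] := proj_in Hip cW y; exists x.
  by rewrite hx; apply/eqP; rewrite eq_sym -subr_eq0 z0.
have /choice[g hg] := onto.
have gT x : g (T x) = x.
  by apply/eqP; rewrite -subr_eq0; apply/eqP/injT; rewrite (linB lT) hg subrr.
have lg : linear g by move=> c x y; rewrite -{1}(hg x) -{1}(hg y) -lT gT.
pose G : {linear H -> H} := HB.pack g (GRing.isLinear.Build _ _ _ _ g lg).
apply: nz; exists G; split; last exact: hg; last exact: gT.
apply: (bounded_continuous Hip (M := k^-1)) => [|x]; first by rewrite invr_ge0 ltW.
rewrite -(ler_pM2l k0) mulrA divff ?gt_eqF // mul1r.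
by have := hk (g x); rewrite -/(T _) hg.
Qed.

(** The cross term vanishes because the form of E - s is real; a nonzero imaginary part t thus
    provides the lower bound t^2. *)
Let shift_nn x s t : nn (E x - (s +i* t)%C *: x) = nn (E x - s%:C *: x) + t ^+ 2 * nn x.
Proof.
have -> : (s +i* t)%C = s%:C + t%:C * 'i%C by apply: complexP; rewrite ?ReD ?ImD ?ReM ?ImM /=; ring.
rewrite scalerDl opprD addrA nnB nnZ ab2M ab2R.
have -> : ab2 'i%C = 1 :> R by rewrite /ab2 /=; ring.
have -> : rp (E x - s%:C *: x) ((t%:C * 'i%C) *: x) = 0.
  rewrite /rip ipBl ipZl ipZr ipZr (sa_ip_rp _ sE) ipnn //.
  by rewrite ReD ReN !(ReM, ImM, ReJ, ImJ) /=; ring.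
by ring.
Qed.

(** A gap of radius e around s splits x into u below and v above. Testing (E - s) x against v - u,
    which has the same norm as x, gives e |x|^2 <= |(E - s) x| |x|. *)
Let off_support s (p : @pair R H) : good ip p ->
  (forall x, space p x) -> (forall x, op p x = E x) ->
  ~ support ip p s -> exists2 k : R, 0 < k & forall x, k * nn x <= nn (E x - s%:C *: x).
Proof.
move=> gp Sp Ep ns; have [e e0 he] : exists2 e, 0 < e & forall x, sm ip p `]s - e, s + e[ x = 0.
  apply: contrapT => h; apply: ns => e e0; apply: contrapT => h'.
  by apply: h; exists e => // x; apply: contrapT => hx; apply: h'; exists x.
have [_ _ hP] := gp.
exists (e ^+ 2) => [|x]; first by rewrite exprn_gt0.
have Sx := Sp x.
pose B1 := `]-oo, s - e]%classic : set R; pose B2 := `[s + e, +oo[%classic : set R.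
have m1 : measurable B1 by exact: measurable_itv.
have m2 : measurable B2 by exact: measurable_itv.
have mI : measurable (`]s - e, s + e[ : set R) by exact: measurable_itv.
have d12 : B1 `&` B2 = set0.
  by apply/seteqP; split=> t // []; rewrite /B1 /B2 /= !in_itv /= andbT => h1 h2; lra.
pose u := sm ip p B1 x; pose v := sm ip p B2 x.
have xE : x = u + v.
  have dI : `]s - e, s + e[ `&` (B1 `|` B2) = set0.
    apply/seteqP; split=> t // []; rewrite /B1 /B2 /= !in_itv /= andbT => /andP[h1 h2] [] h3; lra.
  have TE : setT = `]s - e, s + e[ `|` (B1 `|` B2).
    apply/seteqP; split=> t // _; rewrite /B1 /B2 /= !in_itv /= andbT.
    case: (leP t (s - e)) => h1; first by right; left.
    by case: (leP (s + e) t) => h2; [right; right|left].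
  rewrite -[LHS](sm_T hP Sx) TE (sm_U Hip hP) // ?he ?add0r; last exact: measurableU.
  by rewrite (sm_U Hip hP).
have su : spr p B1 u by exact: spr_sm.
have sv : spr p B2 v by exact: spr_sm.
have uv : ip u v = 0 by exact: (spr_perp Hip gp m1 m2 d12).
have Euv : ip (E u) v = 0.
  by apply: (spr_perp Hip gp m1 m2 d12 _ sv); rewrite -Ep; exact: (spr_A Hip gp).
have Evu : ip (E v) u = 0 by rewrite sE; exact: ip_eq0C.
have hu : rp (E u) u <= (s - e) * nn u.
  by rewrite -Ep; apply: (spr_le Hip gp m1 _ su) => t; rewrite /B1 /= in_itv.
have hv : (s + e) * nn v <= rp (E v) v.
  by rewrite -Ep; apply: (spr_ge Hip gp m2 _ sv) => t; rewrite /B2 /= in_itv /= andbT.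
clearbody u v; pose w := v - u.
have nx : nn x = nn u + nn v by rewrite xE (nnD_orth uv).
have nw : nn w = nn x.
  by rewrite nnBC /w nnB nx; rewrite /rip uv Re0; ring.
set y := E x - s%:C *: x.
have low : e * nn x <= rp y w.
  have -> : rp y w = rp (E v) v - rp (E u) u - s * nn v + s * nn u.
    rewrite /y /w xE linearD scalerDr /rip !(ipBl, ipBr, ipDl, ipZl) Euv Evu uv (ip_eq0C uv) -/(ip v v).
    by rewrite !ipnn // !(ReD, ReN, ReM, ImR, ReR, Re0, mulr0) /=; ring.
  by rewrite nx; lra.
have cs := CSr Hip y w; rewrite nw in cs.
have n0 := nn_ge0 Hip x; have y0 := nn_ge0 Hip y.
case: (eqVneq (nn x) 0) => [->|nz]; first by rewrite mulr0.
have xp : 0 < nn x by rewrite lt_neqAle eq_sym nz.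
have sq : (e * nn x) ^+ 2 <= rp y w ^+ 2.
  by rewrite ler_pXn2r ?nnegrE //; [rewrite mulr_ge0 // ltW|apply: le_trans low; rewrite mulr_ge0 // ltW].
have := le_trans sq cs; rewrite exprMn [nn x ^+ 2]expr2 mulrA ler_pM2r //.
Qed.

Lemma support_uncountable (p : @pair R H) : good ip p ->
  (forall x, space p x) -> (forall x, op p x = E x) ->
  ~ countable (spectrum E) -> ~ countable (support ip p).
Proof.
move=> gp Sp Ep nc cs; apply: nc.
apply: (@sub_countable _ _ _ ((fun l : R => l%:C) @` support ip p)); last first.
  exact: sub_countable (card_image_le _ _) cs.
apply: subset_card_le => -[s t] sz; apply: contrapT => h.
have nnx := nn_ge0 Hip.
case: (eqVneq t 0) => t0.
  have ns : ~ support ip p s by move=> hs; apply: h; exists s => //; rewrite t0.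
  have [k k0 hk] := off_support gp Sp Ep ns.
  move: sz; rewrite t0; apply: (bounded_below_surjective k0) => x; first exact: hk.
  by have := hk x; congr (_ <= nn (_ - _ *: _)); rewrite /= oppr0.
have k0 : 0 < t ^+ 2 by rewrite lt_neqAle sqr_ge0 eq_sym sqrf_eq0 t0.
move: sz; apply: (bounded_below_surjective k0) => x.
  by rewrite shift_nn lerDr.
by rewrite /= shift_nn sqrrN lerDr.
Qed.

End Spectrum.

(** * Stages as spectral restrictions *)

Section Restriction.
Context {R : realType} {H : completeNormedModType R[i]}.
Variable ip : {dot H for Num.conj}.
Hypothesis Hip : inner_product_norm ip.
Implicit Types (x y z v : H) (I : set R) (J : set nat) (e l t : R).

Local Notation spr := (spr ip).
Local Notation ess := (ess ip).
Local Notation regular := (regular ip).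

Definition restrict (p : @pair R H) I J := Pair (op p) (spr p I) (term p) J.

Variable p : @pair R H.
Hypotheses (gp : good ip p) (unc : ~ countable (support ip p)).
Let K := condensation (support ip p).
Let Kinf : infinite_set K. Proof. exact: condensation_infinite. Qed.

Definition wide I := measurable I /\ forall k k' t, condensation (support ip p) k ->
  condensation (support ip p) k' -> k < t < k' -> I t.

Let hr I J (mI : measurable I) :=
  good_restr (q := restrict p I J) Hip gp mI (erefl _) (erefl _).

Lemma spr_restrict I J B : measurable I -> measurable B ->
  spr (restrict p I J) B = spr p (B `&` I).
Proof.
move=> mI mB; apply: (congr1 (fun f : H -> H => range f)); apply/funext => x.
by have [_ ->] := hr J mI.
Qed.

Let dim_right l (v : R) : K l -> l < v -> dim_infinite (spr p `]l, v[).
Proof.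
move=> [_ h] lv; have [h1 _] := h (v - l) (etrans (subr_gt0 l v) lv).
have mI : measurable (`]l, v[ : set R) by exact: measurable_itv.
apply/(not_findimP Hip (spr_subsp Hip gp mI)) => /(support_finite Hip gp)/finite_set_countable.
by rewrite (_ : v = l + (v - l)) //; ring.
Qed.

Let dim_left l (v : R) : K l -> v < l -> dim_infinite (spr p `]v, l[).
Proof.
move=> [_ h] lv; have [_ h1] := h (l - v) (etrans (subr_gt0 v l) lv).
have mI : measurable (`]v, l[ : set R) by exact: measurable_itv.
apply/(not_findimP Hip (spr_subsp Hip gp mI)) => /(support_finite Hip gp)/finite_set_countable.
by rewrite [X in `]X, _[](_ : v = l - (l - v)) //; ring.
Qed.

(** Between k and another condensation point the set I is full, and k has infinite rank on that
    side, however short the interval. *)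
Lemma ess_restrict I J : wide I -> K `<=` ess (restrict p I J).
Proof.
move=> [mI hI] k Kk e e0.
rewrite -[spectral_range _ _ _]/(spr _ _) spr_restrict //.
have mB : measurable (`]k - e, k + e[ `&` I) by apply: measurableI => //; exact: measurable_itv.
have [k' Kk' kk'] : exists2 k', K k' & k' != k.
  apply: contrapT => h; apply: Kinf; apply: (sub_finite_set _ (finite_set1 k)) => l Kl.
  by apply: contrapT => /eqP lk; apply: h; exists l.
case: (ltgtP k' k) kk' => // lk _.
  have h : Num.max (k - e) k' < k by rewrite gt_max lk andbT; lra.
  apply: (spr_dim_sub gp _ mB _ (dim_left Kk h)); first exact: measurable_itv.
  move=> t; rewrite /= in_itv /= gt_max => /andP[/andP[h1 h2] h3]; split.
    by rewrite in_itv /= h1 /=; lra.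
  by apply: (hI k' k) => //; rewrite h2.
have h : k < Num.min (k + e) k' by rewrite lt_min lk andbT; lra.
apply: (spr_dim_sub gp _ mB _ (dim_right Kk h)); first exact: measurable_itv.
move=> t; rewrite /= in_itv /= lt_min => /andP[h1 /andP[h2 h3]]; split.
  by rewrite in_itv /= h2 andbT; lra.
by apply: (hI k k') => //; rewrite h1.
Qed.

Lemma regular_restrict I J : wide I -> regular (restrict p I J).
Proof.
move=> wI; split; first by have [] := hr J wI.1.
by move=> f; apply: Kinf; apply: sub_finite_set f; exact: ess_restrict.
Qed.

Let shrink_low I J : wide I ->
  exists I' J', wide I' /\ low_cut ip (restrict p I J) = restrict p I' J'.
Proof.
move=> wI; have rg := regular_restrict J wI; set q := restrict p I J.
have mP : measurable (`[ess_min ip q, +oo[ : set R) by exact: measurable_itv.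
exists (`[ess_min ip q, +oo[ `&` I), (d_in q (fun t => ess_min ip q <= t)); split.
  split; first exact: measurableI wI.1.
  move=> k k' t Kk Kk' /andP[kt tk]; split; last by apply: (wI.2 k k') => //; rewrite kt.
  have := ess_min_le Hip rg (ess_restrict J wI Kk); rewrite /= in_itv /= andbT => h.
  exact: le_trans h (ltW kt).
by rewrite /low_cut spr_restrict //; exact: wI.1.
Qed.

Let shrink_up I J : wide I ->
  exists I' J', wide I' /\ up_cut ip (restrict p I J) = restrict p I' J'.
Proof.
move=> wI; have rg := regular_restrict J wI; set q := restrict p I J.
have mP : measurable (`]-oo, ess_max ip q] : set R) by exact: measurable_itv.
exists (`]-oo, ess_max ip q] `&` I), (d_in q (fun t => t <= ess_max ip q)); split.
  split; first exact: measurableI wI.1.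
  move=> k k' t Kk Kk' /andP[kt tk]; split; last by apply: (wI.2 k k') => //; rewrite kt.
  have := le_ess_max Hip rg (ess_restrict J wI Kk'); rewrite /= in_itv /= => h.
  exact: le_trans (ltW tk) h.
by rewrite up_cutE // spr_restrict //; exact: wI.1.
Qed.

Lemma shrink_restrict I J : wide I ->
  exists I' J', wide I' /\ shrink ip (restrict p I J) = restrict p I' J'.
Proof.
move=> wI; rewrite /shrink; case: ifP => _; first by exists I, J.
case: ifP => _; first exact: shrink_low.
by case: ifP => _; [exact: shrink_up|exists I, J].
Qed.

End Restriction.

(** * The transfinite recursion *)

Section Tower.
Context {R : realType} {H : completeNormedModType R[i]}.
Variable ip : {dot H for Num.conj}.
Hypothesis Hip : inner_product_norm ip.
Hypothesis sepH : separable H.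
Variables (E : {linear H -> H}) (d : nat -> R).
Hypotheses (cE : continuous E) (sE : self_adjoint ip E).
Hypothesis specE : ~ countable (spectrum E).
Implicit Types (x y z : H) (o : countable_ordinal) (p q : @pair R H) (g u : nat -> H).

Local Notation regular := (regular ip).
Local Notation shrink := (shrink ip).
Local Notation splits := (splits ip).
Local Notation removes := (removes ip).
Local Notation realizes := (realizes ip).
Local Notation orthn := (orthn ip).

Let p0 : pair := Pair E setT d setT.
Let good0 : good ip p0. Proof. exact: (good_full Hip d setT (bsa_of_continuous Hip cE sE)). Qed.
Let unc : ~ countable (support ip p0).
Proof. by apply: (support_uncountable Hip cE sE good0 _ _ specE). Qed.

(* The pairs before each pass, without normalization. *)
Fixpoint core o : pair := match o with
  | OZero => p0
  | OSucc o' => shrink (core o')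
  | OSup s => Pair E (\bigcap_n space (core (s n))) d (\bigcap_n idx (core (s n)))
  end.

Let coreP o : exists I J, wide ip p0 I /\ core o = restrict ip p0 I J.
Proof.
elim: o => [|o IH|s IH] /=.
- exists setT, setT; split; first by split; [exact: measurableT|].
  by congr Pair; apply/seteqP; split=> x _ //; apply/(spr_T good0).
- have [I [J [wI ->]]] := IH; have [I' [J' [wI' ->]]] := shrink_restrict Hip good0 unc J wI.
  by exists I', J'.
have /choice[I hI] : forall n, exists I, wide ip p0 I /\ space (core (s n)) = spr ip p0 I.
  by move=> n; have [I [J [wI ->]]] := IH n; exists I.
have mI n : measurable (I n) by case: (hI n) => -[].
have mC : measurable (\bigcap_n I n) by exact: bigcapT_measurable.
exists (\bigcap_n I n), (\bigcap_n idx (core (s n))); split.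
  by split => // k k' t Kk Kk' kt n _; have [[_ h] _] := hI n; exact: h kt.
have [_ _ hP] := good0.
congr Pair; apply/seteqP; split=> x hx.
  have Sx : space p0 x by [].
  (* The complement of the intersection is a countable union of sets that carry nothing of x. *)
  have C0 : sm ip p0 (~` \bigcap_n I n) x = 0.
    rewrite setC_bigcap; apply: (sm_bigcup0 Hip hP) => [n|n]; first exact: measurableC.
    apply/(spr_setC Hip good0) => //; first exact: measurableC.
    by rewrite setCK; have := hx n Logic.I; rewrite (hI n).2.
  by rewrite -[\bigcap_n I n]setCK; apply/(spr_setC Hip good0 _ Sx) => //; exact: measurableC.
move=> n _; rewrite (hI n).2; apply: (spr_sub good0 mC (mI n) _ hx).
by move=> t; apply.
Qed.

Let core_regular o : regular (core o).
Proof. by have [I [J [wI ->]]] := coreP o; exact: (regular_restrict Hip good0 unc). Qed.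

Let core_op o : op (core o) = E.
Proof. by have [I [J [wI ->]]] := coreP o. Qed.

Let core_term o : term (core o) = d.
Proof. by have [I [J [wI ->]]] := coreP o. Qed.

(** Normalizations accumulate into one increasing affine map per stage; at a limit the map is reset
    to the identity, since limits restart from the original operator. *)
Let stage_core o : exists c e, 0 < c /\ stage ip E d o = aff c e (core o).
Proof.
elim: o => [|o IH|s IH] /=; first by exists 1, 0; rewrite aff_id.
  have [c [e [c0 sE']]] := IH; have rg := core_regular o.
  have rs : regular (stage ip E d o) by rewrite sE'; exact: regular_aff.
  have shE : shrink (stage ip E d o) = aff c e (shrink (core o)) by rewrite sE' shrink_aff.
  case: (one_passP Hip rs) => [c' e' c'0 _|sh _|sh _].
  - exists (c' * c), (c' * e + e'); split; first exact: mulr_gt0.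
    by rewrite shE aff_aff.
  - by exists c, e; rewrite -shE sh.
  - by exists c, e; rewrite -shE sh.
exists 1, 0; split; first exact: ltr01.
rewrite aff_id; congr Pair.
  by apply: eq_bigcapr => n _; have [c [e [_ ->]]] := IH n.
by apply: eq_bigcapr => n _; have [c [e [_ ->]]] := IH n.
Qed.

Let stage_regular o : regular (stage ip E d o).
Proof. by have [c [e [c0 ->]]] := stage_core o; exact: regular_aff. Qed.

(* The stages are linearly ordered by inclusion: as in the Bourbaki-Witt
   theorem, every stage is comparable with all others. *)
Definition earlier p q := space q `<=` space p /\ idx q `<=` idx p.

Let earlier_refl p : earlier p p. Proof. by split. Qed.

Let earlier_trans q p p' : earlier p q -> earlier q p' -> earlier p p'.
Proof. by move=> [a b] [a' b']; split=> x h; [apply/a/a'|apply/b/b']. Qed.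

Let earlier_anti o o' : earlier (core o) (core o') -> earlier (core o') (core o) ->
  core o = core o'.
Proof.
have [I [J [_ ->]]] := coreP o; have [I' [J' [_ ->]]] := coreP o'.
by move=> [a b] [a' b']; congr Pair; apply/seteqP.
Qed.

Let earlier_shrink o : earlier (core o) (shrink (core o)).
Proof. exact: (shrink_sub Hip (core_regular o)). Qed.

Let earlier_sup s n : earlier (core (s n)) (core (OSup s)).
Proof. by split=> x /(_ n I). Qed.

Let sup_greatest s p : (forall n, earlier (core (s n)) p) -> earlier (core (OSup s)) p.
Proof. by move=> h; split=> x hx n _; [apply: (h n).1|apply: (h n).2]. Qed.

Let sup_above o s : (forall n, earlier (core (s n)) (core o)) -> earlier (core (OSup s)) (core o).
Proof. exact: sup_greatest. Qed.

(** No stage strictly before o jumps past it in one pass. *)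
Let extreme o := forall o', earlier (core o') (core o) -> core o' <> core o ->
  earlier (shrink (core o')) (core o).

(** Induction on the notation o': a stage before o either equals it or stays at or before it after
    one more pass, and a limit of stages before o is before o because limits are intersections. *)
Let extreme_split o : extreme o -> forall o',
  earlier (core o') (core o) \/ earlier (shrink (core o)) (core o').
Proof.
move=> xo; elim=> [|o' [h|h]|s IH].
- by left; split.
- case: (pselect (core o' = core o)) => e; last by left; exact: xo.
  by right; rewrite /= e; exact: earlier_refl.
- by right; exact: earlier_trans h (earlier_shrink o').
case: (pselect (exists n, earlier (shrink (core o)) (core (s n)))) => [[n h]|h].
  by right; exact: earlier_trans h (earlier_sup s n).
by left; apply: sup_above => n; case: (IH n) => // h'; case: h; exists n.
Qed.

Let all_extreme o : extreme o.
Proof.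
elim: o => [|o xo|s xs] o' le ne.
- by case: ne; apply: earlier_anti => //; split.
- case: (extreme_split xo o') => h; last by case: ne; exact: earlier_anti.
  case: (pselect (core o' = core o)) => e; first by rewrite e; exact: earlier_refl.
  exact: earlier_trans (xo _ h e) (earlier_shrink o).
have [n hn] : exists n, ~ earlier (shrink (core (s n))) (core o').
  apply: contrapT => h; apply: ne; apply: earlier_anti => //; apply: sup_above => n.
  by apply: contrapT => hn; apply: h; exists n => h'; apply: hn; exact: earlier_trans (earlier_shrink _) h'.
case: (extreme_split (xs n) o') => // h.
case: (pselect (core o' = core (s n))) => e; last exact: earlier_trans (xs n _ h e) (earlier_sup s n).
case: (extreme_split (xs n) (OSup s)) => h'; last by rewrite e.
by case: ne; rewrite e; apply: earlier_anti => //; exact: earlier_sup.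
Qed.

Let comparable o o' : earlier (core o') (core o) \/ earlier (shrink (core o)) (core o').
Proof. exact: (@extreme_split o (@all_extreme o) o'). Qed.

Let drops o i := idx (core o) i /\ ~ idx (shrink (core o)) i.

(** By comparability two passes dropping the same entry start from the same pair, so one vector per
    entry can serve the whole recursion. *)
Let drops_unique o o' i : drops o i -> drops o' i -> core o = core o'.
Proof.
move=> [h1 h2] [h1' h2']; apply: earlier_anti.
  by case: (comparable o' o) => // -[_ h]; case: h2'; exact: h.
by case: (comparable o o') => // -[_ h]; case: h2; exact: h.
Qed.

Let removes_ext p q g g' : (forall i, (idx p `\` idx q) i -> g i = g' i) ->
  removes p q g -> removes p q g'.
Proof.
move=> gg [og hg cg]; split.
- by move=> i j hi hj; rewrite -!gg //; exact: og.
- by move=> i hi; rewrite -gg //; exact: hg.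
by move=> x Sx hx hi; apply: cg => // i h; rewrite gg //; exact: hi.
Qed.

Let removes_refl p : removes p p (fun=> 0).
Proof.
rewrite /removes setDv; split => // x Sx h _.
by apply: (nn_eq0 Hip); rewrite /sqn h // ?Re0.
Qed.

Let removes_trans p q r g : csub ip (space q) -> subsp (space p) ->
  earlier p q -> earlier q r -> op q = op p -> term q = term p ->
  removes p q g -> removes q r g -> removes p r g.
Proof.
move=> cq sp [Spq Jpq] [Sqr Jqr] oq tq [og hg cg] [og' hg' cg'].
have cases i : (idx p `\` idx r) i -> (idx p `\` idx q) i \/ (idx q `\` idx r) i.
  by move=> [h1 h2]; case: (pselect (idx q i)) => h; [right|left].
split.
- move=> i j hi hj; case: (cases i hi) => h; case: (cases j hj) => h'.
  + exact: og.
  + have [_ _ pi] := hg i h; have [Sj _ _] := hg' j h'; rewrite pi //.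
    by case: eqP => // ij; case: h => _; rewrite ij; case: h'.
  + have [_ _ pj] := hg j h'; have [Si _ _] := hg' i h; rewrite (ip_eq0C (pj _ Si)).
    by case: eqP => // ij; case: h' => _; rewrite -ij; case: h.
  + exact: og'.
- move=> i hi; case: (cases i hi) => h.
    by have [Si vi pi] := hg i h; split => // y /Sqr; exact: pi.
  by have [Si vi pi] := hg' i h; split => //; [exact: Spq|rewrite -oq -tq].
move=> x Sx hx hi; pose y := proj Hip cq x.
have Sy : space q y by exact: proj_in.
have z0 : x - y = 0.
  apply: cg; first by apply: subspB => //; exact: Spq.
    by move=> z Sz; exact: proj_perp.
  move=> i h; have [_ _ pi] := hg i h.
  by rewrite ipBl (ip_eq0C (pi _ Sy)) hi ?subr0 //; case: h => h1 h2; split => // /Jqr.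
have xy : x = y by apply/eqP; rewrite -subr_eq0 z0.
by apply: cg' => //; [rewrite xy|move=> i [h1 h2]; apply: hi; split => //; exact: Jpq].
Qed.

Let subsp0 : subsp (space p0). Proof. by split. Qed.

(** A single family works for all stages: g i comes from the pass at a chosen stage r i that drops
    i. At a limit a vector orthogonal to the g i dropped so far lies in every retained space, hence
    in their intersection. *)
Let core_removes : exists g, forall o, removes p0 (core o) g.
Proof.
have /choice[G hG] : forall p, exists g, regular p -> removes p (shrink p) g.
  move=> p; case: (pselect (regular p)) => [/(shrink_removes Hip)[g hg]|h]; first by exists g.
  by exists (fun=> 0).
have /choice[r hr] : forall i, exists o, (exists o', drops o' i) -> drops o i.
  move=> i; case: (pselect (exists o, drops o i)) => [[k hk]|h]; first by exists k.
  by exists OZero.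
exists (fun i => G (core (r i)) i); set g := fun i => _.
have sub0 o : earlier p0 (core o) by split.
elim=> [|o IH|s IH].
- by apply: (removes_ext _ (removes_refl p0)) => i []; rewrite /=.
- rewrite -[core (OSucc o)]/(shrink (core o)).
  apply: (removes_trans (regular_csub Hip (core_regular o)) subsp0 (sub0 o)
    (earlier_shrink o) _ _ IH); [exact: core_op|exact: core_term|].
  apply: (removes_ext _ (hG _ (core_regular o))) => i [h1 h2].
  by rewrite /g; congr (G _ i); apply: (drops_unique (i := i)) => //; apply: hr; exists o.
have out i : (idx p0 `\` idx (core (OSup s))) i -> exists n, (idx p0 `\` idx (core (s n))) i.
  move=> [_ h]; apply: contrapT => h'; apply: h => n _; apply: contrapT => hn.
  by apply: h'; exists n.
split.
- move=> i j /out[n [_ hn]] /out[m [_ hm]].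
  case: (comparable (s n) (s m)) => [[_ h]|/(earlier_trans (earlier_shrink _))[_ h]].
    by have [og _ _] := IH n; apply: og; split => // h'; apply: hm; exact: h.
  by have [og _ _] := IH m; apply: og; split => // h'; apply: hn; exact: h.
- move=> i /out[n hn]; have [_ hg _] := IH n; have [Si vi pi] := hg i hn.
  by split => // y Sy; apply: pi; exact: (earlier_sup s n).1.
move=> x _ hx hi.
have Sx : space (core (OSup s)) x.
  move=> n _; have cn := regular_csub Hip (core_regular (s n)).
  have Sy : space (core (s n)) (proj Hip cn x) by exact: proj_in.
  have [_ hg cg] := IH n.
  have z0 : x - proj Hip cn x = 0.
    apply: cg => // [y Sy'|i h]; first exact: proj_perp.
    have [_ _ pi] := hg i h; rewrite ipBl (ip_eq0C (pi _ Sy)) hi ?subr0 //.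
    by case: h => _ h; split => // /(earlier_sup s n).2.
  by have -> : x = proj Hip cn x by apply/eqP; rewrite -subr_eq0 z0.
by apply: (nn_eq0 Hip); rewrite /sqn hx // ?Re0.
Qed.

Let core_splits u o : realizes p0 u -> splits p0 (core o) u.
Proof.
move=> hu; elim: o => [|o IH|s IH].
- by split => // i [_ []].
- have [ho po] := IH; have [hs ps] := shrink_splits Hip (core_regular o) ho.
  split => // i [_ hi] y Sy; case: (pselect (idx (core o) i)) => h; first by apply: ps.
  by apply: po => //; exact: (earlier_shrink o).1.
have perp i : (idx p0 `\` idx (core (OSup s))) i -> forall y, space (core (OSup s)) y -> ip (u i) y = 0.
  move=> [_ h] y Sy; have [n hn] : exists n, ~ idx (core (s n)) i.
    by apply: contrapT => h'; apply: h => n _; apply: contrapT => hn; apply: h'; exists n.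
  by have [_ pn] := IH n; apply: pn => //; exact: (earlier_sup s n).1.
have [ou vu cu] := hu; split => //; split.
- by move=> i j _ _; exact: ou.
- move=> i hi; split; last by case: (vu i).
  by move=> n _; have [[_ h _] _] := IH n; case: (h i (hi n I)).
move=> x Sx hx; apply: cu => // i _.
case: (pselect (idx (core (OSup s)) i)) => h; first exact: hx.
by apply: ip_eq0C; apply: perp.
Qed.

Let diagonal_realizes : is_diagonal ip E d <-> exists u, realizes p0 u.
Proof.
split=> [[u [bu hu]]|[u [ou hu cu]]]; exists u.
  split; first by move=> i j _ _; exact: bu.1.
    by move=> i _; split => //; rewrite /rip hu.
  by move=> x _ hx; apply: (basis_complete Hip bu) => i; exact: hx.
split; first by apply: (complete_basis Hip) => // x hx; apply: cu => // i _; exact: hx.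
by move=> i; have [_ h] := hu i I; rewrite (sa_ip_rp _ sE) h.
Qed.

Lemma algorithm_stops : exists w, stops_with ip E d w.
Proof.
apply: contrapT => nw.
have drop o : exists i, drops o i.
  have nst w : one_pass ip (stage ip E d o) <> Stop w by move=> h; apply: nw; exists w, o.
  have [c [e [c0 sE']]] := stage_core o.
  move: nst; case: (one_passP Hip (stage_regular o)) => [c' e' _ [i hi]|_ _|_ _] nst.
  - by exists i; move: hi; rewrite sE' shrink_aff.
  - by have := nst NotDiagonal.
  - by have := nst Diagonal.
(* One stage for each of the countably many entries, so that their supremum has a notation; an entry
   that is never dropped is assigned [OZero]. *)
have /choice[s hs] : forall i, exists o, (exists o', ~ idx (core o') i) -> ~ idx (core o) i.
  move=> i; case: (pselect (exists o, ~ idx (core o) i)) => [[k hk]|h]; first by exists k.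
  by exists OZero.
have [i [h1 h2]] := drop (OSup s).
by apply: (hs i) => //; [exists (OSucc (OSup s))|exact: h1].
Qed.

(** A realization of the original pair induces one at every stage, so a failed test refutes it;
    conversely, a realization found at the last stage is completed by the vectors of
    [core_removes]. *)
Lemma algorithm_correct w : stops_with ip E d w -> correct ip E d w.
Proof.
move=> [k]; have [c [e [c0 sE']]] := stage_core k; have rs := stage_regular k.
case: (one_passP Hip rs) => [//|_ nt [<-]|_ [tp nl nu tf] [<-]] /=.
  move=> /diagonal_realizes[u hu]; apply: nt.
  have [hk _] := core_splits k hu.
  have hr : realizing ip (stage ip E d k) u.
    by apply: realizes_realizing; rewrite sE'; exact: realizes_aff.
  split; first exact: (realizing_test Hip rs hr).
  exact: (realizing_test Hip (regular_final_cut Hip rs) (realizing_final_cut Hip rs hr)).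
have hr := realizable_of_final_cut Hip sepH rs tp nl nu tf.
apply/diagonal_realizes; rewrite sE' in hr.
have hk := realizable_aff c0 hr.
have [g hg] := core_removes.
by apply: (glue Hip (regular_csub Hip (core_regular k)) subsp0 _ _ _ _ (hg k) hk);
  rewrite ?core_op ?core_term.
Qed.

End Tower.

Theorem theorem1p5 (R : realType) (H : completeNormedModType R[i])
    (ip : {dot H for Num.conj}) (Hip : inner_product_norm ip)
    (Hsep : separable H)
    (E : {linear H -> H}) (Ebounded : continuous E) (Esa : self_adjoint ip E)
    (Espec : ~ countable (spectrum E))
    (d : nat -> R) (dbounded : exists M : R, forall i, `|d i| <= M) :
  conclusive ip E d.
Proof.
split; first exact: algorithm_stops.
by move=> w; exact: algorithm_correct.
Qed.
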